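(* The mapping $$\underline{\breve v}\mapsto(\underline v^k)_{k\in\mathbb Z},$$ which sends a vector field to the sequence of Fourier coefficients (with respect to $\theta$) of its cylindrical component vector, is an isometric isomorphism between $\bigl(H^1(\breve\Omega)\bigr)^3$ and the $l_2$-sum $\bigoplus_2\{\boldsymbol H^1_{(k)}(\Omega)\colon k\in\mathbb Z\}$: $$\|\underline{\breve v}\|_{(H^1(\breve\Omega))^3}=\Bigl(\sum_{k\in\mathbb Z}\|\underline v^k\|^2_{\boldsymbol H^1_{(k)}(\Omega)}\Bigr)^{1/2}=\|(\underline v^k)\|_{\bigoplus_2\{\boldsymbol H^1_{(k)}(\Omega)\colon k\in\mathbb Z\}},$$ where $$\boldsymbol H^1_{(k)}(\Omega):=\begin{cases}V^1_1(\Omega)\times V^1_1(\Omega)\times H^1_1(\Omega), & k=0,\\ \{\underline v^k\in H^1_1(\Omega)\times H^1_1(\Omega)\times V^1_1(\Omega):\ v_r^k+ikv_\theta^k\in L^2_{-1}(\Omega)\}, & |k|=1,\\ V^1_1(\Omega)\times V^1_1(\Omega)\times V^1_1(\Omega), & |k|\ge2,\end{cases}$$ and where the norms $\|\cdot\|_{\boldsymbol H^1_{(k)}(\Omega)}$ are given as follows. For $k=0$: $$\|\underline v^k\|^2_{\boldsymbol H^1_{(k)}(\Omega)}:=\|\underline v^k\|^2_{(L^2_1(\Omega))^3}+\|v_r^k\|^2_{V^1_1(\Omega)}+\|v_\theta^k\|^2_{V^1_1(\Omega)}+|v_z^k|^2_{H^1_1(\Omega)};$$ for $|k|=1$: $$\|\underline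 v^k\|^2_{\boldsymbol H^1_{(k)}(\Omega)}:=\|\underline v^k\|^2_{(L^2_1(\Omega))^3}+2\|v_r^k+ikv_\theta^k\|^2_{L^2_{-1}(\Omega)}+|v_r^k|^2_{H^1_1(\Omega)}+|v_\theta^k|^2_{H^1_1(\Omega)}+\|v_z^k\|^2_{V^1_1(\Omega)};$$ for $|k|\ge2$: $$\begin{aligned}\|\underline v^k\|^2_{\boldsymbol H^1_{(k)}(\Omega)}:=\ &\|\underline v^k\|^2_{(L^2_1(\Omega))^3}+|\underline v^k|^2_{(H^1_1(\Omega))^3}+(1+k^2)\bigl(\|v_r^k\|^2_{L^2_{-1}(\Omega)}+\|v_\theta^k\|^2_{L^2_{-1}(\Omega)}\bigr)\\&+k^2\|v_z^k\|^2_{L^2_{-1}(\Omega)}+2ik\int_\Omega\bigl(v_\theta^k\bar v_r^k-v_r^k\bar v_\theta^k\bigr)\frac1r\,dr\,dz.\end{aligned}$$ Moreover, for $|k|\ge2$, the norm $\|\cdot\|_{\boldsymbol H^1_{(k)*}(\Omega)}$ defined by $$\|\underline v^k\|^2_{\boldsymbol H^1_{(k)*}(\Omega)}:=\|\underline v^k\|^2_{(L^2_1(\Omega))^3}+|\underline v^k|^2_{(H^1_1(\Omega))^3}+k^2\|\underline v^k\|^2_{(L^2_{-1}(\Omega))^3}$$ is equivalent to $\|\cdot\|_{\boldsymbol H^1_{(k)}(\Omega)}$.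
   Context: Domain. $\breve\Omega\subset\mathbb R^3$ is a bounded domain invariant by rotation around the $z$-axis. Its half section (meridian domain) $\Omega\subset\{(r,z): r>0\}$ is polygonal; $\Gamma_0$ denotes the interior of the part of $\partial\Omega$ contained in the axis $r=0$, and $\breve\Omega$ is obtained by rotating $\Omega$ (together with $\Gamma_0$) around the $z$-axis. Cylindrical coordinates are $x=r\cos\theta$, $y=r\sin\theta$, $z$, with $\theta\in(-\pi,\pi]$. All functions are complex-valued. Cylindrical components and Fourier coefficients. A vector field with Cartesian component vector $\underline{\breve v}=(\breve v_x,\breve v_y,\breve v_z)^T$ has cylindrical component vector $\underline v=(v_r,v_\theta,v_z)^T$ given by $\underline{\breve v}(x,y,z)=\mathcal R_\theta\,\underline v(r,\theta,z)$, where $$\mathcal R_\theta=\begin{pmatrix}\cos\theta&-\sin\theta&0\\ \sin\theta&\cos\theta&0\\0&0&1\end{pmatrix}.$$ Its Fourier coefficients $\underline v^k=(v_r^k,v_\theta^k,v_z^k)^T$ are defined by $\underline v(r,\theta,z)=\frac1{\sqrt{2\pi}}\sum_{k\in\mathbb Z}\underline v^k(r,z)e^{ik\theta}$, i.e. $\underline v^k(r,z)=\frac1{\sqrt{2\pi}}\int_{-\pi}^{\pi}\underline v(r,\theta,z)e^{-ik\theta}\,d\theta$. Norm on $(H^1(\breve\Omega))^3$: the sum over the Cartesian components of $\|\breve w\|^2_{H^1(\breve\Omega)}=\|\breve w\|^2_{L^2}+\|\partial_x\breve w\|^2_{L^2}+\|\partial_y\breve w\|^2_{L^2}+\|\partial_z\breve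 w\|^2_{L^2}$ (square of the norm). Weighted spaces on $\Omega$ (derivatives in the sense of distributions). $L^2_{\pm1}(\Omega)$: measurable $v:\Omega\to\mathbb C$ with $\|v\|^2_{L^2_{\pm1}(\Omega)}=\int_\Omega|v|^2r^{\pm1}\,dr\,dz<\infty$. $H^1_1(\Omega)$: functions $v\in L^2_1(\Omega)$ with $\partial_rv,\partial_zv\in L^2_1(\Omega)$; semi-norm $|v|^2_{H^1_1(\Omega)}=\|\partial_rv\|^2_{L^2_1(\Omega)}+\|\partial_zv\|^2_{L^2_1(\Omega)}$. $V^1_1(\Omega)=H^1_1(\Omega)\cap L^2_{-1}(\Omega)$ with norm $\|v\|^2_{V^1_1(\Omega)}=\|v\|^2_{L^2_{-1}(\Omega)}+|v|^2_{H^1_1(\Omega)}$. For vector functions, squared (semi-)norms such as $\|\cdot\|^2_{(L^2_1(\Omega))^3}$ and $|\cdot|^2_{(H^1_1(\Omega))^3}$ are sums over components. $l_2$-sum. For normed spaces $X_k$, $k\in\mathbb Z$, $\bigoplus_2\{X_k\colon k\in\mathbb Z\}$ is the subspace of the Cartesian product of the $X_k$ consisting of all sequences $(x^k)$ with $\|(x^k)\|=(\sum_{k\in\mathbb Z}\|x^k\|_{X_k}^2)^{1/2}<\infty$. *)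

(* Defs.v *)
From HB Require Import structures.
From mathcomp Require Import all_boot all_order all_algebra.
From mathcomp Require Import all_classical all_reals all_analysis.
From mathcomp Require Import complex ring lra.

Set Implicit Arguments.
Unset Strict Implicit.
Unset Printing Implicit Defensive.

Import Order.TTheory GRing.Theory Num.Theory.
Import numFieldNormedType.Exports.

Local Open Scope classical_set_scope.
Local Open Scope ring_scope.
Local Open Scope complex_scope.

(* Points (r, z) of the meridian half plane and (x, y, z) of space. The
   measurable structure is the product one for which [lebesgue_measure \x
   lebesgue_measure] is defined (it lives on [measurableTypeR R]); the topology
   is the product topology. *)

#[short(type=measurableNormedModType)]
HB.structure Definition MeasurableNormedModule (R : numFieldType)
  (d : measure_display) := {V of Measurable d V & NormedModule R V}.

Definition plane (R : realType) : Type := (R * R)%type.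
HB.instance Definition _ (R : realType) :=
  Measurable.copy (plane R) (measurableTypeR R * measurableTypeR R)%type.
HB.instance Definition _ (R : realType) :=
  NormedModule.copy (plane R) (R * R)%type.

Definition espace (R : realType) : Type := (R * R * R)%type.
HB.instance Definition _ (R : realType) :=
  Measurable.copy (espace R)
    (measurableTypeR R * measurableTypeR R * measurableTypeR R)%type.
HB.instance Definition _ (R : realType) :=
  NormedModule.copy (espace R) (R * R * R)%type.

Definition leb2 (R : realType) : {measure set (plane R) -> \bar R} :=
  [the {measure set (measurableTypeR R * measurableTypeR R) -> \bar R} of
     (@lebesgue_measure R \x @lebesgue_measure R)%E].

Definition leb3 (R : realType) : {measure set (espace R) -> \bar R} :=
  [the {measure set (measurableTypeR R * measurableTypeR R * measurableTypeR R)
          -> \bar R} of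
     (@lebesgue_measure R \x @lebesgue_measure R \x @lebesgue_measure R)%E].

Section complex_functions.
Context {R : realType} {d : measure_display} {T : measurableType d}.
Implicit Types (mu : {measure set T -> \bar R}) (D : set T) (f : T -> R[i]).

Definition cmeasurable D f :=
  measurable_fun D (fun x => complex.Re (f x)) /\
  measurable_fun D (fun x => complex.Im (f x)).

Definition cintegral mu D f : R[i] :=
  (\int[mu]_(x in D) complex.Re (f x)) +i* (\int[mu]_(x in D) complex.Im (f x)).

Definition L2_integral mu D (w : T -> R) f : \bar R :=
  (\int[mu]_(x in D) (Normc.normc (f x) ^+ 2 * w x)%:E)%E.

Definition L2 mu D w : set (T -> R[i]) :=
  [set f | cmeasurable D f /\ (L2_integral mu D w f < +oo)%E].

(* The square of the norm; only meaningful on [L2 mu D w]. *)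
Definition L2_sqnorm mu D w f : R := fine (L2_integral mu D w f).

End complex_functions.

Section smooth_functions.
Context {R : realType} {V : normedModType R}.

(* C^oo in the form: all iterated directional derivatives exist everywhere
   and are continuous. *)
Definition iter_derive (s : seq V) (phi : V -> R) : V -> R :=
  foldr (fun e g => fun x => 'D_e g x) phi s.

Definition smooth (phi : V -> R) := forall s : seq V,
  continuous (iter_derive s phi) /\
  forall x e, derivable (iter_derive s phi) x e.

Definition test_function (D : set V) (phi : V -> R) :=
  [/\ smooth phi,
      compact (closure [set x | phi x != 0])
    & closure [set x | phi x != 0] `<=` D].

End smooth_functions.

Section sobolev.
Context {R : realType} {d : measure_display} {T : measurableNormedModType R d}.
Implicit Types (mu : {measure set T -> \bar R}) (D : set T) (e : T).
Implicit Types (v g : T -> R[i]).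

Definition clocally_integrable mu D v :=
  cmeasurable D v /\
  forall K : set T, compact K -> K `<=` D ->
    (\int[mu]_(x in K) (Normc.normc (v x))%:E < +oo)%E.

(* Real test functions are enough: the identity is C-linear in phi. *)
Definition weak_derivative mu D e v g :=
  [/\ clocally_integrable mu D v, clocally_integrable mu D g
    & forall phi : T -> R, test_function D phi ->
        cintegral mu D (fun x => v x * ('D_e phi x)%:C) =
        - cintegral mu D (fun x => g x * (phi x)%:C)].

(* A chosen representative of the a.e. unique weak derivative. *)
Definition wderive mu D e v : T -> R[i] :=
  xget (fun=> 0) [set g | weak_derivative mu D e v g].

Definition H1 mu D w (es : seq T) : set (T -> R[i]) :=
  [set v | L2 mu D w v /\
     forall e, e \in es -> exists2 g, weak_derivative mu D e v g & L2 mu D w g].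

Definition H1_sqseminorm mu D w (es : seq T) v : R :=
  \sum_(e <- es) L2_sqnorm mu D w (wderive mu D e v).

End sobolev.

(* Spaces are sets of representatives, identified along a relation [eqX]
   (almost everywhere equality in the applications). *)

Section normed_spaces.
Context {R : realType}.

Definition normed_space {V : lmodType R[i]} (X : set V)
    (eqX : V -> V -> Prop) (N : V -> R) :=
  [/\ X 0,
      forall (a : R[i]) u v, X u -> X v -> X (a *: u + v),
      forall u v, X u -> X v -> N (u + v) <= N u + N v,
      forall (a : R[i]) u, X u -> N (a *: u) = Normc.normc a * N u
    & forall u, X u -> 0 <= N u /\ (N u = 0 <-> eqX u 0)].

Definition isometric_isomorphism {V W : lmodType R[i]}
    (X : set V) (eqX : V -> V -> Prop) (NX : V -> R)
    (Y : set W) (eqY : W -> W -> Prop) (NY : W -> R) (F : V -> W) :=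
  [/\ forall u, X u -> Y (F u),
      forall u v, X u -> X v -> (eqX u v <-> eqY (F u) (F v)),
      forall (a : R[i]) u v, X u -> X v -> eqY (F (a *: u + v)) (a *: F u + F v),
      forall w, Y w -> exists2 u, X u & eqY (F u) w
    & forall u, X u -> NX u = NY (F u)].

Definition equivalent_norms {V : Type} (X : set V) (N N' : V -> R) :=
  exists c C : R, [/\ 0 < c, 0 < C
    & forall u, X u -> c * N u <= N' u /\ N' u <= C * N u].

Definition l2_sqsum {W : Type} (N : int -> W -> R) (x : int -> W) : \bar R :=
  (\esum_(k in [set: int]) (N k (x k) ^+ 2)%:E)%E.

Definition l2_sum {W : Type} (X : int -> set W) (N : int -> W -> R) :
    set (int -> W) :=
  [set x | (forall k, X k (x k)) /\ (l2_sqsum N x < +oo)%E].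

Definition l2_norm {W : Type} (N : int -> W -> R) (x : int -> W) : R :=
  Num.sqrt (fine (l2_sqsum N x)).

End normed_spaces.

Section geometry.
Context {R : realType}.

Definition bounded_domain {V : normedModType R} (D : set V) :=
  [/\ open D, connected D, D !=set0 & bounded_set D].

Definition boundary {V : topologicalType} (D : set V) : set V :=
  closure D `\` interior D.

Definition segment {V : lmodType R} (a b : V) : set V :=
  [set (1 - t) *: a + t *: b | t in `[0, 1]].

Definition polygonal_domain (D : set (plane R)) :=
  bounded_domain D /\
  exists s : seq (plane R * plane R),
    (forall ab, ab \in s -> ab.1 != ab.2) /\
    boundary D = \bigcup_(ab in [set` s]) segment ab.1 ab.2.

(* The interior is taken relative to the axis r = 0. *)
Definition axis_part (Omega : set (plane R)) : set (plane R) :=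
  [set p | p.1 = 0 /\ interior [set z : R | boundary Omega (0, z)] p.2].

Definition cartesian (r t z : R) : espace R := (r * cos t, r * sin t, z).

Definition revolve (G : set (plane R)) : set (espace R) :=
  [set q | exists p t, [/\ G p, - pi < t <= pi & q = cartesian p.1 t p.2]].

End geometry.

Section fourier.
Context {R : realType}.

Definition rotation (t : R) : 'M[R[i]]_3 :=
  \matrix_(i < 3, j < 3)
    (nth 0 (nth [::] [:: [:: cos t; - sin t; 0];
                         [:: sin t; cos t; 0];
                         [:: 0; 0; 1]] i) j)%:C.

Definition cylindrical (v : espace R -> 'cV[R[i]]_3) (r t z : R) :
    'cV[R[i]]_3 :=
  invmx (rotation t) *m v (cartesian r t z).

Definition expi (t : R) : R[i] := cos t +i* sin t.

Definition fourier_coefficient (k : int) (f : R -> R[i]) : R[i] :=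
  (Num.sqrt (2 * pi))^-1%:C *
  cintegral (@lebesgue_measure R) `]- pi, pi]
    (fun t => f t * expi (- (k%:~R * t))).

Definition fourier_coefficients (v : espace R -> 'cV[R[i]]_3) :
    int -> (plane R -> 'cV[R[i]]_3) :=
  fun k p => \col_j fourier_coefficient k (fun t => cylindrical v p.1 t p.2 j 0).

End fourier.

Definition component {R : realType} {T : Type} (j : 'I_3)
  (v : T -> 'cV[R[i]]_3) : T -> R[i] := fun x => v x j 0.

(* Positions of v_r, v_theta, v_z in a column of cylindrical components. *)
Definition jr : 'I_3 := @Ordinal 3 0 isT.
Definition jt : 'I_3 := @Ordinal 3 1 isT.
Definition jz : 'I_3 := @Ordinal 3 2 isT.

Section space3.
Context {R : realType}.
Variable D : set (espace R).

Definition axes3 : seq (espace R) := [:: (1, 0, 0); (0, 1, 0); (0, 0, 1)].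

Definition H1vec : set (espace R -> 'cV[R[i]]_3) :=
  [set v | forall j, H1 (leb3 R) D (fun=> 1) axes3 (component j v)].

Definition H1vec_norm (v : espace R -> 'cV[R[i]]_3) : R :=
  Num.sqrt (\sum_(j < 3)
    (L2_sqnorm (leb3 R) D (fun=> 1) (component j v) +
     H1_sqseminorm (leb3 R) D (fun=> 1) axes3 (component j v))).

Definition ae_eq3 (u v : espace R -> 'cV[R[i]]_3) := u = v %[ae leb3 R in D].

End space3.

Section weighted.
Context {R : realType}.
Variable Omega : set (plane R).
Implicit Types (v : plane R -> R[i]) (u : plane R -> 'cV[R[i]]_3) (k : int).

Definition axes2 : seq (plane R) := [:: (1, 0); (0, 1)].

Definition wpos (p : plane R) : R := p.1.
Definition wneg (p : plane R) : R := p.1^-1.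

Definition L2m : set (plane R -> R[i]) := L2 (leb2 R) Omega wneg.
Definition H11 : set (plane R -> R[i]) := H1 (leb2 R) Omega wpos axes2.
Definition V11 : set (plane R -> R[i]) := H11 `&` L2m.

Definition sqL2p v : R := L2_sqnorm (leb2 R) Omega wpos v.
Definition sqL2m v : R := L2_sqnorm (leb2 R) Omega wneg v.
Definition sqH11 v : R := H1_sqseminorm (leb2 R) Omega wpos axes2 v.
Definition sqV11 v : R := sqL2m v + sqH11 v.

Definition mixed k u : plane R -> R[i] := fun p =>
  component jr u p + 'i%C * k%:~R * component jt u p.

Definition cross_term k u : R[i] :=
  2 * 'i%C * k%:~R *
  cintegral (leb2 R) Omega (fun p =>
    (component jt u p * (component jr u p)^*%C
     - component jr u p * (component jt u p)^*%C) * (p.1^-1)%:C).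

Definition H1k k : set (plane R -> 'cV[R[i]]_3) :=
  if k == 0 then
    [set u | [/\ V11 (component jr u), V11 (component jt u)
               & H11 (component jz u)]]
  else if `|k| == 1 then
    [set u | [/\ H11 (component jr u), H11 (component jt u),
                 V11 (component jz u) & L2m (mixed k u)]]
  else
    [set u | [/\ V11 (component jr u), V11 (component jt u)
               & V11 (component jz u)]].

(* [cross_term k u] is real, see [Im_cross_term] below. *)
Definition H1k_sqnorm k u : R :=
  \sum_(j < 3) sqL2p (component j u) +
  if k == 0 then
    sqV11 (component jr u) + sqV11 (component jt u) + sqH11 (component jz u)
  else if `|k| == 1 then
    2 * sqL2m (mixed k u)
    + sqH11 (component jr u) + sqH11 (component jt u) + sqV11 (component jz u)
  else
    \sum_(j < 3) sqH11 (component j u)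
    + (1 + k%:~R ^+ 2) * (sqL2m (component jr u) + sqL2m (component jt u))
    + k%:~R ^+ 2 * sqL2m (component jz u)
    + complex.Re (cross_term k u).

Definition H1k_norm k u : R := Num.sqrt (H1k_sqnorm k u).

Definition H1k_star_norm k u : R :=
  Num.sqrt (\sum_(j < 3) sqL2p (component j u)
            + \sum_(j < 3) sqH11 (component j u)
            + k%:~R ^+ 2 * \sum_(j < 3) sqL2m (component j u)).

Definition ae_eq2 (u w : plane R -> 'cV[R[i]]_3) := u = w %[ae leb2 R in Omega].

Definition ae_eq_seq (u w : int -> (plane R -> 'cV[R[i]]_3)) :=
  forall k, ae_eq2 (u k) (w k).

Lemma Im_cross_term k u : complex.Im (cross_term k u) = 0.
Proof.
rewrite /cross_term /cintegral.
under eq_Rintegral => p _.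
  rewrite (_ : complex.Re _ = 0); last first.
    case: (component jt u p) => a b; case: (component jr u p) => c e.
    by rewrite /=; ring.
  over.
rewrite /Rintegral integral0 /=.
have [m ->] : exists m : R, k%:~R = m%:C :> R[i].
  by exists k%:~R; rewrite rmorph_int.
by rewrite /=; ring.
Qed.

End weighted.

Lemma rotation_cylindrical (R : realType) (v : espace R -> 'cV[R[i]]_3) r t z :
  v (cartesian r t z) = rotation t *m cylindrical v r t z.
Proof.
rewrite /cylindrical mulmxA mulmxV ?mul1mx//.
have /mulmx1_unit[] // : rotation t *m (rotation t)^T = 1%:M.
apply/matrixP => i j; rewrite !mxE !big_ord_recr big_ord0 /= !mxE /=.
have := cos2Dsin2 t.
case: i => [[|[|[|i]]] // hi]; case: j => [[|[|[|j]]] // hj] /=.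
all: move=> h; apply/eqP; rewrite eq_complex /=; apply/andP; split; apply/eqP; nra.
Qed.

(* Main.v *)
(** In cylindrical components the fields [v_x + i v_y], [v_x - i v_y], [v_z] become
    [e^(i theta) (v_r + i v_theta)], [e^(- i theta) (v_r - i v_theta)], [v_z], so the
    [k]-th coefficients of [v_r + i v_theta], [v_r - i v_theta], [v_z] are the
    coefficients of index [k + 1], [k - 1], [k] of scalar fields.  By the parallelogram
    law both norms split along these three scalars, which reduces everything to a scalar
    statement: [f] is in H^1 of the revolved domain iff its coefficients [c_k] have [c_k],
    [d_r c_k], [d_z c_k], [(k / r) c_k] in L^2_1 with summable squared norms.

    The direct part is Parseval's identity for [f] and for the radial, angular and axial
    parts of its gradient; the weak derivatives of [c_k] are obtained by testing those of
    [f] with products of a meridian test function and a trigonometric function.  For the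
    converse, a single mode [c (r, z) e^(i k theta)] has the expected weak gradient away
    from the axis, hence everywhere because the axis has zero H^1-capacity; the series of
    modes is then summed by completeness of L^2 and closedness of weak derivatives. *)

(* The three shapes of [H1k] have a single cause. A scalar coefficient of angular frequency [m]
   needs [m^2 |c|^2 / r] to be integrable, a condition that is void exactly when [m = 0]. A vector
   field of index [k] involves the frequencies [k + 1], [k - 1], [k], which vanish respectively for
   [k = -1, 1, 0], and never when [|k| >= 2]. The cross term is what remains after expanding [(k +
   1)^2 |v_r + i v_theta|^2 + (k - 1)^2 |v_r - i v_theta|^2], and the starred norm only replaces
   [k + 1] and [k - 1] by [k]; the ratios of the squares lie between 1/4 and 9/4. The obstacle is
   the axis, where [r], [1 / r] and [exp (i theta)] are singular while weak derivatives are tested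
   with smooth functions. Meridian test functions are supported away from the axis and lift to
   space. Test functions of space may meet the axis; they are cut off near it, at the price of
   gradients that are unbounded but stay bounded in L^2. Slices of an L^2 field are integrable only
   for almost every meridian point, so most identities between coefficients hold almost
   everywhere. *)
Require Import Defs.
From HB Require Import structures.
From mathcomp Require Import all_boot all_order all_algebra.
From mathcomp Require Import all_classical all_reals all_analysis.
From mathcomp Require Import measurable_realfun.
From mathcomp Require Import complex ring lra.

Set Implicit Arguments.
Unset Strict Implicit.
Unset Printing Implicit Defensive.

Import Order.TTheory GRing.Theory Num.Theory.
Import numFieldNormedType.Exports.

Local Open Scope classical_set_scope.
Local Open Scope ring_scope.
Local Open Scope complex_scope.

(** * Complex-valued integrals and weighted L2 spaces *)

Section zero_integrals.
Context {d : measure_display} {T : measurableType d} {R : realType}.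
Variable mu : {measure set T -> \bar R}.
Local Open Scope ereal_scope.

(** The sets [A] whose preimage carries a zero integral form a Dynkin class: complements use the
    zero integral over [D], disjoint unions use the integrability of the signed [f]. Since [G] is
    stable under intersection, the class contains the sigma-algebra generated by [G]. *)
Lemma zero_integral_preimage {d' : measure_display} {T' : measurableType d'}
    (D : set T) (f : T -> \bar R) (h : T -> T') (G : set (set T')) :
  measurable D -> mu.-integrable D f -> measurable_fun setT h ->
  measurable = <<s G >> -> setI_closed G -> \int[mu]_(x in D) f x = 0 ->
  (forall A, G A -> \int[mu]_(x in D `&` h @^-1` A) f x = 0) ->
  forall A, measurable A -> \int[mu]_(x in D `&` h @^-1` A) f x = 0.
Proof.
move=> mD fi mh mG IG D0 G0.
have mhA A : measurable A -> measurable (D `&` h @^-1` A).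
  by move=> mA; apply: measurableI => //; rewrite -[X in measurable X]setTI; exact: mh.
move=> A mA; have : <<s G >> A by rewrite -mG.
move: A {mA}; apply: (dynkin_induction mG IG); rewrite ?preimage_setT ?setIT//.
- move=> S mS S0; rewrite preimage_setC.
  move: D0.
  rewrite -{1}(setUIDK D (h @^-1` S)) integral_setU.
  + by rewrite S0 add0e.
  + exact: mhA.
  + by rewrite setDE -[~` _]/(h @^-1` (~` S)); apply: mhA; exact: measurableC.
  + by rewrite setUIDK; exact: measurable_int fi.
  + by apply/disj_setPS => x [[_ hS] [_ /(_ hS)]].
- move=> F mF tF F0.
  rewrite preimage_bigcup setI_bigcupr integral_bigcup//.
  + by rewrite eseries0// => i _ _; rewrite F0.
  + apply/trivIsetP => i j _ _ ij; rewrite setIACA setIid -preimage_setI.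
    by move/trivIsetP : tF => -> //; rewrite preimage_set0 setI0.
  + by move=> k; exact: mhA.
  + apply: integrableS fi => //; last by move=> x [i _ []].
    by apply: bigcup_measurable => k _; exact: mhA.
Qed.

Lemma ae_eq0_zero_integral (D : set T) (f : T -> \bar R) :
  measurable D -> mu.-integrable D f ->
  (forall A, measurable A -> \int[mu]_(x in D `&` A) f x = 0) ->
  ae_eq mu D f (cst 0).
Proof.
move=> mD fi f0; apply: integral_ae_eq => // E ED mE.
by rewrite integral0 -[X in integral _ X _](setIidr ED) f0.
Qed.

(** Rays are stable under intersection and generate the Borel sets. Iterating this lemma over the
    coordinates turns information on boxes into information on all measurable sets. *)
Lemma zero_integral_rays (D : set T) (f : T -> \bar R) (h : T -> measurableTypeR R) :
  measurable D -> mu.-integrable D f -> measurable_fun setT h ->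
  \int[mu]_(x in D) f x = 0 ->
  (forall a : R, \int[mu]_(x in D `&` h @^-1` `]a, +oo[%classic) f x = 0) ->
  forall A, measurable A -> \int[mu]_(x in D `&` h @^-1` A) f x = 0.
Proof.
move=> mD fi mh D0 H; apply: (@zero_integral_preimage _ _ _ _ _ (@RGenOInfty.G R)) => //.
- exact: RGenOInfty.measurableE.
- move=> _ _ [a ->] [b ->]; exists (Num.max a b).
  by apply/seteqP; split=> x /=; rewrite !in_itv /= !andbT gt_max; [move=> [-> ->]|move=> /andP].
- by move=> _ [a ->].
Qed.

Lemma zero_integral_rectangles {d1 d2} {T1 : measurableType d1} {T2 : measurableType d2}
    (D : set T) (f : T -> \bar R) (h1 : T -> T1) (h2 : T -> T2) :
  measurable D -> mu.-integrable D f -> measurable_fun setT h1 -> measurable_fun setT h2 ->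
  (forall A B, measurable A -> measurable B ->
     \int[mu]_(x in D `&` h1 @^-1` A `&` h2 @^-1` B) f x = 0) ->
  forall E, measurable E -> \int[mu]_(x in D `&` (fun x => (h1 x, h2 x)) @^-1` E) f x = 0.
Proof.
move=> mD fi m1 m2 H.
apply: (@zero_integral_preimage _ _ _ _ _ [set A `*` B | A in @measurable d1 T1 & B in @measurable d2 T2]) => //.
- exact/measurable_fun_pair.
- exact: measurable_prod_measurableType.
- move=> _ _ [A1 mA1 [B1 mB1 <-]] [A2 mA2 [B2 mB2 <-]].
  exists (A1 `&` A2); first exact: measurableI.
  by exists (B1 `&` B2); [exact: measurableI|rewrite setXI].
- by have := H _ _ measurableT measurableT; rewrite !preimage_setT !setIT.
- move=> _ [A mA [B mB <-]]; rewrite -(H A B)//; congr (integral _ _ _).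
  by apply/seteqP; split => [x [Dx [/= ? ?]]|x [[Dx ?] ?]].
Qed.

End zero_integrals.

Section complex_arith.
Context {R : realType}.
Implicit Types x y : R[i].
Local Notation Re := complex.Re.
Local Notation Im := complex.Im.

Lemma complexE2 x y : Re x = Re y -> Im x = Im y -> x = y.
Proof. by case: x => a b; case: y => c e /= -> ->. Qed.

Lemma ReD x y : Re (x + y) = Re x + Re y. Proof. by case: x; case: y. Qed.
Lemma ImD x y : Im (x + y) = Im x + Im y. Proof. by case: x; case: y. Qed.
Lemma ReN x : Re (- x) = - Re x. Proof. by case: x. Qed.
Lemma ImN x : Im (- x) = - Im x. Proof. by case: x. Qed.
Lemma ReM x y : Re (x * y) = Re x * Re y - Im x * Im y.
Proof. by case: x; case: y. Qed.
Lemma ImM x y : Im (x * y) = Re x * Im y + Im x * Re y.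
Proof. by case: x => a b; case: y => c e /=; ring. Qed.
Lemma Re_conj x : Re x^*%C = Re x. Proof. by case: x. Qed.
Lemma Im_conj x : Im x^*%C = - Im x. Proof. by case: x. Qed.

Lemma sqr_normc x : Normc.normc x ^+ 2 = Re x ^+ 2 + Im x ^+ 2.
Proof. by case: x => a b /=; rewrite sqr_sqrtr// addr_ge0// sqr_ge0. Qed.

Lemma normc_ge0 x : 0 <= Normc.normc x.
Proof. by case: x => a b; exact: sqrtr_ge0. Qed.

Lemma sqr_normcM x y :
  Normc.normc (x * y) ^+ 2 = Normc.normc x ^+ 2 * Normc.normc y ^+ 2.
Proof. by rewrite !sqr_normc ReM ImM; ring. Qed.

(** The difference of the two sides is [t |x - y / t|^2]. *)
Lemma sqr_normcD_le (t : R) x y : 0 < t ->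
  Normc.normc (x + y) ^+ 2 <=
  (1 + t) * Normc.normc x ^+ 2 + (1 + t^-1) * Normc.normc y ^+ 2.
Proof.
move=> t0; rewrite !sqr_normc ReD ImD -subr_ge0.
have -> : (1 + t) * (Re x ^+ 2 + Im x ^+ 2) + (1 + t^-1) * (Re y ^+ 2 + Im y ^+ 2)
   - ((Re x + Re y) ^+ 2 + (Im x + Im y) ^+ 2) =
   t * ((Re x - t^-1 * Re y) ^+ 2 + (Im x - t^-1 * Im y) ^+ 2).
  by field; rewrite gt_eqF.
by rewrite mulr_ge0 ?(ltW t0)// addr_ge0 ?sqr_ge0.
Qed.

Lemma sqr_normcD_le2 x y : Normc.normc (x + y) ^+ 2 <=
  2 * Normc.normc x ^+ 2 + 2 * Normc.normc y ^+ 2.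
Proof. by have := @sqr_normcD_le 1 x y ltr01; rewrite invr1. Qed.

Lemma sqr_normc_eq0 x : (Normc.normc x ^+ 2 == 0) = (x == 0).
Proof.
rewrite sqr_normc paddr_eq0 ?sqr_ge0// !sqrf_eq0; apply/andP/eqP => [[/eqP a /eqP b]|->//].
exact: complexE2.
Qed.

Lemma normr_Re_le x : `|Re x| <= Normc.normc x.
Proof. by case: x => a b /=; rewrite -sqrtr_sqr ler_sqrt ?lerDl ?addr_ge0 ?sqr_ge0. Qed.

Lemma normr_Im_le x : `|Im x| <= Normc.normc x.
Proof. by case: x => a b /=; rewrite -sqrtr_sqr ler_sqrt ?lerDr ?addr_ge0 ?sqr_ge0. Qed.

Lemma normc_le_ReIm x : Normc.normc x <= `|Re x| + `|Im x|.
Proof.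
rewrite -(@ler_pXn2r _ 2)// ?nnegrE ?normc_ge0 ?addr_ge0//.
rewrite sqr_normc sqrrD !real_normK ?num_real// lerD2r lerDl mulrn_wge0//.
Qed.

End complex_arith.

Section cmeasurable_theory.
Context {R : realType} {d : measure_display} {T : measurableType d}.
Implicit Types (D : set T) (f g : T -> R[i]).

Lemma eq_cmeasurable D f g : (forall x, D x -> f x = g x) ->
  cmeasurable D f -> cmeasurable D g.
Proof.
by move=> fg [fR fI]; split; [move: fR|move: fI]; apply: eq_measurable_fun => x;
  rewrite inE => /fg ->.
Qed.

Lemma cmeasurableS D E f : measurable E -> D `<=` E -> cmeasurable E f -> cmeasurable D f.
Proof. by move=> mE DE [? ?]; split; apply: measurable_funS DE _. Qed.

Lemma cmeasurableD D f g : cmeasurable D f -> cmeasurable D g ->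
  cmeasurable D (fun x => f x + g x).
Proof.
move=> [fR fI] [gR gI]; split; [under eq_fun do rewrite ReD|under eq_fun do rewrite ImD];
exact: measurable_funD.
Qed.

Lemma cmeasurableM D f g : cmeasurable D f -> cmeasurable D g ->
  cmeasurable D (fun x => f x * g x).
Proof.
move=> [fR fI] [gR gI]; split.
  under eq_fun do rewrite ReM; apply: measurable_funB; exact: measurable_funM.
under eq_fun do rewrite ImM; apply: measurable_funD; exact: measurable_funM.
Qed.

Lemma cmeasurable_cst D (c : R[i]) : cmeasurable D (fun=> c).
Proof. by split; exact: measurable_cst. Qed.

Lemma cmeasurableC D (f : T -> R) : measurable_fun D f ->
  cmeasurable D (fun x => (f x)%:C).
Proof. by move=> mf; split => //=; exact: measurable_cst. Qed.

Lemma cmeasurableZ D (c : R[i]) f : cmeasurable D f -> cmeasurable D (fun x => c * f x).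
Proof. by move=> mf; apply: cmeasurableM => //; exact: cmeasurable_cst. Qed.

Lemma cmeasurable_conj D f : cmeasurable D f -> cmeasurable D (fun x => (f x)^*%C).
Proof.
move=> [fR fI]; split; first by under eq_fun do rewrite Re_conj.
by under eq_fun do rewrite Im_conj; exact: measurable_funN.
Qed.

Lemma measurable_sqr_normc D f : cmeasurable D f ->
  measurable_fun D (fun x => Normc.normc (f x) ^+ 2).
Proof.
move=> [fR fI]; under eq_fun do rewrite sqr_normc.
by apply: measurable_funD; exact: measurable_funX.
Qed.

Lemma measurable_normc D f : cmeasurable D f ->
  measurable_fun D (fun x => Normc.normc (f x)).
Proof.
move=> mf; rewrite [X in measurable_fun _ X](_ : _ = Num.sqrt \o (fun x => Normc.normc (f x) ^+ 2)).
  apply: measurableT_comp; [exact: continuous_measurable_fun (@sqrt_continuous R)|exact: measurable_sqr_normc].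
by apply/funext => x /=; rewrite sqrtr_sqr ger0_norm// normc_ge0.
Qed.

End cmeasurable_theory.

Section cintegral_theory.
Context {R : realType} {d : measure_display} {T : measurableType d}.
Variables (mu : {measure set T -> \bar R}) (D : set T) (mD : measurable D).
Implicit Types (f g : T -> R[i]).
Local Notation Re := complex.Re.
Local Notation Im := complex.Im.

Definition cintegrable f :=
  mu.-integrable D (fun x => (Re (f x))%:E) /\ mu.-integrable D (fun x => (Im (f x))%:E).

Lemma RintegrableZl (r : R) (h : T -> R) : mu.-integrable D (EFin \o h) ->
  mu.-integrable D (EFin \o (fun x => r * h x)).
Proof. by move=> hi; have := integrableZl mD r hi. Qed.

Lemma cintegrable_cmeasurable f : cintegrable f -> cmeasurable D f.
Proof. by move=> [/measurable_int/measurable_EFinP ? /measurable_int/measurable_EFinP ?]. Qed.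

Lemma eq_cintegrable f g : (forall x, D x -> f x = g x) -> cintegrable f -> cintegrable g.
Proof.
by move=> fg [fR fI]; split; [move: fR|move: fI]; apply: eq_integrable => // x /[!inE] /fg ->.
Qed.

Lemma cintegrable_le f (g : T -> R) : cmeasurable D f -> mu.-integrable D (EFin \o g) ->
  (forall x, D x -> Normc.normc (f x) <= g x) -> cintegrable f.
Proof.
move=> [fR fI] gi fg; split.
  apply: le_integrable gi => //; first exact/measurable_EFinP.
  move=> x Dx /=; rewrite lee_fin (le_trans (normr_Re_le _))// (le_trans (fg _ Dx))//.
  exact: ler_norm.
apply: le_integrable gi => //; first exact/measurable_EFinP.
move=> x Dx /=; rewrite lee_fin (le_trans (normr_Im_le _))// (le_trans (fg _ Dx))//.
exact: ler_norm.
Qed.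

Lemma cintegrable_normc f : cintegrable f ->
  mu.-integrable D (fun x => (Normc.normc (f x))%:E).
Proof.
move=> fi; have [fR fI] := fi.
have := integrableD mD (integrable_abse fR) (integrable_abse fI).
apply: le_integrable => //.
  by apply/measurable_EFinP/measurable_normc/cintegrable_cmeasurable.
move=> x Dx /=; rewrite lee_fin ger0_norm ?normc_ge0// ger0_norm ?addr_ge0//.
exact: normc_le_ReIm.
Qed.

Lemma cintegrableP f : cintegrable f <->
  cmeasurable D f /\ (\int[mu]_(x in D) (Normc.normc (f x))%:E < +oo)%E.
Proof.
split=> [fi|[mf foo]].
  split; first exact: cintegrable_cmeasurable.
  have /integrableP[_] := cintegrable_normc fi.
  by apply: le_lt_trans; under eq_integral do rewrite -(ger0_norm (normc_ge0 _)).
apply: (@cintegrable_le _ (fun x => Normc.normc (f x))) => //.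
apply/integrableP; split; first exact/measurable_EFinP/measurable_normc.
by under eq_integral do rewrite /= ger0_norm ?normc_ge0//.
Qed.

Lemma cintegrableD f g : cintegrable f -> cintegrable g -> cintegrable (fun x => f x + g x).
Proof.
move=> [fR fI] [gR gI]; split.
  by under eq_fun do rewrite ReD EFinD; exact: integrableD.
by under eq_fun do rewrite ImD EFinD; exact: integrableD.
Qed.

Lemma cintegrableZ (c : R[i]) f : cintegrable f -> cintegrable (fun x => c * f x).
Proof.
move=> [fR fI]; split.
  under eq_fun do rewrite ReM EFinB !EFinM.
  by apply: integrableB => //; exact: integrableZl.
under eq_fun do rewrite ImM EFinD !EFinM.
by apply: integrableD => //; exact: integrableZl.
Qed.

Lemma eq_cintegral f g : (forall x, D x -> f x = g x) -> cintegral mu D f = cintegral mu D g.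
Proof.
by move=> fg; congr (_ +i* _); apply: eq_Rintegral => x /[!inE] /fg ->.
Qed.

Lemma ae_eq_cintegral f g : cmeasurable D f -> cmeasurable D g ->
  f = g %[ae mu in D] -> cintegral mu D f = cintegral mu D g.
Proof.
move=> [fR fI] [gR gI] fg; congr (_ +i* _); congr fine; apply: ae_eq_integral => //;
  try exact/measurable_EFinP.
  by move: fg; apply: filterS => x + Dx => /(_ Dx) ->.
by move: fg; apply: filterS => x + Dx => /(_ Dx) ->.
Qed.

Lemma cintegralD f g : cintegrable f -> cintegrable g ->
  cintegral mu D (fun x => f x + g x) = cintegral mu D f + cintegral mu D g.
Proof.
move=> [fR fI] [gR gI]; apply: complexE2; rewrite ?ReD ?ImD /=.
  by under eq_Rintegral do rewrite ReD; rewrite RintegralD.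
by under eq_Rintegral do rewrite ImD; rewrite RintegralD.
Qed.

Lemma cintegralZ (c : R[i]) f : cintegrable f ->
  cintegral mu D (fun x => c * f x) = c * cintegral mu D f.
Proof.
move=> [fR fI]; apply: complexE2; rewrite ?ReM ?ImM /=.
  under eq_Rintegral do rewrite ReM.
  by rewrite RintegralB ?RintegralZl//; exact: RintegrableZl.
under eq_Rintegral do rewrite ImM.
by rewrite RintegralD ?RintegralZl//; exact: RintegrableZl.
Qed.

Lemma cintegralZr (c : R[i]) f : cintegrable f ->
  cintegral mu D (fun x => f x * c) = cintegral mu D f * c.
Proof. by move=> fi; rewrite mulrC -cintegralZ//; apply: eq_cintegral => x _; rewrite mulrC. Qed.

Lemma cintegralN f : cintegrable f ->
  cintegral mu D (fun x => - f x) = - cintegral mu D f.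
Proof. by move=> fi; rewrite -mulN1r -cintegralZ//; apply: eq_cintegral => x _; rewrite mulN1r. Qed.

Lemma cintegrableN f : cintegrable f -> cintegrable (fun x => - f x).
Proof. by move=> /(cintegrableZ (-1)); apply: eq_cintegrable => x _; rewrite mulN1r. Qed.

Lemma cintegralB f g : cintegrable f -> cintegrable g ->
  cintegral mu D (fun x => f x - g x) = cintegral mu D f - cintegral mu D g.
Proof. by move=> fi gi; rewrite cintegralD ?cintegralN//; exact: cintegrableN. Qed.

Lemma cintegral0 : cintegral mu D (fun=> 0) = 0 :> R[i].
Proof. by rewrite /cintegral /Rintegral integral0. Qed.

Lemma cintegral_conj f : cintegrable f ->
  cintegral mu D (fun x => (f x)^*%C) = (cintegral mu D f)^*%C.
Proof.
move=> [fR fI]; rewrite /cintegral /=; congr (_ +i* _).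
  by apply: eq_Rintegral => x _; rewrite Re_conj.
under eq_Rintegral do rewrite Im_conj -mulN1r.
by rewrite RintegralZl// mulN1r.
Qed.

(** The factor 2 comes from bounding the real and imaginary parts separately; every use is a
    convergence estimate or absorbs it. *)
Lemma normc_cintegral_le f : cintegrable f ->
  Normc.normc (cintegral mu D f) <= 2 * (\int[mu]_(x in D) Normc.normc (f x)).
Proof.
move=> fi; have [fR fI] := fi.
apply: le_trans (normc_le_ReIm _) _; rewrite mulr2n mulrDl mul1r; apply: lerD.
  apply: le_trans (le_normr_Rintegral mD fR) _; apply: le_Rintegral => //.
  - exact: (integrable_abse fR).
  - exact: cintegrable_normc.
  - by move=> x _; exact: normr_Re_le.
apply: le_trans (le_normr_Rintegral mD fI) _; apply: le_Rintegral => //.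
- exact: (integrable_abse fI).
- exact: cintegrable_normc.
- by move=> x _; exact: normr_Im_le.
Qed.

Lemma cintegral_dominated (f_ : nat -> T -> R[i]) f (g : T -> R) :
  (forall n, cmeasurable D (f_ n)) -> cmeasurable D f ->
  mu.-integrable D (EFin \o g) ->
  (forall n x, D x -> Normc.normc (f_ n x) <= g x) ->
  (forall x, D x -> (fun n => Re (f_ n x)) @ \oo --> Re (f x)) ->
  (forall x, D x -> (fun n => Im (f_ n x)) @ \oo --> Im (f x)) ->
  ((fun n => Re (cintegral mu D (f_ n))) @ \oo --> Re (cintegral mu D f)) /\
  ((fun n => Im (cintegral mu D (f_ n))) @ \oo --> Im (cintegral mu D f)).
Proof.
move=> mf_ [fR fI] gi f_g cR cI.
have key (h_ : nat -> T -> R) (h : T -> R) : (forall n, measurable_fun D (h_ n)) ->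
    measurable_fun D h -> (forall n x, D x -> `|h_ n x| <= g x) ->
    (forall x, D x -> (fun n => h_ n x) @ \oo --> h x) ->
    (fun n => \int[mu]_(x in D) h_ n x) @ \oo --> \int[mu]_(x in D) h x.
  move=> mh_ mh hg ch.
  have := @dominated_convergence _ _ _ mu D mD (fun n x => (h_ n x)%:E)
    (EFin \o h) (EFin \o g).
  have Hmh n : measurable_fun D (fun x => (h_ n x)%:E) by exact/measurable_EFinP.
  have Hh : measurable_fun D (EFin \o h) by exact/measurable_EFinP.
  have Hc : {ae mu, forall x, D x -> (fun n => (h_ n x)%:E) @ \oo --> (EFin \o h) x}.
    by apply: aeW => x Dx; apply: cvg_EFin; [exact: nearW|exact: ch].
  have Hg : {ae mu, forall x n, D x -> (`|(h_ n x)%:E| <= (EFin \o g) x)%E}.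
    by apply: aeW => x n Dx; rewrite /= lee_fin hg.
  move=> /(_ Hmh Hh Hc gi Hg) [hi _ H].
  apply: fine_cvg; rewrite fineK//; exact: integrable_fin_num.
split; apply: key => //.
- by move=> n; case: (mf_ n).
- by move=> n x Dx; rewrite (le_trans (normr_Re_le _)) ?f_g.
- by move=> n; case: (mf_ n).
- by move=> n x Dx; rewrite (le_trans (normr_Im_le _)) ?f_g.
Qed.

End cintegral_theory.

Section L2_theory.
Context {R : realType} {d : measure_display} {T : measurableType d}.
Variables (mu : {measure set T -> \bar R}) (D : set T) (mD : measurable D).
Variables (w : T -> R) (mw : measurable_fun D w) (w_gt0 : forall x, D x -> 0 < w x).
Implicit Types (f g : T -> R[i]).

Let w_ge0 x : D x -> 0 <= w x. Proof. by move=> /w_gt0 /ltW. Qed.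

Lemma measurable_L2_integrand f : cmeasurable D f ->
  measurable_fun D (fun x => Normc.normc (f x) ^+ 2 * w x).
Proof. by move=> mf; apply: measurable_funM => //; exact: measurable_sqr_normc. Qed.

Lemma L2_integral_ge0 f : (0 <= L2_integral mu D w f)%E.
Proof. by apply: integral_ge0 => x Dx; rewrite lee_fin mulr_ge0 ?sqr_ge0 ?w_ge0. Qed.

Lemma L2_sqnorm_ge0 f : 0 <= L2_sqnorm mu D w f.
Proof. exact/fine_ge0/L2_integral_ge0. Qed.

Lemma L2_sqnormE f : L2 mu D w f -> (L2_sqnorm mu D w f)%:E = L2_integral mu D w f.
Proof. by move=> [_ foo]; rewrite /L2_sqnorm fineK// ge0_fin_numE ?L2_integral_ge0. Qed.

Lemma L2_integrable f : L2 mu D w f ->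
  mu.-integrable D (EFin \o (fun x => Normc.normc (f x) ^+ 2 * w x)).
Proof.
move=> [mf foo]; apply/integrableP; split; first exact/measurable_EFinP/measurable_L2_integrand.
rewrite (eq_integral (fun x => (Normc.normc (f x) ^+ 2 * w x)%:E))// => x /[!inE] Dx.
by rewrite /= ger0_norm// mulr_ge0 ?sqr_ge0 ?w_ge0.
Qed.

Lemma integrable_L2 f : cmeasurable D f ->
  mu.-integrable D (EFin \o (fun x => Normc.normc (f x) ^+ 2 * w x)) -> L2 mu D w f.
Proof.
move=> mf /integrableP[_ foo]; split=> //; rewrite /L2_integral.
rewrite (eq_integral (fun x => `|(EFin \o (fun x => Normc.normc (f x) ^+ 2 * w x)%R) x|)%E)//.
by move=> x /[!inE] Dx; rewrite /= ger0_norm// mulr_ge0 ?sqr_ge0 ?w_ge0.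
Qed.

Lemma L2_le f (h : T -> R) : cmeasurable D f ->
  mu.-integrable D (EFin \o h) ->
  (forall x, D x -> Normc.normc (f x) ^+ 2 * w x <= h x) -> L2 mu D w f.
Proof.
move=> mf hi fh; apply: integrable_L2 => //; apply: le_integrable hi => //.
  exact/measurable_EFinP/measurable_L2_integrand.
move=> x Dx /=; rewrite lee_fin ger0_norm ?mulr_ge0 ?sqr_ge0 ?normc_ge0 ?w_ge0//.
by rewrite (le_trans (fh _ Dx))// ler_norm.
Qed.

Lemma L2D f g : L2 mu D w f -> L2 mu D w g -> L2 mu D w (fun x => f x + g x).
Proof.
move=> Lf Lg; apply: (@L2_le _ (fun x => 2 * (Normc.normc (f x) ^+ 2 * w x) +
   2 * (Normc.normc (g x) ^+ 2 * w x))).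
- by apply: cmeasurableD; [case: Lf|case: Lg].
- under [X in _.-integrable _ X]eq_fun do rewrite /= EFinD.
  by apply: integrableD => //; apply: RintegrableZl => //; exact: L2_integrable.
- move=> x Dx; have := ler_wpM2r (w_ge0 Dx) (sqr_normcD_le2 (f x) (g x)).
  by rewrite mulrDl -!mulrA.
Qed.

Lemma L2_integralZ (c : R[i]) f : L2_integral mu D w (fun x => c * f x) =
  (\int[mu]_(x in D) (Normc.normc c ^+ 2 * (Normc.normc (f x) ^+ 2 * w x))%:E)%E.
Proof. by apply: eq_integral => x _; rewrite sqr_normcM mulrA. Qed.

Lemma L2_Z (c : R[i]) f : L2 mu D w f -> L2 mu D w (fun x => c * f x).
Proof.
move=> Lf; apply: (@L2_le _ (fun x => Normc.normc c ^+ 2 * (Normc.normc (f x) ^+ 2 * w x))).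
- by apply: cmeasurableZ; case: Lf.
- by apply: RintegrableZl => //; exact: L2_integrable.
- by move=> x _; rewrite sqr_normcM mulrA.
Qed.

Lemma L2_0 : L2 mu D w (fun=> 0).
Proof.
split; first exact: cmeasurable_cst.
by rewrite /L2_integral; under eq_integral do rewrite sqr_normc /= !expr0n addr0 mul0r; rewrite integral0.
Qed.

Lemma L2_N f : L2 mu D w f -> L2 mu D w (fun x => - f x).
Proof. by move=> /(L2_Z (-1)); under eq_fun do rewrite mulN1r. Qed.

Lemma L2B f g : L2 mu D w f -> L2 mu D w g -> L2 mu D w (fun x => f x - g x).
Proof. by move=> Lf /L2_N; exact: L2D. Qed.

Lemma L2_sum (I : Type) (s : seq I) (F : I -> T -> R[i]) :
  (forall i, L2 mu D w (F i)) -> L2 mu D w (fun x => \sum_(i <- s) F i x).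
Proof.
move=> LF; elim: s => [|i s IH]; first by under eq_fun do rewrite big_nil; exact: L2_0.
by under eq_fun do rewrite big_cons; exact: L2D.
Qed.

Lemma L2_sqnormZ (c : R[i]) f : L2 mu D w f ->
  L2_sqnorm mu D w (fun x => c * f x) = Normc.normc c ^+ 2 * L2_sqnorm mu D w f.
Proof.
move=> Lf; rewrite {1}/L2_sqnorm L2_integralZ.
by rewrite -[LHS]/(\int[mu]_(x in D) _) RintegralZl//; exact: L2_integrable.
Qed.

Lemma ae_eq_L2_integral f g : cmeasurable D f -> cmeasurable D g ->
  f = g %[ae mu in D] -> L2_integral mu D w f = L2_integral mu D w g.
Proof.
move=> mf mg fg; apply: ge0_ae_eq_integral => //.
- exact/measurable_EFinP/measurable_L2_integrand.
- exact/measurable_EFinP/measurable_L2_integrand.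
- by move=> x Dx; rewrite lee_fin mulr_ge0 ?sqr_ge0 ?w_ge0.
- by move=> x Dx; rewrite lee_fin mulr_ge0 ?sqr_ge0 ?w_ge0.
- by move: fg; apply: filterS => x + Dx => /(_ Dx) ->.
Qed.

Lemma ae_eq_L2 f g : cmeasurable D g ->
  f = g %[ae mu in D] -> L2 mu D w f -> L2 mu D w g.
Proof. by move=> mg fg [mf foo]; split=> //; rewrite -(ae_eq_L2_integral mf mg fg). Qed.

Lemma L2_integral_eq0 f : cmeasurable D f ->
  L2_integral mu D w f = 0%E <-> f = (fun=> 0) %[ae mu in D].
Proof.
move=> mf; have mi := (measurable_EFinP _ _).2 (measurable_L2_integrand mf).
have H := ae_eq_integral_abs mu mD mi.
have E : L2_integral mu D w f =
    (\int[mu]_(x in D) `|(EFin \o (fun x => Normc.normc (f x) ^+ 2 * w x)%R) x|)%E.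
  apply: eq_integral => x /[!inE] Dx.
  by rewrite /= ger0_norm// mulr_ge0 ?sqr_ge0 ?w_ge0.
rewrite E; apply: (iff_trans H); split; apply: filterS => x + Dx => /(_ Dx) /=.
  move=> [] /eqP; rewrite mulf_eq0 sqr_normc_eq0 (gt_eqF (w_gt0 Dx)) orbF => /eqP //.
by move=> ->; rewrite sqr_normc /= !expr0n addr0 mul0r.
Qed.

Lemma L2_sqnorm_eq0 f : L2 mu D w f ->
  L2_sqnorm mu D w f = 0 <-> f = (fun=> 0) %[ae mu in D].
Proof.
move=> Lf; apply: iff_trans (L2_integral_eq0 Lf.1).
by rewrite -L2_sqnormE//; split=> [->|[]].
Qed.

End L2_theory.

Section L2_complete.
Context {R : realType} {d : measure_display} {T : measurableType d}.
Variables (mu : {measure set T -> \bar R}) (D : set T) (mD : measurable D).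
Variables (w : T -> R) (mw : measurable_fun D w) (w_gt0 : forall x, D x -> 0 < w x).
Let w_ge0 x : D x -> 0 <= w x. Proof. by move=> /w_gt0 /ltW. Qed.

(** The increments are dominated by the geometric sequence [sqrt M / 2^j]. *)
Lemma cvg_of_sqr_telescope (a : nat -> R) (M : R) :
  (forall j, 4 ^+ j * (a j.+1 - a j) ^+ 2 <= M) -> cvgn a.
Proof.
move=> aM; set M' := Num.max M 0; have M0 : 0 <= M' by rewrite le_max lexx orbT.
have b j : `|a j.+1 - a j| <= geometric (Num.sqrt M') 2^-1 j.
  rewrite /geometric /= -sqrtr_sqr -[_ ^+ j]ger0_norm ?exprn_ge0// -sqrtr_sqr -sqrtrM//.
  rewrite ler_sqrt ?mulr_ge0 ?sqr_ge0// -exprM mulnC exprM.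
  have -> : (2^-1 ^+ 2) ^+ j = (4 ^+ j)^-1 :> R.
    by rewrite -exprVn; congr (_ ^+ j); field.
  by rewrite ler_pdivlMr ?exprn_gt0// mulrC (le_trans (aM j))// le_max lexx.
have ct : cvgn (series (telescope a)).
  apply: normed_cvg; apply: series_le_cvg b _ => //.
    by move=> n; rewrite /geometric /= mulr_ge0 ?exprn_ge0 ?sqrtr_ge0.
  by apply: is_cvg_geometric_series; rewrite ger0_norm// invf_lt1 ?ltr1n.
rewrite (_ : a = (fun n => a 0%N + series (telescope a) n)); last first.
  by apply/funext => n; rewrite -eq_sum_telescope.
by apply: is_cvgD => //; exact: is_cvg_cst.
Qed.

Local Open Scope ereal_scope.

(** Riesz-Fischer: along a fast subsequence the series of squared increments weighted by [4^j] has a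
    finite integral, hence a finite sum almost everywhere, and [cvg_of_sqr_telescope] gives
    pointwise convergence. Fatou's lemma turns it into convergence in norm of the whole sequence. *)
Lemma L2_complete_real (f : nat -> T -> R) : (forall n, measurable_fun D (f n)) ->
  (forall e : R, (0 < e)%R -> exists N, forall m n, (N <= m)%N -> (N <= n)%N ->
     \int[mu]_(x in D) ((f m x - f n x) ^+ 2 * w x)%:E <= e%:E) ->
  exists2 g : T -> R, measurable_fun D g &
  forall e : R, (0 < e)%R -> exists N, forall n, (N <= n)%N ->
     \int[mu]_(x in D) ((g x - f n x) ^+ 2 * w x)%:E <= e%:E.
Proof.
move=> mf fC.
have mi (h : T -> R) : measurable_fun D h -> measurable_fun D (fun x => (h x ^+ 2 * w x)%:E).
  move=> mh; apply/measurable_EFinP; apply: measurable_funM => //; exact: measurable_funX.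
(* The first factor compensates the weight [4^j] of [F j]; the second is summable. *)
pose e (j : nat) : R := ((4 ^+ j)^-1 * (1 / (2 ^ j.+1)%:R))%R.
have e0 j : (0 < e j)%R by rewrite /e mulr_gt0 ?divr_gt0 ?invr_gt0 ?exprn_gt0 ?ltr0n ?expn_gt0.
have /choice[M HM] : forall j, exists N, forall m n, (N <= m)%N -> (N <= n)%N ->
     \int[mu]_(x in D) ((f m x - f n x) ^+ 2 * w x)%:E <= (e j)%:E by move=> j; exact: fC.
(* The sum makes the ranks nondecreasing and at least [M j]; the summand [j] makes them
   unbounded. *)
pose N j := (j + \sum_(i < j.+1) M i)%N.
have NM j : (M j <= N j)%N by rewrite /N big_ord_recr /= addnA leq_addl.
have NS j : (N j <= N j.+1)%N.
  by rewrite /N [in leqRHS]big_ord_recr /= addSn addnA -addSn (leq_trans _ (leq_addr _ _))// leqnSn.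
have NN i j : (i <= j)%N -> (N i <= N j)%N.
  by move=> ij; exact: (homo_leq leqnn leq_trans NS ij).
pose F (j : nat) x := (4 ^+ j * ((f (N j.+1) x - f (N j) x) ^+ 2 * w x))%:E.
have F0 j x : D x -> 0 <= F j x.
  by move=> Dx; rewrite /F lee_fin; apply: mulr_ge0; rewrite ?exprn_ge0// mulr_ge0 ?sqr_ge0 ?w_ge0.
have mF j : measurable_fun D (F j).
  apply/measurable_EFinP; apply: measurable_funM => //.
  by apply/measurable_EFinP; apply: (mi (fun x => f (N j.+1) x - f (N j) x)%R); exact: measurable_funB.
have SF : \int[mu]_(x in D) (\sum_(0 <= j <oo) F j x) < +oo.
  rewrite integral_nneseries//.
  apply: (@le_lt_trans _ _ (\sum_(0 <= j <oo) (1 / (2 ^ j.+1)%:R)%:E)); last first.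
    exact: le_lt_trans (epsilon_trick0 xpredT ler01) (ltry _).
  apply: lee_nneseries; [by move=> *; apply: integral_ge0 => x Dx; exact: F0|move=> j _].
  rewrite /F; under eq_integral do rewrite EFinM.
  have -> : \int[mu]_(x in D) ((4 ^+ j)%:E * ((f (N j.+1) x - f (N j) x) ^+ 2 * w x)%:E) =
      (4 ^+ j)%:E * \int[mu]_(x in D) ((f (N j.+1) x - f (N j) x) ^+ 2 * w x)%:E.
    rewrite ge0_integralZl_EFin ?exprn_ge0//.
      by move=> x Dx; rewrite lee_fin mulr_ge0 ?sqr_ge0 ?w_ge0.
    by apply: (mi (fun x => f (N j.+1) x - f (N j) x)%R); exact: measurable_funB.
  have := HM j _ _ (leq_trans (NM j) (NS j)) (NM j).
  move=> /(@lee_wpmul2l _ (4 ^+ j)%:E _); rewrite lee_fin exprn_ge0// => /(_ isT).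
  move=> /le_trans; apply.
  rewrite -EFinM lee_fin /e [X in (X <= _)%R]mulrA divff ?mul1r//.
have aec : {ae mu, forall x, D x -> cvgn (fun j => f (N j) x)}.
  have : {ae mu, forall x, D x -> (\sum_(0 <= j <oo) F j x) \is a fin_num}.
    apply: integrable_ae => //; apply/integrableP; split.
      by apply: ge0_emeasurable_sum => // j x Dx _; exact: F0.
    apply: le_lt_trans SF; rewrite le_eqVlt; apply/orP; left; apply/eqP.
    apply: eq_integral => x /[!inE] Dx; rewrite gee0_abs//.
    by apply: nneseries_ge0 => n _ _; exact: F0.
  apply: filterS => x + Dx => /(_ Dx) fin.
  apply: (@cvg_of_sqr_telescope _ (fine (\sum_(0 <= j <oo) F j x) / w x)%R) => j.
  rewrite ler_pdivlMr ?w_gt0// -lee_fin fineK// -mulrA.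
  rewrite (nneseries_split 0 j.+1); last by move=> k _; exact: F0.
  rewrite add0n big_nat_recr//= addeAC leeDr//.
  by rewrite adde_ge0 ?sume_ge0 ?nneseries_ge0// => *; exact: F0.
(* An upper limit is measurable on all of [D], while the limit itself exists only almost
   everywhere. *)
pose g x := fine (limn_esup (fun j => (f (N j) x)%:E)).
have gE x : D x -> cvgn (fun j => f (N j) x) -> (fun j => f (N j) x) @ \oo --> g x.
  move=> Dx cx; have cE : (fun j => (f (N j) x)%:E) @ \oo --> (limn (fun j => f (N j) x))%:E.
    by apply: cvg_EFin => //; exact: nearW.
  by rewrite /g is_cvg_limn_esupE; [rewrite (cvg_lim _ cE)|apply/cvg_ex; eexists; exact: cE].
have mg : measurable_fun D g.
  have mls : measurable_fun D (fun x => limn_esup (fun j => (f (N j) x)%:E)).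
    by apply: measurable_fun_limn_esup => n; exact/measurable_EFinP.
  exact: measurableT_comp (fine_measurable measurableT) mls.
exists g => // r r0; have [N0 HN0] := fC r r0; exists N0 => n N0n.
pose G (j : nat) x := ((f (N (j + N0)%N) x - f n x) ^+ 2 * w x)%:E.
have mG j : measurable_fun D (G j).
  by apply: (mi (fun x => f (N (j + N0)%N) x - f n x)%R); exact: measurable_funB.
have Gr j : \int[mu]_(x in D) G j x <= r%:E.
  apply: HN0 => //; apply: leq_trans (leq_addl j N0) _; rewrite /N; exact: leq_addr.
(* Almost everywhere the integrand is a lower limit along the subsequence, the form in which Fatou's
   lemma applies. *)
have -> : \int[mu]_(x in D) ((g x - f n x) ^+ 2 * w x)%:E =
    \int[mu]_(x in D) limn_einf (G ^~ x).
  apply: ge0_ae_eq_integral => //.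
  - by apply: (mi (fun x => g x - f n x)%R); exact: measurable_funB.
  - rewrite /limn_einf; apply: measurableT_comp; first exact: oppe_measurable.
    by apply: measurable_fun_limn_esup => j; apply: measurableT_comp => //; exact: oppe_measurable.
  - by move=> x Dx; rewrite lee_fin mulr_ge0 ?sqr_ge0 ?w_ge0.
  - move=> x Dx; rewrite limn_einf_lim; apply: lime_ge; first exact: is_cvg_einfs.
    apply: nearW => k; apply: le_ereal_inf_tmp => _ [j _ <-].
    by rewrite lee_fin mulr_ge0 ?sqr_ge0 ?w_ge0.
  - move: aec; apply: filterS => x + Dx => /(_ Dx) cx.
    have cG : G ^~ x @ \oo --> ((g x - f n x) ^+ 2 * w x)%:E.
      apply: cvg_EFin; first exact: nearW.
      have cgf : (fun j => f (N (j + N0)%N) x - f n x)%R @ \oo --> (g x - f n x)%R.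
        apply: cvgB; last exact: cvg_cst.
        by rewrite (cvg_shiftn N0 (fun j => f (N j) x)); exact: gE.
      by apply: cvgM; [under eq_fun do rewrite expr2; rewrite expr2; exact: cvgM|exact: cvg_cst].
    by rewrite is_cvg_limn_einfE; [rewrite (cvg_lim _ cG)|apply/cvg_ex; eexists; exact: cG].
apply: le_trans (fatou mu mD mG _) _.
  by move=> j x Dx; rewrite lee_fin mulr_ge0 ?sqr_ge0 ?w_ge0.
rewrite limn_einf_lim; apply: lime_le; first exact: is_cvg_einfs.
by apply: nearW => k; apply: le_trans (Gr k); apply: ereal_inf_lbound; exists k => /=.
Qed.

End L2_complete.

(** * Smooth functions *)

Section derive_facts.
Context {R : realType} {V : normedModType R}.
Implicit Types (f g : V -> R) (a v : V).

Lemma is_deriveP f a v (l : R) :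
  is_derive a v f l <-> (fun h : R => h^-1 * (f (h *: v + a) - f a)) @ 0^' --> l.
Proof.
split=> [[df <-]|cf]; first exact: df.
have df : derivable f a v by apply/cvg_ex; exists l.
by split => //; apply: cvg_lim.
Qed.

End derive_facts.

(** Reduces directional derivatives to one real variable, where the chain rule and the mean value
    theorem are available. *)
Lemma is_derive_lineP {R : realType} {V : normedModType R} (f : V -> R) (a v : V) (l : R) :
  is_derive a v f l <-> is_derive (0 : R) 1 (fun h : R => f (h *: v + a)) l.
Proof.
rewrite !is_deriveP; set g1 := fun h => _; set g2 := fun h => _.
suff -> : g1 = g2 by [].
by apply/funext => h; rewrite /g1 /g2 addr0 scale0r add0r [_%:A]mulr1.
Qed.

Lemma is_derive_shiftP {R : realType} (f : R -> R) (a l : R) :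
  is_derive (a : R) (1 : R) f l <-> is_derive (0 : R) (1 : R) (fun h => f (h + a)) l.
Proof.
rewrite is_derive_lineP; set g1 := fun h => _; set g2 := fun h => _.
suff -> : g1 = g2 by [].
by apply/funext => h; rewrite /g1 /g2 [_%:A]mulr1.
Qed.

Lemma is_derive_comp1 {R : realType} {V : normedModType R} (g : R -> R) (u : V -> R) (a v : V) (g' u' : R) :
  is_derive (u a : R) (1 : R) g g' -> is_derive a v u u' -> is_derive a v (fun x => g (u x)) (g' * u').
Proof.
move=> dg /is_derive_lineP du; apply/is_derive_lineP.
rewrite (_ : (fun h : R => _) = g \o (fun h : R => u (h *: v + a)))//.
apply: is_derive1_comp.
by move: dg; rewrite scale0r add0r.
Qed.

Lemma is_derive_continuous {R : realType} (f : R -> R) (a l : R) :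
  is_derive (a : R) (1 : R) f l -> {for a, continuous f}.
Proof. by move=> [df _]; apply: differentiable_continuous; apply/derivable1_diffP. Qed.

Lemma cvg_pairT {T : Type} {U V : topologicalType} (F : set_system T) {FF : Filter F}
    (f : T -> U) (g : T -> V) (y : U) (z : V) :
  f @ F --> y -> g @ F --> z -> (fun x => (f x, g x)) @ F --> ((y, z) : (U * V)%type).
Proof. exact: (@cvg_pair _ _ _ F (nbhs y) (nbhs z)). Qed.

Lemma is_derive_pow {R : realType} {V : normedModType R} (f : V -> R) (x v : V) (l : R) n :
  is_derive x v f l -> is_derive x v (fun y => f y ^+ n) (n%:R * f x ^+ n.-1 * l).
Proof.
move=> df; elim: n => [|n IH].
  by under eq_fun do rewrite expr0; rewrite !mul0r; exact: is_derive_cst.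
under eq_fun do rewrite exprS.
apply: (is_derive_eq (is_deriveM df IH)).
rewrite -[X in X + _ = _]/(_ * _) -[X in _ + X = _]/(_ * _).
case: n {IH} => [|n] /=; first by ring.
rewrite exprS -[n.+2%:R]natr1; ring.
Qed.

Section curves.
Context {R : realType} {V : normedModType R}.

(** [smooth] gives directional derivatives but no differential. The increment is therefore split
    into a move of [a] with [b] frozen at [b t0], and a move in the last coordinate, written by the
    mean value theorem at an intermediate point; continuity of the partial derivative gives the
    limit there. *)
Lemma is_derive_curve_prod (phi : V * R -> R) (a : R -> V) (b : R -> R) (t0 l b' : R) :
  is_derive t0 (1 : R) (fun t => phi (a t, b t0)) l ->
  {for t0, continuous a} -> is_derive t0 (1 : R) b b' ->
  (forall q, derivable phi q (0, 1)) ->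
  {for (a t0, b t0), continuous (fun q => 'D_(0, 1) phi q)} ->
  is_derive t0 (1 : R) (fun t => phi (a t, b t)) (l + b' * 'D_(0, 1) phi (a t0, b t0)).
Proof.
move=> dl ca db dphi cphi.
have cb := is_derive_continuous db.
have dline (x : V) (y : R) : is_derive y (1 : R) (fun s => phi (x, s)) ('D_(0, 1) phi (x, y)).
  have := @derivableP _ _ _ phi (x, y) (0, 1) (dphi _).
  move=> /is_derive_lineP H; apply/is_derive_shiftP; move: H.
  set g1 := (X in is_derive _ _ X); set g2 := (X in _ -> is_derive _ _ X _).
  suff -> : g1 = g2 by [].
  by apply/funext => h; rewrite /g1 /g2 /=; congr phi; rewrite /GRing.scale/= /GRing.add /= /add_pair/= scaler0 add0r [_%:A]mulr1.
have mvt x y1 y2 : exists c, `|c - y1| <= `|y2 - y1| /\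
    phi (x, y2) - phi (x, y1) = 'D_(0, 1) phi (x, c) * (y2 - y1).
  have cl : continuous (fun s => phi (x, s)) by move=> s; exact: is_derive_continuous (dline x s).
  have [le12|/ltW le21] := leP y1 y2.
    have [c] := MVT_segment le12 (fun s _ => dline x s) (continuous_subspaceT cl).
    rewrite in_itv /= => /andP[c1 c2] E; exists c; split=> //.
    by rewrite !ger0_norm ?subr_ge0// lerD2r.
  have [c] := MVT_segment le21 (fun s _ => dline x s) (continuous_subspaceT cl).
  rewrite in_itv /= => /andP[c1 c2] E; exists c; split.
    by rewrite !ler0_norm ?subr_le0// lerN2 lerD2r.
  by rewrite -opprB E -mulrN opprB.
have /choice[c Hc] : forall h : R, exists c, `|c - b t0| <= `|b (h + t0) - b t0| /\
    phi (a (h + t0), b (h + t0)) - phi (a (h + t0), b t0) =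
    'D_(0, 1) phi (a (h + t0), c) * (b (h + t0) - b t0) by move=> h; exact: mvt.
have ca0 : (fun h : R => a (h + t0)) @ 0^' --> a t0 by move/continuous_withinNshiftx : ca.
have cb0 : (fun h : R => b (h + t0)) @ 0^' --> b t0 by move/continuous_withinNshiftx : cb.
have cc0 : c @ (0 : R)^' --> b t0.
  apply/cvgrPdist_lt => e e0; move/cvgrPdist_lt : cb0 => /(_ e e0).
  apply: filterS => h; rewrite distrC => hb; rewrite distrC.
  exact: le_lt_trans (Hc h).1 hb.
have cD : (fun h : R => 'D_(0, 1) phi (a (h + t0), c h)) @ 0^' --> 'D_(0, 1) phi (a t0, b t0).
  have cp : (fun h : R => (a (h + t0), c h)) @ 0^' --> ((a t0, b t0) : (V * R)%type).
    exact: cvg_pairT.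
  exact: (cvg_comp (fun h : R => (a (h + t0), c h)) (fun q => 'D_(0, 1) phi q) cp cphi).
apply/is_deriveP.
move/is_deriveP in dl; move/is_deriveP in db.
rewrite (_ : (fun h : R => _) = (fun h : R => h^-1 * (phi (a (h *: 1 + t0), b t0) - phi (a t0, b t0)) +
   (h^-1 * (b (h *: 1 + t0) - b t0)) * 'D_(0, 1) phi (a (h + t0), c h))).
  by apply: cvgD => //; exact: cvgM.
apply/funext => h; rewrite [h%:A]mulr1 -mulrA [X in _ + _ * X]mulrC -(Hc h).2 -mulrDr; congr (_ * _); ring.
Qed.

End curves.

Section chain_rules.
Context {R : realType}.

Lemma is_derive_plane_curve (phi : plane R -> R) (a b : R -> R) (t a' b' : R) :
  (forall e q, derivable phi q e) -> (forall e, continuous (fun q => 'D_e phi q)) ->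
  is_derive t (1 : R) a a' -> is_derive t (1 : R) b b' ->
  is_derive t (1 : R) (fun s => phi (a s, b s))
    (a' * 'D_((1, 0) : plane R) phi (a t, b t) + b' * 'D_((0, 1) : plane R) phi (a t, b t)).
Proof.
move=> dphi cphi da db; apply: (@is_derive_curve_prod R R phi a b t) => //.
- apply: is_derive_eq.
    apply: (@is_derive_comp1 R R (fun x => phi (x, b t)) a t 1 ('D_((1, 0) : plane R) phi (a t, b t))) => //.
    have := @derivableP _ _ _ phi (a t, b t) (1, 0) (dphi _ _).
    move=> /is_derive_lineP H; apply/is_derive_shiftP; move: H.
    set g1 := (X in is_derive _ _ X); set g2 := (X in _ -> is_derive _ _ X _).
    suff -> : g1 = g2 by [].
    apply/funext => h; rewrite /g1 /g2 /=; congr phi; congr pair; rewrite /=.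
      by rewrite [_%:A]mulr1.
    by rewrite [_ *: _]mulr0 add0r.
  by rewrite mulrC.
- exact: is_derive_continuous da.
- by apply: cphi.
Qed.

Lemma is_derive_espace_curve (phi : espace R -> R) (a b c : R -> R) (t a' b' c' : R) :
  (forall e q, derivable phi q e) -> (forall e, continuous (fun q => 'D_e phi q)) ->
  is_derive t (1 : R) a a' -> is_derive t (1 : R) b b' -> is_derive t (1 : R) c c' ->
  is_derive t (1 : R) (fun s => phi (a s, b s, c s))
    (a' * 'D_((1, 0, 0) : espace R) phi (a t, b t, c t) +
     b' * 'D_((0, 1, 0) : espace R) phi (a t, b t, c t) +
     c' * 'D_((0, 0, 1) : espace R) phi (a t, b t, c t)).
Proof.
move=> dphi cphi da db dc.
apply: (@is_derive_curve_prod R (R * R)%type phi (fun s => (a s, b s)) c t) => //.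
(* With the third coordinate frozen, the planar chain rule handles the first two. *)
- pose psi : plane R -> R := fun p => phi (p, c t).
  have E (e : plane R) q : is_derive q e psi ('D_((e, 0) : espace R) phi (q, c t)).
    have := @derivableP _ _ _ phi (q, c t) (e, 0) (dphi _ _).
    move=> /is_derive_lineP H; apply/is_derive_lineP; move: H.
    set g1 := (X in is_derive _ _ X); set g2 := (X in _ -> is_derive _ _ X _).
    suff -> : g1 = g2 by [].
    apply/funext => h; rewrite /g1 /g2 /psi /=; congr phi; congr pair; rewrite /=.
    by rewrite [_ *: _]mulr0 add0r.
  have E' (e : plane R) : (fun q => 'D_e psi q) = (fun q => 'D_((e, 0) : espace R) phi (q, c t)).
    by apply/funext => q; apply: derive_val; exact: E.
  have := @is_derive_plane_curve psi a b t a' b' _ _ da db.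
  rewrite -!(congr1 (fun f => f (a t, b t)) (E' _)); apply.
    by move=> e q; case: (E e q).
  move=> e; rewrite E' => q; apply: (@continuous_comp _ _ _ (fun q : plane R => (q, c t) : espace R)
     (fun q => 'D_((e, 0) : espace R) phi q)).
    by apply: cvg_pairT; [exact: cvg_id|exact: cvg_cst].
  by apply: cphi.
- by apply: cvg_pairT; [exact: is_derive_continuous da|exact: is_derive_continuous db].
- by apply: cphi.
Qed.

End chain_rules.

Section derivation_closed_algebras.
Context {R : realType} {V : normedModType R}.
Implicit Types (B : set (V -> R)) (f g : V -> R).

(** Smoothness is proved by exhibiting continuous generators whose directional derivatives belong to
    the algebra they generate. All iterated derivatives then stay in the algebra, and no explicit
    Leibniz or higher chain formula is required. *)
Inductive generated_algebra B : (V -> R) -> Prop :=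
| ga_gen f : B f -> generated_algebra B f
| ga_cst (c : R) : generated_algebra B (fun=> c)
| ga_add f g : generated_algebra B f -> generated_algebra B g ->
    generated_algebra B (fun x => f x + g x)
| ga_mul f g : generated_algebra B f -> generated_algebra B g ->
    generated_algebra B (fun x => f x * g x).

Lemma ga_sub B B' f : B `<=` B' -> generated_algebra B f -> generated_algebra B' f.
Proof.
move=> BB'; elim => [g /BB' Bg|c|g h _ ? _ ?|g h _ ? _ ?].
- exact: ga_gen.
- exact: ga_cst.
- exact: ga_add.
- exact: ga_mul.
Qed.

Lemma ga_opp B f : generated_algebra B f -> generated_algebra B (fun x => - f x).
Proof. by move=> /(ga_mul (ga_cst B (-1))); under eq_fun do rewrite mulN1r. Qed.

Variable B : set (V -> R).
Hypothesis B_cont : forall f, B f -> continuous f.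
Hypothesis B_derive : forall f (e : V), B f ->
  exists2 g, generated_algebra B g & forall x, is_derive x e f (g x).

Let ga_cont f : generated_algebra B f -> continuous f.
Proof.
elim => [g /B_cont //|c|g h _ cg _ ch|g h _ cg _ ch] x.
- exact: cvg_cst.
- by apply: cvgD; [exact: cg|exact: ch].
- by apply: cvgM; [exact: cg|exact: ch].
Qed.

Let ga_derive f (e : V) : generated_algebra B f ->
  exists2 g, generated_algebra B g & forall x, is_derive x e f (g x).
Proof.
elim => [g /B_derive //|c|g h Bg [g' Bg' dg] Bh [h' Bh' dh]|g h Bg [g' Bg' dg] Bh [h' Bh' dh]].
- exists (fun=> 0); first exact: ga_cst.
  by move=> x; exact: is_derive_cst.
- exists (fun x => g' x + h' x); first exact: ga_add.
  by move=> x; apply: is_deriveD.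
- exists (fun x => g x * h' x + h x * g' x).
    by apply: ga_add; exact: ga_mul.
  by move=> x; apply: is_deriveM.
Qed.

Lemma generated_algebra_smooth f : generated_algebra B f -> smooth f.
Proof.
move=> Bf s; suff Bs : generated_algebra B (iter_derive s f).
  split; first exact: ga_cont.
  by move=> x e; have [g _ /(_ x)[]] := ga_derive e Bs.
elim: s => [//|e s IH] /=; have [g Bg dg] := ga_derive e IH.
rewrite (_ : (fun x => _) = g)//; apply/funext => x; exact: derive_val.
Qed.

End derivation_closed_algebras.

Section smooth_theory.
Context {R : realType} {V : normedModType R}.
Implicit Types (f g : V -> R).

Lemma iter_derive_cat (s t : seq V) f : iter_derive s (iter_derive t f) = iter_derive (s ++ t) f.
Proof. by rewrite /iter_derive foldr_cat. Qed.

Lemma smooth_iter s f : smooth f -> smooth (iter_derive s f).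
Proof. by move=> sf t; rewrite iter_derive_cat; exact: sf. Qed.

Lemma smooth_derive (e : V) f : smooth f -> smooth (fun x => 'D_e f x).
Proof. exact: (@smooth_iter [:: e]). Qed.

Lemma smooth_continuous f : smooth f -> continuous f.
Proof. by move=> /(_ [::])[]. Qed.

Lemma smooth_derivable f (e x : V) : smooth f -> derivable f x e.
Proof. by move=> /(_ [::])[_]. Qed.

Lemma smooth_is_derive f (e x : V) : smooth f -> is_derive x e f ('D_e f x).
Proof. by move=> sf; apply/derivableP/smooth_derivable. Qed.

Lemma smooth_derive_continuous (e : V) f : smooth f -> continuous (fun x => 'D_e f x).
Proof. by move=> /smooth_derive /smooth_continuous. Qed.

(** Adjoining all iterated derivatives to the generators yields a family stable under derivation. *)
Lemma smooth_algebra (S : set (V -> R)) f : (forall g, S g -> smooth g) ->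
  generated_algebra S f -> smooth f.
Proof.
move=> Ssm Sf.
apply: (@generated_algebra_smooth _ _ [set g | exists2 h, S h & exists s, g = iter_derive s h]).
- by move=> g [h Sh [s ->]]; exact/smooth_continuous/smooth_iter/Ssm.
- move=> g e [h Sh [s ->]]; exists (iter_derive (e :: s) h).
    by apply: ga_gen; exists h => //; exists (e :: s).
  by move=> x; exact/smooth_is_derive/smooth_iter/Ssm.
- by apply: ga_sub Sf => g Sg; exists g => //; exists [::].
Qed.

Lemma smooth_cst (c : R) : smooth ((fun=> c) : V -> R).
Proof. by apply: (@smooth_algebra set0) => //; exact: ga_cst. Qed.

Lemma smoothD f g : smooth f -> smooth g -> smooth (fun x => f x + g x).
Proof.
by move=> sf sg; apply: (@smooth_algebra [set f; g]) => [h [->|->]//|]; apply: ga_add;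
  apply: ga_gen; [left|right].
Qed.

Lemma smoothM f g : smooth f -> smooth g -> smooth (fun x => f x * g x).
Proof.
by move=> sf sg; apply: (@smooth_algebra [set f; g]) => [h [->|->]//|]; apply: ga_mul;
  apply: ga_gen; [left|right].
Qed.

End smooth_theory.

Section smooth_compose.
Context {R : realType}.

(** By the chain rule, the iterated derivatives of [u] together with those of [g] composed with [u]
    generate an algebra stable under derivation. The same device serves compositions with functions
    of two and three variables. *)
Lemma smooth_comp1 {V : normedModType R} (g : R -> R) (u : V -> R) :
  smooth g -> smooth u -> smooth (fun x => g (u x)).
Proof.
move=> sg su.
pose B : set (V -> R) := [set f | (exists s, f = iter_derive s u) \/
   (exists s, f = fun x => iter_derive s g (u x))].
apply: (@generated_algebra_smooth _ _ B).
- move=> _ [[s ->]|[s ->]]; first exact/smooth_continuous/smooth_iter.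
  move=> x; apply: (@continuous_comp _ _ _ u (iter_derive s g)).
    exact: smooth_continuous.
  exact/smooth_continuous/smooth_iter.
- move=> _ e [[s ->]|[s ->]].
    exists (iter_derive (e :: s) u); first by apply: ga_gen; left; exists (e :: s).
    by move=> x; exact/smooth_is_derive/smooth_iter.
  exists (fun x => iter_derive (1 :: s) g (u x) * iter_derive [:: e] u x).
    apply: ga_mul; apply: ga_gen; [by right; exists (1 :: s)|by left; exists [:: e]].
  move=> x; apply: is_derive_comp1; last exact: smooth_is_derive.
  exact/smooth_is_derive/smooth_iter.
- by apply: ga_gen; right; exists [::].
Qed.

Lemma smooth_plane_comp {V : normedModType R} (phi : plane R -> R) (u v : V -> R) :
  smooth phi -> smooth u -> smooth v -> smooth (fun x => phi (u x, v x)).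
Proof.
move=> sphi su sv.
pose B : set (V -> R) := [set f | (exists s, f = iter_derive s u \/ f = iter_derive s v) \/
   (exists s, f = fun x => iter_derive s phi (u x, v x))].
apply: (@generated_algebra_smooth _ _ B).
- move=> _ [[s [->|->]]|[s ->]]; try exact/smooth_continuous/smooth_iter.
  move=> x; apply: (@continuous_comp _ _ _ (fun x => (u x, v x)) (iter_derive s phi)).
    by apply: cvg_pairT; exact: smooth_continuous.
  by have := smooth_continuous (smooth_iter s sphi); apply.
- move=> _ e [[s [->|->]]|[s ->]].
  + exists (iter_derive (e :: s) u); first by apply: ga_gen; left; exists (e :: s); left.
    by move=> x; exact/smooth_is_derive/smooth_iter.
  + exists (iter_derive (e :: s) v); first by apply: ga_gen; left; exists (e :: s); right.
    by move=> x; exact/smooth_is_derive/smooth_iter.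
  exists (fun x => iter_derive [:: e] u x * iter_derive (((1, 0) : plane R) :: s) phi (u x, v x) +
     iter_derive [:: e] v x * iter_derive (((0, 1) : plane R) :: s) phi (u x, v x)).
    apply: ga_add; apply: ga_mul; apply: ga_gen.
    * by left; exists [:: e]; left.
    * by right; exists (((1, 0) : plane R) :: s).
    * by left; exists [:: e]; right.
    * by right; exists (((0, 1) : plane R) :: s).
  move=> x; apply/is_derive_lineP.
  have du := (is_derive_lineP _ _ _ _).1 (smooth_is_derive e x su).
  have dv := (is_derive_lineP _ _ _ _).1 (smooth_is_derive e x sv).
  have sps := smooth_iter s sphi.
  have := is_derive_plane_curve (fun e q => smooth_derivable (e := e) (x := q) sps)
    (fun e => smooth_derive_continuous (e := e) sps) du dv.
  by rewrite scale0r add0r.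
- by apply: ga_gen; right; exists [::].
Qed.

Lemma smooth_espace_comp {V : normedModType R} (phi : espace R -> R) (u v w : V -> R) :
  smooth phi -> smooth u -> smooth v -> smooth w -> smooth (fun x => phi (u x, v x, w x)).
Proof.
move=> sphi su sv sw.
pose B : set (V -> R) := [set f | (exists s, [\/ f = iter_derive s u, f = iter_derive s v | f = iter_derive s w]) \/
   (exists s, f = fun x => iter_derive s phi (u x, v x, w x))].
apply: (@generated_algebra_smooth _ _ B).
- move=> _ [[s [->|->|->]]|[s ->]]; try exact/smooth_continuous/smooth_iter.
  move=> x; apply: (@continuous_comp _ _ _ (fun x => (u x, v x, w x)) (iter_derive s phi)).
    by do 2?[apply: cvg_pairT]; exact: smooth_continuous.
  by have := smooth_continuous (smooth_iter s sphi); apply.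
- move=> _ e [[s [->|->|->]]|[s ->]].
  + exists (iter_derive (e :: s) u); first by apply: ga_gen; left; exists (e :: s); constructor 1.
    by move=> x; exact/smooth_is_derive/smooth_iter.
  + exists (iter_derive (e :: s) v); first by apply: ga_gen; left; exists (e :: s); constructor 2.
    by move=> x; exact/smooth_is_derive/smooth_iter.
  + exists (iter_derive (e :: s) w); first by apply: ga_gen; left; exists (e :: s); constructor 3.
    by move=> x; exact/smooth_is_derive/smooth_iter.
  exists (fun x => iter_derive [:: e] u x * iter_derive (((1, 0, 0) : espace R) :: s) phi (u x, v x, w x) +
     iter_derive [:: e] v x * iter_derive (((0, 1, 0) : espace R) :: s) phi (u x, v x, w x) +
     iter_derive [:: e] w x * iter_derive (((0, 0, 1) : espace R) :: s) phi (u x, v x, w x)).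
    apply: ga_add; [apply: ga_add|]; apply: ga_mul; apply: ga_gen.
    * by left; exists [:: e]; constructor 1.
    * by right; exists (((1, 0, 0) : espace R) :: s).
    * by left; exists [:: e]; constructor 2.
    * by right; exists (((0, 1, 0) : espace R) :: s).
    * by left; exists [:: e]; constructor 3.
    * by right; exists (((0, 0, 1) : espace R) :: s).
  move=> x; apply/is_derive_lineP.
  have du := (is_derive_lineP _ _ _ _).1 (smooth_is_derive e x su).
  have dv := (is_derive_lineP _ _ _ _).1 (smooth_is_derive e x sv).
  have dw := (is_derive_lineP _ _ _ _).1 (smooth_is_derive e x sw).
  have sps := smooth_iter s sphi.
  have := is_derive_espace_curve (fun e q => smooth_derivable (e := e) (x := q) sps)
    (fun e => smooth_derive_continuous (e := e) sps) du dv dw.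
  by rewrite scale0r add0r.
- by apply: ga_gen; right; exists [::].
Qed.

Lemma smooth_linear {V : normedModType R} (l : V -> R) : continuous l ->
  (forall (h : R) (x y : V), l (h *: x + y) = h * l x + l y) -> smooth l.
Proof.
move=> cl ll; apply: (@generated_algebra_smooth _ _ [set l]).
- by move=> _ ->.
- move=> _ e ->; exists (fun=> l e); first exact: ga_cst.
  move=> x; apply/is_derive_lineP.
  rewrite (_ : (fun h : R => _) = (fun h : R => h * l e + l x)); last by apply/funext => h; rewrite ll.
  apply: is_derive_eq; rewrite ?scaler0 ?add0r ?addr0 ?[_%:A]mulr1//.
- exact: ga_gen.
Qed.

End smooth_compose.

(** * Smooth cut-offs and a smoothed radius *)

Section flat_functions.
Context {R : realType}.
Implicit Types (x : R) (n : nat).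

(* The derivatives of [exp (- 1 / x)] are linear combinations of these functions. *)
Definition flat n (x : R) : R := if 0 < x then x ^- n * expR (- x^-1) else 0.

Lemma flat_le0 n x : x <= 0 -> flat n x = 0.
Proof. by rewrite /flat ltNge => ->. Qed.

Lemma flat_gt0 n x : 0 < x -> 0 < flat n x.
Proof. by rewrite /flat => x0; rewrite x0 mulr_gt0 ?expR_gt0// invr_gt0 exprn_gt0. Qed.

Lemma flat_ge0 n x : 0 <= flat n x.
Proof. by have [/flat_le0 ->//|/(flat_gt0 n)/ltW] := leP x 0. Qed.

Lemma flat0_le1 x : flat 0 x <= 1.
Proof.
rewrite /flat; case: ltP => // x0; rewrite expr0 invr1 mul1r.
by rewrite -expR0 ler_expR oppr_le0 invr_ge0 ltW.
Qed.

(** This is [exp y >= y] at [y = 1 / (k x)], raised to the power [k] and inverted. *)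
Lemma expRN_le_pow x k : 0 < x -> (0 < k)%N -> expR (- x^-1) <= (k%:R * x) ^+ k.
Proof.
move=> x0 k0; have kx : 0 < k%:R * x by rewrite mulr_gt0 ?ltr0n.
rewrite expRN -[_ ^+ k]invrK -exprVn lef_pV2 ?posrE ?expR_gt0 ?exprn_gt0 ?invr_gt0//.
have -> : x^-1 = (k%:R * x)^-1 * k%:R.
  by rewrite invfM mulrAC mulVf ?mul1r// pnatr_eq0 -lt0n.
rewrite expRM_natr.
rewrite lerXn2r ?nnegrE ?invr_ge0 ?(ltW kx) ?expR_ge0//.
by apply: le_trans (expR_ge1Dx _); rewrite lerDr.
Qed.

(** The exponent [n + 1] in [expRN_le_pow] absorbs [x^-n] and leaves one factor [x], enough for the
    limit 0 at the origin. *)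
Lemma flat_le_linear n x : flat n x <= n.+1%:R ^+ n.+1 * `|x|.
Proof.
rewrite /flat; case: ltP => [x0|_]; last by rewrite mulr_ge0 ?exprn_ge0.
rewrite gtr0_norm// -ler_pdivlMl ?invr_gt0 ?exprn_gt0// invrK.
apply: le_trans (expRN_le_pow x0 (ltn0Sn n)) _.
by rewrite exprMn exprSr [in leRHS]mulrC -!mulrA [x * _]mulrC -exprSr.
Qed.

Lemma is_derive_flat n x :
  is_derive x (1 : R) (flat n) (flat n.+2 x - n%:R * flat n.+1 x).
Proof.
have [x0|x0|->] := ltgtP x 0.
- rewrite !flat_le0 ?(ltW x0)// mulr0 subr0.
  apply: (@near_eq_is_derive _ _ _ (fun=> 0)) => //.
  near=> y; rewrite flat_le0// ltW//; near: y; exact: lt_nbhsl.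
- have nE : \near x, x ^- n * expR (- x^-1) = flat n x.
    by near=> y; rewrite /flat ifT//; near: y; exact: lt_nbhsr.
  apply: near_eq_is_derive nE _.
  rewrite /flat x0.
  have xn0 : x != 0 by rewrite gt_eqF.
  have dV : is_derive x (1 : R) (fun y : R => y^-1) (- x ^- 2).
    by apply: is_derive_eq; [exact: is_deriveV|rewrite [_ *: _]mulr1].
  have dE : is_derive x (1 : R) (fun y : R => expR (- y^-1)) (expR (- x^-1) * x ^- 2).
    have dN : is_derive x (1 : R) (fun y : R => - y^-1) (x ^- 2).
      by have := is_deriveN dV; rewrite opprK.
    exact: (@is_derive_comp1 R R (@expR R) (fun y => - y^-1) x 1 _ _ (is_derive_expR _) dN).
  have dX : is_derive x (1 : R) (fun y : R => y ^- n) (- (n%:R * x ^- n.+1)).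
    rewrite (_ : (fun y : R => _) = (fun y => (y^-1) ^+ n)); last by apply/funext => y; rewrite exprVn.
    apply: is_derive_eq; first exact: (is_derive_pow n dV).
    case: n => [|n]; first by rewrite !mul0r oppr0.
    by rewrite /= -!exprVn !exprS; ring.
  apply: (is_derive_eq (is_deriveM dX dE)).
  rewrite -[X in X + _ = _]/(_ * _) -[X in _ + X = _]/(_ * _).
  by rewrite -!exprVn !exprS; ring.
rewrite !flat_le0// mulr0 subr0; apply/is_deriveP.
(* At the origin the difference quotient of [flat n] is [flat n.+1] itself, which tends to 0. *)
rewrite (_ : (fun h : R => _) = flat n.+1); last first.
  apply/funext => h; rewrite [h%:A]mulr1 addr0 (flat_le0 _ (lexx 0)) subr0 /flat.
  case: ifP => h0; last by rewrite mulr0.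
  by rewrite mulrA exprS invfM.
apply: (@cvg_to_0_linear _ _ (n.+2%:R ^+ n.+2) 1) => // r _.
by rewrite ger0_norm ?flat_ge0// flat_le_linear.
Unshelve. all: by end_near. Qed.

Lemma smooth_flat n : smooth (flat n : R -> R).
Proof.
apply: (@generated_algebra_smooth _ _ [set f | exists m, f = flat m]).
- by move=> _ [m ->] x; exact: is_derive_continuous (is_derive_flat m x).
- move=> _ e [m ->]; exists (fun x => e * (flat m.+2 x + (- m%:R) * flat m.+1 x)).
    apply: ga_mul; first exact: ga_cst.
    by apply: ga_add; [|apply: ga_mul; [exact: ga_cst|]]; apply: ga_gen; eexists.
  move=> x; apply: is_derive_eq.
    exact: (@is_derive_comp1 _ _ (flat m) id x e _ _ (is_derive_flat m x) (is_derive_id x e)).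
  by rewrite mulNr mulrC.
- by apply: ga_gen; exists n.
Qed.

Lemma smooth1_id : smooth (fun x : R => x).
Proof. by apply: smooth_linear => // x; exact: cvg_id. Qed.

Lemma smooth_affine (a b : R) : smooth (fun x : R => a * x + b).
Proof. by apply: smoothD; [apply: smoothM; [exact: smooth_cst|exact: smooth1_id]|exact: smooth_cst]. Qed.

(* The algebra generated by [1 / f] and the derivatives of [f] is stable under
   derivation, since [(1 / f)' = - f' / f ^ 2]. *)
Lemma smooth_inv (f : R -> R) : smooth f -> (forall x, 0 < f x) -> smooth (fun x => (f x)^-1).
Proof.
move=> sf f0; pose B : set (R -> R) := [set g | (exists s, g = iter_derive s f) \/ g = (fun x => (f x)^-1)].
have dfV (e x : R) : is_derive x e (fun x => (f x)^-1) (- (f x)^-1 * (f x)^-1 * 'D_e f x).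
  have df := smooth_is_derive e x sf.
  apply: is_derive_eq; first by apply: is_deriveV; rewrite gt_eqF.
  by rewrite -[_ *: _]/(_ * _) -exprVn expr2 !mulNr.
apply: (@generated_algebra_smooth _ _ B).
- move=> _ [[s ->]|->]; first exact/smooth_continuous/smooth_iter.
  by move=> x; exact: is_derive_continuous (dfV 1 x).
- move=> _ e [[s ->]|->].
    exists (iter_derive (e :: s) f); first by apply: ga_gen; left; exists (e :: s).
    by move=> x; exact/smooth_is_derive/smooth_iter.
  exists (fun x => - (f x)^-1 * (f x)^-1 * 'D_e f x) => //.
  by do 2?[apply: ga_mul]; [apply: ga_opp| |]; apply: ga_gen; [right|right|left; exists [:: e]].
- by apply: ga_gen; right.
Qed.

(** Writing the derivative as [f' / (2 f)] times [sqrt f] keeps it in the algebra generated by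
    smooth functions and [sqrt f]. *)
Lemma smooth_sqrt (f : R -> R) : smooth f -> (forall x, 0 < f x) -> smooth (fun x => Num.sqrt (f x)).
Proof.
move=> sf f0; have sfV := smooth_inv sf f0.
pose B : set (R -> R) := [set g | smooth g \/ g = (fun x => Num.sqrt (f x))].
have dfV (e x : R) : is_derive x e (fun x => Num.sqrt (f x)) (2^-1 * (f x)^-1 * 'D_e f x * Num.sqrt (f x)).
  have df := smooth_is_derive e x sf.
  apply: is_derive_eq; first by apply: (@is_derive_comp1 _ _ Num.sqrt f) => //; apply: is_derive1_sqrt; rewrite ?gt_eqF.
  have sq0 : Num.sqrt (f x) != 0 by rewrite gt_eqF// sqrtr_gt0.
  have -> : (f x)^-1 = (Num.sqrt (f x))^-1 * (Num.sqrt (f x))^-1.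
    by rewrite -invfM -expr2 sqr_sqrtr// ltW.
  by field.
apply: (@generated_algebra_smooth _ _ B).
- move=> g [sg|->]; first exact/smooth_continuous.
  by move=> x; exact: is_derive_continuous (dfV 1 x).
- move=> g e [sg|->].
    exists ('D_e g); first by apply: ga_gen; left; exact: smooth_derive.
    by move=> x; exact/smooth_is_derive.
  exists (fun x => 2^-1 * (f x)^-1 * 'D_e f x * Num.sqrt (f x)) => //.
  do 3?[apply: ga_mul]; first exact: ga_cst.
  + by apply: ga_gen; left.
  + by apply: ga_gen; left; exact: smooth_derive.
  + by apply: ga_gen; right.
- by apply: ga_gen; right.
Qed.

(** The quotient of [flat 0 x] by [flat 0 x + flat 0 (1 - x)]: the denominator is positive because
    [x] and [1 - x] are never both nonpositive. *)
Lemma smooth_step : exists chi : R -> R, [/\ smooth chi, forall x, 0 <= chi x <= 1,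
  forall x, x <= 0 -> chi x = 0 & forall x, 1 <= x -> chi x = 1].
Proof.
pose D (x : R) : R := flat 0 x + flat 0 (- 1 * x + 1).
have D0 x : 0 < D x.
  rewrite /D; have [x0|x0] := leP x 0.
    by rewrite flat_le0// add0r flat_gt0// mulN1r; lra.
  by rewrite ltr_pwDl ?flat_gt0 ?flat_ge0.
have sD : smooth D.
  apply: smoothD; first exact: smooth_flat.
  exact: (smooth_comp1 (smooth_flat 0) (smooth_affine _ _)).
exists (fun x => flat 0 x * (D x)^-1); split.
- by apply: smoothM; [exact: smooth_flat|exact: smooth_inv].
- move=> x; rewrite mulr_ge0 ?flat_ge0 ?invr_ge0 ?(ltW (D0 x))//=.
  by rewrite ler_pdivrMr// mul1r /D lerDl flat_ge0.
- by move=> x x0; rewrite flat_le0// mul0r.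
- move=> x x1; rewrite /D (@flat_le0 0 (- 1 * x + 1)); last by lra.
  by rewrite addr0 divff// gt_eqF// flat_gt0; lra.
Qed.

(** The radius and its inverse are not smooth on the axis, but [x^2 + y^2] is. Composed with it, [s]
    and [k] replace them at distance at least [d]. The last bound keeps [s] in the range
    [[0, d]]-side where a function supported beyond [d] vanishes. *)
Lemma smooth_radius (d : R) : 0 < d -> exists s k : R -> R, [/\ smooth s, smooth k,
   forall x, d <= x -> s (x ^+ 2) = x /\ k (x ^+ 2) = x^-1 &
   forall x, 0 <= x -> x < d -> s (x ^+ 2) <= d].
Proof.
move=> d0; have [chi [schi chi01 chi0 chi1]] := smooth_step.
have d20 : 0 < d ^+ 2 by rewrite exprn_gt0.
pose u (x : R) := chi (2 / d ^+ 2 * x + (-1)).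
(* [u] rises from 0 to 1 between [d^2 / 2] and [d^2], so [tau] is the constant [d^2 / 2] and then
   the identity; being positive, it has a smooth square root. *)
pose tau (x : R) := d ^+ 2 / 2 + (x + (- (d ^+ 2 / 2))) * u x.
have su : smooth u by exact: (smooth_comp1 schi (smooth_affine _ _)).
have stau : smooth tau.
  apply: smoothD; first exact: smooth_cst.
  exact: (smoothM (smoothD smooth1_id (smooth_cst _)) su).
have ulow x : x <= d ^+ 2 / 2 -> u x = 0.
  move=> h; rewrite /u chi0//; have : 2 / d ^+ 2 * x <= 2 / d ^+ 2 * (d ^+ 2 / 2).
    by rewrite ler_wpM2l// divr_ge0// ltW.
  have -> : 2 / d ^+ 2 * (d ^+ 2 / 2) = 1 by field; rewrite gt_eqF.
  by lra.
have uhigh x : d ^+ 2 <= x -> u x = 1.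
  move=> h; rewrite /u chi1//; have : 2 / d ^+ 2 * d ^+ 2 <= 2 / d ^+ 2 * x.
    by rewrite ler_wpM2l// divr_ge0// ltW.
  have -> : 2 / d ^+ 2 * d ^+ 2 = 2 by field; rewrite gt_eqF.
  by lra.
have tau0 x : 0 < tau x.
  rewrite /tau; have [/ulow ->|h] := leP x (d ^+ 2 / 2); first by rewrite mulr0 addr0 divr_gt0.
  by rewrite ltr_pwDl ?divr_gt0// mulr_ge0 ?subr_ge0 ?(ltW h)//; case/andP: (chi01 (2 / d ^+ 2 * x + (-1))).
have tauh x : d ^+ 2 <= x -> tau x = x.
  by move=> h; rewrite /tau uhigh// mulr1; ring.
exists (fun x => Num.sqrt (tau x)), (fun x => (Num.sqrt (tau x))^-1); split.
- exact: smooth_sqrt.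
- by apply: smooth_inv; [exact: smooth_sqrt|move=> x; rewrite sqrtr_gt0].
- move=> x dx; have x0 : 0 <= x by rewrite (le_trans (ltW d0)).
  by rewrite tauh ?lerXn2r ?nnegrE ?(ltW d0)// sqrtr_sqr ger0_norm.
- move=> x x0 xd; rewrite -[leRHS]ger0_norm ?(ltW d0)// -sqrtr_sqr ler_sqrt ?exprn_ge0 ?(ltW d0)//.
  have x2d : x ^+ 2 <= d ^+ 2 by rewrite lerXn2r ?nnegrE ?(ltW d0) ?(ltW xd).
  rewrite /tau; have [/ulow ->|h] := leP (x ^+ 2) (d ^+ 2 / 2).
    by rewrite mulr0 addr0 ler_pdivrMr// ler_peMr ?(ltW d20)// ler1n.
  have /andP[c0 c1] := chi01 (2 / d ^+ 2 * x ^+ 2 + (-1)).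
  have : (x ^+ 2 + - (d ^+ 2 / 2)) * u (x ^+ 2) <= (x ^+ 2 + - (d ^+ 2 / 2)) * 1.
    by rewrite ler_wpM2l// subr_ge0 ltW.
  by rewrite mulr1; lra.
Qed.

End flat_functions.

(** * Test functions and the fundamental lemma *)

Section test_functions.
Context {R : realType} {V : normedModType R}.
Implicit Types (D : set V) (phi psi : V -> R).

Definition support_closure phi : set V := closure [set x | phi x != 0].

Lemma support_closure_out phi x : ~ support_closure phi x -> phi x = 0.
Proof. by move=> h; apply/eqP; apply: contra_notT h => nz; exact: subset_closure. Qed.

Lemma test_function_le D phi psi : smooth psi ->
  [set x | psi x != 0] `<=` support_closure phi ->
  test_function D phi -> test_function D psi.
Proof.
move=> sp pp [_ cK KD].
have sub : support_closure psi `<=` support_closure phi.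
  have := closure_subset pp; rewrite -(closure_id (support_closure phi)).1//.
  exact: closed_closure.
split=> //; last exact: subset_trans sub KD.
exact: subclosed_compact (@closed_closure _ _) cK sub.
Qed.

Lemma test_function_derive D phi (e : V) : test_function D phi -> test_function D (fun x => 'D_e phi x).
Proof.
move=> tp; have [sp _ _] := tp; apply: test_function_le tp; first exact: smooth_derive.
move=> x /=; apply: contraPP => nx; apply/negP; rewrite negbK; apply/eqP.
have -> : 'D_e phi x = 'D_e (fun=> 0 : R) x; last by rewrite derive_cst.
apply: near_eq_derive.
have : open (~` support_closure phi) by rewrite openC; exact: closed_closure.
move=> oS; have : nbhs x (~` support_closure phi) by apply: open_nbhs_nbhs; split.
by apply: filterS => y /support_closure_out.
Qed.

Lemma test_functionM D phi psi : smooth psi -> test_function D phi ->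
  test_function D (fun x => psi x * phi x).
Proof.
move=> sp tp; have [sphi _ _] := tp; apply: (test_function_le _ _ tp); first exact: (smoothM sp sphi).
by move=> x /=; rewrite mulf_eq0 negb_or => /andP[_ nz]; exact: subset_closure.
Qed.

Lemma test_function_bounded D phi : test_function D phi -> exists2 M : R, 0 < M & forall x, `|phi x| <= M.
Proof.
move=> [sp cK _]; have cp := smooth_continuous sp.
have : compact (phi @` support_closure phi).
  by apply: continuous_compact => //; exact: continuous_subspaceT.
move=> /compact_bounded [M [_ HM]].
exists (Num.max (M + 1) 1); first by rewrite lt_max ltr01 orbT.
move=> x; have [Kx|/support_closure_out ->] := pselect (support_closure phi x).
  by rewrite le_max; apply/orP; left; apply: HM; [rewrite ltrDl|exists x].
by rewrite normr0 le_max ler01 orbT.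
Qed.

End test_functions.

Section locally_integrable.
Context {R : realType} {d : measure_display} {T : measurableNormedModType R d}.
Variables (mu : {measure set T -> \bar R}) (D : set T).
Hypothesis open_measurableT : forall U : set T, open U -> measurable U.
Hypothesis oD : open D.

Let mD : measurable D. Proof. exact: open_measurableT. Qed.

Lemma closed_measurableT (K : set T) : closed K -> measurable K.
Proof. by move=> cK; rewrite -[K]setCK; apply/measurableC/open_measurableT; rewrite openC. Qed.

Lemma continuous_measurableT (f : T -> R) : continuous f -> measurable_fun setT f.
Proof.
move=> cf; apply: (measurability _ (RGenOpens.measurableE R)) => //.
move=> _ [_ [a [b ->]] <-]; rewrite setTI; apply: open_measurableT.
by apply: open_comp => //; move=> x _; exact: cf.
Qed.

Lemma smooth_measurable (f : T -> R) (E : set T) : smooth f -> measurable_fun E f.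
Proof. by move=> /smooth_continuous /continuous_measurableT; exact: measurable_funTS. Qed.

Lemma locally_integrable_test (g phi : T -> R) : measurable_fun D g ->
  (forall K : set T, compact K -> K `<=` D -> (\int[mu]_(x in K) `|g x|%:E < +oo)%E) ->
  test_function D phi -> mu.-integrable D (EFin \o (fun x => g x * phi x)).
Proof.
move=> mg lg tp; have [M M0 HM] := test_function_bounded tp; have [sp cK KD] := tp.
have mK : measurable (support_closure phi) by apply: closed_measurableT; exact: closed_closure.
have mgp : measurable_fun D (fun x => g x * phi x).
  by apply: measurable_funM => //; exact: smooth_measurable.
apply/integrableP; split; first exact/measurable_EFinP.
rewrite (_ : (\int[mu]_(x in D) _)%E = (\int[mu]_(x in support_closure phi) `|(g x * phi x)%:E|)%E).
  apply: (@le_lt_trans _ _ (\int[mu]_(x in support_closure phi) (M%:E * `|g x|%:E))%E).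
    apply: ge0_le_integral => //.
    - apply: measurableT_comp => //; apply/measurable_EFinP; exact: measurable_funS mgp.
    - apply: measurable_funeM; apply/measurable_EFinP; apply: measurableT_comp => //.
      exact: measurable_funS mg.
    - by move=> x _; rewrite -EFinM /= lee_fin normrM mulrC ler_wpM2r.
  rewrite ge0_integralZl_EFin ?(ltW M0)//.
    by rewrite lte_mul_pinfty// ?lee_fin ?(ltW M0)//; exact: lg.
  by apply/measurable_EFinP; apply: measurableT_comp => //; exact: measurable_funS mg.
have KD' : support_closure phi `<=` D := KD.
rewrite -[in RHS](setIidr KD') integral_mkcondr; apply: eq_integral => x _.
rewrite patchE; case: ifPn => // /negP; rewrite inE => nx.
by rewrite /= (support_closure_out nx) mulr0 normr0.
Qed.

(** The [phi n] converge boundedly to the indicator of [Q] and vanish off [K], so dominated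
    convergence with bound [|g|] on [K] passes from test functions to [Q]. *)
Lemma zero_integral_bump (g : T -> R) (Q K : set T) (phi : nat -> T -> R) :
  measurable_fun D g ->
  (forall K : set T, compact K -> K `<=` D -> (\int[mu]_(x in K) `|g x|%:E < +oo)%E) ->
  (forall p, test_function D p -> (\int[mu]_(x in D) (g x * p x)%:E = 0)%E) ->
  measurable Q -> Q `<=` K -> compact K -> measurable K -> K `<=` D ->
  (forall n, test_function D (phi n)) -> (forall n x, 0 <= phi n x <= 1) ->
  (forall n x, ~ K x -> phi n x = 0) ->
  (forall x, Q x -> (fun n => phi n x) @ \oo --> (1 : R)) ->
  (forall n x, ~ Q x -> phi n x = 0) ->
  (\int[mu]_(x in Q) (g x)%:E = 0)%E.
Proof.
move=> mg lg g0 mQ QK cK mK KD tp p01 pK pQ pnQ.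
have mgK : measurable_fun K g by exact: measurable_funS mg.
have iK : mu.-integrable K (EFin \o (fun x => `|g x|)).
  apply/integrableP; split; first by apply/measurable_EFinP; exact: measurableT_comp.
  by under eq_integral do rewrite /= normr_id; exact: lg.
have z n : (\int[mu]_(x in K) (g x * phi n x)%:E = 0)%E.
  rewrite -(g0 _ (tp n)) -[in LHS](setIidr KD) integral_mkcondr; apply: eq_integral => x _.
  rewrite patchE; case: ifPn => // /negP; rewrite inE => nx.
  by rewrite (pK _ _ nx) mulr0.
pose h : T -> \bar R := fun x => (g x * \1_Q x)%:E.
have mh : measurable_fun K h.
  by apply/measurable_EFinP; apply: measurable_funM.
have mhn n : measurable_fun K (fun x => (g x * phi n x)%:E).
  by apply/measurable_EFinP; apply: measurable_funM => //; apply: smooth_measurable; case: (tp n).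
have hc : {ae mu, forall x, K x -> (fun n => (g x * phi n x)%:E) @ \oo --> h x}.
  apply: aeW => x Kx; apply: cvg_EFin; first exact: nearW.
  rewrite /=; apply: cvgM; first exact: cvg_cst.
  rewrite indicE; case: (boolP (x \in Q)) => [/[!inE] Qx|/negP]; first exact: pQ.
  by rewrite inE => nQ; under eq_fun do rewrite pnQ//; exact: cvg_cst.
have hb : {ae mu, forall x n, K x -> (`|(g x * phi n x)%:E| <= `|g x|%:E)%E}.
  apply: aeW => x n Kx; rewrite /= lee_fin normrM ler_piMr//.
  by have /andP[a b] := p01 n x; rewrite ger0_norm.
have [_ _ /=] := dominated_convergence mK mhn mh hc iK hb.
under eq_fun do rewrite z.
move=> ch; have H : (\int[mu]_(x in K) h x = 0)%E.
  by rewrite -(cvg_lim _ ch)//; exact: lim_cst.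
have -> : (\int[mu]_(x in Q) (g x)%:E = \int[mu]_(x in K) h x)%E; last by [].
rewrite -[in LHS](setIidr QK) integral_mkcondr; apply: eq_integral => x _.
by rewrite patchE /h indicE; case: ifPn => _; rewrite ?mulr1 ?mulr0.
Qed.

End locally_integrable.

Section bumps.
Context {R : realType}.
Implicit Types (p q x : R).

(** An approximate indicator of the open interval: for [u > 0], [exp (- 1 / (n u))] tends to 1,
    while each factor vanishes on one side of the interval for every [n]. *)
Definition bump (n : nat) p q x : R := flat 0 (n%:R * (x - p)) * flat 0 (n%:R * (q - x)).

Lemma bump_ge0_le1 n p q x : 0 <= bump n p q x <= 1.
Proof. by rewrite /bump mulr_ge0 ?flat_ge0//= mulr_ile1 ?flat_ge0 ?flat0_le1. Qed.

Lemma bump_out n p q x : ~ (p < x < q) -> bump n p q x = 0.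
Proof.
move=> /negP; rewrite negb_and -!leNgt => /orP[h|h]; rewrite /bump.
  by rewrite (@flat_le0 _ 0 (n%:R * (x - p))) ?mul0r// mulr_ge0_le0// subr_le0.
by rewrite (@flat_le0 _ 0 (n%:R * (q - x))) ?mulr0// mulr_ge0_le0// subr_le0.
Qed.

Lemma cvg_flat0 (u : R) : 0 < u -> (fun n : nat => flat 0 (n%:R * u)) @ \oo --> (1 : R).
Proof.
move=> u0; rewrite -(cvg_shiftS (fun n : nat => flat 0 (n%:R * u))).
have -> : (fun n : nat => flat 0 (n.+1%:R * u)) = (fun n : nat => expR (- (n.+1%:R^-1 * u^-1))).
  by apply/funext => n; rewrite /flat mulr_gt0// expr0 invr1 mul1r invfM.
have cu : (fun n : nat => - (n.+1%:R^-1 * u^-1)) @ \oo --> (0 : R).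
  rewrite -[X in _ --> X]oppr0 -[X in _ --> - X](mul0r u^-1).
  by apply: cvgN; apply: cvgM; [exact: (@cvg_harmonic R)|exact: cvg_cst].
have := continuous_cvg _ (@continuous_expR R 0) cu.
by rewrite expR0; apply.
Qed.

Lemma cvg_bump p q x : p < x < q -> (fun n => bump n p q x) @ \oo --> (1 : R).
Proof.
move=> /andP[px xq]; rewrite -[X in _ --> X]mulr1.
by apply: cvgM; apply: cvg_flat0; rewrite subr_gt0.
Qed.

Lemma smooth_bump n p q : smooth (bump n p q).
Proof.
apply: smoothM.
  rewrite (_ : (fun x => _) = (fun x => flat 0 (n%:R * x + (- (n%:R * p))))).
    exact: (smooth_comp1 (smooth_flat 0) (smooth_affine _ _)).
  by apply/funext => x; rewrite mulrBr.
rewrite (_ : (fun x => _) = (fun x => flat 0 (- n%:R * x + n%:R * q))).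
  exact: (smooth_comp1 (smooth_flat 0) (smooth_affine _ _)).
by apply/funext => x; rewrite mulrBr addrC mulNr.
Qed.

Lemma nbhs_rat_itv (A : set R) (x : R) : nbhs x A ->
  exists p q : rat, ratr p < x < ratr q /\ `[ratr p, ratr q] `<=` A.
Proof.
move=> /nbhs_ballP[e /= e0 eA].
have /rat_in_itvoo[p] : x - e < x by rewrite ltrBlDr ltrDl.
have /rat_in_itvoo[q] : x < x + e by rewrite ltrDl.
rewrite !in_itv /= => /andP[xq qe] /andP[ep px]; exists p, q; split; first by rewrite px.
move=> y /=; rewrite in_itv /= => /andP[py yq]; apply: eA; rewrite /ball /=.
by rewrite ltr_norml; apply/andP; split; lra.
Qed.

End bumps.

Section boxes.
Context {R : realType}.

Definition obox2 (a b c d : R) : set (plane R) := `]a, b[%classic `*` `]c, d[%classic.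
Definition cbox2 (a b c d : R) : set (plane R) := `[a, b]%classic `*` `[c, d]%classic.
Definition obox3 (a b c d e f : R) : set (espace R) :=
  `]a, b[%classic `*` `]c, d[%classic `*` `]e, f[%classic.
Definition cbox3 (a b c d e f : R) : set (espace R) :=
  `[a, b]%classic `*` `[c, d]%classic `*` `[e, f]%classic.

Lemma measurable_obox2 a b c d : measurable (obox2 a b c d).
Proof. by apply: measurableX. Qed.
Lemma measurable_cbox2 a b c d : measurable (cbox2 a b c d).
Proof. by apply: measurableX. Qed.
Lemma measurable_obox3 a b c d e f : measurable (obox3 a b c d e f).
Proof. by do 2?[apply: measurableX]. Qed.
Lemma measurable_cbox3 a b c d e f : measurable (cbox3 a b c d e f).
Proof. by do 2?[apply: measurableX]. Qed.

Lemma compact_cbox2 a b c d : compact (cbox2 a b c d).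
Proof. by apply: compact_setX; exact: segment_compact. Qed.
Lemma compact_cbox3 a b c d e f : compact (cbox3 a b c d e f).
Proof. by do 2?[apply: compact_setX]; exact: segment_compact. Qed.

Lemma obox2_sub a b c d : obox2 a b c d `<=` cbox2 a b c d.
Proof. by move=> x [? ?]; split; apply: subset_itv_oo_cc. Qed.
Lemma obox3_sub a b c d e f : obox3 a b c d e f `<=` cbox3 a b c d e f.
Proof. by move=> x [[? ?] ?]; split; [split|]; apply: subset_itv_oo_cc. Qed.

Definition rbox2 (i : rat * rat * rat * rat) :=
  obox2 (ratr i.1.1.1) (ratr i.1.1.2) (ratr i.1.2) (ratr i.2).
Definition rcbox2 (i : rat * rat * rat * rat) :=
  cbox2 (ratr i.1.1.1) (ratr i.1.1.2) (ratr i.1.2) (ratr i.2).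
Definition rbox3 (i : rat * rat * rat * rat * rat * rat) :=
  obox3 (ratr i.1.1.1.1.1) (ratr i.1.1.1.1.2) (ratr i.1.1.1.2) (ratr i.1.1.2) (ratr i.1.2) (ratr i.2).
Definition rcbox3 (i : rat * rat * rat * rat * rat * rat) :=
  cbox3 (ratr i.1.1.1.1.1) (ratr i.1.1.1.1.2) (ratr i.1.1.1.2) (ratr i.1.1.2) (ratr i.1.2) (ratr i.2).

Lemma nbhs_rbox2 (U : set (plane R)) (x : plane R) : nbhs x U ->
  exists i, rbox2 i x /\ rcbox2 i `<=` U.
Proof.
case: x => x y [[P Q] /= [nP nQ] PQU].
have [a [b [abx abP]]] := nbhs_rat_itv nP; have [c [d [cdy cdQ]]] := nbhs_rat_itv nQ.
exists (a, b, c, d); split; first by split; rewrite /= in_itv.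
by move=> [u v] [/= /abP Pu /cdQ Qv]; apply: PQU.
Qed.

Lemma nbhs_rbox3 (U : set (espace R)) (x : espace R) : nbhs x U ->
  exists i, rbox3 i x /\ rcbox3 i `<=` U.
Proof.
case: x => x z [[P Q] /= [nP nQ] PQU].
have [[[[a b] c] d] [ix iP]] := @nbhs_rbox2 P x nP; have [e [f [efz efQ]]] := nbhs_rat_itv nQ.
exists (a, b, c, d, e, f); split; first by split => //; rewrite /= in_itv.
by move=> [u v] [/= /iP Pu /efQ Qv]; apply: PQU.
Qed.

(* The index is decoded from nat so that the boxes inside U form a sequence. *)
Definition box_sequence {T : Type} {I : countType} (box cbox : I -> set T) (U : set T) (n : nat) : set T :=
  if unpickle n is Some i then [set x | cbox i `<=` U /\ box i x] else set0.

Lemma mem_box_sequence {T : Type} {I : countType} (box cbox : I -> set T) (U : set T) i x :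
  cbox i `<=` U -> box i x -> box_sequence box cbox U (pickle i) x.
Proof. by move=> iU ix; rewrite /box_sequence pickleK. Qed.

Lemma bigcup_box_sequence {T : Type} {I : countType} (box cbox : I -> set T) (U : set T) :
  (forall i, box i `<=` cbox i) ->
  (forall x, U x -> exists i, box i x /\ cbox i `<=` U) ->
  U = \bigcup_n box_sequence box cbox U n.
Proof.
move=> bc H; apply/seteqP; split=> [x Ux|x [n _]].
  by have [i [ix iU]] := H _ Ux; exists (pickle i) => //; exact: mem_box_sequence.
by rewrite /box_sequence; case: unpickle => // i [iU /bc /iU].
Qed.

Lemma measurable_box_sequence {d} {T : measurableType d} {I : countType} (box cbox : I -> set T) (U : set T) n :
  (forall i, measurable (box i)) -> measurable (box_sequence box cbox U n).
Proof.
move=> mb; rewrite /box_sequence; case: unpickle => // i.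
have [iU|iU] := pselect (cbox i `<=` U).
  by rewrite (_ : [set _ | _] = box i)//; apply/seteqP; split => x // [].
by rewrite (_ : [set _ | _] = set0)//; apply/seteqP; split => x // [].
Qed.

(** Links the product topology with the product sigma-algebra: an open set is a countable union of
    boxes with rational vertices. *)
Lemma open_measurable_plane (U : set (plane R)) : open U -> measurable U.
Proof.
move=> oU; rewrite (@bigcup_box_sequence _ _ rbox2 rcbox2 U).
- apply: bigcupT_measurable => n; apply: measurable_box_sequence => i; exact: measurable_obox2.
- by move=> i; exact: obox2_sub.
- by move=> x Ux; apply: nbhs_rbox2; apply: open_nbhs_nbhs; split.
Qed.

Lemma open_measurable_espace (U : set (espace R)) : open U -> measurable U.
Proof.
move=> oU; rewrite (@bigcup_box_sequence _ _ rbox3 rcbox3 U).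
- apply: bigcupT_measurable => n; apply: measurable_box_sequence => i; exact: measurable_obox3.
- by move=> i; exact: obox3_sub.
- by move=> x Ux; apply: nbhs_rbox3; apply: open_nbhs_nbhs; split.
Qed.

Lemma smooth_fst2 : smooth (fun p : plane R => p.1).
Proof. by apply: smooth_linear => // x; exact: cvg_fst. Qed.
Lemma smooth_snd2 : smooth (fun p : plane R => p.2).
Proof. by apply: smooth_linear => // x; exact: cvg_snd. Qed.
Lemma smooth_fst3 : smooth (fun p : espace R => p.1.1).
Proof.
apply: smooth_linear => // x.
by apply: (@cvg_comp _ _ _ (fst : espace R -> plane R) (fst : plane R -> R) _ (nbhs x.1)); exact: cvg_fst.
Qed.
Lemma smooth_snd3 : smooth (fun p : espace R => p.1.2).
Proof.
apply: smooth_linear => // x.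
by apply: (@cvg_comp _ _ _ (fst : espace R -> plane R) (snd : plane R -> R) _ (nbhs x.1)); [exact: cvg_fst|exact: cvg_snd].
Qed.
Lemma smooth_thd3 : smooth (fun p : espace R => p.2).
Proof. by apply: smooth_linear => // x; exact: cvg_snd. Qed.

Definition bump2 n a b c d (p : plane R) := bump n a b p.1 * bump n c d p.2.
Definition bump3 n a b c d e f (p : espace R) := bump n a b p.1.1 * bump n c d p.1.2 * bump n e f p.2.

Lemma bump2_out n a b c d p : ~ obox2 a b c d p -> bump2 n a b c d p = 0.
Proof.
move=> np; rewrite /bump2.
have [h1|/bump_out ->] := pselect (a < p.1 < b); last by rewrite mul0r.
have [h2|/bump_out ->] := pselect (c < p.2 < d); last by rewrite mulr0.
by exfalso; apply: np; split; rewrite /= in_itv.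
Qed.

Lemma bump3_out n a b c d e f p : ~ obox3 a b c d e f p -> bump3 n a b c d e f p = 0.
Proof.
move=> np; rewrite /bump3.
have [h1|/bump_out ->] := pselect (a < p.1.1 < b); last by rewrite !mul0r.
have [h2|/bump_out ->] := pselect (c < p.1.2 < d); last by rewrite mulr0 mul0r.
have [h3|/bump_out ->] := pselect (e < p.2 < f); last by rewrite mulr0.
by exfalso; apply: np; split; [split|]; rewrite /= in_itv.
Qed.

Lemma test_function_compact {V : normedModType R} (D K : set V) (phi : V -> R) :
  smooth phi -> compact K -> closed K -> K `<=` D -> (forall x, ~ K x -> phi x = 0) -> test_function D phi.
Proof.
move=> sp cK clK KD pK.
have sub : closure [set x | phi x != 0] `<=` K.
  rewrite [X in _ `<=` X]((closure_id K).1 clK); apply: closure_subset => x /=.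
  by apply: contra_neqP => /pK.
split=> //; last exact: subset_trans KD.
exact: subclosed_compact (@closed_closure _ _) cK sub.
Qed.

Lemma closed_cbox2 a b c d : closed (cbox2 a b c d).
Proof. by apply: compact_closed; [exact: norm_hausdorff|exact: compact_cbox2]. Qed.
Lemma closed_cbox3 a b c d e f : closed (cbox3 a b c d e f).
Proof. by apply: compact_closed; [exact: norm_hausdorff|exact: compact_cbox3]. Qed.

Lemma test_bump2 (D : set (plane R)) n a b c d : cbox2 a b c d `<=` D -> test_function D (bump2 n a b c d).
Proof.
move=> KD; apply: (@test_function_compact _ D (cbox2 a b c d)) => //.
- apply: smoothM; [exact: (smooth_comp1 (smooth_bump n a b) smooth_fst2)|
    exact: (smooth_comp1 (smooth_bump n c d) smooth_snd2)].
- exact: compact_cbox2.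
- exact: closed_cbox2.
- by move=> x nx; apply: bump2_out => /obox2_sub.
Qed.

Lemma test_bump3 (D : set (espace R)) n a b c d e f : cbox3 a b c d e f `<=` D -> test_function D (bump3 n a b c d e f).
Proof.
move=> KD; apply: (@test_function_compact _ D (cbox3 a b c d e f)) => //.
- apply: smoothM; [apply: smoothM|].
  + exact: (smooth_comp1 (smooth_bump n a b) smooth_fst3).
  + exact: (smooth_comp1 (smooth_bump n c d) smooth_snd3).
  + exact: (smooth_comp1 (smooth_bump n e f) smooth_thd3).
- exact: compact_cbox3.
- exact: closed_cbox3.
- by move=> x nx; apply: bump3_out => /obox3_sub.
Qed.

Lemma itvoo_ray (a b c : R) (x : R) : (`]a, b[%classic x /\ `]c, +oo[%classic x) <-> `]Num.max a c, b[%classic x.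
Proof.
rewrite /= !in_itv /= andbT gt_max; split; first by move=> [/andP[-> ->] ->].
by move=> /andP[/andP[-> ->] ->].
Qed.

End boxes.

Section fundamental_lemma.
Context {R : realType}.

(** Stated as a property of the pair [(mu, D)], so that the theory of weak derivatives can be shared
    by the plane and the space. *)
Definition fundamental_lemma {d} {T : measurableNormedModType R d} (mu : {measure set T -> \bar R}) (D : set T) :=
  forall g : T -> R, measurable_fun D g ->
  (forall K : set T, compact K -> K `<=` D -> (\int[mu]_(x in K) `|g x|%:E < +oo)%E) ->
  (forall p, test_function D p -> (\int[mu]_(x in D) (g x * p x)%:E = 0)%E) ->
  ae_eq mu D g (cst 0).

(** Bumps make the integral of [g] vanish on every box inside [D]. Boxes cut by rays are boxes, so a
    Dynkin argument in each coordinate gives [g = 0] almost everywhere on a box, and countably many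
    rational boxes cover [D]. *)
Lemma fundamental_lemma_plane (D : set (plane R)) : open D -> fundamental_lemma (leb2 R) D.
Proof.
move=> oD g mg lg g0.
have oM := @open_measurable_plane R.
have mD := oM _ oD.
(* The inner box may be empty, as happens when a ray starts beyond the outer one. *)
have bz a b c d a' b' c' d' : cbox2 a b c d `<=` D -> a <= a' -> b' <= b -> c <= c' -> d' <= d ->
    (\int[leb2 R]_(x in obox2 a' b' c' d') (g x)%:E = 0)%E.
  move=> KD ha hb hc hd.
  have KD' : cbox2 a' b' c' d' `<=` D.
    move=> x [/=]; rewrite !in_itv /= => /andP[h1 h2] /andP[h3 h4]; apply: KD.
    by split; rewrite /= in_itv /=; apply/andP; split; lra.
  apply: (@zero_integral_bump _ _ _ (leb2 R) D oM oD g (obox2 a' b' c' d') (cbox2 a' b' c' d')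
    (fun n => bump2 n a' b' c' d')) => //.
  + exact: measurable_obox2.
  + exact: obox2_sub.
  + exact: compact_cbox2.
  + exact: measurable_cbox2.
  + by move=> n; exact: test_bump2.
  + move=> n x; have /andP[p0 p1] := bump_ge0_le1 n a' b' x.1.
    have /andP[q0 q1] := bump_ge0_le1 n c' d' x.2.
    by rewrite mulr_ge0//= mulr_ile1.
  + by move=> n x nx; apply: bump2_out => /obox2_sub.
  + move=> x [/= x1 x2]; rewrite in_itv /= in x1; rewrite in_itv /= in x2.
    by rewrite -[X in _ --> X]mulr1; apply: cvgM; exact: cvg_bump.
  + by move=> n x; exact: bump2_out.
have main n : {ae leb2 R, forall x, box_sequence rbox2 rcbox2 D n x -> g x = cst 0 x}.
  rewrite /box_sequence; case: unpickle => [i|]; last exact: aeW.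
  case: i => [[[a b] c] d].
  have [KD|nK] := pselect (rcbox2 (a, b, c, d) `<=` D); last by apply: aeW => x [].
  set Q := rbox2 (a, b, c, d).
  suff : ae_eq (leb2 R) Q (EFin \o g) (cst 0%E).
    by apply: filterS => x + [_ Qx] => /(_ Qx) [].
  have QD : Q `<=` D by move=> x /obox2_sub /KD.
  have mQ : measurable Q by exact: measurable_obox2.
  have iQ : (leb2 R).-integrable Q (EFin \o g).
    apply/integrableP; split; first by apply/measurable_EFinP; exact: measurable_funS mg.
    apply: (@le_lt_trans _ _ (\int[leb2 R]_(x in rcbox2 (a, b, c, d)) `|g x|%:E)%E).
      apply: ge0_subset_integral => //; [exact: measurable_cbox2| |exact: obox2_sub].
      apply/measurable_EFinP; apply: measurableT_comp => //; apply: measurable_funS mg => //.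
    by apply: lg => //; exact: compact_cbox2.
  have m1 : measurable_fun setT (fst : plane R -> measurableTypeR R) by exact: measurable_fst.
  have m2 : measurable_fun setT (snd : plane R -> measurableTypeR R) by exact: measurable_snd.
  apply: ae_eq0_zero_integral => // E mE.
  rewrite -(@zero_integral_rectangles _ _ _ (leb2 R) _ _ _ _ Q (EFin \o g) _ _ mQ iQ m1 m2 _ E mE).
    by congr (integral _ _ _); apply/seteqP; split=> [[x y]|[x y]].
  have ir (S : set (plane R)) : measurable S -> S `<=` Q -> (leb2 R).-integrable S (EFin \o g).
    by move=> mS SQ; exact: integrableS iQ.
  have mray (h : plane R -> measurableTypeR R) (A : set (measurableTypeR R)) :
      measurable_fun setT h -> measurable A -> measurable (h @^-1` A).
    by move=> mh mA; rewrite -[X in measurable X]setTI; exact: mh.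
  have rays c0 d0 : (\int[leb2 R]_(x in Q `&` fst @^-1` `]c0, +oo[%classic `&` snd @^-1` `]d0, +oo[%classic) (EFin \o g) x = 0)%E.
    rewrite (_ : _ `&` _ = obox2 (Num.max (ratr a) c0) (ratr b) (Num.max (ratr c) d0) (ratr d)).
      by apply: (bz _ _ _ _ _ _ _ _ KD); rewrite // le_max lexx.
    apply/seteqP; split=> [x [[[h1 h2] h3] h4]|x [/itvoo_ray[? ?] /itvoo_ray[? ?]]].
      by split; apply/itvoo_ray.
    by split; [split|].
  (* The ray starting at the lower edge contains the box, so the integral over a full slice is one
     of the ray integrals. *)
  have low1 (S : set (plane R)) : Q `&` S = Q `&` fst @^-1` `]ratr a, +oo[%classic `&` S.
    apply/seteqP; split=> [x [Qx Sx]|x [[]]//]; split=> //; split=> //.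
    by case: Qx => /= + _; rewrite !in_itv /= andbT => /andP[].
  have low2 (S : set (plane R)) : Q `&` S = Q `&` S `&` snd @^-1` `]ratr c, +oo[%classic.
    apply/seteqP; split=> [x [Qx Sx]|x [[]]//]; split=> //.
    by case: Qx => /= _; rewrite !in_itv /= andbT => /andP[].
  have step1 c0 (B : set (measurableTypeR R)) : measurable B ->
      (\int[leb2 R]_(x in Q `&` fst @^-1` `]c0, +oo[%classic `&` snd @^-1` B) (EFin \o g) x = 0)%E.
    have mS : measurable (Q `&` fst @^-1` `]c0, +oo[%classic).
      by apply: measurableI => //; exact: (mray fst).
    move=> mB; apply: (@zero_integral_rays _ _ _ _ _ _ (snd : plane R -> measurableTypeR R)) => //.
    - by apply: ir => // x [].
    - by rewrite low2; exact: rays.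
  move=> A B mA mB; rewrite -setIA [X in Q `&` X]setIC setIA.
  have mS : measurable (Q `&` snd @^-1` B) by apply: measurableI => //; exact: (mray snd).
  apply: (@zero_integral_rays _ _ _ _ _ _ (fst : plane R -> measurableTypeR R)) => //.
  - by apply: ir => // x [].
  - by rewrite low1; exact: step1.
  - by move=> c0; rewrite -setIA [X in Q `&` X]setIC setIA; exact: step1.
have : {ae leb2 R, forall x, forall n, box_sequence rbox2 rcbox2 D n x -> g x = cst 0 x}.
  exact: ae_foralln.
apply: filterS => x H Dx; have [i [ix iU]] := nbhs_rbox2 (open_nbhs_nbhs (conj oD Dx)).
exact: (H (pickle i) (mem_box_sequence iU ix)).
Qed.

Lemma fundamental_lemma_espace (D : set (espace R)) : open D -> fundamental_lemma (leb3 R) D.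
Proof.
move=> oD g mg lg g0.
have oM := @open_measurable_espace R.
have mD := oM _ oD.
have bz a b c d e f a' b' c' d' e' f' : cbox3 a b c d e f `<=` D ->
    a <= a' -> b' <= b -> c <= c' -> d' <= d -> e <= e' -> f' <= f ->
    (\int[leb3 R]_(x in obox3 a' b' c' d' e' f') (g x)%:E = 0)%E.
  move=> KD ha hb hc hd he hf.
  have KD' : cbox3 a' b' c' d' e' f' `<=` D.
    move=> x [[/=]]; rewrite !in_itv /= => /andP[h1 h2] /andP[h3 h4] /andP[h5 h6]; apply: KD.
    by split; [split|]; rewrite /= in_itv /= ?(le_trans ha h1) ?(le_trans h2 hb) ?(le_trans hc h3) ?(le_trans h4 hd)
      ?(le_trans he h5) ?(le_trans h6 hf).
  apply: (@zero_integral_bump _ _ _ (leb3 R) D oM oD g (obox3 a' b' c' d' e' f') (cbox3 a' b' c' d' e' f')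
    (fun n => bump3 n a' b' c' d' e' f')) => //.
  + exact: measurable_obox3.
  + exact: obox3_sub.
  + exact: compact_cbox3.
  + exact: measurable_cbox3.
  + by move=> n; exact: test_bump3.
  + move=> n x; have /andP[p0 p1] := bump_ge0_le1 n a' b' x.1.1.
    have /andP[q0 q1] := bump_ge0_le1 n c' d' x.1.2.
    have /andP[r0 r1] := bump_ge0_le1 n e' f' x.2.
    rewrite /bump3; apply/andP; split; first by apply: mulr_ge0 => //; exact: mulr_ge0.
    by apply: mulr_ile1 => //; [exact: mulr_ge0|exact: mulr_ile1].
  + by move=> n x nx; apply: bump3_out => /obox3_sub.
  + move=> x [[/= x1 x2] x3]; rewrite in_itv /= in x1; rewrite in_itv /= in x2; rewrite in_itv /= in x3.
    rewrite -[X in _ --> X]mulr1; apply: cvgM; last exact: cvg_bump.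
    by rewrite -[X in _ --> X]mulr1; apply: cvgM; exact: cvg_bump.
  + by move=> n x; exact: bump3_out.
have main n : {ae leb3 R, forall x, box_sequence rbox3 rcbox3 D n x -> g x = cst 0 x}.
  rewrite /box_sequence; case: unpickle => [i|]; last exact: aeW.
  case: i => [[[[[a b] c] d] e] f].
  have [KD|nK] := pselect (rcbox3 (a, b, c, d, e, f) `<=` D); last by apply: aeW => x [].
  set Q := rbox3 (a, b, c, d, e, f).
  suff : ae_eq (leb3 R) Q (EFin \o g) (cst 0%E).
    by apply: filterS => x + [_ Qx] => /(_ Qx) [].
  have QD : Q `<=` D by move=> x /obox3_sub /KD.
  have mQ : measurable Q by exact: measurable_obox3.
  have iQ : (leb3 R).-integrable Q (EFin \o g).
    apply/integrableP; split; first by apply/measurable_EFinP; exact: measurable_funS mg.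
    apply: (@le_lt_trans _ _ (\int[leb3 R]_(x in rcbox3 (a, b, c, d, e, f)) `|g x|%:E)%E).
      apply: ge0_subset_integral => //; [exact: measurable_cbox3| |exact: obox3_sub].
      apply/measurable_EFinP; apply: measurableT_comp => //; apply: measurable_funS mg => //.
    by apply: lg => //; exact: compact_cbox3.
  pose X1 : espace R -> measurableTypeR R := fun x => x.1.1.
  pose X2 : espace R -> measurableTypeR R := fun x => x.1.2.
  pose X3 : espace R -> measurableTypeR R := fun x => x.2.
  have m12 : measurable_fun setT (fst : espace R -> plane R) by exact: measurable_fst.
  have m1 : measurable_fun setT X1 by exact: measurableT_comp measurable_fst m12.
  have m2 : measurable_fun setT X2 by exact: measurableT_comp measurable_snd m12.
  have m3 : measurable_fun setT X3 by exact: measurable_snd.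
  have mray (h : espace R -> measurableTypeR R) (A : set (measurableTypeR R)) :
      measurable_fun setT h -> measurable A -> measurable (h @^-1` A).
    by move=> mh mA; rewrite -[X in measurable X]setTI; exact: mh.
  have rays a0 c0 e0 : (\int[leb3 R]_(x in Q `&` X1 @^-1` `]a0, +oo[%classic `&` X2 @^-1` `]c0, +oo[%classic
       `&` X3 @^-1` `]e0, +oo[%classic) (EFin \o g) x = 0)%E.
    rewrite (_ : _ `&` _ = obox3 (Num.max (ratr a) a0) (ratr b) (Num.max (ratr c) c0) (ratr d) (Num.max (ratr e) e0) (ratr f)).
      by apply: (bz _ _ _ _ _ _ _ _ _ _ _ _ KD); rewrite // le_max lexx.
    apply/seteqP; split=> [x [[[[[h1 h2] h3] h4] h5] h6]|x [[/itvoo_ray[? ?] /itvoo_ray[? ?]] /itvoo_ray[? ?]]].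
      by split; [split|]; apply/itvoo_ray.
    by split; [split; [split; [split; [split|]|]|]|].
  have low1 (S S' : set (espace R)) : Q `&` S `&` S' = Q `&` X1 @^-1` `]ratr a, +oo[%classic `&` S `&` S'.
    apply/seteqP; split=> [x [[Qx Sx] S'x]|x [[[]]]//]; split=> //; split=> //; split=> //.
    by case: Qx => /= [[+ _] _]; rewrite /X1 !in_itv /= andbT => /andP[].
  have low2 (S S' : set (espace R)) : Q `&` S `&` S' = Q `&` S `&` X2 @^-1` `]ratr c, +oo[%classic `&` S'.
    apply/seteqP; split=> [x [[Qx Sx] S'x]|x [[[]]]//]; split=> //; split=> //.
    by case: Qx => /= [[_ +] _]; rewrite /X2 !in_itv /= andbT => /andP[].
  have low3 (S S' : set (espace R)) : Q `&` S `&` S' = Q `&` S `&` S' `&` X3 @^-1` `]ratr e, +oo[%classic.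
    apply/seteqP; split=> [x [[Qx Sx] S'x]|x [[[]]]//]; split=> //.
    by case: Qx => /= [_]; rewrite /X3 !in_itv /= andbT => /andP[].
  have ir (S : set (espace R)) : measurable S -> S `<=` Q -> (leb3 R).-integrable S (EFin \o g).
    by move=> mS SQ; exact: integrableS iQ.
  (* The coordinates pass from rays to Borel sets one at a time: [X3], then [X2], then [X1]; [step4]
     and the end regroup them into measurable sets of the product. *)
  have step1 a0 c0 (C : set (measurableTypeR R)) : measurable C ->
      (\int[leb3 R]_(x in Q `&` X1 @^-1` `]a0, +oo[%classic `&` X2 @^-1` `]c0, +oo[%classic `&` X3 @^-1` C) (EFin \o g) x = 0)%E.
    have mS : measurable (Q `&` X1 @^-1` `]a0, +oo[%classic `&` X2 @^-1` `]c0, +oo[%classic).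
      by apply: measurableI; [apply: measurableI|] => //; exact: mray.
    move=> mC; apply: (@zero_integral_rays _ _ _ _ _ _ X3) => //.
    - by apply: ir => // x [[]].
    - by rewrite low3; exact: rays.
  have step2 a0 (B C : set (measurableTypeR R)) : measurable B -> measurable C ->
      (\int[leb3 R]_(x in Q `&` X1 @^-1` `]a0, +oo[%classic `&` X3 @^-1` C `&` X2 @^-1` B) (EFin \o g) x = 0)%E.
    move=> mB mC.
    have mS : measurable (Q `&` X1 @^-1` `]a0, +oo[%classic `&` X3 @^-1` C).
      by apply: measurableI; [apply: measurableI|] => //; exact: mray.
    apply: (@zero_integral_rays _ _ _ _ _ _ X2) => //.
    - by apply: ir => // x [[]].
    - by rewrite low2; exact: step1.
    - by move=> c0; rewrite (setIAC (Q `&` X1 @^-1` `]a0, +oo[)); exact: step1.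
  have step3 (A B C : set (measurableTypeR R)) : measurable A -> measurable B -> measurable C ->
      (\int[leb3 R]_(x in Q `&` X3 @^-1` C `&` X2 @^-1` B `&` X1 @^-1` A) (EFin \o g) x = 0)%E.
    move=> mA mB mC.
    have mS : measurable (Q `&` X3 @^-1` C `&` X2 @^-1` B).
      by apply: measurableI; [apply: measurableI|] => //; exact: mray.
    apply: (@zero_integral_rays _ _ _ _ _ _ X1) => //.
    - by apply: ir => // x [[]].
    - by rewrite low1; exact: step2.
    - by move=> a0; rewrite (setIAC (Q `&` X3 @^-1` C)) (setIAC Q); exact: step2.
  have step4 (E : set (plane R)) (C : set (measurableTypeR R)) : measurable E -> measurable C ->
      (\int[leb3 R]_(x in Q `&` fst @^-1` E `&` X3 @^-1` C) (EFin \o g) x = 0)%E.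
    move=> mE mC; have mS : measurable (Q `&` X3 @^-1` C) by apply: measurableI => //; exact: mray.
    have iS : (leb3 R).-integrable (Q `&` X3 @^-1` C) (EFin \o g) by apply: ir => // x [].
    rewrite setIAC -(@zero_integral_rectangles _ _ _ (leb3 R) _ _ _ _ _ (EFin \o g) X1 X2 mS iS m1 m2 _ E mE).
      by congr (integral _ _ _); apply/seteqP; split=> [[[x y] z]|[[x y] z]].
    by move=> A B mA mB; rewrite (setIAC (Q `&` X3 @^-1` C)); exact: step3.
  apply: ae_eq0_zero_integral => // E mE.
  rewrite -(@zero_integral_rectangles _ _ _ (leb3 R) _ _ _ _ Q (EFin \o g) fst X3 mQ iQ m12 m3 _ E mE).
    by congr (integral _ _ _); apply/seteqP; split=> [[x y]|[x y]].
  by move=> A B mA mB; exact: step4.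
have : {ae leb3 R, forall x, forall n, box_sequence rbox3 rcbox3 D n x -> g x = cst 0 x}.
  exact: ae_foralln.
apply: filterS => x H Dx; have [i [ix iU]] := nbhs_rbox3 (open_nbhs_nbhs (conj oD Dx)).
exact: (H (pickle i) (mem_box_sequence iU ix)).
Qed.

End fundamental_lemma.

(** * Polar coordinates *)

Section density_pushforward.
Local Open Scope ereal_scope.
Context {R : realType} {dX dY : measure_display} {X : measurableType dX} {Y : measurableType dY}.
Variables (mu : {measure set X -> \bar R}) (D : set X) (mD : measurable D).
Variables (phi : X -> Y) (mphi : measurable_fun D phi).
Variables (h : X -> R) (mh : measurable_fun D h) (h0 : forall x, D x -> (0 <= h x)%R).

Import HBNNSimple.

Let mDphi A : measurable A -> measurable (D `&` phi @^-1` A).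
Proof. by move=> mA; exact: mphi. Qed.

(** The image under [phi] of the measure with density [h]. A change of variables amounts to
    recognizing this measure; for Lebesgue measure on the line, its values on half-open intervals
    decide. *)
Definition density_pushforward (A : set Y) : \bar R := \int[mu]_(x in D `&` phi @^-1` A) (h x)%:E.

Let dp0 : density_pushforward set0 = 0.
Proof. by rewrite /density_pushforward preimage_set0 setI0 integral_set0. Qed.

Let dp_ge0 A : 0 <= density_pushforward A.
Proof. by apply: integral_ge0 => x [Dx _]; rewrite lee_fin h0. Qed.

Let dp_sigma_additive : semi_sigma_additive density_pushforward.
Proof.
move=> F mF tF mUF; rewrite /density_pushforward preimage_bigcup setI_bigcupr.
rewrite ge0_integral_bigcup//=.
- by apply: is_cvg_ereal_nneg_natsum_cond => // n _ _; exact: dp_ge0.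
- by move=> k; exact: mDphi.
- apply/measurable_EFinP; apply: measurable_funS mh => //.
  by move=> x [i _ []].
- by move=> x [i _ [Dx _]]; rewrite lee_fin h0.
- apply/trivIsetP => i j _ _ ij; rewrite setIACA setIid -preimage_setI.
  by move/trivIsetP : tF => -> //; rewrite preimage_set0 setI0.
Qed.

HB.instance Definition _ := isMeasure.Build _ _ _ density_pushforward dp0 dp_ge0 dp_sigma_additive.

Definition density_pushforward_measure : {measure set Y -> \bar R} := density_pushforward.

Lemma ge0_integral_density_pushforward (m : {measure set Y -> \bar R}) (f : Y -> \bar R) :
  (forall A, measurable A -> m A = density_pushforward A) ->
  measurable_fun setT f -> (forall y, 0 <= f y) ->
  \int[m]_y f y = \int[mu]_(x in D) (f (phi x) * (h x)%:E).
Proof.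
move=> mE mf f0; pose f_ := nnsfun_approx measurableT mf.
have mfphi n : measurable_fun D (fun x => f_ n (phi x)).
  exact: (measurable_comp measurableT (@subsetT _ _)).
transitivity (limn (fun n => \int[m]_y (f_ n y)%:E)).
  rewrite -monotone_convergence//.
  - apply: eq_integral => y _; apply/esym/cvg_lim => //.
    exact: cvg_nnsfun_approx.
  - by move=> n; exact/measurable_EFinP.
  - by move=> n y _; rewrite lee_fin.
  - by move=> y _ a b ab; rewrite lee_fin; exact/lefP/nd_nnsfun_approx.
transitivity (limn (fun n => \int[mu]_(x in D) ((f_ n (phi x))%:E * (h x)%:E))); last first.
  rewrite -monotone_convergence//.
  - apply: eq_integral => x /[!inE] Dx; apply/cvg_lim => //.
    by apply: cvgeZr => //; exact: cvg_nnsfun_approx.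
  - by move=> n; apply: emeasurable_funM; exact/measurable_EFinP.
  - by move=> n x Dx; rewrite mule_ge0 ?lee_fin ?h0.
  - move=> x Dx a b ab; rewrite lee_wpmul2r ?lee_fin ?h0//.
    exact/lefP/nd_nnsfun_approx.
apply: congr_lim; apply/funext => n.
under eq_integral do rewrite fimfunE -fsumEFin//.
rewrite ge0_integral_fsum//; last 2 first.
- by move=> y; apply/measurable_EFinP; exact: measurable_funM.
- by move=> y x _; rewrite nnfun_muleindic_ge0.
under [RHS]eq_integral => x _.
  rewrite fimfunE -fsumEFin// ge0_mule_fsuml; last first.
    by move=> k; rewrite nnfun_muleindic_ge0.
  over.
rewrite ge0_integral_fsum//; last 2 first.
- move=> k; apply: emeasurable_funM; apply/measurable_EFinP => //.
  apply: measurable_funM => //; apply: (measurable_comp measurableT (@subsetT _ _) _ mphi).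
  by apply: measurable_indic; exact: measurable_sfunP.
- by move=> k x Dx; rewrite mule_ge0 ?nnfun_muleindic_ge0// lee_fin h0.
apply: eq_fsbigr => k _.
have mk : measurable (f_ n @^-1` [set k]) by exact: measurable_sfunP.
have [k0|k0] := ltP k 0%R.
  rewrite !(preimage_nnfun0 _ k0).
  under eq_integral do rewrite indic0 mulr0.
  under [RHS]eq_integral do rewrite indic0 mulr0 mul0e.
  by rewrite !integral0.
under eq_integral do rewrite EFinM.
rewrite ge0_integralZl//; try by apply/measurable_EFinP; exact: measurable_indic.
rewrite integral_indic// setIT mE//.
under [RHS]eq_integral do rewrite EFinM -muleA.
rewrite ge0_integralZl//; last first.
  by move=> x Dx; rewrite mule_ge0 ?lee_fin ?h0.
  apply: emeasurable_funM; apply/measurable_EFinP => //.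
  apply: (measurable_comp measurableT (@subsetT _ _) _ mphi).
  exact: measurable_indic.
congr (_ * _); rewrite /density_pushforward integral_mkcondr.
apply: eq_integral => x _; rewrite patchE indicE.
have -> : (phi x \in f_ n @^-1` [set k]) = (x \in phi @^-1` (f_ n @^-1` [set k])) by [].
by case: ifPn; rewrite ?mul1e ?mul0e.
Qed.

End density_pushforward.

Section substitutions.
Local Open Scope ereal_scope.
Context {R : realType}.
Local Notation leb := (@lebesgue_measure R).

Lemma FTC2_itv (f F : R -> R) (a b : R) : (a < b)%R ->
  (forall x, (a <= x <= b)%R -> is_derive x (1%R : R) F (f x)) ->
  (forall x, (a <= x <= b)%R -> {for x, continuous f}) ->
  \int[leb]_(x in `[a, b]) (f x)%:E = (F b - F a)%:E.
Proof.
move=> ab dF cf; rewrite (@continuous_FTC2 _ f F)//.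
- apply: continuous_in_subspaceT => x; rewrite inE /= in_itv /=; exact: cf.
- split.
  + by move=> x; rewrite in_itv /= => /andP[ax xb]; have [] := dF x; rewrite ?(ltW ax) ?(ltW xb).
  + apply: cvg_at_right_filter; apply: is_derive_continuous (dF a _).
    by rewrite lexx ltW.
  + apply: cvg_at_left_filter; apply: is_derive_continuous (dF b _).
    by rewrite lexx ltW.
- move=> x; rewrite in_itv /= => /andP[ax xb]; rewrite derive1E.
  by apply: derive_val; apply: dF; rewrite ?(ltW ax) ?(ltW xb).
Qed.

Lemma ge0_integral_affine (c a : R) (f : R -> \bar R) : (0 < c)%R ->
  measurable_fun setT f -> (forall x, 0 <= f x) ->
  \int[leb]_x f x = \int[leb]_x (f (c * x + a)%R * c%:E).
Proof.
move=> c0 mf f0.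
have mphi : measurable_fun setT (fun x : R => (c * x + a)%R : measurableTypeR R).
  by apply: measurable_funD => //; exact: measurable_funM.
have h0 (x : R) : [set: R] x -> (0 <= cst c x)%R by move=> _; exact: ltW.
rewrite (@ge0_integral_density_pushforward _ _ _ _ _ leb setT measurableT _ mphi (cst c) (measurable_cst _) h0)//.
move=> A mA; apply: (@lebesgue_measure_unique _ (density_pushforward_measure leb measurableT mphi (measurable_cst c) h0)) => //.
move=> _ [[u v] _ <-].
have mp : measurable ((fun x : R => (c * x + a)%R : measurableTypeR R) @^-1` [set` `]u, v]]).
  by rewrite -[X in measurable X]setTI; apply: mphi => //; exact: measurable_itv.
transitivity (c%:E * leb ((fun x : R => (c * x + a)%R) @^-1` [set` `]u, v]])); last first.
  rewrite /density_pushforward_measure /= /density_pushforward setTI; apply/esym.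
  exact: (integral_cst leb mp c%:E).
have -> : (fun x : R => (c * x + a)%R) @^-1` [set` `]u, v]] = `]((u - a) / c)%R, ((v - a) / c)%R]%classic.
  apply/seteqP; split=> x /=; rewrite !in_itv /= ltr_pdivrMr// ler_pdivlMr// [(x * c)%R]mulrC.
    by move=> /andP[h1 h2]; apply/andP; split; lra.
  by move=> /andP[h1 h2]; apply/andP; split; lra.
rewrite !lebesgue_measure_itv /= !lte_fin ltr_pM2r ?invr_gt0// ltrD2r.
case: ifP => _; last by rewrite mule0.
by rewrite -!EFinB -EFinM; congr EFin; field; rewrite gt_eqF.
Qed.

Lemma cos_gt0_pihalf' (x : R) : x \in `](- (pi / 2)), (pi / 2)[%R -> (0 < cos x)%R.
Proof. by rewrite in_itv /= => h; exact: cos_gt0_pihalf. Qed.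

(** The image under [tan] of the density [1 / cos^2] gives []u, v]] the mass
    [tan (atan v) - tan (atan u) = v - u]. *)
Lemma ge0_integral_tan (f : R -> \bar R) :
  measurable_fun setT f -> (forall x, 0 <= f x) ->
  \int[leb]_x f x = \int[leb]_(t in `](- (pi / 2))%R, (pi / 2)%R[) (f (tan t) * ((cos t) ^- 2)%:E).
Proof.
move=> mf f0; set I := `](- (pi / 2))%R, (pi / 2)%R[%classic.
have mI : measurable (I : set (measurableTypeR R)) by exact: measurable_itv.
have oI : open I by exact: interval_open.
have cI x : x \in I -> (0 < cos x)%R by rewrite inE => /cos_gt0_pihalf'.
have mphi : measurable_fun I (@tan R : R -> measurableTypeR R).
  by apply: open_continuous_measurable_fun => // x /cI c0; apply: continuous_tan; rewrite gt_eqF.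
have cch (x : R) : cos x != 0%R -> {for x, continuous (fun t : R => (cos t) ^- 2)%R}.
  move=> c0; apply: continuousV; first by rewrite expf_neq0.
  exact: continuousM (@continuous_cos R x) (@continuous_cos R x).
have mh : measurable_fun I (fun t : R => (cos t) ^- 2)%R.
  by apply: open_continuous_measurable_fun => // x /cI c0; apply: cch; rewrite gt_eqF.
have h0 (x : R) : I x -> (0 <= (cos x) ^- 2)%R by move=> _; rewrite invr_ge0 sqr_ge0.
rewrite (@ge0_integral_density_pushforward _ _ _ _ _ leb I mI _ mphi _ mh h0)//.
move=> A mA; apply: (@lebesgue_measure_unique _ (density_pushforward_measure leb mI mphi mh h0)) => //.
move=> _ [[u v] _ <-]; rewrite /density_pushforward_measure /= /density_pushforward.
have aI (x : R) : I (atan x) by rewrite /I /= in_itv /= atan_gtNpi2 atan_ltpi2.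
have -> : I `&` (@tan R) @^-1` [set` `]u, v]] = `](atan u), (atan v)]%classic.
  apply/seteqP; split=> x /=.
    move=> [Ix]; rewrite !in_itv /= => /andP[ux xv]; rewrite -(tanK Ix).
    by rewrite lt_atan// le_atan.
  rewrite !in_itv /= => /andP[ux xv].
  have Ix : I x.
    by rewrite /I /= in_itv /= (lt_trans (atan_gtNpi2 u) ux) (le_lt_trans xv (atan_ltpi2 v)).
  split=> //; rewrite -(atanK u) -(atanK v) ltr_tan ?ux//=; [|exact: aI].
  rewrite leNgt ltr_tan -?leNgt//; exact: aI.
rewrite lebesgue_measure_itv /= lte_fin.
case: ifPn => [uv|vu]; last first.
  rewrite set_itv_ge ?integral_set0//= bnd_simp -leNgt.
  by apply: le_atan; rewrite leNgt.
have sub : `[(atan u), (atan v)]%classic `<=` I.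
  move=> x; rewrite /I /= !in_itv /= => /andP[h1 h2].
  by rewrite (lt_le_trans (atan_gtNpi2 u) h1) (le_lt_trans h2 (atan_ltpi2 v)).
have c0 x : (atan u <= x <= atan v)%R -> cos x != 0%R.
  by move=> h; rewrite gt_eqF//; apply: cI; rewrite inE; apply: sub; rewrite /= in_itv.
rewrite integral_itv_obnd_cbnd; last first.
  apply/measurable_EFinP; apply: measurable_funS mh => //.
  by move=> x /subset_itv_oc_cc /sub.
have -> : \int[leb]_(x in `[(atan u), (atan v)]) ((cos x) ^- 2)%:E = (tan (atan v) - tan (atan u))%:E.
  apply: FTC2_itv; first exact: lt_atan.
  - by move=> x /c0 cx; exact: is_derive_tan.
  - by move=> x /c0 cx; exact: cch.
by rewrite !atanK.
Qed.

End substitutions.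

Section tonelli_domains.
Local Open Scope ereal_scope.
Context {R : realType} {d1 d2 : measure_display} {T1 : measurableType d1} {T2 : measurableType d2}.
Variables (m1 : {sigma_finite_measure set T1 -> \bar R}) (m2 : {sigma_finite_measure set T2 -> \bar R}).
Variables (D1 : set T1) (D2 : set T2) (mD1 : measurable D1) (mD2 : measurable D2).
Variables (f : T1 * T2 -> \bar R) (mf : measurable_fun (D1 `*` D2) f).
Hypothesis f0 : forall x y, D1 x -> D2 y -> 0 <= f (x, y).

Let g := f \_ (D1 `*` D2).
Let mg : measurable_fun setT g.
Proof. by apply/(measurable_restrictT _ _).1 => //; exact: measurableX. Qed.
Let g0 z : 0 <= g z.
Proof. by rewrite /g patchE; case: ifPn => // /[!inE] -[]; case: z => /= *; exact: f0. Qed.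

Let gE1 x : D1 x -> \int[m2]_y g (x, y) = \int[m2]_(y in D2) f (x, y).
Proof.
move=> Dx; rewrite [RHS]integral_mkcond; apply: eq_integral => y _.
by rewrite /g !patchE in_setX (mem_set Dx).
Qed.

Let gE1' : \int[m1]_x \int[m2]_y g (x, y) = \int[m1]_(x in D1) \int[m2]_(y in D2) f (x, y).
Proof.
rewrite [RHS]integral_mkcond; apply: eq_integral => x _; rewrite patchE.
case: ifPn => [/[!inE] Dx|xD]; first by rewrite gE1.
under eq_integral do rewrite /g patchE in_setX (negbTE xD).
by rewrite integral0.
Qed.

Let gE2' : \int[m2]_y \int[m1]_x g (x, y) = \int[m2]_(y in D2) \int[m1]_(x in D1) f (x, y).
Proof.
rewrite [RHS]integral_mkcond; apply: eq_integral => y _; rewrite patchE.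
case: ifPn => [yD|yD].
  rewrite [RHS]integral_mkcond; apply: eq_integral => x _.
  by rewrite /g !patchE in_setX yD andbT.
under eq_integral do rewrite /g patchE in_setX (negbTE yD) andbF.
by rewrite integral0.
Qed.

Lemma tonelli_dom : \int[m1]_(x in D1) \int[m2]_(y in D2) f (x, y) =
  \int[m2]_(y in D2) \int[m1]_(x in D1) f (x, y).
Proof. by rewrite -gE1' -gE2' fubini_tonelli. Qed.

Lemma tonelli_dom1 : \int[m1 \x m2]_(z in D1 `*` D2) f z = \int[m1]_(x in D1) \int[m2]_(y in D2) f (x, y).
Proof. by rewrite -gE1' -fubini_tonelli1// [LHS]integral_mkcond. Qed.

Lemma measurable_tonelli_dom1 : measurable_fun D1 (fun x => \int[m2]_(y in D2) f (x, y)).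
Proof.
have := @measurable_fun_fubini_tonelli_F _ _ _ _ _ m2 g mg g0.
move/(measurable_funTS (D := D1)); apply: eq_measurable_fun => x /[!inE] Dx.
exact: gE1.
Qed.

End tonelli_domains.

Section polar_coordinates.
Local Open Scope ereal_scope.
Context {R : realType}.
Local Notation leb := (@lebesgue_measure R).
Local Notation Rm := (measurableTypeR R).

Let mcos : measurable_fun setT (@cos R : Rm -> Rm).
Proof. by apply: continuous_measurable_fun; exact: continuous_cos. Qed.
Let msin : measurable_fun setT (@sin R : Rm -> Rm).
Proof. by apply: continuous_measurable_fun; exact: continuous_sin. Qed.

Definition polar (p : Rm * Rm) : Rm * Rm := (p.1 * cos p.2, p.1 * sin p.2)%R.

Lemma measurable_polar : measurable_fun setT polar.
Proof.
apply/measurable_fun_pair => /=.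
  by apply: measurable_funM; [exact: measurable_fst|exact: measurableT_comp mcos measurable_snd].
by apply: measurable_funM; [exact: measurable_fst|exact: measurableT_comp msin measurable_snd].
Qed.

Variables (f : Rm * Rm -> \bar R) (mf : measurable_fun setT f) (f0 : forall z, 0 <= f z).

(** A two-dimensional substitution is replaced by three one-dimensional ones separated by Tonelli
    exchanges: [y = x t], then [t = tan theta], then [x = r cos theta]. The factors [x],
    [1 / cos^2 theta] and [cos theta] multiply to [r]. *)
Lemma half_plane_polar (g : Rm * Rm -> \bar R) : measurable_fun setT g -> (forall z, 0 <= g z) ->
  \int[leb]_(x in `]0%R, +oo[) \int[leb]_y g (x, y) =
  \int[leb]_(r in `]0%R, +oo[) \int[leb]_(t in `](- (pi / 2))%R, (pi / 2)%R[) (g (polar (r, t)) * r%:E).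
Proof.
move=> mg g0; set I := `](- (pi / 2))%R, (pi / 2)%R[%classic.
set P := `]0%R, +oo[%classic.
have mI : measurable (I : set Rm) by exact: measurable_itv.
have mP : measurable (P : set Rm) by exact: measurable_itv.
have msc : measurable_fun setT (fun z : Rm * Rm => (z.1, z.1 * z.2)%R : Rm * Rm).
  apply/measurable_fun_pair => /=; first exact: measurable_fst.
  by apply: measurable_funM; [exact: measurable_fst|exact: measurable_snd].
have mg1 (x : R) : measurable_fun setT (fun y : Rm => g (x, y)).
  by apply: measurableT_comp mg _; exact: measurable_pair1.
have mx : measurable_fun setT (fun z : Rm * Rm => (z.1)%:E).
  by apply/measurable_EFinP; exact: measurable_fst.
transitivity (\int[leb]_(x in P) \int[leb]_t (g (x, x * t)%R * x%:E)).
  apply: eq_integral => x; rewrite inE /P /= in_itv /= andbT => x0.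
  rewrite (@ge0_integral_affine _ x 0%R (fun y => g (x, y)))//.
    by apply: eq_integral => t _; rewrite addr0.
  exact: mg1.
have mG : measurable_fun setT (fun z : Rm * Rm => g (z.1, z.1 * z.2)%R * (z.1)%:E).
  by apply: emeasurable_funM => //; exact: measurableT_comp mg msc.
have P0 x : P x -> (0 < x)%R by rewrite /P /= in_itv /= andbT.
rewrite (@tonelli_dom _ _ _ _ _ leb leb P setT mP measurableT (fun z => g (z.1, z.1 * z.2)%R * (z.1)%:E)); last 2 first.
- exact: measurable_funTS.
- by move=> x y /P0 x0 _; rewrite mule_ge0// lee_fin ltW.
pose K (t : R) := \int[leb]_(x in P) (g (x, x * t)%R * x%:E).
have mK : measurable_fun setT K.
  have := @measurable_tonelli_dom1 _ _ _ _ _ leb setT P measurableT mP (fun z => g (z.2, z.2 * z.1)%R * (z.2)%:E).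
  apply.
    apply: measurable_funTS; apply: emeasurable_funM.
      apply: measurableT_comp mg _; apply/measurable_fun_pair => /=; first exact: measurable_snd.
      by apply: measurable_funM; [exact: measurable_snd|exact: measurable_fst].
    by apply/measurable_EFinP; exact: measurable_snd.
  by move=> x y _ /P0 y0; rewrite mule_ge0// lee_fin ltW.
have K0 t : 0 <= K t by apply: integral_ge0 => x /P0 x0; rewrite mule_ge0// lee_fin ltW.
rewrite (ge0_integral_tan mK K0).
rewrite (@tonelli_dom _ _ _ _ _ leb leb P I mP mI (fun z => g (polar z) * (z.1)%:E)); last 2 first.
- apply: measurable_funTS; apply: emeasurable_funM => //; exact: measurableT_comp mg measurable_polar.
- by move=> x y /P0 x0 _; rewrite mule_ge0// lee_fin ltW.
apply: eq_integral => t; rewrite inE => It.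
have ct : (0 < cos t)%R by exact: cos_gt0_pihalf'.
have mk : measurable_fun setT (fun x : Rm => g (x, x * tan t)%R * x%:E * (\1_P x)%:E).
  apply: emeasurable_funM; last by apply/measurable_EFinP; exact: measurable_indic.
  apply: emeasurable_funM; last exact/measurable_EFinP.
  apply: measurableT_comp mg _; apply/measurable_fun_pair => //=.
  exact: measurable_funM.
have k0 x : 0 <= g (x, x * tan t)%R * x%:E * (\1_P x)%:E.
  rewrite indicE; case: (boolP (x \in P)) => [/[!inE] /P0 x0|_]; last by rewrite mule0.
  by rewrite mule1 mule_ge0// lee_fin ltW.
have KE : K (tan t) = \int[leb]_x (g (x, x * tan t)%R * x%:E * (\1_P x)%:E).
  rewrite /K integral_mkcond; apply: eq_integral => x _; rewrite patchE indicE.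
  by case: ifPn; rewrite ?mule1 ?mule0.
rewrite KE (@ge0_integral_affine _ (cos t) 0%R _ ct mk k0).
rewrite muleC -ge0_integralZl//; last 3 first.
- apply: emeasurable_funM => //; apply: (measurableT_comp mk).
  by apply: measurable_funD => //; exact: measurable_funM.
- by move=> x _; rewrite mule_ge0// lee_fin ltW.
- by rewrite lee_fin invr_ge0 sqr_ge0.
rewrite [RHS]integral_mkcond; apply: eq_integral => r _.
rewrite patchE addr0 indicE.
have -> : ((cos t * r)%R \in P) = (r \in P).
  by apply/idP/idP; rewrite !inE /P /= !in_itv /= !andbT pmulr_rgt0.
case: ifPn => [rP|_]; last by rewrite mule0 mul0e mule0.
rewrite mule1 /polar /= [(cos t * r)%R]mulrC /tan mulrA.
have -> : (r * cos t * sin t / cos t = r * sin t)%R by field; rewrite gt_eqF.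
rewrite muleC -!muleA; congr (_ * _); rewrite -!EFinM; congr EFin.
by field; rewrite gt_eqF.
Qed.

(** The two intervals of length [pi] are the angles of the right and left half planes; together they
    cover one period. *)
Lemma ge0_integral_periodic (G : R -> \bar R) : measurable_fun setT G -> (forall x, 0 <= G x) ->
  (forall x, G (x + 2 * pi)%R = G x) ->
  \int[leb]_(t in `](- (pi / 2))%R, (pi / 2)%R[) G t +
  \int[leb]_(t in `](- (pi / 2))%R, (pi / 2)%R[) G (t + pi)%R = \int[leb]_(t in `](- pi)%R, pi]) G t.
Proof.
move=> mG G0 Gper.
have pi0 := pi_gt0 R.
have shift (a b c : R) : \int[leb]_(t in `]a, b]) G (t + c)%R = \int[leb]_(t in `](a + c)%R, (b + c)%R]) G t.
  rewrite integral_mkcond [RHS]integral_mkcond.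
  rewrite [RHS](@ge0_integral_affine _ 1%R c _ ltr01); last 2 first.
  - by apply/(measurable_restrictT _ _).1; [exact: measurable_itv|exact: measurable_funTS].
  - by move=> x; rewrite patchE; case: ifP.
  apply: eq_integral => x _; rewrite mule1 mul1r !patchE.
  have -> : (x + c \in `](a + c)%R, (b + c)%R]%classic)%R = (x \in `]a, b]%classic)%R.
    by apply/idP/idP; rewrite !inE /= !in_itv /= ltrD2r lerD2r.
  by [].
have oo (H : R -> \bar R) : measurable_fun setT H ->
    \int[leb]_(t in `](- (pi / 2))%R, (pi / 2)%R[) H t = \int[leb]_(t in `](- (pi / 2))%R, (pi / 2)%R]) H t.
  by move=> mH; rewrite integral_itv_bndo_bndc//; exact: measurable_funTS.
rewrite !oo//; last first.
  by apply: (measurableT_comp mG); apply: measurable_funD.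
rewrite shift.
have split2 (a b c : R) : (a <= b)%R -> (b <= c)%R ->
    \int[leb]_(t in `]a, c]) G t = \int[leb]_(t in `]a, b]) G t + \int[leb]_(t in `]b, c]) G t.
  move=> ab bc; rewrite -ge0_integral_setU//=; try exact: measurable_itv.
  - by rewrite (@itv_bndbnd_setU _ _ _ (BRight b))// bnd_simp.
  - exact: measurable_funTS.
  - by apply/disj_setPS => x [] /=; rewrite !in_itv /= => /andP[_ h1] /andP[h2 _]; move: (lt_le_trans h2 h1); rewrite ltxx.
rewrite (split2 (- (pi / 2) + pi)%R pi (pi / 2 + pi)%R); [|lra|lra].
(* The part beyond [pi] is moved back by one period. *)
have -> : \int[leb]_(t in `]pi, (pi / 2 + pi)%R]) G t = \int[leb]_(t in `](- pi)%R, (- (pi / 2))%R]) G t.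
  transitivity (\int[leb]_(t in `](- pi)%R, (- (pi / 2))%R]) G (t + 2 * pi)%R); last first.
    by apply: eq_integral => t _; rewrite Gper.
  rewrite shift.
  have -> : (- pi + 2 * pi = pi :> R)%R by lra.
  by have -> : (- (pi / 2) + 2 * pi = pi / 2 + pi :> R)%R by lra.
rewrite (split2 (- pi)%R (- (pi / 2))%R pi); [|lra|lra].
rewrite (split2 (- (pi / 2))%R (pi / 2)%R pi); [|lra|lra].
have -> : (- (pi / 2) + pi = pi / 2 :> R)%R by lra.
by rewrite addeA addeC.
Qed.

Lemma integral_polar : \int[leb \x leb]_z f z =
  \int[leb]_(r in `]0%R, +oo[) \int[leb]_(t in `](- pi)%R, pi]) (f (polar (r, t)) * r%:E).
Proof.
set P := `]0%R, +oo[%classic.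
have mP : measurable (P : set Rm) by exact: measurable_itv.
pose I : set Rm := `](- (pi / 2))%R, (pi / 2)%R[%classic.
have mI : measurable (I : set Rm) by exact: measurable_itv.
have mN : measurable (`]-oo, 0%R[%classic : set Rm) by exact: measurable_itv.
have P0 x : P x -> (0 < x)%R by rewrite /P /= in_itv /= andbT.
rewrite (fubini_tonelli1 f mf f0).
have mF := @measurable_fun_fubini_tonelli_F _ _ _ _ _ leb f mf f0.
set F := fun x => \int[leb]_y f (x, y).
have F0 x : 0 <= F x by exact: integral_ge0.
have -> : \int[leb]_x F x = \int[leb]_(x in P) F x + \int[leb]_(x in `]-oo, 0%R[) F x.
  (* The line [x = 0], seen by neither half plane, is null. *)
  have -> : \int[leb]_(x in `]-oo, 0%R[) F x = \int[leb]_(x in `]-oo, 0%R]) F x.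
    by rewrite integral_itv_bndo_bndc//; exact: measurable_funTS.
  rewrite -ge0_integral_setU//=; try exact: measurable_itv.
  - congr (integral _ _ _); apply/seteqP; split=> // x _; rewrite /P /= !in_itv /= andbT.
    by case: (ltP 0%R x); [left|right].
  - exact: measurable_funTS.
  - by apply/disj_setPS => x []; rewrite /P /= !in_itv /= andbT => h1 h2; move: (lt_le_trans h1 h2); rewrite ltxx.
(* The left half plane is the image of the right one under the reflection through the origin, which
   adds [pi] to the angle. *)
pose fN (z : Rm * Rm) := f (- z.1, - z.2)%R.
have mneg : measurable_fun setT (fun z : Rm * Rm => (- z.1, - z.2)%R : Rm * Rm).
  by apply/measurable_fun_pair => /=; apply: measurable_funN; [exact: measurable_fst|exact: measurable_snd].
have mfN : measurable_fun setT fN by exact: measurableT_comp mf mneg.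
have neg (H : R -> \bar R) : measurable_fun setT H -> (forall x, 0 <= H x) ->
    \int[leb]_x H x = \int[leb]_x H (- x)%R.
  move=> mH H0.
  have mo : measurable_fun setT (-%R : Rm -> Rm) by exact: oppr_measurable.
  have := @ge0_integral_pushforward _ _ _ _ R (-%R : Rm -> Rm) mo leb setT H measurableT mH (fun y _ => H0 y).
  rewrite preimage_setT => <-; apply: eq_measure_integral => A mA _.
  exact/esym/lebesgue_measureN.
have -> : \int[leb]_(x in `]-oo, 0%R[) F x = \int[leb]_(x in P) \int[leb]_y fN (x, y).
  rewrite integral_mkcond [RHS]integral_mkcond neg; last 2 first.
  - by apply/(measurable_restrictT _ _).1; [exact: measurable_itv|exact: measurable_funTS].
  - by move=> x; rewrite patchE; case: ifP.
  apply: eq_integral => x _; rewrite !patchE.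
  have -> : (- x \in `]-oo, 0[%classic)%R = (x \in P).
    by apply/idP/idP; rewrite !inE /P /= !in_itv /= andbT oppr_lt0.
  case: ifPn => // _; rewrite /F neg//.
  by apply: measurableT_comp mf _; exact: measurable_pair1.
rewrite /F half_plane_polar// half_plane_polar//; last by move=> z; exact: f0.
rewrite -ge0_integralD//; first last.
- apply: (@measurable_tonelli_dom1 _ _ _ _ _ leb P I mP mI (fun z => fN (polar z) * (z.1)%:E)).
    by apply: measurable_funTS; apply: emeasurable_funM; [exact: measurableT_comp mfN measurable_polar|apply/measurable_EFinP; exact: measurable_fst].
  by move=> x y /P0 x0 _; rewrite mule_ge0 ?f0// lee_fin ltW.
- by move=> x /P0 x0; apply: integral_ge0 => y _; rewrite mule_ge0 ?f0// lee_fin ltW.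
- apply: (@measurable_tonelli_dom1 _ _ _ _ _ leb P I mP mI (fun z => f (polar z) * (z.1)%:E)).
    by apply: measurable_funTS; apply: emeasurable_funM; [exact: measurableT_comp mf measurable_polar|apply/measurable_EFinP; exact: measurable_fst].
  by move=> x y /P0 x0 _; rewrite mule_ge0 ?f0// lee_fin ltW.
- by move=> x /P0 x0; apply: integral_ge0 => y _; rewrite mule_ge0 ?f0// lee_fin ltW.
apply: eq_integral => r; rewrite inE => /P0 r0.
rewrite -(@ge0_integral_periodic (fun t => f (polar (r, t)) * r%:E)).
- congr (_ + _); apply: eq_integral => t _.
  by rewrite /fN /polar /= cosDpi sinDpi !mulrN.
- apply: emeasurable_funM => //; apply: measurableT_comp mf _.
  by apply: measurableT_comp measurable_polar _; exact: measurable_pair1.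
- by move=> x; rewrite mule_ge0 ?f0// lee_fin ltW.
- by move=> x; rewrite /polar /= mulr_natl cosD2pi sinD2pi.
Qed.

End polar_coordinates.

(** * Cylindrical coordinates *)

Lemma measurable_slice1 {d1 d2 d3} {T1 : measurableType d1} {T2 : measurableType d2}
    {T3 : measurableType d3} (D1 : set T1) (D2 : set T2) (f : T1 * T2 -> T3) (x : T1) :
  measurable D1 -> measurable D2 -> measurable_fun (D1 `*` D2) f -> D1 x ->
  measurable_fun D2 (fun y => f (x, y)).
Proof.
move=> mD1 mD2 mf Dx; apply: (measurable_comp (measurableX mD1 mD2)) mf _.
  by move=> _ [y Dy <-].
by apply: measurable_funTS; exact: measurable_pair1.
Qed.

Section fubini_domains.
Context {R : realType} {d1 d2 : measure_display} {T1 : measurableType d1} {T2 : measurableType d2}.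
Variables (m1 : {sigma_finite_measure set T1 -> \bar R}) (m2 : {sigma_finite_measure set T2 -> \bar R}).
Variables (D1 : set T1) (D2 : set T2) (mD1 : measurable D1) (mD2 : measurable D2).

Section real.
Variables (f : T1 * T2 -> R) (fi : (m1 \x m2)%E.-integrable (D1 `*` D2) (EFin \o f)).

Let mD12 : measurable (D1 `*` D2). Proof. exact: measurableX. Qed.
Let g := (EFin \o f) \_ (D1 `*` D2).
Let gi : (m1 \x m2)%E.-integrable setT g.
Proof. by apply/(integrable_mkcond _ _).1. Qed.

Let gE1 x : (fun y => g (x, y)) = if x \in D1 then (fun y => (f (x, y))%:E) \_ D2 else cst 0%E.
Proof.
apply/funext => y; rewrite /g patchE in_setX; case: ifPn => //= [/andP[-> yD]|].
  by rewrite patchE yD.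
by case: ifP => //= _ yD; rewrite patchE (negbTE yD).
Qed.

Let gE2 y : (fun x => g (x, y)) = if y \in D2 then (fun x => (f (x, y))%:E) \_ D1 else cst 0%E.
Proof.
apply/funext => x; rewrite /g patchE in_setX andbC; case: ifPn => //= [/andP[-> yD]|].
  by rewrite patchE yD.
by case: ifP => //= _ yD; rewrite patchE (negbTE yD).
Qed.

Lemma ae_integrable_slice1 : {ae m1, forall x, D1 x -> m2.-integrable D2 (fun y => (f (x, y))%:E)}.
Proof.
apply: filterS (ae_integrable1 gi) => x; rewrite gE1 => h Dx.
by rewrite mem_set// in h; apply/(integrable_mkcond _ _).2.
Qed.

Lemma ae_integrable_slice2 : {ae m2, forall y, D2 y -> m1.-integrable D1 (fun x => (f (x, y))%:E)}.
Proof.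
apply: filterS (ae_integrable2 gi) => y; rewrite gE2 => h Dy.
by rewrite mem_set// in h; apply/(integrable_mkcond _ _).2.
Qed.

Let FE1 : fubini_F m2 g = (fun x => \int[m2]_(y in D2) (f (x, y))%:E)%E \_ D1.
Proof.
apply/funext => x; rewrite /fubini_F (_ : integral _ _ _ = integral m2 setT (fun y => g (x, y)))// gE1 patchE.
by case: ifPn => _; [rewrite -integral_mkcond|rewrite integral0].
Qed.

Let FE2 : fubini_G m1 g = (fun y => \int[m1]_(x in D1) (f (x, y))%:E)%E \_ D2.
Proof.
apply/funext => y; rewrite /fubini_G (_ : integral _ _ _ = integral m1 setT (fun x => g (x, y)))// gE2 patchE.
by case: ifPn => _; [rewrite -integral_mkcond|rewrite integral0].
Qed.

Let Fi1 : m1.-integrable D1 (fun x => \int[m2]_(y in D2) (f (x, y))%:E)%E.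
Proof. by apply/(integrable_mkcond _ _).2 => //; rewrite -FE1; exact: integrable_fubini_F gi. Qed.

Let G_integrable : m2.-integrable setT (fubini_G m1 g).
Proof.
apply/integrableP; split; first exact: measurable_fubini_G gi.
have mg := measurable_int _ gi.
apply: le_lt_trans ((integrable21ltyP m1 m2 mg).1 gi).
apply: ge0_le_integral => //.
- by apply: measurableT_comp => //; exact: measurable_fubini_G gi.
- apply: (measurable_fun_fubini_tonelli_G (abse \o g)) => //=.
  exact: measurableT_comp.
- move=> y _; apply: le_abse_integral => //.
  by apply: measurableT_comp mg _; exact: measurable_pair2.
Qed.

Let Fi2 : m2.-integrable D2 (fun y => \int[m1]_(x in D1) (f (x, y))%:E)%E.
Proof. by apply/(integrable_mkcond _ _).2 => //; rewrite -FE2; exact: G_integrable. Qed.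

(** The real-valued inner integral is 0 wherever the extended one is infinite, so the latter
    dominates it. *)
Lemma integrable_slice1 : m1.-integrable D1 (fun x => (\int[m2]_(y in D2) f (x, y))%:E).
Proof.
apply: le_integrable Fi1 => //.
  by apply/measurable_EFinP/measurableT_comp; [exact: fine_measurable|exact: measurable_int Fi1].
by move=> x _; rewrite /Rintegral; case: (integral _ _ _) => [r||] //=; rewrite normr0 leey.
Qed.

Lemma integrable_slice2 : m2.-integrable D2 (fun y => (\int[m1]_(x in D1) f (x, y))%:E).
Proof.
apply: le_integrable Fi2 => //.
  by apply/measurable_EFinP/measurableT_comp; [exact: fine_measurable|exact: measurable_int Fi2].
by move=> x _; rewrite /Rintegral; case: (integral _ _ _) => [r||] //=; rewrite normr0 leey.
Qed.

Lemma Rintegral_slice1 : \int[(m1 \x m2)%E]_(z in D1 `*` D2) f z =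
  \int[m1]_(x in D1) \int[m2]_(y in D2) f (x, y).
Proof.
rewrite {1 2}/Rintegral; congr fine; rewrite [LHS]integral_mkcond.
rewrite -[LHS](integral12_prod_meas1 gi) FE1 -integral_mkcond.
apply: ae_eq_integral => //; first exact: measurable_int Fi1.
  exact: measurable_int integrable_slice1.
apply: filterS ae_integrable_slice1 => x h Dx.
by rewrite /Rintegral fineK//; exact: integrable_fin_num (h Dx).
Qed.

Lemma Rintegral_slice2 : \int[(m1 \x m2)%E]_(z in D1 `*` D2) f z =
  \int[m2]_(y in D2) \int[m1]_(x in D1) f (x, y).
Proof.
rewrite {1 2}/Rintegral; congr fine; rewrite [LHS]integral_mkcond.
rewrite -[LHS](integral21_prod_meas1 gi) FE2 -integral_mkcond.
apply: ae_eq_integral => //; first exact: measurable_int Fi2.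
  exact: measurable_int integrable_slice2.
apply: filterS ae_integrable_slice2 => x h Dx.
by rewrite /Rintegral fineK//; exact: integrable_fin_num (h Dx).
Qed.

End real.

Section cplx.
Variables (f : T1 * T2 -> R[i]) (fi : cintegrable (m1 \x m2)%E (D1 `*` D2) f).

Let fR := fi.1. Let fI := fi.2.

Lemma ae_cintegrable_slice1 : {ae m1, forall x, D1 x -> cintegrable m2 D2 (fun y => f (x, y))}.
Proof.
by apply: filterS2 (ae_integrable_slice1 fR) (ae_integrable_slice1 fI) => x h k Dx; split; [exact: h|exact: k].
Qed.

Lemma cintegrable_slice1 : cintegrable m1 D1 (fun x => cintegral m2 D2 (fun y => f (x, y))).
Proof. by split; [exact: (integrable_slice1 fR)|exact: (integrable_slice1 fI)]. Qed.

Lemma cintegral_slice1 : cintegral (m1 \x m2)%E (D1 `*` D2) f =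
  cintegral m1 D1 (fun x => cintegral m2 D2 (fun y => f (x, y))).
Proof. by apply: complexE2; [exact: (Rintegral_slice1 fR)|exact: (Rintegral_slice1 fI)]. Qed.

Lemma cintegral_slice2 : cintegral (m1 \x m2)%E (D1 `*` D2) f =
  cintegral m2 D2 (fun y => cintegral m1 D1 (fun x => f (x, y))).
Proof. by apply: complexE2; [exact: (Rintegral_slice2 fR)|exact: (Rintegral_slice2 fI)]. Qed.

End cplx.
End fubini_domains.

Section cylindrical_coordinates.
Context {R : realType}.
Local Notation leb := (@lebesgue_measure R).
Local Notation Rm := (measurableTypeR R).

Definition angles : set Rm := `]- pi, pi]%classic.

(** The angle is kept apart from the meridian point so that Fubini's theorem separates [Omega] from
    the circle. *)
Definition cyl (w : plane R * Rm) : espace R := cartesian w.1.1 w.2 w.1.2.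

Lemma sigma_finite_leb2 : sigma_finite setT (leb2 R : set (plane R) -> \bar R).
Proof.
have /sigma_finiteP[F [TF ndF Foo]] := sigma_finiteT (@lebesgue_measure R).
exists (fun n => F n `*` F n).
  apply/seteqP; split=> // -[x y] _.
  have [n _ Fx] : (\bigcup_i F i) x by rewrite -TF.
  have [k _ Fy] : (\bigcup_i F i) y by rewrite -TF.
  exists (maxn n k) => //; split=> /=.
    by move: x Fx; exact/subsetPset/ndF/leq_maxl.
  by move: y Fy; exact/subsetPset/ndF/leq_maxr.
move=> k; have [mF Fk] := Foo k.
split; first exact: measurableX.
rewrite [ltLHS](_ : _ = (lebesgue_measure (F k) * lebesgue_measure (F k))%E).
  by rewrite lte_mul_pinfty// ge0_fin_numE.
exact: product_measure1E.
Qed.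

(* A copy of [leb2] carrying the sigma-finite structure that Fubini's theorem requires. *)
Definition leb2_fun : set (plane R) -> \bar R := leb2 R.
HB.instance Definition _ := Measure.copy leb2_fun (leb2 R).
HB.instance Definition _ := @Measure_isSigmaFinite.Build _ _ _ leb2_fun sigma_finite_leb2.
Definition sleb2 : {sigma_finite_measure set (plane R) -> \bar R} := leb2_fun.

Lemma measurable_angles : measurable angles.
Proof. exact: measurable_itv. Qed.

Definition radius (q : espace R) : R := Num.sqrt (q.1.1 ^+ 2 + q.1.2 ^+ 2).

Lemma radius_cartesian r t z : 0 <= r -> radius (cartesian r t z) = r.
Proof.
move=> r0; rewrite /radius /= !exprMn -mulrDr cos2Dsin2 mulr1 sqrtr_sqr.
by rewrite ger0_norm.
Qed.

(** The angle is [acos (x / r)] with the sign of [y], and 0 on the axis. *)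
Lemma cartesian_surj (q : espace R) : exists2 t, angles t & q = cartesian (radius q) t q.2.
Proof.
case: q => [[x y] z]; set r := radius _.
have r0 : 0 <= r by exact: sqrtr_ge0.
have r2 : r ^+ 2 = x ^+ 2 + y ^+ 2 by rewrite sqr_sqrtr// addr_ge0// sqr_ge0.
have pi0 := pi_gt0 R.
have [r00|rn0] := eqVneq r 0.
  exists 0; first by rewrite /angles /= in_itv /=; lra.
  have /eqP : x ^+ 2 + y ^+ 2 = 0 by rewrite -r2 r00 expr0n.
  rewrite paddr_eq0 ?sqr_ge0// !sqrf_eq0 => /andP[/eqP-> /eqP->].
  by rewrite r00 /cartesian !mul0r.
have rp : 0 < r by rewrite lt_neqAle eq_sym rn0.
have xr1 : -1 <= x / r <= 1.
  by rewrite ler_pdivlMr// ler_pdivrMr//; apply/andP; split; nra.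
have s2 : (r * sin (acos (x / r))) ^+ 2 = y ^+ 2.
  rewrite sin_acos// exprMn [X in _ * X]sqr_sqrtr; last first.
    by move: xr1; set u := x / r => ?; nra.
  rewrite r2 /= -r2.
  have xx : x / r * r = x by rewrite divfK.
  by transitivity (r ^+ 2 - (x / r * r) ^+ 2); [ring|rewrite xx r2; ring].
have sg : 0 <= sin (acos (x / r)).
  by rewrite sin_acos// sqrtr_ge0.
have xE : x = r * cos (acos (x / r)) by rewrite acosK// mulrC divfK.
have a0 : 0 <= acos (x / r) by exact: acos_ge0.
have api : acos (x / r) <= pi by exact: acos_lepi.
have [y0|y0] := leP 0 y.
  exists (acos (x / r)); first by rewrite /angles /= in_itv /=; lra.
  rewrite /cartesian -xE /=; congr (_, _, _).
  by apply/eqP; rewrite -(eqrXn2 (n := 2)) ?s2// mulr_ge0.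
have yE : y = r * sin (- acos (x / r)).
  rewrite sinN mulrN -[LHS]opprK; congr (- _).
  by apply/eqP; rewrite -(eqrXn2 (n := 2)) ?s2 ?sqrrN// ?oppr_ge0 ?mulr_ge0// ltW.
exists (- acos (x / r)); last by rewrite /cartesian cosN -xE -yE.
(* The excluded endpoint [- pi] would force [y = 0]. *)
rewrite /angles /= in_itv /=; apply/andP; split; last lra.
rewrite ltrN2 lt_neqAle api andbT; apply/eqP => apiE.
by move: yE y0; rewrite apiE sinN sinpi oppr0 mulr0 => ->; rewrite ltxx.
Qed.

Lemma measurable_cyl : measurable_fun setT cyl.
Proof.
have mcos : measurable_fun setT (@cos R : Rm -> Rm).
  by apply: continuous_measurable_fun; exact: continuous_cos.
have msin : measurable_fun setT (@sin R : Rm -> Rm).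
  by apply: continuous_measurable_fun; exact: continuous_sin.
have m1 : measurable_fun setT (fun w : plane R * Rm => w.1.1 : Rm).
  by apply: (measurableT_comp (f := fst)); [exact: measurable_fst|exact: measurable_fst].
have m2 : measurable_fun setT (fun w : plane R * Rm => w.1.2 : Rm).
  by apply: (measurableT_comp (f := snd)); [exact: measurable_snd|exact: measurable_fst].
apply/measurable_fun_pair => //=; apply/measurable_fun_pair => /=.
  by apply: measurable_funM => //; exact: measurableT_comp mcos measurable_snd.
by apply: measurable_funM => //; exact: measurableT_comp msin measurable_snd.
Qed.

Lemma measurable_half_plane : measurable [set p : plane R | 0 < p.1].
Proof.
have -> : [set p : plane R | 0 < p.1] = `]0, +oo[%classic `*` [set: Rm].
  by apply/seteqP; split=> p /=; rewrite /setX /= in_itv /= andbT => // -[].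
by apply: measurableX => //; exact: measurable_itv.
Qed.

Local Open Scope ereal_scope.

(** Integration in [z] is kept outermost while polar coordinates act on [(x, y)]; Tonelli's theorem
    then reassembles the meridian point [(r, z)]. *)
Lemma ge0_integral_cyl_space (f : espace R -> \bar R) : measurable_fun setT f -> (forall x, 0 <= f x) ->
  \int[leb3 R]_x f x =
  \int[sleb2 \x leb]_(w in [set p : plane R | (0 < p.1)%R] `*` angles) (f (cyl w) * (w.1.1)%:E).
Proof.
move=> mf f0.
have mJ := measurable_angles.
pose P : set Rm := `]0%R, +oo[%classic.
have mP : measurable (P : set Rm) by exact: measurable_itv.
have P0 x : P x -> (0 < x)%R by rewrite /P /= in_itv /= andbT.
have PE : [set p : plane R | (0 < p.1)%R] = P `*` [set: Rm].
  by apply/seteqP; split=> p /=; rewrite /P /setX /= in_itv /= andbT => // -[].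
have mPT : measurable (P `*` [set: Rm]) by exact: measurableX.
have -> : \int[leb3 R]_x f x = \int[leb]_z \int[sleb2]_x f (x, z).
  rewrite (@fubini_tonelli1 _ _ _ _ _ sleb2 leb f mf f0).
  exact: (@fubini_tonelli _ _ _ _ _ sleb2 leb f mf f0).
under eq_integral => z _.
  rewrite (@integral_polar _ (fun x => f (x, z))); last 2 first.
  - by apply: measurableT_comp mf _; exact: measurable_pair2.
  - by move=> x; exact: f0.
  over.
pose F (w : plane R * Rm) := f (cyl w) * (w.1.1)%:E.
have mF : measurable_fun setT F.
  apply: emeasurable_funM; first exact: measurableT_comp mf measurable_cyl.
  apply/measurable_EFinP; apply: (measurableT_comp (f := fst)); [exact: measurable_fst|exact: measurable_fst].
have F0 p t : (P `*` [set: Rm]) p -> angles t -> 0 <= F (p, t).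
  by move=> [/P0 p0 _] _; rewrite mule_ge0 ?f0// lee_fin ltW.
rewrite PE (@tonelli_dom1 _ _ _ _ _ sleb2 leb _ angles mPT mJ F (measurable_funTS mF) F0).
pose G (p : plane R) := \int[leb]_(t in angles) F (p, t).
have mG : measurable_fun (P `*` [set: Rm]) G.
  exact: (@measurable_tonelli_dom1 _ _ _ _ _ leb _ angles mPT mJ F (measurable_funTS mF) F0).
have G0 r z : P r -> [set: Rm] z -> 0 <= G (r, z).
  by move=> Pr _; apply: integral_ge0 => t Jt; exact: F0.
transitivity (\int[leb]_z \int[leb]_(r in P) G (r, z)); first by [].
rewrite -(@tonelli_dom _ _ _ _ _ leb leb P setT mP measurableT G mG G0).
by rewrite -(@tonelli_dom1 _ _ _ _ _ leb leb P setT mP measurableT G mG G0).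
Qed.

End cylindrical_coordinates.

Section revolved_domain.
Context {R : realType}.
Local Notation leb := (@lebesgue_measure R).
Local Notation Rm := (measurableTypeR R).
Local Notation J := (@angles R).
Variables (Omega : set (plane R)) (Obreve : set (espace R)).

(* Unlike [revolve], this leaves the null set [radius q = 0] unconstrained. *)
Definition revolved := [/\ open Omega, open Obreve, forall p, Omega p -> 0 < p.1
  & forall q : espace R, 0 < radius q -> (Obreve q <-> Omega (radius q, q.2))].

Hypothesis rev : revolved.

Lemma revolved_measurable_plane : measurable Omega.
Proof. by case: rev => o _ _ _; exact: open_measurable_plane. Qed.
Lemma revolved_measurable_espace : measurable Obreve.
Proof. by case: rev => _ o _ _; exact: open_measurable_espace. Qed.

Lemma measurable_revolvedX : measurable (Omega `*` J).
Proof. by apply: measurableX; [exact: revolved_measurable_plane|exact: measurable_angles]. Qed.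


Lemma revolved_pos p : Omega p -> 0 < p.1.
Proof. by case: rev => _ _ + _; apply. Qed.

Lemma revolved_cartesian r t z : 0 < r -> Obreve (cartesian r t z) <-> Omega (r, z).
Proof.
case: rev => _ _ _ h r0.
have rr : radius (cartesian r t z) = r by rewrite radius_cartesian// ltW.
by have := h (cartesian r t z); rewrite rr => /(_ r0).
Qed.

Lemma revolved_cyl w : (Omega `*` J) w -> Obreve (cyl w).
Proof.
case=> O1 _; apply/revolved_cartesian; first exact: revolved_pos O1.
by rewrite -surjective_pairing.
Qed.

Lemma measurable_cyl_comp d (T : measurableType d) (f : espace R -> T) : measurable_fun Obreve f ->
  measurable_fun (Omega `*` J) (f \o cyl).
Proof.
move=> mf; apply: (measurable_comp revolved_measurable_espace) mf _.
  by move=> _ [w /revolved_cyl + <-].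
by apply: measurable_funTS; exact: measurable_cyl.
Qed.

Lemma cmeasurable_cyl (f : espace R -> R[i]) : cmeasurable Obreve f -> cmeasurable (Omega `*` J) (f \o cyl).
Proof. by move=> [fR fI]; split; [exact: measurable_cyl_comp fR|exact: measurable_cyl_comp fI]. Qed.

Lemma measurable_fst1 (D : set (plane R * Rm)) : measurable_fun D (fun w => w.1.1 : R).
Proof.
apply: measurable_funTS; apply: (measurableT_comp (f := fst)); [exact: measurable_fst|exact: measurable_fst].
Qed.

Lemma ge0_integral_cyl (f : espace R -> \bar R) : measurable_fun Obreve f ->
  (forall x, Obreve x -> 0 <= f x)%E ->
  (\int[leb3 R]_(x in Obreve) f x =
   \int[(sleb2 \x leb)%E]_(w in Omega `*` J) (f (cyl w) * (w.1.1)%:E))%E.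
Proof.
move=> mf f0.
have mP : measurable [set p : plane R | 0 < p.1] by exact: measurable_half_plane.
rewrite integral_mkcond.
rewrite ge0_integral_cyl_space; last 2 first.
- by apply/(measurable_restrictT _ _).1 => //; exact: revolved_measurable_espace.
- by move=> x; rewrite patchE; case: ifPn => // /[!inE]; exact: f0.
rewrite [LHS]integral_mkcond [RHS]integral_mkcond; apply: eq_integral => -[p t] _.
rewrite !patchE !in_setX /=.
case: (boolP (t \in angles)) => Jt; rewrite ?andbF// !andbT.
case: ifPn => [/[!inE] p0|p0].
  have -> : (cyl (p, t) \in Obreve) = (p \in Omega).
    apply/idP/idP; rewrite !inE => h.
      by have := (revolved_cartesian t p.2 p0).1 h; rewrite -surjective_pairing.
    by apply/revolved_cartesian => //; rewrite -surjective_pairing.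
  by case: ifPn => //; rewrite mul0e.
case: ifPn => // /[!inE] /revolved_pos h.
by move: p0; rewrite notin_setE /= h.
Qed.

(** The Jacobian [r] is positive on [Omega], hence commutes with positive and negative parts. *)
Lemma integral_cyl (f : espace R -> \bar R) : measurable_fun Obreve f ->
  (\int[leb3 R]_(x in Obreve) f x =
   \int[(sleb2 \x leb)%E]_(w in Omega `*` J) (f (cyl w) * (w.1.1)%:E))%E.
Proof.
move=> mf.
have e1 := @integralE _ _ _ (leb3 R) Obreve f.
have e2 := @integralE _ _ _ (sleb2 \x leb)%E (Omega `*` J) (fun w => (f (cyl w) * (w.1.1)%:E)%E).
apply: (etrans e1); apply: (etrans _ (esym e2)); apply: (f_equal2 (fun x y : \bar R => x - y)%E).
  rewrite ge0_integral_cyl//; last exact: measurable_funepos.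
  apply: eq_integral => w /[!inE] -[/revolved_pos w0 _].
  rewrite muleC (congr1 (fun F : espace R -> \bar R => F (cyl w)) (esym (ge0_funeposM f (ltW w0)))).
  by rewrite !funeposE muleC.
rewrite ge0_integral_cyl//; last exact: measurable_funeneg.
apply: eq_integral => w /[!inE] -[/revolved_pos w0 _].
rewrite muleC (congr1 (fun F : espace R -> \bar R => F (cyl w)) (esym (ge0_funenegM f (ltW w0)))).
by rewrite !funenegE muleC.
Qed.

Lemma integrable_cyl (f : espace R -> R) : measurable_fun Obreve f ->
  (leb3 R).-integrable Obreve (EFin \o f) <->
  (sleb2 \x leb)%E.-integrable (Omega `*` J) (EFin \o (fun w => f (cyl w) * w.1.1)).
Proof.
move=> mf.
have E : (\int[leb3 R]_(x in Obreve) `|(f x)%:E| =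
   \int[(sleb2 \x leb)%E]_(w in Omega `*` J) `|(f (cyl w) * w.1.1)%:E|)%E.
  rewrite ge0_integral_cyl//; last first.
    by apply: measurableT_comp => //; exact/measurable_EFinP.
  apply: eq_integral => w /[!inE] -[/revolved_pos w0 _].
  by rewrite EFinM abseM/= [`|w.1.1|]gtr0_norm.
split=> /integrableP[_ h]; apply/integrableP; split; first 1 last.
- by move: h; rewrite /comp /= E.
- exact/measurable_EFinP.
- by move: h; rewrite /comp /= -E.
  apply/measurable_EFinP/measurable_funM; last exact: measurable_fst1.
  exact: measurable_cyl_comp mf.
Qed.

Lemma Rintegral_cyl (f : espace R -> R) : measurable_fun Obreve f ->
  \int[leb3 R]_(x in Obreve) f x = \int[(sleb2 \x leb)%E]_(w in Omega `*` J) (f (cyl w) * w.1.1).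
Proof. by move=> mf; rewrite /Rintegral integral_cyl//; exact/measurable_EFinP. Qed.

Lemma cintegrable_cyl f : cmeasurable Obreve f ->
  cintegrable (leb3 R) Obreve f <->
  cintegrable (sleb2 \x leb)%E (Omega `*` J) (fun w => f (cyl w) * (w.1.1)%:C).
Proof.
move=> [fR fI]; rewrite /cintegrable.
have -> : (fun w => (complex.Re (f (cyl w) * (w.1.1)%:C))%:E) = EFin \o (fun w => complex.Re (f (cyl w)) * w.1.1).
  by apply/funext => w /=; rewrite ReM /= mulr0 subr0.
have -> : (fun w => (complex.Im (f (cyl w) * (w.1.1)%:C))%:E) = EFin \o (fun w => complex.Im (f (cyl w)) * w.1.1).
  by apply/funext => w /=; rewrite ImM /= mulr0 add0r.
split=> -[h k]; split.
- exact: (integrable_cyl fR).1 h.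
- exact: (integrable_cyl fI).1 k.
- exact: (integrable_cyl fR).2 h.
- exact: (integrable_cyl fI).2 k.
Qed.

Lemma cintegral_cyl f : cmeasurable Obreve f ->
  cintegral (leb3 R) Obreve f =
  cintegral (sleb2 \x leb)%E (Omega `*` J) (fun w => f (cyl w) * (w.1.1)%:C).
Proof.
move=> [fR fI]; apply: complexE2 => /=; rewrite Rintegral_cyl//.
  by under [RHS]eq_Rintegral do rewrite ReM /= mulr0 subr0.
by under [RHS]eq_Rintegral do rewrite ImM /= mulr0 add0r.
Qed.

Lemma L2_integral_cyl (f : espace R -> R[i]) : cmeasurable Obreve f ->
  (L2_integral (leb3 R) Obreve (fun=> (1 : R)%R) f =
   \int[sleb2]_(p in Omega) (\int[leb]_(t in angles) (Normc.normc (f (cyl (p, t))) ^+ 2)%:E * (p.1)%:E))%E.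
Proof.
move=> mf; rewrite /L2_integral ge0_integral_cyl; last 2 first.
- by apply/measurable_EFinP; apply: measurable_funM => //; exact: measurable_sqr_normc.
- by move=> x _; rewrite mulr1 lee_fin sqr_ge0.
have mfc : measurable_fun (Omega `*` J) (fun w => Normc.normc (f (cyl w)) ^+ 2).
  exact/measurable_sqr_normc/cmeasurable_cyl.
rewrite tonelli_dom1//.
- apply: eq_integral => p /[!inE] Op /=; have p0 := revolved_pos Op.
  rewrite muleC -ge0_integralZl//; last first.
  + by rewrite lee_fin ltW.
  + by move=> t _; rewrite lee_fin sqr_ge0.
  + apply/measurable_EFinP.
    exact: (measurable_slice1 revolved_measurable_plane measurable_angles mfc Op).
  + exact: measurable_angles.
  by apply: eq_integral => t _; rewrite mulr1 muleC.
- exact: revolved_measurable_plane.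
- exact: measurable_angles.
- apply: (@emeasurable_funM _ _ _ _ (fun w => (Normc.normc (f (cyl w)) ^+ 2 * 1)%:E) (fun w => (w.1.1)%:E)).
    by apply/measurable_EFinP; exact: measurable_funM.
  by apply/measurable_EFinP; exact: measurable_fst1.
- move=> p t /revolved_pos p0 _; rewrite mule_ge0// lee_fin ?(ltW p0)//.
  by rewrite mulr1 sqr_ge0.
Qed.

End revolved_domain.

(** * Weak derivatives *)

Section weak_derivatives.
Context {R : realType} {d : measure_display} {T : measurableNormedModType R d}.
Variables (mu : {measure set T -> \bar R}) (D : set T).
Hypothesis open_measurableT : forall U : set T, open U -> measurable U.
Hypothesis oD : open D.
Implicit Types (v g u h : T -> R[i]) (e : T) (phi : T -> R).

Let mD : measurable D. Proof. exact: open_measurableT. Qed.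

Let mcompact (K : set T) : compact K -> measurable K.
Proof.
move=> cK; apply: closed_measurableT => //; exact: compact_closed.
Qed.

Lemma clocally_integrable_Re v : clocally_integrable mu D v ->
  forall K : set T, compact K -> K `<=` D -> (\int[mu]_(x in K) `|complex.Re (v x)|%:E < +oo)%E.
Proof.
move=> [mv lv] K cK KD; apply: le_lt_trans (lv K cK KD).
have mvK := cmeasurableS mD KD mv.
apply: ge0_le_integral => //.
- exact: mcompact.
- by apply/measurable_EFinP; apply: measurableT_comp => //; case: mvK.
- by apply/measurable_EFinP; exact: measurable_normc.
- by move=> x _; rewrite lee_fin; exact: normr_Re_le.
Qed.

Lemma clocally_integrable_Im v : clocally_integrable mu D v ->
  forall K : set T, compact K -> K `<=` D -> (\int[mu]_(x in K) `|complex.Im (v x)|%:E < +oo)%E.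
Proof.
move=> [mv lv] K cK KD; apply: le_lt_trans (lv K cK KD).
have mvK := cmeasurableS mD KD mv.
apply: ge0_le_integral => //.
- exact: mcompact.
- by apply/measurable_EFinP; apply: measurableT_comp => //; case: mvK.
- by apply/measurable_EFinP; exact: measurable_normc.
- by move=> x _; rewrite lee_fin; exact: normr_Im_le.
Qed.

Lemma cintegrable_test v phi : clocally_integrable mu D v -> test_function D phi ->
  cintegrable mu D (fun x => v x * (phi x)%:C).
Proof.
move=> lv tp; have [mR mI] := lv.1.
have hR := @locally_integrable_test _ _ _ mu D open_measurableT oD _ _ mR (clocally_integrable_Re lv) tp.
have hI := @locally_integrable_test _ _ _ mu D open_measurableT oD _ _ mI (clocally_integrable_Im lv) tp.
split; [move: hR|move: hI]; apply: eq_integrable => // x _ /=.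
  by rewrite ReM /= mulr0 subr0.
by rewrite ImM /= mulr0 add0r.
Qed.

Lemma clocally_integrableD v u : clocally_integrable mu D v -> clocally_integrable mu D u ->
  clocally_integrable mu D (fun x => v x + u x).
Proof.
move=> [mv lv] [mu' lu]; split; first exact: cmeasurableD.
move=> K cK KD; have mK := mcompact cK.
have mvK := cmeasurableS mD KD mv; have muK := cmeasurableS mD KD mu'.
have [_] := (cintegrableP mu mK _).1 (cintegrableD mK
  ((cintegrableP mu mK v).2 (conj mvK (lv K cK KD))) ((cintegrableP mu mK u).2 (conj muK (lu K cK KD)))).
by [].
Qed.

Lemma clocally_integrableZ (a : R[i]) v : clocally_integrable mu D v ->
  clocally_integrable mu D (fun x => a * v x).
Proof.
move=> [mv lv]; split; first exact: cmeasurableZ.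
move=> K cK KD; have mK := mcompact cK; have mvK := cmeasurableS mD KD mv.
have [_] := (cintegrableP mu mK _).1 (cintegrableZ mK a ((cintegrableP mu mK v).2 (conj mvK (lv K cK KD)))).
by [].
Qed.

Lemma ae_eq_clocally_integrable v u : cmeasurable D u -> v = u %[ae mu in D] ->
  clocally_integrable mu D v -> clocally_integrable mu D u.
Proof.
move=> mu' vu [mv lv]; split=> // K cK KD; apply: le_lt_trans (lv K cK KD).
have mK := mcompact cK.
rewrite le_eqVlt; apply/orP; left; apply/eqP; apply: ge0_ae_eq_integral => //.
- by apply/measurable_EFinP/measurable_normc; exact: cmeasurableS mu'.
- by apply/measurable_EFinP/measurable_normc; exact: cmeasurableS mv.
- by move=> x _; rewrite lee_fin normc_ge0.
- by move=> x _; rewrite lee_fin normc_ge0.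
- by move: vu; apply: filterS => x + Kx => /(_ (KD _ Kx)) ->.
Qed.

Lemma weak_derivative_linear e (a : R[i]) v g u h :
  weak_derivative mu D e v g -> weak_derivative mu D e u h ->
  weak_derivative mu D e (fun x => a * v x + u x) (fun x => a * g x + h x).
Proof.
move=> [lv lg vg] [lu lh uh]; split.
- by apply: clocally_integrableD => //; exact: clocally_integrableZ.
- by apply: clocally_integrableD => //; exact: clocally_integrableZ.
move=> phi tp; have tdp := test_function_derive e tp.
have E (f k : T -> R[i]) psi : clocally_integrable mu D f -> clocally_integrable mu D k -> test_function D psi ->
    cintegral mu D (fun x => (a * f x + k x) * (psi x)%:C) =
    a * cintegral mu D (fun x => f x * (psi x)%:C) + cintegral mu D (fun x => k x * (psi x)%:C).
  move=> lf lk tpsi; have cf := cintegrable_test lf tpsi; have ck := cintegrable_test lk tpsi.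
  transitivity (cintegral mu D (fun x => a * (f x * (psi x)%:C) + k x * (psi x)%:C)).
    by apply: eq_cintegral => x _; rewrite mulrDl mulrA.
  by rewrite (cintegralD mD (cintegrableZ mD a cf) ck) (cintegralZ mD a cf).
by rewrite !E// vg// uh// mulrN opprD.
Qed.

Lemma weak_derivative0 e : weak_derivative mu D e (fun=> 0) (fun=> 0).
Proof.
have l0 : clocally_integrable mu D (fun=> 0).
  split; first exact: cmeasurable_cst.
  by move=> K _ _; rewrite Normc.normc0 integral0.
split=> // phi _; under eq_cintegral do rewrite mul0r.
rewrite cintegral0; under eq_cintegral do rewrite mul0r.
by rewrite cintegral0 oppr0.
Qed.

Lemma ae_eq_weak_derivative e v g v' g' : cmeasurable D v' -> cmeasurable D g' ->
  v = v' %[ae mu in D] -> g = g' %[ae mu in D] ->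
  weak_derivative mu D e v g -> weak_derivative mu D e v' g'.
Proof.
move=> mv' mg' vv gg [lv lg vg].
have lv' := ae_eq_clocally_integrable mv' vv lv; have lg' := ae_eq_clocally_integrable mg' gg lg.
split=> // phi tp; have tdp := test_function_derive e tp.
have E (f k : T -> R[i]) psi : clocally_integrable mu D f -> clocally_integrable mu D k -> test_function D psi ->
    f = k %[ae mu in D] ->
    cintegral mu D (fun x => f x * (psi x)%:C) = cintegral mu D (fun x => k x * (psi x)%:C).
  move=> lf lk tpsi fk; apply: ae_eq_cintegral => //.
  - exact/cintegrable_cmeasurable/cintegrable_test.
  - exact/cintegrable_cmeasurable/cintegrable_test.
  - by move: fk; apply: filterS => x + Dx => /(_ Dx) ->.
by rewrite -(E v v')// -(E g g')//; exact: vg.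
Qed.

Hypothesis FL : fundamental_lemma mu D.

Lemma fundamental_lemma_complex g : clocally_integrable mu D g ->
  (forall phi, test_function D phi -> cintegral mu D (fun x => g x * (phi x)%:C) = 0) ->
  g = (fun=> 0) %[ae mu in D].
Proof.
move=> lg g0; have [mR mI] := lg.1.
have aR : ae_eq mu D (fun x => complex.Re (g x)) (cst 0).
  apply: FL => //; first exact: clocally_integrable_Re.
  move=> p tp; have /(congr1 (@complex.Re R)) /= := g0 p tp.
  rewrite /Rintegral => E; rewrite -[LHS]fineK.
    rewrite -[RHS]/(0%:E) -E; congr (fine _)%:E.
    by apply: eq_integral => x _; rewrite ReM /= mulr0 subr0.
  apply: integrable_fin_num => //.
  exact: (@locally_integrable_test _ _ _ mu D open_measurableT oD _ _ mR (clocally_integrable_Re lg) tp).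
have aI : ae_eq mu D (fun x => complex.Im (g x)) (cst 0).
  apply: FL => //; first exact: clocally_integrable_Im.
  move=> p tp; have /(congr1 (@complex.Im R)) /= := g0 p tp.
  rewrite /Rintegral => E; rewrite -[LHS]fineK.
    rewrite -[RHS]/(0%:E) -E; congr (fine _)%:E.
    by apply: eq_integral => x _; rewrite ImM /= mulr0 add0r.
  apply: integrable_fin_num => //.
  exact: (@locally_integrable_test _ _ _ mu D open_measurableT oD _ _ mI (clocally_integrable_Im lg) tp).
by apply: filterS2 aR aI => x h k Dx; apply: complexE2; [exact: h|exact: k].
Qed.

Lemma weak_derivative_unique e v g v' g' :
  weak_derivative mu D e v g -> weak_derivative mu D e v' g' ->
  v = v' %[ae mu in D] -> g = g' %[ae mu in D].
Proof.
move=> vg vg' vv.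
have [lv lg wg] := vg; have [lv' lg' wg'] := vg'.
have [_ l0 w0] := weak_derivative_linear (-1) vg' vg.
have z : (fun x => -1 * g' x + g x) = (fun=> 0) %[ae mu in D].
  apply: fundamental_lemma_complex => // phi tp.
  apply/eqP; rewrite -oppr_eq0 -w0//; apply/eqP.
  rewrite -[RHS](cintegral0 mu D); apply: ae_eq_cintegral.
  - exact: mD.
  - apply/cintegrable_cmeasurable/cintegrable_test; last exact: test_function_derive.
    by apply: clocally_integrableD => //; exact: clocally_integrableZ.
  - exact: cmeasurable_cst.
  - by move: vv; apply: filterS => x + Dx => /(_ Dx) ->; rewrite mulN1r addNr mul0r.
by move: z; apply: filterS => x + Dx => /(_ Dx) /eqP; rewrite mulN1r addrC subr_eq0 => /eqP.
Qed.

Lemma wderiveP e v g : weak_derivative mu D e v g ->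
  weak_derivative mu D e v (wderive mu D e v) /\ wderive mu D e v = g %[ae mu in D].
Proof.
move=> vg; have w : weak_derivative mu D e v (wderive mu D e v).
  by rewrite /wderive; apply: xgetPex; exists g.
by split=> //; apply: weak_derivative_unique w vg _; exact: ae_eq_refl.
Qed.

(** Both sides of the defining identity are continuous for L^1 convergence on compact sets, because
    a test function and its derivative are bounded with compact support. *)
Lemma weak_derivative_cvg e v g (v_ g_ : nat -> T -> R[i]) :
  clocally_integrable mu D v -> clocally_integrable mu D g ->
  (forall n, weak_derivative mu D e (v_ n) (g_ n)) ->
  (forall K : set T, compact K -> K `<=` D -> forall eps : R, 0 < eps -> exists n,
    (\int[mu]_(x in K) (Normc.normc (v x - v_ n x))%:E <= eps%:E)%E /\
    (\int[mu]_(x in K) (Normc.normc (g x - g_ n x))%:E <= eps%:E)%E) ->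
  weak_derivative mu D e v g.
Proof.
move=> lv lg w cv; split=> // phi tp; have tdp := test_function_derive e tp.
apply/eqP; rewrite -addr_eq0 -sqr_normc_eq0 sqrf_eq0.
have [M M0 HM] := test_function_bounded tp; have [M' M0' HM'] := test_function_bounded tdp.
have [_ cK KD] := tp; pose K := support_closure phi; have [_ cK' KD'] := tdp.
pose K' := support_closure (fun x => 'D_e phi x).
have cU : compact (K `|` K') by exact: compactU.
have UD : K `|` K' `<=` D by move=> x [/KD|/KD'].
have mU := mcompact cU.
have B (f k : T -> R[i]) psi (C eps : R) : clocally_integrable mu D f -> clocally_integrable mu D k ->
    test_function D psi -> 0 < C -> (forall x, `|psi x| <= C) -> support_closure psi `<=` K `|` K' ->
    (\int[mu]_(x in K `|` K') (Normc.normc (f x - k x))%:E <= eps%:E)%E ->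
    Normc.normc (cintegral mu D (fun x => f x * (psi x)%:C) - cintegral mu D (fun x => k x * (psi x)%:C)) <= 2 * (C * eps).
  move=> lf lk tpsi C0 HC sub le.
  rewrite -(cintegralB mD (cintegrable_test lf tpsi) (cintegrable_test lk tpsi)).
  have ld : clocally_integrable mu D (fun x => f x - k x).
    by have := clocally_integrableD lf (clocally_integrableZ (-1) lk); under eq_fun do rewrite mulN1r.
  rewrite (@eq_cintegral _ _ _ _ _ _ (fun x => (f x - k x) * (psi x)%:C)); last first.
    by move=> x _; rewrite mulrBl.
  have ci := cintegrable_test ld tpsi.
  apply: le_trans (normc_cintegral_le mD ci) _; rewrite ler_pM2l//.
  have fi := cintegrable_normc mD ci.
  rewrite -lee_fin /Rintegral fineK ?integrable_fin_num//.
  apply: (@le_trans _ _ (C%:E * \int[mu]_(x in K `|` K') (Normc.normc (f x - k x))%:E)%E); last first.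
    by rewrite EFinM lee_wpmul2l// lee_fin ltW.
  have mUn : measurable_fun (K `|` K') (fun x => (Normc.normc (f x - k x))%:E).
    by apply/measurable_EFinP/measurable_normc; exact: cmeasurableS ld.1.
  rewrite -ge0_integralZl//; last 2 first.
  - by move=> x _; rewrite lee_fin normc_ge0.
  - by rewrite lee_fin ltW.
  rewrite -[in leRHS](setIidr UD) integral_mkcondr; apply: ge0_le_integral => //.
  - by move=> x _; rewrite lee_fin normc_ge0.
  - exact: measurable_int fi.
  - by apply/(measurable_restrict _ mU mD).1; rewrite setIidr//; exact: measurable_funeM.
  - move=> x _; rewrite patchE; case: ifPn => [_|/negP nx].
      rewrite -EFinM lee_fin Normc.normcM mulrC ler_wpM2r ?normc_ge0//.
      by rewrite /= expr0n addr0 sqrtr_sqr.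
    by rewrite (support_closure_out (phi := psi)) ?mulr0 ?Normc.normc0// => /sub /mem_set.
rewrite eq_le normc_ge0 andbT; apply/ler_addgt0Pl => eps eps0; rewrite addr0.
have C0 : 0 < 2 * M + 2 * M' by rewrite addr_gt0// mulr_gt0.
(* [M] and [M'] bound [phi] and its derivative; the factors 2 are those of [normc_cintegral_le]. *)
have [n [h1 h2]] := cv _ cU UD (eps / (2 * M + 2 * M')) (divr_gt0 eps0 C0).
have [lvn lgn wn] := w n.
have := B v (v_ n) _ M' _ lv lvn tdp M0' HM' (@subsetUr _ _ _) h1.
have := B g (g_ n) _ M _ lg lgn tp M0 HM (@subsetUl _ _ _) h2.
set I1 := cintegral _ _ _; set I2 := cintegral _ _ _; set I3 := cintegral _ _ _.
rewrite (wn phi tp) -/I2 opprK => b1 b2.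
have -> : I3 + I1 = (I1 - I2) + (I3 + I2) by ring.
apply: le_trans (le_normcD _ _) _; apply: le_trans (lerD b1 b2) _.
set t := eps / _; have -> : 2 * (M * t) + 2 * (M' * t) = (2 * M + 2 * M') * t by ring.
rewrite /t.
by rewrite mulrC divfK// gt_eqF.
Qed.

Section weighted.
Variables (w : T -> R) (mw : measurable_fun D w) (w_gt0 : forall x, D x -> 0 < w x).

(** The weight is bounded from below on compact sets of finite measure: this embeds the weighted L^2
    space into the locally integrable functions. *)
Definition locally_bounded_weight := forall K : set T, compact K -> K `<=` D ->
  (mu K < +oo)%E /\ exists2 c : R, 0 < c & forall x, K x -> c <= w x.

(** Pointwise, [a <= eps + a^2 / eps], and [a^2 <= a^2 w / c] on [K]. The free parameter lets a
    small L^2 norm produce a small L^1 norm. *)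
Lemma integral_normc_le_L2 (K : set T) (c eps : R) v : measurable K -> K `<=` D -> 0 < c -> 0 < eps ->
  (forall x, K x -> c <= w x) -> cmeasurable D v ->
  (\int[mu]_(x in K) (Normc.normc (v x))%:E <=
    eps%:E * mu K + (eps * c)^-1%:E * L2_integral mu D w v)%E.
Proof.
move=> mK KD c0 e0 Kc mv; have mvK := cmeasurableS mD KD mv.
have mi : measurable_fun D (fun x => (Normc.normc (v x) ^+ 2 * w x)%:E).
  by apply/measurable_EFinP; exact: measurable_L2_integrand.
apply: (@le_trans _ _ (\int[mu]_(x in K) (eps%:E + (eps * c)^-1%:E * (Normc.normc (v x) ^+ 2 * w x)%:E))%E).
  apply: ge0_le_integral => //.
  - by move=> x _; rewrite lee_fin normc_ge0.
  - by apply/measurable_EFinP/measurable_normc.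
  - apply: emeasurable_funD => //; apply: measurable_funeM; exact: measurable_funS mi.
  - move=> x Kx; rewrite -EFinM -EFinD lee_fin.
    set a := Normc.normc _; have wc := Kc x Kx.
    apply: (@le_trans _ _ (eps + (eps * c)^-1 * (a ^+ 2 * c))).
      have -> : (eps * c)^-1 * (a ^+ 2 * c) = a ^+ 2 / eps by field; rewrite !gt_eqF.
      rewrite -(ler_pM2r e0) mulrDl divfK ?gt_eqF//.
      have := sqr_ge0 (a - eps); have := normc_ge0 (v x); rewrite -/a; nra.
    rewrite lerD2l; apply: ler_wpM2l; first by rewrite invr_ge0 mulr_ge0// ltW.
    by apply: ler_wpM2l => //; exact: sqr_ge0.
rewrite ge0_integralD//; last 3 first.
- by move=> x _; rewrite lee_fin ltW.
- move=> x Kx; rewrite -EFinM lee_fin; apply: mulr_ge0; first by rewrite invr_ge0 ltW// mulr_gt0.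
  by apply: mulr_ge0; [exact: sqr_ge0|exact/ltW/w_gt0/KD].
- by apply: measurable_funeM; exact: measurable_funS mi.
rewrite integral_cst// leeD2l// ge0_integralZl//; last 3 first.
- exact: measurable_funS mi.
- by move=> x Kx; rewrite lee_fin mulr_ge0 ?sqr_ge0// ltW//; exact/w_gt0/KD.
- by rewrite lee_fin invr_ge0 mulr_ge0// ltW.
apply: lee_wpmul2l; first by rewrite lee_fin invr_ge0 ltW// mulr_gt0.
apply: ge0_subset_integral => // x Dx.
by rewrite lee_fin mulr_ge0 ?sqr_ge0// ltW//; exact: w_gt0.
Qed.

Hypothesis lw : locally_bounded_weight.

Lemma L2_clocally_integrable v : L2 mu D w v -> clocally_integrable mu D v.
Proof.
move=> [mv voo]; split=> // K cK KD; have [Koo [c c0 Kc]] := lw cK KD.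
apply: le_lt_trans (integral_normc_le_L2 (mcompact cK) KD c0 ltr01 Kc mv) _.
rewrite lte_add_pinfty// lte_mul_pinfty//.
by rewrite lee_fin invr_ge0 mulr_ge0// ltW.
Qed.

Lemma weak_derivative_cvg_L2 e v g (v_ g_ : nat -> T -> R[i]) :
  L2 mu D w v -> L2 mu D w g -> (forall n, L2 mu D w (v_ n)) -> (forall n, L2 mu D w (g_ n)) ->
  (forall n, weak_derivative mu D e (v_ n) (g_ n)) ->
  (forall eps : R, 0 < eps -> exists n,
    L2_sqnorm mu D w (fun x => v x - v_ n x) <= eps /\ L2_sqnorm mu D w (fun x => g x - g_ n x) <= eps) ->
  weak_derivative mu D e v g.
Proof.
move=> Lv Lg Lv_ Lg_ wd cv.
apply: weak_derivative_cvg wd _; [exact: L2_clocally_integrable|exact: L2_clocally_integrable|].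
move=> K cK KD eps eps0; have [Koo [c c0 Kc]] := lw cK KD.
have mK := mcompact cK.
have KE : mu K = (fine (mu K))%:E by rewrite fineK// ge0_fin_numE.
have k0 : 0 <= fine (mu K) by exact: fine_ge0.
(* Each of the two terms of [integral_normc_le_L2] becomes at most [eps / 2]; the added 1 covers the
   case of a null [K]. *)
pose del := eps / 2 / (fine (mu K) + 1).
have del0 : 0 < del by rewrite !divr_gt0// ltr_wpDl.
have [n [h1 h2]] := cv (eps / 2 * (del * c)) (mulr_gt0 (divr_gt0 eps0 (ltr0Sn R 1)) (mulr_gt0 del0 c0)).
have H u : L2 mu D w u -> L2_sqnorm mu D w u <= eps / 2 * (del * c) ->
    (\int[mu]_(x in K) (Normc.normc (u x))%:E <= eps%:E)%E.
  move=> Lu hu; apply: le_trans (integral_normc_le_L2 mK KD c0 del0 Kc Lu.1) _.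
  rewrite -L2_sqnormE// KE -!EFinM -EFinD lee_fin.
  have -> : eps = eps / 2 + eps / 2 by field.
  apply: lerD.
    rewrite /del mulrAC ler_pdivrMr ?ltr_wpDl//.
    by apply: ler_wpM2l; rewrite ?divr_ge0 ?(ltW eps0)// lerDl.
  by rewrite mulrC ler_pdivrMr// mulr_gt0.
exists n; split; apply: H => //; exact: L2B.
Qed.

End weighted.
End weak_derivatives.

Section locally_bounded_weights.
Context {R : realType}.

Lemma compact_sub_cbox2 (K : set (plane R)) : compact K -> exists M, K `<=` cbox2 (- M) M (- M) M.
Proof.
move=> /(@compact_bounded R (plane R)) [M [_ KM]]; exists (`|M| + 1) => p Kp.
have : `|p| <= `|M| + 1 by apply: (KM (`|M| + 1)) => //; rewrite (le_lt_trans (ler_norm M))// ltrDl.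
by rewrite [X in X <= _]prod_normE ge_max /= !ler_norml => /andP[h1 h2]; split; rewrite /= in_itv.
Qed.

Lemma compact_sub_cbox3 (K : set (espace R)) : compact K -> exists M, K `<=` cbox3 (- M) M (- M) M (- M) M.
Proof.
move=> /(@compact_bounded R (espace R)) [M [_ KM]]; exists (`|M| + 1) => p Kp.
have : `|p| <= `|M| + 1 by apply: (KM (`|M| + 1)) => //; rewrite (le_lt_trans (ler_norm M))// ltrDl.
rewrite [X in X <= _]prod_normE ge_max prod_normE ge_max /= !ler_norml => /andP[/andP[h1 h2] h3].
by split; [split|]; rewrite /= in_itv.
Qed.

Lemma compact_leb2_lty (K : set (plane R)) : compact K -> (leb2 R K < +oo)%E.
Proof.
move=> cK; have [M KM] := compact_sub_cbox2 cK.
apply: (@le_lt_trans _ _ (leb2 R (cbox2 (- M) M (- M) M))).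
  apply: le_measure => //; rewrite inE; last exact: measurable_cbox2.
  apply: closed_measurableT; first exact: open_measurable_plane.
  exact: compact_closed.
rewrite (_ : leb2 R _ = (lebesgue_measure `[(- M)%R, M]%classic * lebesgue_measure `[(- M)%R, M]%classic)%E).
  by rewrite !lebesgue_measure_itv /= -!EFinB; case: ifP => _; rewrite ?mul0e// -EFinM ltry.
exact: product_measure1E.
Qed.

Lemma compact_leb3_lty (K : set (espace R)) : compact K -> (leb3 R K < +oo)%E.
Proof.
move=> cK; have [M KM] := compact_sub_cbox3 cK.
apply: (@le_lt_trans _ _ (leb3 R (cbox3 (- M) M (- M) M (- M) M))).
  apply: le_measure => //; rewrite inE; last exact: measurable_cbox3.
  apply: closed_measurableT; first exact: open_measurable_espace.
  exact: compact_closed.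
rewrite (_ : leb3 R _ = (leb2 R (cbox2 (- M) M (- M) M) * lebesgue_measure `[(- M)%R, M]%classic)%E); last first.
  by apply: product_measure1E; [exact: measurable_cbox2|exact: measurable_itv].
have b2 := compact_leb2_lty (@compact_cbox2 R (- M) M (- M) M).
rewrite lebesgue_measure_itv /= -EFinB; case: ifP => mm; last by rewrite mule0.
by rewrite muleC lte_mul_pinfty// lee_fin; move: mm; rewrite lte_fin; lra.
Qed.

Lemma locally_bounded_wpos (Omega : set (plane R)) : (forall p, Omega p -> 0 < p.1) ->
  locally_bounded_weight (leb2 R) Omega wpos.
Proof.
move=> O0 K cK KO; split; first exact: compact_leb2_lty.
have [->|/set0P Kn] := eqVneq K set0; first by exists 1 => // x.
have cf : {within K, continuous (wpos : plane R -> R)}.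
  apply: continuous_subspaceT => p; exact: (@cvg_fst R R).
have [c /[!inE] Kc cmin] := compact_EVT_min Kn cK cf.
by exists c.1; [exact/O0/KO|move=> x Kx; apply: cmin; rewrite inE].
Qed.

Lemma locally_bounded_cst1 (Obreve : set (espace R)) :
  locally_bounded_weight (leb3 R) Obreve (fun=> 1).
Proof. by move=> K cK KO; split; [exact: compact_leb3_lty|exists 1]. Qed.

End locally_bounded_weights.

(** * Fourier coefficients on the circle *)

Lemma cmeasurableN {R : realType} {d} {T : measurableType d} (D : set T) (f : T -> R[i]) :
  cmeasurable D f -> cmeasurable D (fun x => - f x).
Proof. by move/(cmeasurableZ (-1)); apply: eq_cmeasurable => x _; rewrite mulN1r. Qed.

Section complex_exponential.
Context {R : realType}.
Local Notation leb := (@lebesgue_measure R).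
Local Notation Rm := (measurableTypeR R).
Local Notation J := (@angles R).
Implicit Types (s t : R) (k m : int).

Lemma expiD s t : expi (s + t) = expi s * expi t :> R[i].
Proof. by rewrite /expi cosD sinD; apply: complexE2; rewrite ?ReM ?ImM /= // addrC mulrC [X in _ + X]mulrC addrC. Qed.

Lemma expi0 : expi 0 = 1 :> R[i].
Proof. by rewrite /expi cos0 sin0. Qed.

Lemma expiN t : expi (- t) = (expi t)^*%C :> R[i].
Proof. by rewrite /expi cosN sinN. Qed.

Lemma normc_expi t : Normc.normc (expi t) = 1 :> R.
Proof. by rewrite /= cos2Dsin2 sqrtr1. Qed.

Lemma expi_period m : expi (m%:~R * (2 * pi)) = 1 :> R[i].
Proof.
have H (n : nat) : expi (n%:R * (2 * pi)) = 1 :> R[i].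
  elim: n => [|n IH]; first by rewrite mul0r expi0.
  by rewrite -natr1 mulrDl mul1r expiD IH mul1r /expi mulr_natl cos2pi sin2pi.
case: m => n; first by rewrite -pmulrn H.
by rewrite NegzE mulrNz mulNr expiN -pmulrn H; apply: complexE2; rewrite /= ?oppr0.
Qed.

Lemma expi_int_endpoints m : expi (m%:~R * pi) = expi (m%:~R * - pi) :> R[i].
Proof.
have -> : m%:~R * pi = m%:~R * (2 * pi) + m%:~R * - pi :> R by ring.
by rewrite expiD expi_period mul1r.
Qed.

Lemma continuous_Re_expi (a : R) : continuous (fun t => complex.Re (expi (a * t))).
Proof.
move=> t; apply: (@continuous_comp _ _ _ (fun t : R => a * t) cos); last exact: continuous_cos.
by apply: continuousM; [exact: cvg_cst|exact: cvg_id].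
Qed.

Lemma continuous_Im_expi (a : R) : continuous (fun t => complex.Im (expi (a * t))).
Proof.
move=> t; apply: (@continuous_comp _ _ _ (fun t : R => a * t) sin); last exact: continuous_sin.
by apply: continuousM; [exact: cvg_cst|exact: cvg_id].
Qed.

Lemma cmeasurable_expi (D : set Rm) (a : R) : cmeasurable D (fun t => expi (a * t)).
Proof.
split; apply: measurable_funTS; apply: continuous_measurable_fun => t.
  exact: continuous_Re_expi.
exact: continuous_Im_expi.
Qed.

Lemma integral_periodic_derivative (F f : R -> R) :
  (forall t, is_derive t (1 : R) F (f t)) -> continuous f -> F pi = F (- pi) ->
  \int[leb]_(t in J) f t = 0.
Proof.
move=> dF cf Fpi; rewrite /Rintegral.
have mf : measurable_fun setT (f : Rm -> R) by apply: continuous_measurable_fun.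
have pi0 := pi_gt0 R.
rewrite integral_itv_obnd_cbnd; last exact/measurable_EFinP/measurable_funTS.
rewrite (@FTC2_itv _ f F) ?Fpi ?subrr//; first by lra.
by move=> x _; exact: cf.
Qed.

Lemma cintegral_expi m : cintegral leb J (fun t => expi (m%:~R * t)) = if m == 0 then (2 * pi)%:C else 0.
Proof.
have pi0 := pi_gt0 R.
case: eqP => [->|/eqP m0].
  under eq_cintegral do rewrite mul0r expi0.
  have E : \int[leb]_(t in J) (1 : R) = 2 * pi.
    rewrite /Rintegral integral_cst//=; last exact: measurable_angles.
    rewrite mul1e lebesgue_measure_itv /= lte_fin ifT; last by lra.
    by rewrite -EFinB /=; ring.
  by apply: complexE2 => //=; rewrite /Rintegral integral0.
have mR0 : m%:~R != 0 :> R by rewrite intr_eq0.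
have dl (t : R) : is_derive t (1 : R) (fun t : R => m%:~R * t) m%:~R.
  apply: (is_derive_eq (is_deriveM (is_derive_cst (m%:~R : R) t 1) (is_derive_id t (1 : R)))).
  by rewrite /GRing.scale /= mulr1 mulr0 addr0.
have ends := expi_int_endpoints m.
apply: complexE2 => /=.
  apply: (@integral_periodic_derivative (fun t => (m%:~R)^-1 * sin (m%:~R * t))).
  - move=> t; have ds := is_derive_comp1 (@is_derive_sin R (m%:~R * t)) (dl t).
    apply: (is_derive_eq (is_deriveM (is_derive_cst ((m%:~R)^-1 : R) t 1) ds)).
    by rewrite /GRing.scale /= mulr0 addr0 mulrCA mulVf// mulr1.
  - exact: continuous_Re_expi.
  - by move/(congr1 (@complex.Im R)) : ends => /= ->.
apply: (@integral_periodic_derivative (fun t => (m%:~R)^-1 * - cos (m%:~R * t))).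
- move=> t; have ds := is_derive_comp1 (@is_derive_cos R (m%:~R * t)) (dl t).
  apply: (is_derive_eq (is_deriveM (is_derive_cst ((m%:~R)^-1 : R) t 1) (is_deriveN ds))).
  by rewrite /GRing.scale /= mulr0 addr0 mulNr opprK mulrCA mulVf// mulr1.
- exact: continuous_Im_expi.
- by move/(congr1 (@complex.Re R)) : ends => /= ->.
Qed.

End complex_exponential.

(** * Uniqueness of Fourier coefficients through approximate indicators of arcs *)

Section bernstein.
Context {R : realType}.

Lemma bernoulli_le (x : R) (m : nat) : 0 <= x <= 1 -> 1 - m%:R * x <= (1 - x) ^+ m.
Proof.
move=> /andP[x0 x1]; elim: m => [|m IH]; first by rewrite mul0r subr0.
rewrite exprS -natr1; have h : 0 <= 1 - x by lra.
apply: le_trans (ler_wpM2l h IH); have : 0 <= m%:R :> R by exact: ler0n.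
by nra.
Qed.

Lemma bernoulli_ge (x : R) (m : nat) : 0 <= x -> 1 + m%:R * x <= (1 + x) ^+ m.
Proof.
move=> x0; elim: m => [|m IH]; first by rewrite mul0r addr0.
rewrite exprS -natr1; have h : 0 <= 1 + x by lra.
apply: le_trans (ler_wpM2l h IH); have : 0 <= m%:R :> R by exact: ler0n.
by nra.
Qed.

(* As [n] grows this converges to [1] for [0 <= q < 1 / 2] and to [0] for [1 / 2 < q <= 1];
   composed with an affine function of [cos (t - t0)], it yields trigonometric
   polynomials converging boundedly to the indicator of an arc. *)
Definition bernstein (n : nat) (q : R) : R := (1 - q ^+ n) ^+ (2 ^ n).

Lemma bernstein_itv n q : 0 <= q <= 1 -> 0 <= bernstein n q <= 1.
Proof.
move=> /andP[q0 q1]; have := exprn_ge0 n q0; have := exprn_ile1 n q0 q1 => h1 h0.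
by rewrite /bernstein exprn_ge0 ?exprn_ile1 //; lra.
Qed.

(** Bernoulli's inequality bounds [bernstein n q] below by [1 - (2 q)^n]. *)
Lemma cvg_bernstein1 q : 0 <= q < 1 / 2 -> bernstein n q @[n --> \oo] --> (1 : R).
Proof.
move=> /andP[q0 q1].
apply: (@squeeze_cvgr _ _ _ _ (fun n => 1 - (2 * q) ^+ n) (cst 1)).
- apply: nearW => n; have /andP[_ ->] : 0 <= bernstein n q <= 1 by apply: bernstein_itv; lra.
  rewrite andbT exprMn; apply: le_trans (bernoulli_le (2 ^ n) _); first by rewrite natrX.
  by rewrite exprn_ge0// exprn_ile1//; lra.
- rewrite -[X in _ --> X]subr0; apply: cvgB; first exact: cvg_cst.
  by apply: cvg_expr; rewrite ger0_norm; lra.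
- exact: cvg_cst.
Qed.

(** Since [(1 - q^n) (1 + q^n) <= 1], the value is at most the inverse of [(1 + q^n)^(2^n)], which
    by Bernoulli's inequality exceeds [(2 q)^n]. *)
Lemma cvg_bernstein0 q : 1 / 2 < q <= 1 -> bernstein n q @[n --> \oo] --> (0 : R).
Proof.
move=> /andP[q0 q1].
apply: (@squeeze_cvgr _ _ _ _ (cst 0) (fun n => ((2 * q)^-1) ^+ n)).
- apply: nearW => n; have /andP[b0 _] : 0 <= bernstein n q <= 1 by apply: bernstein_itv; lra.
  apply/andP; split; first exact: b0.
  have qn0 : 0 < q ^+ n by rewrite exprn_gt0//; lra.
  have qn1 : q ^+ n <= 1 by rewrite exprn_ile1//; lra.
  have m0 : 0 < (2 * q) ^+ n by rewrite exprn_gt0//; lra.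
  rewrite exprVn -[leRHS]mul1r ler_pdivlMr//.
  apply: le_trans (_ : bernstein n q * (1 + q ^+ n) ^+ (2 ^ n) <= 1).
    apply: ler_wpM2l => //; apply: le_trans (bernoulli_ge _ (ltW qn0)).
    by rewrite exprMn natrX lerDr.
  rewrite -exprMn; apply: exprn_ile1; nra.
- exact: cvg_cst.
- apply: cvg_expr; rewrite ger0_norm ?invr_ge0; last by lra.
  by rewrite invf_lt1; lra.
Qed.

End bernstein.

Section fourier_uniqueness.
Context {R : realType}.
Local Notation leb := (@lebesgue_measure R).
Local Notation Rm := (measurableTypeR R).
Local Notation J := (@angles R).
Implicit Types f g : R -> R[i].

Let mJ := @measurable_angles R.

Definition fourier_null f := cintegrable leb J f /\
  forall k : int, cintegral leb J (fun t => f t * expi (- (k%:~R * t))) = 0.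

Lemma cintegrable_expiM f k : cintegrable leb J f -> cintegrable leb J (fun t => f t * expi (k * t)).
Proof.
move=> fi; apply: (cintegrable_le mJ _ (cintegrable_normc mJ fi)).
  by apply: cmeasurableM; [exact: cintegrable_cmeasurable fi|exact: cmeasurable_expi].
by move=> t _; rewrite Normc.normcM normc_expi mulr1.
Qed.

Lemma fourier_null_expi f (m : int) : fourier_null f -> fourier_null (fun t => f t * expi (m%:~R * t)).
Proof.
move=> [fi f0]; split; first exact: cintegrable_expiM.
move=> k; rewrite -(f0 (k - m)); apply: eq_cintegral => t _.
rewrite -mulrA -expiD; congr (_ * expi _).
by rewrite rmorphB /=; ring.
Qed.

Lemma fourier_nullD f g : fourier_null f -> fourier_null g -> fourier_null (fun t => f t + g t).
Proof.
move=> [fi f0] [gi g0]; split; first exact: cintegrableD.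
move=> k; have H (h : R -> R[i]) : cintegrable leb J h -> cintegrable leb J (fun t => h t * expi (- (k%:~R * t))).
  by move=> /(@cintegrable_expiM _ (- k%:~R)); under eq_fun do rewrite mulNr.
transitivity (cintegral leb J (fun t => f t * expi (- (k%:~R * t)) + g t * expi (- (k%:~R * t)))).
  by apply: eq_cintegral => t _; rewrite mulrDl.
by rewrite (cintegralD mJ (H _ fi) (H _ gi)) f0 g0 addr0.
Qed.

Lemma fourier_nullZ (a : R[i]) f : fourier_null f -> fourier_null (fun t => a * f t).
Proof.
move=> [fi f0]; split; first exact: cintegrableZ.
move=> k; have H : cintegrable leb J (fun t => f t * expi (- (k%:~R * t))).
  by have := @cintegrable_expiM _ (- k%:~R) fi; under eq_fun do rewrite mulNr.
transitivity (cintegral leb J (fun t => a * (f t * expi (- (k%:~R * t))))).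
  by apply: eq_cintegral => t _; rewrite mulrA.
by rewrite (cintegralZ mJ a H) f0 mulr0.
Qed.

Lemma eq_fourier_null f g : (forall t, f t = g t) -> fourier_null f -> fourier_null g.
Proof. by move=> /funext ->. Qed.

Lemma real_complexM (x y : R) : (x * y)%:C = x%:C * y%:C.
Proof. by apply: complexE2; rewrite ?ReM ?ImM /=; ring. Qed.

(** Multiplication by an exponential of integer frequency only shifts coefficients, so vanishing
    coefficients survive multiplication by any polynomial in [q]. *)
Lemma fourier_null_bernstein f (c a : R) (q := fun t => c * (1 + cos (t - a))) n :
  fourier_null f -> fourier_null (fun t => f t * (bernstein n (q t))%:C).
Proof.
have Hq f' : fourier_null f' -> fourier_null (fun t => f' t * (q t)%:C).
  move=> f0.
  (* [c cos (t - a)] is the sum of [(c / 2) exp (- i a) exp (i t)] and its conjugate. *)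
  have h1 := fourier_nullZ (c / 2 * cos a +i* (c / 2 * - sin a)) (fourier_null_expi 1 f0).
  have h2 := fourier_nullZ (c / 2 * cos a +i* (c / 2 * sin a)) (fourier_null_expi (-1) f0).
  apply: eq_fourier_null (fourier_nullD (fourier_nullZ c%:C f0) (fourier_nullD h1 h2)) => t.
  rewrite mulr1z mulrN1z mul1r mulN1r /expi cosN sinN /q cosB.
  by case: (f' t) => x y; apply: complexE2 => /=; field.
have HX f' m : fourier_null f' -> fourier_null (fun t => f' t * (q t ^+ m)%:C).
  move=> f0; elim: m => [|m IH]; first by apply: eq_fourier_null f0 => t; rewrite expr0 mulr1.
  by apply: eq_fourier_null (Hq _ IH) => t; rewrite exprSr real_complexM mulrA.
have HB f' : fourier_null f' -> fourier_null (fun t => f' t * (1 - q t ^+ n)%:C).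
  move=> f0; apply: eq_fourier_null (fourier_nullD f0 (fourier_nullZ (-1) (HX _ n f0))) => t.
  by rewrite rmorphB rmorph1 mulrBr mulr1 mulN1r.
rewrite /bernstein; elim: (2 ^ n)%N => [|m IH] f0.
  by apply: eq_fourier_null f0 => t; rewrite expr0 mulr1.
by apply: eq_fourier_null (HB _ (IH f0)) => t; rewrite exprSr real_complexM mulrA.
Qed.

Lemma fourier_null_cintegral f : fourier_null f -> cintegral leb J f = 0.
Proof.
move=> [_ /(_ 0)]; under eq_cintegral do rewrite mul0r oppr0 expi0 mulr1.
by [].
Qed.

(** The cosine of the distance to the midpoint decreases along the circle, and [s] is its value at
    both ends of the arc. Outside, distances above [pi] are measured the other way round. The angle
    [pi] is set apart because for [b = - pi] it is the endpoint [b] of the arc. *)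
Lemma cos_arc (b c t : R) (a := (b + c) / 2) (s := cos ((c - b) / 2)) :
  - pi <= b -> b < c -> c <= pi -> J t -> t != b -> t != c -> t != pi ->
  if b < t < c then s < cos (t - a) else cos (t - a) < s.
Proof.
move=> b0 bc c0; rewrite /angles /= in_itv /= => /andP[t0 t1] tb tc tpi.
have {}t1 : t < pi by rewrite lt_neqAle tpi.
have L u v : 0 <= u -> u < v -> v <= pi -> cos v < cos u :> R.
  by move=> u0 uv v1; rewrite ltr_cos// in_itv /=; lra.
case: ifPn => [/andP[h1 h2]|].
  have [ta|ta] := leP 0 (t - a); first by apply: L; rewrite // /a in ta *; lra.
  by rewrite -cosN; apply: L; rewrite // /a in ta *; lra.
rewrite negb_and -!leNgt => /orP[tb'|tc'].
  have tb2 : t < b by rewrite lt_neqAle tb.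
  rewrite -cosN opprB; have [h|h] := leP (a - t) pi; first by apply: L; rewrite // /a; lra.
  by rewrite -cosN -(cosD2pi (- (a - t))) -mulr_natl; apply: L; rewrite // /a in h *; lra.
have tc2 : c < t by rewrite lt_neqAle eq_sym tc.
have [h|h] := leP (t - a) pi; first by apply: L; rewrite // /a; lra.
by rewrite -cosN -(cosD2pi (- (t - a))) -mulr_natl; apply: L; rewrite // /a in h *; lra.
Qed.

Lemma cintegralI (A : set Rm) f : measurable A ->
  cintegral leb (J `&` A) f = cintegral leb J (fun t => f t * (\1_A t)%:C).
Proof.
move=> mA; rewrite /cintegral /Rintegral; congr (fine _ +i* fine _).
  rewrite integral_mkcondr; apply: eq_integral => t _; rewrite patchE indicE ReM /= mulr0 subr0.
  by case: (t \in A); rewrite ?mulr1 ?mulr0.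
rewrite integral_mkcondr; apply: eq_integral => t _; rewrite patchE indicE ImM /= mulr0 add0r.
by case: (t \in A); rewrite ?mulr1 ?mulr0.
Qed.

(** Weighted by [bernstein n (q t)], the integral of [f] is 0 for every [n], and the weights tend to
    the indicator of the complement of the arc. As the total integral also vanishes, so does the one
    over the arc. *)
Lemma fourier_null_arc f (b c : R) : fourier_null f -> - pi <= b -> b < c -> c <= pi -> c - b <= pi ->
  cintegral leb (J `&` `]b, c[%classic) f = 0.
Proof.
move=> f0 b0 bc c0 cb; have pi0 := pi_gt0 R.
have fi := f0.1; have mf := cintegrable_cmeasurable fi.
pose s := cos ((c - b) / 2); pose a := (b + c) / 2.
have s0 : 0 <= s by apply: cos_ge0_pihalf; lra.
have s1 : s <= 1 by exact: cos_le1.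
(* Normalized so that [q] equals 1/2 at the ends of the arc. An arc of length at most [pi] has
   [s >= 0], which keeps [q] below 1. *)
pose k := (2 * (1 + s))^-1.
have k0 : 0 < k by rewrite invr_gt0; lra.
pose q t := k * (1 + cos (t - a)).
have qE t : q t * (2 * (1 + s)) = 1 + cos (t - a) by rewrite /q mulrC mulrA divff ?mul1r// gt_eqF//; lra.
have q01 t : 0 <= q t <= 1.
  have := qE t; have := cos_le1 (t - a); have := cos_geN1 (t - a); nra.
(* At these points [q] may equal 1/2, where the weights need not converge to 0 or 1; replacing [f]
   by 0 on this null set gives convergence everywhere. *)
pose F : set Rm := [set b] `|` [set c] `|` [set pi].
have mF : measurable F by do 2?[apply: measurableU]; exact: measurable_set1.
have F0 : leb.-negligible F.
  have h1 (x : R) : leb.-negligible [set x].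
    by apply/negligibleP; [exact: measurable_set1|exact: lebesgue_measure_set1].
  by apply: negligibleU; first apply: negligibleU.
pose g t := f t * (\1_(~` F) t)%:C.
have gE : {ae leb, forall t, J t -> f t = g t}.
  apply: negligibleS F0 => t /= /not_implyP[_]; rewrite /g indicE.
  case: (boolP (t \in ~` F)) => [_|]; first by rewrite mulr1.
  by rewrite notin_setE /= => /contrapT.
have mg : cmeasurable J g.
  by apply: cmeasurableM => //; apply: cmeasurableC; apply: measurable_indic; exact: measurableC.
have gi : cintegrable leb J g.
  apply: (cintegrable_le mJ mg (cintegrable_normc mJ fi)) => t _.
  rewrite /g Normc.normcM indicE; case: (_ \in _) => /=; last by rewrite expr0n addr0 sqrtr0 mulr0 normc_ge0.
  by rewrite expr1n expr0n addr0 sqrtr1 mulr1.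
pose I : set Rm := `]b, c[%classic.
have mI : measurable I by exact: measurable_itv.
have mq : measurable_fun setT (q : Rm -> R).
  apply: measurable_funM => //; apply: measurable_funD => //.
  apply: (measurableT_comp (f := @cos R : Rm -> Rm)); last exact: measurable_funB.
  by apply: continuous_measurable_fun; exact: continuous_cos.
have mbq n : cmeasurable J (fun t => (bernstein n (q t))%:C).
  apply: cmeasurableC; apply: measurable_funX; apply: measurable_funB => //.
  by apply: measurable_funX; exact: measurable_funTS.
have lim t : J t -> (fun n => bernstein n (q t) * (\1_(~` F) t)) @ \oo --> (\1_(~` I) t * \1_(~` F) t : R).
  move=> Jt; rewrite !indicE; case: (boolP (t \in ~` F)) => tF /=; last first.
    by under eq_fun do rewrite mulr0; rewrite mulr0; exact: cvg_cst.
  under eq_fun do rewrite mulr1; rewrite mulr1.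
  have [tb tc tpi] : [/\ t != b, t != c & t != pi].
    move: tF; rewrite inE /F /= => h; split; apply/eqP => e; apply: h; by [left; left|left; right|right].
  have := cos_arc b0 bc c0 Jt tb tc tpi; rewrite -/a -/s => ca; have := qE t; have := q01 t.
  case: (boolP (t \in ~` I)) ca => [|].
    rewrite inE /I /= in_itv /= => /negP/negbTE -> ca q1 qe.
    by apply: cvg_bernstein1; nra.
  rewrite notin_setE /I /= in_itv /= => /contrapT -> ca q1 qe.
  by apply: cvg_bernstein0; nra.
have [] := @cintegral_dominated _ _ _ leb J mJ (fun n t => g t * (bernstein n (q t))%:C)
  (fun t => g t * (\1_(~` I) t)%:C) (fun t => Normc.normc (g t)).
- by move=> n; exact: cmeasurableM.
- by apply: cmeasurableM => //; apply: cmeasurableC; apply: measurable_indic; exact: measurableC.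
- exact: cintegrable_normc.
- move=> n t _; rewrite Normc.normcM ler_piMr ?normc_ge0//=.
  have /andP[h1 h2] := bernstein_itv n (q01 t).
  by rewrite expr0n addr0 sqrtr_sqr ger0_norm.
- move=> t Jt; under eq_fun do rewrite /g !ReM /= !mulr0 !subr0 -mulrA [_ * bernstein _ _]mulrC.
  rewrite /g !ReM /= !mulr0 !subr0 -mulrA [_ * \1_(~` I) _]mulrC.
  by apply: cvgM; [exact: cvg_cst|exact: lim].
- move=> t Jt; under eq_fun do rewrite /g !ImM /= !mulr0 !add0r -mulrA [_ * bernstein _ _]mulrC.
  rewrite /g !ImM /= !mulr0 !add0r -mulrA [_ * \1_(~` I) _]mulrC.
  by apply: cvgM; [exact: cvg_cst|exact: lim].
have z n : cintegral leb J (fun t => g t * (bernstein n (q t))%:C) = 0.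
  rewrite -(fourier_null_cintegral (fourier_null_bernstein k a n f0)).
  apply: ae_eq_cintegral => //; try exact: cmeasurableM.
  by move: gE; apply: filterS => t + Jt => /(_ Jt) ->.
under eq_fun do rewrite z; move=> /cvg_lim zR; under eq_fun do rewrite z; move=> /cvg_lim zI.
have zz : cintegral leb J (fun t => g t * (\1_(~` I) t)%:C) = 0.
  apply: complexE2; first by rewrite -zR//; apply/cvg_lim => //; exact: cvg_cst.
  by rewrite -zI//; apply/cvg_lim => //; exact: cvg_cst.
have fz : cintegral leb J g = 0.
  by rewrite -(fourier_null_cintegral f0); apply/esym/ae_eq_cintegral.
rewrite cintegralI//; transitivity (cintegral leb J (fun t => g t - g t * (\1_(~` I) t)%:C)).
  apply: ae_eq_cintegral => //.
  - by apply: cmeasurableM => //; apply: cmeasurableC; exact: measurable_indic.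
  - apply: cmeasurableD => //; apply: cmeasurableN; apply: cmeasurableM => //; apply: cmeasurableC.
    by apply: measurable_indic; exact: measurableC.
  - move: gE; apply: filterS => t + Jt => /(_ Jt) ->; rewrite !indicE in_setC.
    by case: (t \in I); rewrite /= ?mulr0 ?mulr1 ?subr0 ?subrr.
rewrite cintegralB// ?fz ?zz ?subrr//.
apply: (cintegrable_le mJ _ (cintegrable_normc mJ gi)).
  by apply: cmeasurableM => //; apply: cmeasurableC; apply: measurable_indic; exact: measurableC.
move=> t _; rewrite Normc.normcM ler_piMr ?normc_ge0//= expr0n addr0 sqrtr_sqr indicE.
by case: (_ \in _); rewrite ?normr1 ?normr0.
Qed.

(** Every interval cut from []l, u[] by a ray is an arc of length at most [pi], as
    [fourier_null_arc] requires. *)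
Lemma fourier_null_half f (l u : R) : fourier_null f -> - pi <= l -> l < u -> u <= pi -> u - l <= pi ->
  {ae leb, forall t, `]l, u[%classic t -> f t = 0}.
Proof.
move=> f0 l0 lu u0 ul; set D : set Rm := `]l, u[%classic.
have mD : measurable D by exact: measurable_itv.
have DJ : D `<=` J by move=> t; rewrite /D /angles /= !in_itv /= => /andP[h1 h2]; apply/andP; split; lra.
have A (a : R) : cintegral leb (D `&` `]a, +oo[%classic) f = 0.
  have [ua|au] := leP u (Num.max a l).
    have -> : D `&` `]a, +oo[%classic = set0.
      apply/seteqP; split=> // t []; rewrite /D /= !in_itv /= andbT => /andP[h1 h2] h3.
      by move: ua; rewrite leNgt gt_max => /negP; apply; rewrite (lt_trans h3) ?(lt_trans h1).
    by rewrite /cintegral /Rintegral !integral_set0.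
  have -> : D `&` `]a, +oo[%classic = J `&` `](Num.max a l), u[%classic.
    apply/seteqP; split=> t.
      move=> [Dt]; split; first exact: DJ.
      by move: Dt b; rewrite /D /= !in_itv /= andbT gt_max => /andP[-> ->] ->.
    by move=> [_]; rewrite /D /= !in_itv /= gt_max andbT => /andP[/andP[-> ->] ->].
  have ml : l <= Num.max a l by rewrite le_max lexx orbT.
  by apply: fourier_null_arc => //; lra.
have D0 : cintegral leb D f = 0.
  have := A l; rewrite (_ : D `&` _ = D)//.
  by apply/seteqP; split=> t; [case|rewrite /D /= !in_itv /= andbT => /andP[-> ->]].
have [fR fI] := f0.1.
have H (h : R -> R) : leb.-integrable J (EFin \o h) -> \int[leb]_(t in D) h t = 0 ->
    (forall a, \int[leb]_(t in D `&` `]a, +oo[%classic) h t = 0) -> ae_eq leb D (EFin \o h) (cst 0%E).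
  move=> hi h0 ha; have hD : leb.-integrable D (EFin \o h) by exact: integrableS hi.
  apply: ae_eq0_zero_integral => // B mB.
  apply: (@zero_integral_rays _ _ _ leb D (EFin \o h) id) => //.
    by rewrite -[LHS]fineK ?integrable_fin_num//; congr EFin.
  move=> a; have mDa : measurable (D `&` `]a, +oo[%classic) by apply: measurableI => //; exact: measurable_itv.
  rewrite preimage_id -[LHS]fineK ?integrable_fin_num//; first by congr EFin; exact: ha.
  by apply: integrableS hD => //; exact: subIsetl.
have aR := H _ fR (congr1 (@complex.Re R) D0) (fun a => congr1 (@complex.Re R) (A a)).
have aI := H _ fI (congr1 (@complex.Im R) D0) (fun a => congr1 (@complex.Im R) (A a)).
by apply: filterS2 aR aI => t h k Dt; apply: complexE2; [case: (h Dt)|case: (k Dt)].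
Qed.

(** The restriction to arcs of length at most [pi] makes it necessary to treat two half circles
    separately. *)
Lemma fourier_unique f : fourier_null f -> f = (fun=> 0) %[ae leb in J].
Proof.
move=> f0; have pi0 := pi_gt0 R.
have h1 : {ae leb, forall t, `]0, pi[%classic t -> f t = 0} by apply: fourier_null_half => //; lra.
have h2 : {ae leb, forall t, `](- pi), 0[%classic t -> f t = 0} by apply: fourier_null_half => //; lra.
have F0 : leb.-negligible ([set 0] `|` [set pi] : set Rm).
  by apply: negligibleU; apply/negligibleP; (try exact: measurable_set1); exact: lebesgue_measure_set1.
apply: (negligibleS _ (negligibleU h1 (negligibleU h2 F0))) => t /not_implyP[].
rewrite /angles /= in_itv /= => /andP[t0 t1] ft.
have [->|tn0] := eqVneq t 0; first by right; right; left.
have [->|tpi] := eqVneq t pi; first by right; right; right.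
have [h|h] := ltP t 0; [right; left|left] => /(_ _)/ft; apply.
  by rewrite /= in_itv /= t0.
by rewrite /= in_itv /= lt_neqAle eq_sym tn0 h lt_neqAle tpi.
Qed.

End fourier_uniqueness.

(** * Orthogonal series in L2 *)

Section L2_orthogonality.
Context {R : realType} {d : measure_display} {T : measurableType d}.
Variables (mu : {measure set T -> \bar R}) (D : set T) (mD : measurable D).
Variables (w : T -> R) (mw : measurable_fun D w) (w_gt0 : forall x, D x -> 0 < w x).
Implicit Types (f g h : T -> R[i]).
Local Notation L2 := (L2 mu D w).
Local Notation sqn := (L2_sqnorm mu D w).

Let w_ge0 x : D x -> 0 <= w x. Proof. by move=> /w_gt0 /ltW. Qed.

Definition inner f g : R[i] := cintegral mu D (fun x => f x * (g x)^*%C * (w x)%:C).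

Let normc_prod f g (s : R) x : 0 < s -> D x ->
  2 * Normc.normc (f x * (g x)^*%C * (w x)%:C) <=
  s * (Normc.normc (f x) ^+ 2 * w x) + s^-1 * (Normc.normc (g x) ^+ 2 * w x).
Proof.
move=> s0 Dx; rewrite !Normc.normcM.
have -> : Normc.normc (w x)%:C = w x by rewrite /= expr0n addr0 sqrtr_sqr ger0_norm// w_ge0.
have -> : Normc.normc (g x)^*%C = Normc.normc (g x) by case: (g x) => a b /=; rewrite sqrrN.
set a := Normc.normc (f x); set b := Normc.normc (g x).
have -> : 2 * (a * b * w x) = (2 * (a * b)) * w x by ring.
have -> : s * (a ^+ 2 * w x) + s^-1 * (b ^+ 2 * w x) = (s * a ^+ 2 + s^-1 * b ^+ 2) * w x by ring.
apply: ler_wpM2r; first exact: w_ge0.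
rewrite -(ler_pM2l s0) mulrDr !mulrA mulfV ?gt_eqF// mul1r.
by have := sqr_ge0 (s * a - b); nra.
Qed.

Lemma integrable_L2D f g (s t : R) : L2 f -> L2 g ->
  mu.-integrable D (EFin \o (fun x => s * (Normc.normc (f x) ^+ 2 * w x) + t * (Normc.normc (g x) ^+ 2 * w x))).
Proof.
move=> Lf Lg; under [X in _.-integrable _ X]eq_fun do rewrite /= EFinD.
by apply: integrableD => //; apply: RintegrableZl => //; exact: L2_integrable.
Qed.

Lemma L2_inner_integrable f g : L2 f -> L2 g ->
  cintegrable mu D (fun x => f x * (g x)^*%C * (w x)%:C).
Proof.
move=> Lf Lg; apply: (cintegrable_le mD _ (integrable_L2D 1 1 Lf Lg)).
  apply: cmeasurableM; last exact: cmeasurableC.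
  by apply: cmeasurableM; [exact: Lf.1|apply: cmeasurable_conj; exact: Lg.1].
move=> x Dx; have := @normc_prod f g 1 x ltr01 Dx; rewrite invr1.
by have := normc_ge0 (f x * (g x)^*%C * (w x)%:C); lra.
Qed.

Lemma inner_linear (a : R[i]) f g h : L2 f -> L2 g -> L2 h ->
  inner (fun x => a * f x + g x) h = a * inner f h + inner g h.
Proof.
move=> Lf Lg Lh; have i1 := L2_inner_integrable Lf Lh; have i2 := L2_inner_integrable Lg Lh.
rewrite /inner -(cintegralZ mD a i1) -(cintegralD mD (cintegrableZ mD a i1) i2).
by apply: eq_cintegral => x _; ring.
Qed.

Lemma inner_conj f g : L2 f -> L2 g -> inner g f = (inner f g)^*%C.
Proof.
move=> Lf Lg; rewrite /inner -(cintegral_conj mD (L2_inner_integrable Lf Lg)).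
apply: eq_cintegral => x _; case: (f x) => a b; case: (g x) => c e.
by apply: complexE2 => /=; ring.
Qed.

Lemma inner_sqnorm f : L2 f -> inner f f = (sqn f)%:C.
Proof.
move=> Lf; apply: complexE2 => /=.
  rewrite /Rintegral /L2_sqnorm; congr fine; apply: eq_integral => x _; congr EFin.
  by rewrite sqr_normc; case: (f x) => a b /=; ring.
rewrite (_ : \int[mu]_(x in D) _ = \int[mu]_(x in D) (0 : R)); first by rewrite /Rintegral integral0.
by apply: eq_Rintegral => x _; case: (f x) => a b /=; ring.
Qed.

(** A weighted form of the Cauchy-Schwarz inequality. The free [s] suits a product of one factor
    that is bounded and another that tends to 0. *)
Lemma normc_inner_le (s : R) f g : 0 < s -> L2 f -> L2 g ->
  Normc.normc (inner f g) <= s * sqn f + s^-1 * sqn g.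
Proof.
move=> s0 Lf Lg; have ci := L2_inner_integrable Lf Lg.
apply: le_trans (normc_cintegral_le mD ci) _.
have fi := cintegrable_normc mD ci; have gi := integrable_L2D s s^-1 Lf Lg.
have si h : L2 h -> sqn h = \int[mu]_(x in D) (Normc.normc (h x) ^+ 2 * w x) by [].
rewrite (si f)// (si g)// -!RintegralZl//; try exact: L2_integrable.
rewrite -RintegralD//; try by apply: RintegrableZl => //; exact: L2_integrable.
by apply: le_Rintegral => //; [exact: RintegrableZl|move=> x Dx; exact: normc_prod].
Qed.

Lemma L2_sqnormD f g : L2 f -> L2 g ->
  sqn (fun x => f x + g x) = sqn f + sqn g + 2 * complex.Re (inner f g).
Proof.
move=> Lf Lg; have Lfg := L2D mD mw w_gt0 Lf Lg.
have L1 : L2 (fun x => 1 * f x + g x) by under eq_fun do rewrite mul1r.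
have E h : L2 h -> inner (fun x => f x + g x) h = inner f h + inner g h.
  by move=> Lh; have := inner_linear 1 Lf Lg Lh; under eq_fun do rewrite mul1r; rewrite mul1r.
have := inner_sqnorm Lfg; rewrite E// (inner_conj Lfg Lf) (inner_conj Lfg Lg) !E// !inner_sqnorm//.
move=> /(congr1 (@complex.Re R)); rewrite (inner_conj Lf Lg).
by case: (inner f g) => a b /= <-; ring.
Qed.

Lemma L2_sqnorm_pythagoras f g : L2 f -> L2 g -> inner f g = 0 ->
  sqn (fun x => f x + g x) = sqn f + sqn g.
Proof. by move=> Lf Lg fg; rewrite L2_sqnormD// fg mulr0 addr0. Qed.

Lemma L2_complete (f : nat -> T -> R[i]) : (forall n, L2 (f n)) ->
  (forall e : R, 0 < e -> exists N, forall m n, (N <= m)%N -> (N <= n)%N ->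
     sqn (fun x => f m x - f n x) <= e) ->
  exists2 g, L2 g & forall e : R, 0 < e -> exists N, forall n, (N <= n)%N ->
     sqn (fun x => g x - f n x) <= e.
Proof.
move=> Lf fC.
have Ld m n : L2 (fun x => f m x - f n x) by exact: L2B.
have part (p : R[i] -> R) : (forall x y, p (x - y) = p x - p y) -> (forall x, p x ^+ 2 <= Normc.normc x ^+ 2) ->
    (forall n, measurable_fun D (fun x => p (f n x))) ->
    exists2 g : T -> R, measurable_fun D g & forall e : R, 0 < e -> exists N, forall n, (N <= n)%N ->
     (\int[mu]_(x in D) ((g x - p (f n x)) ^+ 2 * w x)%:E <= e%:E)%E.
  move=> pB ple mp; apply: (L2_complete_real mD mw w_gt0 mp) => e e0.
  have [N HN] := fC e e0; exists N => m n Nm Nn; apply: le_trans (_ : ((sqn (fun x => f m x - f n x))%:E <= e%:E)%E); last first.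
    by rewrite lee_fin HN.
  rewrite (L2_sqnormE w_gt0 (Ld m n)); apply: ge0_le_integral => //.
  - by move=> x Dx; rewrite lee_fin mulr_ge0 ?sqr_ge0 ?w_ge0.
  - apply/measurable_EFinP/measurable_funM => //; apply: measurable_funX; exact: measurable_funB.
  - by apply/measurable_EFinP; apply: measurable_L2_integrand => //; case: (Ld m n).
  - by move=> x Dx; rewrite lee_fin -pB ler_wpM2r ?w_ge0.
have [gR mgR HR] : exists2 g : T -> R, measurable_fun D g & forall e : R, 0 < e -> exists N, forall n, (N <= n)%N ->
     (\int[mu]_(x in D) ((g x - complex.Re (f n x)) ^+ 2 * w x)%:E <= e%:E)%E.
  apply: part => [x y|x|n]; [by rewrite ReD ReN|by rewrite sqr_normc lerDl sqr_ge0|by case: (Lf n) => -[]].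
have [gI mgI HI] : exists2 g : T -> R, measurable_fun D g & forall e : R, 0 < e -> exists N, forall n, (N <= n)%N ->
     (\int[mu]_(x in D) ((g x - complex.Im (f n x)) ^+ 2 * w x)%:E <= e%:E)%E.
  apply: part => [x y|x|n]; [by rewrite ImD ImN|by rewrite sqr_normc lerDr sqr_ge0|by case: (Lf n) => -[]].
pose g x := gR x +i* gI x.
have mg : cmeasurable D g by [].
have mgf n : cmeasurable D (fun x => g x - f n x).
  by apply: cmeasurableD => //; apply: cmeasurableN; case: (Lf n).
have H (e : R) : 0 < e -> exists N, forall n, (N <= n)%N -> (L2_integral mu D w (fun x => (g x - f n x)%R) <= e%:E)%E.
  move=> e0; have e2 : 0 < e / 2 by rewrite divr_gt0.
  have [N1 H1] := HR _ e2; have [N2 H2] := HI _ e2; exists (maxn N1 N2) => n; rewrite geq_max => /andP[n1 n2].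
  have -> : e = e / 2 + e / 2 by field.
  rewrite EFinD; apply: le_trans (leeD (H1 n n1) (H2 n n2)).
  have [fR fI] := (Lf n).1.
  rewrite -ge0_integralD//; first last.
  - by apply/measurable_EFinP/measurable_funM => //; apply: measurable_funX; exact: measurable_funB.
  - by move=> x Dx; rewrite lee_fin mulr_ge0 ?sqr_ge0 ?w_ge0.
  - by apply/measurable_EFinP/measurable_funM => //; apply: measurable_funX; exact: measurable_funB.
  - by move=> x Dx; rewrite lee_fin mulr_ge0 ?sqr_ge0 ?w_ge0.
  rewrite le_eqVlt; apply/orP; left; apply/eqP; apply: eq_integral => x _.
  by rewrite -EFinD -mulrDl sqr_normc ReD ImD ReN ImN.
have Lg : L2 g.
  have [N HN] := H 1 ltr01.
  have L1 : L2 (fun x => g x - f N x) by split=> //; apply: le_lt_trans (HN N (leqnn N)) _; rewrite ltry.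
  by have := L2D mD mw w_gt0 L1 (Lf N); under eq_fun do rewrite subrK.
exists g => // e e0; have [N HN] := H e e0; exists N => n /HN.
by rewrite -L2_sqnormE// ?lee_fin//; exact: L2B.
Qed.

Lemma L2_sqnorm_cvg g (f : nat -> T -> R[i]) : L2 g -> (forall n, L2 (f n)) ->
  (forall e : R, 0 < e -> exists N, forall n, (N <= n)%N -> sqn (fun x => g x - f n x) <= e) ->
  (fun n => sqn (f n)) @ \oo --> (sqn g : R).
Proof.
move=> Lg Lf H; have s0 := L2_sqnorm_ge0 mu w_gt0 g.
apply/cvgrPdist_le => e e0.
pose M := sqn g + 1; have M0 : 0 < M by rewrite ltr_wpDl.
(* With this [s] and [del], the squared distance is at most [e / 4] and the inner product at most
   [e / 8 + e / 8], for a total of [3 e / 4]. *)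
pose s := e / (8 * M); have s_gt0 : 0 < s by rewrite divr_gt0// mulr_gt0.
pose del := Num.min 1 (Num.min (e / 4) (s * e / 8)).
have del0 : 0 < del by rewrite !lt_min ltr01 !divr_gt0// mulr_gt0.
have [N HN] := H del del0; exists N => // n /= Nn; have := HN n Nn.
have Lb := L2B mD mw w_gt0 Lg (Lf n); set dn := sqn _ => dle.
have d0 : 0 <= dn := L2_sqnorm_ge0 mu w_gt0 _.
have [d1 d2 d3] : [/\ dn <= 1, dn <= e / 4 & dn <= s * e / 8].
  by move: dle; rewrite !le_min => /and3P.
have Lbn : L2 (fun x => -1 * (g x - f n x)) by exact: L2_Z.
have E : sqn (f n) = sqn g + dn + 2 * complex.Re (inner g (fun x => -1 * (g x - f n x))).
  transitivity (sqn (fun x => g x + -1 * (g x - f n x))).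
    by rewrite (_ : (fun x => g x + _) = f n)//; apply/funext => x; ring.
  rewrite L2_sqnormD//; congr (_ + _ + _); rewrite L2_sqnormZ//.
  by rewrite /= sqrrN expr1n oppr0 expr0n addr0 sqr_sqrtr ?ler01// mul1r.
have := normc_inner_le s_gt0 Lg Lbn; have := normr_Re_le (inner g (fun x => -1 * (g x - f n x))).
rewrite L2_sqnormZ// (_ : Normc.normc (-1) ^+ 2 = 1); last first.
  by rewrite /= sqrrN expr1n oppr0 expr0n addr0 sqr_sqrtr.
rewrite mul1r -/dn E => h1 h2.
have h3 : s * sqn g <= e / 8.
  apply: le_trans (_ : s * M <= _); first by apply: ler_wpM2l; [exact: ltW|rewrite lerDl].
  by rewrite /s le_eqVlt; apply/orP; left; apply/eqP; field; rewrite gt_eqF.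
have h4 : s^-1 * dn <= e / 8 by rewrite mulrC ler_pdivrMr//; lra.
rewrite ler_norml; move: h1; rewrite ler_norml => /andP[? ?]; apply/andP; split; lra.
Qed.

Section orthogonal_series.
Variables (m : nat -> T -> R[i]) (Lm : forall n, L2 (m n)).
Hypothesis om : forall i j, i != j -> inner (m i) (m j) = 0.

Definition partial_sum n x := \sum_(i < n) m i x.

Lemma L2_partial_sum n : L2 (partial_sum n).
Proof. by apply: L2_sum => // i _; exact: Lm. Qed.

Lemma partial_sumS n x : partial_sum n.+1 x = partial_sum n x + m n x.
Proof. by rewrite /partial_sum big_ord_recr. Qed.

Lemma inner_partial_sum n f : L2 f -> inner (partial_sum n) f = \sum_(i < n) inner (m i) f.
Proof.
move=> Lf; elim: n => [|n IH].
  rewrite big_ord0 /inner -[RHS](cintegral0 mu D); apply: eq_cintegral => x _.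
  by rewrite /partial_sum big_ord0 !mul0r.
rewrite big_ord_recr /= -IH; have := inner_linear 1 (L2_partial_sum n) (Lm n) Lf.
rewrite mul1r => <-.
have -> // : partial_sum n.+1 = (fun x => 1 * partial_sum n x + m n x).
by apply/funext => x; rewrite mul1r partial_sumS.
Qed.

Lemma sqnorm_partial_sumB n k : (n <= k)%N ->
  sqn (fun x => partial_sum k x - partial_sum n x) = \sum_(n <= i < k) sqn (m i).
Proof.
elim: k => [|k IH] nk.
  move: nk; rewrite leqn0 => /eqP ->; rewrite big_geq//.
  by apply/(L2_sqnorm_eq0 mD mw w_gt0); [exact: L2B (L2_partial_sum _) (L2_partial_sum _)|apply: aeW => x Dx; rewrite subrr].
move: nk; rewrite leq_eqVlt => /predU1P[->|].
  rewrite big_geq//.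
  by apply/(L2_sqnorm_eq0 mD mw w_gt0); [exact: L2B (L2_partial_sum _) (L2_partial_sum _)|apply: aeW => x Dx; rewrite subrr].
rewrite ltnS => nk; rewrite big_nat_recr//= -IH//.
have Lb := L2B mD mw w_gt0 (L2_partial_sum k) (L2_partial_sum n).
rewrite -L2_sqnorm_pythagoras//; first by congr sqn; apply/funext => x; rewrite partial_sumS addrAC.
have := inner_linear (-1) (L2_partial_sum n) (L2_partial_sum k) (Lm k).
rewrite !inner_partial_sum// !big1 ?mulr0 ?addr0.
- move=> <-.
  have -> // : (fun x => partial_sum k x - partial_sum n x) = (fun x => -1 * partial_sum n x + partial_sum k x).
  by apply/funext => x; rewrite mulN1r addrC.
- by move=> i _; apply: om; rewrite ltn_eqF.
- by move=> i _; apply: om; rewrite ltn_eqF// (leq_trans (ltn_ord i)).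
Qed.

Lemma sqnorm_partial_sum n : sqn (partial_sum n) = \sum_(0 <= i < n) sqn (m i).
Proof.
rewrite -sqnorm_partial_sumB//; congr sqn; apply/funext => x.
by rewrite /partial_sum big_ord0 subr0.
Qed.

Lemma orthogonal_series_cvg (B : R) : (forall n, \sum_(0 <= i < n) sqn (m i) <= B) ->
  exists g, [/\ L2 g,
    forall e : R, 0 < e -> exists N, forall n, (N <= n)%N -> sqn (fun x => g x - partial_sum n x) <= e &
    (\sum_(0 <= i <oo) (sqn (m i))%:E)%E = (sqn g)%:E].
Proof.
move=> HB; pose a n := \sum_(0 <= i < n) sqn (m i).
have m0 i : 0 <= sqn (m i) by exact: L2_sqnorm_ge0.
have nda : nondecreasing_seq a.
  by apply/nondecreasing_seqP => n; rewrite /a big_nat_recr//= lerDl.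
have ca : cvgn a.
  by apply: nondecreasing_is_cvgn => //; exists B => _ [n _ <-]; exact: HB.
have [g Lg Hg] : exists2 g, L2 g & forall e : R, 0 < e -> exists N, forall n, (N <= n)%N ->
     sqn (fun x => g x - partial_sum n x) <= e.
  apply: L2_complete; first exact: L2_partial_sum.
  move=> e e0; have /cvgrPdist_le/(_ e e0)[N _ HN] := ca; exists N.
  have H n k : (N <= n)%N -> (n <= k)%N -> sqn (fun x => partial_sum k x - partial_sum n x) <= e.
    move=> Nn nk; rewrite sqnorm_partial_sumB//.
    have -> : \sum_(n <= i < k) sqn (m i) = a k - a n.
      by rewrite /a (@big_cat_nat _ _ _ n 0 k)//= [RHS]addrC addKr.
    have := HN n Nn; rewrite ler_norml => /andP[_].
    by have := nondecreasing_cvgn_le nda ca k; lra.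
  move=> n k Nn Nk; have [nk|kn] := leqP n k; last by apply: H => //; exact: ltnW.
  rewrite (_ : sqn _ = sqn (fun x => -1 * (partial_sum k x - partial_sum n x))); last first.
    by congr sqn; apply/funext => x; ring.
  rewrite L2_sqnormZ//; last exact: L2B (L2_partial_sum _) (L2_partial_sum _).
  by rewrite /= sqrrN expr1n oppr0 expr0n addr0 sqr_sqrtr ?ler01// mul1r H.
exists g; split=> //.
have := L2_sqnorm_cvg Lg L2_partial_sum Hg; under eq_fun do rewrite sqnorm_partial_sum.
move=> cg; apply/cvg_lim => //.
under eq_fun do rewrite sumEFin.
by apply: cvg_EFin => //; exact: nearW.
Qed.

End orthogonal_series.
End L2_orthogonality.

(** * Modes and Parseval's identity *)

Section modes.
Context {R : realType}.
Local Notation leb := (@lebesgue_measure R).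
Local Notation Rm := (measurableTypeR R).
Local Notation J := (@angles R).
Implicit Types (k : int) (f g : espace R -> R[i]) (c : plane R -> R[i]).

Definition hat k f (p : plane R) : R[i] :=
  fourier_coefficient k (fun t => f (cartesian p.1 t p.2)).

Definition fourier_norm : R := (Num.sqrt (2 * pi))^-1.

(* The function [exp (i theta)], with the junk value [0] on the axis. *)
Definition phase (q : espace R) : R[i] := (q.1.1 / radius q) +i* (q.1.2 / radius q).

(** Negative powers use the conjugate instead of the inverse; the two agree off the axis, where
    [phase] has modulus 1. *)
Definition phasez k (q : espace R) : R[i] :=
  match k with Posz n => phase q ^+ n | Negz n => (phase q)^*%C ^+ n.+1 end.

(** The membership test makes the lift measurable on the whole space although [c] is measurable only
    on [Omega]. *)
Definition mode (Omega : set (plane R)) k c (q : espace R) : R[i] :=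
  (if ((radius q, q.2) : plane R) \in Omega then c (radius q, q.2) else 0) *
  (fourier_norm%:C * phasez k q).

Lemma fourier_norm_gt0 : 0 < fourier_norm.
Proof. by rewrite invr_gt0 sqrtr_gt0 mulr_gt0 ?pi_gt0. Qed.

Lemma sqr_fourier_norm : fourier_norm ^+ 2 * (2 * pi) = 1.
Proof.
rewrite exprVn sqr_sqrtr ?mulVf// ?mulf_neq0 ?gt_eqF ?pi_gt0//.
by rewrite mulr_ge0// pi_ge0.
Qed.

Lemma normc_real (x : R) : Normc.normc x%:C = `|x|.
Proof. by rewrite /= expr0n addr0 sqrtr_sqr. Qed.

Lemma hatE k f p : hat k f p =
  fourier_norm%:C * cintegral leb J (fun t => f (cyl (p, t)) * expi (- k%:~R * t)).
Proof. by rewrite /hat /fourier_coefficient; under eq_cintegral do rewrite -mulNr. Qed.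

Lemma expiX (n : nat) t : expi t ^+ n = expi (n%:R * t) :> R[i].
Proof.
elim: n => [|n IH]; first by rewrite expr0 mul0r expi0.
by rewrite exprS IH -expiD -natr1 mulrDl mul1r addrC.
Qed.

Lemma phasez_cyl k p t : 0 < p.1 -> phasez k (cyl (p, t)) = expi (k%:~R * t).
Proof.
move=> p0; have ph : phase (cyl (p, t)) = expi t.
  rewrite /phase /cyl radius_cartesian ?(ltW p0)//=.
  by rewrite ![p.1 * _]mulrC !mulfK// gt_eqF.
case: k => n; rewrite /phasez ph; first by rewrite expiX -pmulrn.
rewrite -expiN expiX NegzE mulrNz -pmulrn; congr expi; ring.
Qed.

Lemma mode_cyl (Omega : set (plane R)) k c p t : Omega p -> 0 < p.1 ->
  mode Omega k c (cyl (p, t)) = c p * (fourier_norm%:C * expi (k%:~R * t)).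
Proof.
move=> Op p0; rewrite /mode phasez_cyl// /cyl radius_cartesian ?(ltW p0)//= -surjective_pairing.
by rewrite mem_set.
Qed.

Lemma measurable_radius : measurable_fun setT (@radius R).
Proof.
apply: (measurableT_comp (f := @Num.sqrt R : Rm -> Rm)).
  by apply: continuous_measurable_fun; exact: sqrt_continuous.
have mx : measurable_fun setT (fun q : espace R => q.1.1 : Rm).
  by apply: (measurableT_comp (f := fst)); [exact: measurable_fst|exact: measurable_fst].
have my : measurable_fun setT (fun q : espace R => q.1.2 : Rm).
  by apply: (measurableT_comp (f := snd)); [exact: measurable_snd|exact: measurable_fst].
by apply: measurable_funD; exact: measurable_funX.
Qed.

Lemma cmeasurable_phase : cmeasurable setT phase.
Proof.
have mx : measurable_fun setT (fun q : espace R => q.1.1 : R).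
  by apply: (measurableT_comp (f := fst)); [exact: measurable_fst|exact: measurable_fst].
have my : measurable_fun setT (fun q : espace R => q.1.2 : R).
  by apply: (measurableT_comp (f := snd)); [exact: measurable_snd|exact: measurable_fst].
have mi : measurable_fun setT (fun q : espace R => (radius q)^-1).
  under eq_fun do rewrite -powR_inv1 ?sqrtr_ge0//.
  by apply: (measurableT_comp (f := (@powR R)^~ (-1))); [exact: measurable_powR|exact: measurable_radius].
by split; exact: measurable_funM.
Qed.

Lemma cmeasurableX {d} {T : measurableType d} (D : set T) (f : T -> R[i]) n :
  cmeasurable D f -> cmeasurable D (fun x => f x ^+ n).
Proof.
move=> mf; elim: n => [|n IH]; first exact: cmeasurable_cst.
by under eq_fun do rewrite exprS; exact: cmeasurableM.
Qed.

Lemma cmeasurable_phasez k : cmeasurable setT (phasez k).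
Proof.
case: k => n; rewrite /phasez; first exact: cmeasurableX cmeasurable_phase.
by apply: cmeasurableX; apply: cmeasurable_conj; exact: cmeasurable_phase.
Qed.

Lemma cmeasurable_mode (Omega : set (plane R)) (D : set (espace R)) k c : measurable Omega ->
  cmeasurable Omega c -> cmeasurable D (mode Omega k c).
Proof.
move=> mO [cR cI].
have cE : cmeasurable setT (fun p : plane R => if p \in Omega then c p else 0).
  split.
    have := (measurable_restrictT _ mO).1 cR; congr measurable_fun; apply/funext => p.
    by rewrite patchE; case: ifP.
  have := (measurable_restrictT _ mO).1 cI; congr measurable_fun; apply/funext => p.
  by rewrite patchE; case: ifP.
have mr : measurable_fun setT (fun q : espace R => (radius q, q.2) : plane R).
  by apply/measurable_fun_pair; [exact: measurable_radius|exact: measurable_snd].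
have sub (h : espace R -> R[i]) : cmeasurable setT h -> cmeasurable D h.
  by move=> [? ?]; split; exact: measurable_funTS.
apply: sub; apply: cmeasurableM.
  by case: cE => [h1 h2]; split; [exact: measurableT_comp h1 mr|exact: measurableT_comp h2 mr].
by apply: cmeasurableZ; exact: cmeasurable_phasez.
Qed.

End modes.

Section int_enumeration.

(** An enumeration of the frequencies, needed to form partial sums of modes. *)
Definition nat_of_int (k : int) : nat := match k with Posz n => n.*2 | Negz n => n.*2.+1 end.
Definition int_of_nat (n : nat) : int := if odd n then Negz n./2 else Posz n./2.

Lemma int_of_natK : cancel int_of_nat nat_of_int.
Proof.
move=> n; rewrite /int_of_nat -[RHS]odd_double_half.
by case: (odd n) => /=; rewrite ?doubleK.
Qed.

Lemma nat_of_intK : cancel nat_of_int int_of_nat.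
Proof.
by case=> n; rewrite /int_of_nat /= ?odd_double /= ?doubleK//= uphalf_double.
Qed.

Lemma int_of_nat_inj : injective int_of_nat.
Proof. exact: can_inj int_of_natK. Qed.

Lemma esum_int {R : realType} (a : int -> \bar R) : (forall k, 0 <= a k)%E ->
  (\esum_(k in [set: int]) a k = \sum_(0 <= n <oo) a (int_of_nat n))%E.
Proof.
move=> a0; rewrite nneseries_esumT//; apply: reindex_esum; split=> //.
  by move=> n m _ _; exact: int_of_nat_inj.
by move=> k _; exists (nat_of_int k) => //; exact: nat_of_intK.
Qed.

End int_enumeration.

Section circle_bessel.
Context {R : realType}.
Local Notation leb := (@lebesgue_measure R).
Local Notation Rm := (measurableTypeR R).
Local Notation J := (@angles R).

Let mJ := @measurable_angles R.
Let m1 : measurable_fun J (fun=> 1 : R). Proof. by []. Qed.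
Let w1 (t : Rm) : J t -> (0 : R) < 1. Proof. by []. Qed.

Lemma angles_finite : leb J = (2 * pi)%:E.
Proof.
have pi0 := pi_gt0 R.
rewrite lebesgue_measure_itv /= lte_fin ifT; last by lra.
by rewrite -EFinB; congr EFin; ring.
Qed.

Definition circle_basis (k : int) (t : R) : R[i] := fourier_norm%:C * expi (k%:~R * t).

Lemma sqr_normc_circle_basis k t : Normc.normc (circle_basis k t) ^+ 2 = fourier_norm ^+ 2.
Proof. by rewrite Normc.normcM normc_expi mulr1 normc_real ger0_norm// ltW// fourier_norm_gt0. Qed.

Lemma L2_circle_basis k : L2 leb J (fun=> 1) (circle_basis k).
Proof.
split; first by apply: cmeasurableZ; exact: cmeasurable_expi.
rewrite /L2_integral; under eq_integral do rewrite sqr_normc_circle_basis mulr1.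
by rewrite integral_cst//= angles_finite -EFinM ltry.
Qed.

Lemma L2_sqnorm_circle_basis k : L2_sqnorm leb J (fun=> 1) (circle_basis k) = 1.
Proof.
rewrite /L2_sqnorm /L2_integral; under eq_integral do rewrite sqr_normc_circle_basis mulr1.
by rewrite integral_cst//= angles_finite -EFinM /= sqr_fourier_norm.
Qed.

Lemma inner_circle_basis f k : L2 leb J (fun=> 1) f ->
  inner leb J (fun=> 1) f (circle_basis k) =
  fourier_norm%:C * cintegral leb J (fun t => f t * expi (- k%:~R * t)).
Proof.
move=> Lf; have := L2_inner_integrable mJ m1 w1 Lf (L2_circle_basis k).
have E t : f t * (circle_basis k t)^*%C * (1 : R)%:C = fourier_norm%:C * (f t * expi (- k%:~R * t)).
  rewrite /circle_basis mulr1 mulNr expiN; case: (expi _) => a b; case: (f t) => c e.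
  by apply: complexE2 => /=; ring.
under eq_fun do rewrite E.
move=> /(cintegrableZ mJ (fourier_norm^-1)%:C).
have nf : fourier_norm != 0 :> R by rewrite gt_eqF// fourier_norm_gt0.
have c1 : (fourier_norm^-1)%:C * (fourier_norm : R)%:C = 1 by rewrite -real_complexM mulVf.
under eq_fun do rewrite mulrA c1 mul1r.
by move=> fe; rewrite /inner -(cintegralZ mJ _ fe); apply: eq_cintegral => t _.
Qed.

(** Bessel's inequality for one coefficient [a]: the squared norm of [f - a e_k] is nonnegative.
    Measurability suffices, an infinite right-hand side being allowed, so that it applies to every
    slice. *)
Lemma bessel1 (f : R -> R[i]) (k : int) : cmeasurable J f ->
  ((Normc.normc (fourier_norm%:C * cintegral leb J (fun t => f t * expi (- k%:~R * t))) ^+ 2)%:E <=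
   \int[leb]_(t in J) (Normc.normc (f t) ^+ 2)%:E)%E.
Proof.
move=> mf; have -> : (\int[leb]_(t in J) (Normc.normc (f t) ^+ 2)%:E = L2_integral leb J (fun=> 1%R) f)%E.
  by apply: eq_integral => t _; rewrite mulr1.
have [foo|] := ltP (L2_integral leb J (fun=> 1) f) +oo%E; last by move=> /(le_trans _); apply; rewrite leey.
have Lf : L2 leb J (fun=> 1) f by [].
have Lb := L2_circle_basis k; rewrite -(inner_circle_basis _ Lf) -(L2_sqnormE w1 Lf) lee_fin.
set a := inner _ _ _ _ _.
have Lab : L2 leb J (fun=> 1) (fun t => - a * circle_basis k t) by exact: L2_Z.
have := L2_sqnorm_ge0 leb w1 (fun t => f t + - a * circle_basis k t).
rewrite (L2_sqnormD mJ m1 w1 Lf Lab) (L2_sqnormZ mJ m1 w1 _ Lb) L2_sqnorm_circle_basis.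
rewrite (inner_conj mJ m1 w1 Lab Lf).
have := inner_linear mJ m1 w1 (- a) Lb (L2_0 leb J (fun=> 1)) Lf.
have -> : (fun x => - a * circle_basis k x + 0) = (fun t => - a * circle_basis k t).
  by apply/funext => t; rewrite addr0.
move=> ->; rewrite (inner_conj mJ m1 w1 Lf Lb) -/a.
have -> : inner leb J (fun=> 1) (fun=> 0) f = 0.
  by rewrite /inner -[RHS](cintegral0 leb J); apply: eq_cintegral => t _; rewrite !mul0r.
rewrite !sqr_normc; case: (a) => x y /=; lra.
Qed.

End circle_bessel.

Section scalar_modes.
Context {R : realType}.
Local Notation leb := (@lebesgue_measure R).
Local Notation Rm := (measurableTypeR R).
Local Notation J := (@angles R).
Variables (Omega : set (plane R)) (Obreve : set (espace R)).
Hypotheses (rev : revolved Omega Obreve) (Obreve_finite : (leb3 R Obreve < +oo)%E).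
Implicit Types (k : int) (f g : espace R -> R[i]) (c : plane R -> R[i]) (p : plane R).

Local Notation L2esp := (L2 (leb3 R) Obreve (fun=> 1)).
Local Notation L2pl := (L2 (leb2 R) Omega (@wpos R)).
Local Notation sqD := (L2_sqnorm (leb3 R) Obreve (fun=> 1)).
Local Notation sqO := (sqL2p Omega).
Local Notation hat := (@hat R).
Local Notation mode := (mode Omega).

Let mO : measurable Omega := revolved_measurable_plane rev.
Let mD : measurable Obreve := revolved_measurable_espace rev.
Let mJ := @measurable_angles R.
Let m1D : measurable_fun Obreve (fun=> 1 : R). Proof. by []. Qed.
Let w1D (x : espace R) : Obreve x -> (0 : R) < 1. Proof. by []. Qed.
Let mwp : measurable_fun Omega (@wpos R). Proof. by apply: measurable_funTS; exact: measurable_fst. Qed.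
Let wp0 p : Omega p -> 0 < wpos p. Proof. exact: (revolved_pos rev). Qed.

Let slice f p : cmeasurable Obreve f -> Omega p -> cmeasurable J (fun t => f (cyl (p, t))).
Proof.
move=> /(cmeasurable_cyl rev)[fR fI] Op; split.
  exact: (measurable_slice1 mO mJ fR Op).
exact: (measurable_slice1 mO mJ fI Op).
Qed.

Lemma L2_espace_integrable f : L2esp f -> cintegrable (leb3 R) Obreve f.
Proof.
move=> Lf; have Lc : L2esp (fun=> 1).
  split; first exact: cmeasurable_cst.
  rewrite /L2_integral; under eq_integral do rewrite mulr1.
  rewrite integral_cst//= lte_mul_pinfty ?lee_fin ?sqr_ge0//.
have := L2_inner_integrable mD m1D w1D Lf Lc; apply: (eq_cintegrable mD) => x _.
by case: (f x) => a b; apply: complexE2 => /=; ring.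
Qed.

Lemma cintegrable_cyl_expi f (a : R) : L2esp f ->
  cintegrable (sleb2 \x leb)%E (Omega `*` J) (fun w => f (cyl w) * expi (a * w.2) * (w.1.1)%:C).
Proof.
move=> Lf; have fi := (cintegrable_cyl rev Lf.1).1 (L2_espace_integrable Lf).
have mX := measurable_revolvedX rev.
apply: (cintegrable_le mX _ (cintegrable_normc mX fi)).
  apply: cmeasurableM; last by apply: cmeasurableC; exact: measurable_fst1.
  apply: cmeasurableM; first exact: (cmeasurable_cyl rev Lf.1).
  have [h1 h2] := @cmeasurable_expi R setT a.
  split; apply: measurable_funTS.
    exact: measurableT_comp h1 (measurable_snd).
  exact: measurableT_comp h2 (measurable_snd).
by move=> w _; rewrite !Normc.normcM normc_expi mulr1.
Qed.

(** Slices are integrable only for almost every meridian point, whereas measurability of [hat] needs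
    an identity at every point. Hence [h] may fail to be integrable, and the default values taken
    for infinite integrals must be examined. *)
Let scale_integral (h : R -> R) (r : R) : measurable_fun J (h : Rm -> R) -> 0 < r ->
  \int[leb]_(t in J) (h t * r) = (\int[leb]_(t in J) h t) * r.
Proof.
move=> mh r0; rewrite /Rintegral.
have mh' : measurable_fun J (EFin \o h : Rm -> \bar R) by exact/measurable_EFinP.
have -> : (\int[leb]_(t in J) (h t * r)%:E = (\int[leb]_(t in J) (h t)%:E) * r%:E)%E.
  have e1 := @integralE _ _ _ leb J (fun t => (h t)%:E).
  have e2 := @integralE _ _ _ leb J (fun t => (h t * r)%:E).
  rewrite e1 e2.
  have P : (\int[leb]_(t in J) ((fun t => (h t * r)%:E)^\+ t) = (\int[leb]_(t in J) ((fun t => (h t)%:E)^\+ t)) * r%:E)%E.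
    rewrite -ge0_integralZr ?lee_fin ?(ltW r0)//; last by apply: measurable_funepos.
    apply: eq_integral => t _; rewrite !funeposE EFinM -[X in maxe _ X](mul0e r%:E) maxe_pMl ?lee_fin ?ltW//.
  have N : (\int[leb]_(t in J) ((fun t => (h t * r)%:E)^\- t) = (\int[leb]_(t in J) ((fun t => (h t)%:E)^\- t)) * r%:E)%E.
    rewrite -ge0_integralZr ?lee_fin ?(ltW r0)//; last by apply: measurable_funeneg.
    apply: eq_integral => t _; rewrite !funenegE EFinM -mulNe -[X in maxe _ X](mul0e r%:E) maxe_pMl ?lee_fin ?ltW//.
  rewrite P N.
  have : (0 <= \int[leb]_(t in J) ((fun t => (h t)%:E)^\+ t))%E by exact: integral_ge0.
  have : (0 <= \int[leb]_(t in J) ((fun t => (h t)%:E)^\- t))%E by exact: integral_ge0.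
  case: (integral _ _ _) => [x||]//; case: (integral _ _ _) => [y||]// _ _.
  - exact: (congr1 EFin (esym (mulrBl r y x))).
  - by rewrite mulyr gtr0_sg// mul1e.
  - by rewrite !mulyr gtr0_sg// mul1e /= mulNyr gtr0_sg// mul1e.
  - by rewrite !mulyr gtr0_sg// !mul1e /= mulNyr gtr0_sg// mul1e.
by case: (integral _ _ _) => [x||] //=; rewrite ?mulyr ?mulNyr gtr0_sg ?mul1e//= mul0r.
Qed.

Lemma hat_scale f k p : cmeasurable Obreve f -> Omega p ->
  cintegral leb J (fun t => f (cyl (p, t)) * expi (- k%:~R * t) * (p.1)%:C) =
  cintegral leb J (fun t => f (cyl (p, t)) * expi (- k%:~R * t)) * (p.1)%:C.
Proof.
move=> mf Op; have p0 := revolved_pos rev Op.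
have [hR hI] : cmeasurable J (fun t => f (cyl (p, t)) * expi (- k%:~R * t)).
  by apply: cmeasurableM; [exact: slice|exact: cmeasurable_expi].
apply: complexE2; rewrite ?ReM ?ImM /= ?mulr0 ?subr0 ?add0r.
  rewrite -(scale_integral hR p0); apply: eq_Rintegral => t _.
  by rewrite ReM /= mulr0 subr0.
rewrite -(scale_integral hI p0); apply: eq_Rintegral => t _.
by rewrite ImM /= mulr0 add0r.
Qed.

(** Fubini's theorem gives measurability of [r] times the coefficient; the factor is then divided
    out. *)
Lemma cmeasurable_hat f k : L2esp f -> cmeasurable Omega (hat k f).
Proof.
move=> Lf; have ci := cintegrable_slice1 mO mJ (cintegrable_cyl_expi (- k%:~R) Lf).
have mr : cmeasurable Omega (fun p : plane R => (p.1^-1)%:C).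
  apply: cmeasurableC.
  apply: (@eq_measurable_fun _ _ _ _ _ (fun p : plane R => p.1 `^ (-1))).
    by move=> p /[!inE] /(revolved_pos rev) /ltW; exact: powR_inv1.
  apply: measurable_funTS.
  by apply: (measurableT_comp (f := (@powR R)^~ (-1))); [exact: measurable_powR|exact: measurable_fst].
have := cmeasurableM (cmeasurableZ (fourier_norm%:C) (cintegrable_cmeasurable ci)) mr.
apply: eq_cmeasurable => p Op; rewrite hatE.
rewrite (_ : cintegral leb J (fun t => f (cyl (p, t)) * expi (- k%:~R * (p, t).2) * ((p, t).1.1)%:C) =
  cintegral leb J (fun t => f (cyl (p, t)) * expi (- k%:~R * t)) * (p.1)%:C); last first.
  exact: (hat_scale _ Lf.1).
have p0 := revolved_pos rev Op.
by rewrite -!mulrA -real_complexM mulfV ?mulr1// gt_eqF.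
Qed.

Lemma ae_slice_integrable f (a : R) : L2esp f ->
  {ae leb2 R, forall p, Omega p -> cintegrable leb J (fun t => f (cyl (p, t)) * expi (a * t))}.
Proof.
move=> Lf; have := ae_cintegrable_slice1 mO mJ (cintegrable_cyl_expi a Lf).
apply: filterS => p h Op; have p0 := revolved_pos rev Op.
have := cintegrableZ mJ (p.1^-1)%:C (h Op); apply: (eq_cintegrable mJ) => t _ /=.
by rewrite mulrCA -real_complexM mulVf ?mulr1// gt_eqF.
Qed.

Lemma L2_integral_slice f : cmeasurable Obreve f -> measurable_fun Omega
  (fun p => (\int[leb]_(t in J) (Normc.normc (f (cyl (p, t))) ^+ 2)%:E * (p.1)%:E)%E).
Proof.
move=> mf; apply: emeasurable_funM; last by apply/measurable_EFinP; exact: mwp.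
apply: (@measurable_tonelli_dom1 _ _ _ _ _ leb Omega J mO mJ (fun w => (Normc.normc (f (cyl w)) ^+ 2)%:E)).
  by apply/measurable_EFinP/measurable_sqr_normc; exact: (cmeasurable_cyl rev mf).
by move=> x y _ _; rewrite lee_fin sqr_ge0.
Qed.

Lemma L2_hat f k : L2esp f -> L2pl (hat k f) /\ sqO (hat k f) <= sqD f.
Proof.
move=> Lf; have mh := cmeasurable_hat k Lf.
have H : (L2_integral (leb2 R) Omega (@wpos R) (hat k f) <= L2_integral (leb3 R) Obreve (fun=> 1%R) f)%E.
  rewrite (L2_integral_cyl rev Lf.1); apply: ge0_le_integral => //.
  - by move=> p /wp0 /ltW p0; rewrite lee_fin mulr_ge0// sqr_ge0.
  - by apply/measurable_EFinP; exact: measurable_L2_integrand.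
  - exact: (L2_integral_slice Lf.1).
  - move=> p Op; rewrite EFinM hatE; apply: lee_wpmul2r; first by rewrite lee_fin ltW// wp0.
    exact/bessel1/slice/Op/Lf.1.
have Lh : L2pl (hat k f) by split=> //; apply: le_lt_trans H Lf.2.
split=> //; rewrite -lee_fin (L2_sqnormE wp0 Lh) (L2_sqnormE w1D Lf); exact: H.
Qed.

(** Only almost everywhere: on a slice that is not integrable the integral takes a default value. *)
Lemma hat_linear k (a : R[i]) f g : L2esp f -> L2esp g ->
  hat k (fun x => a * f x + g x) = (fun p => a * hat k f p + hat k g p) %[ae leb2 R in Omega].
Proof.
move=> Lf Lg; apply: filterS2 (ae_slice_integrable (- k%:~R) Lf) (ae_slice_integrable (- k%:~R) Lg).
move=> p h1 h2 Op; have fi := h1 Op; have gi := h2 Op; rewrite !hatE mulrCA -mulrDr; congr (_ * _).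
rewrite -(cintegralZ mJ a fi) -(cintegralD mJ (cintegrableZ mJ a fi) gi).
by apply: eq_cintegral => t _; rewrite mulrDl mulrA.
Qed.

Lemma hat_mode j k c p : Omega p -> hat j (mode k c) p = if j == k then c p else 0.
Proof.
move=> Op; have p0 := revolved_pos rev Op; rewrite hatE.
have E : cintegral leb J (fun t => expi ((k - j)%:~R * t)) = if j == k then (2 * pi)%:C else 0.
  by rewrite cintegral_expi subr_eq0 eq_sym.
have ci : cintegrable leb J (fun t => expi ((k - j)%:~R * t)).
  apply: (cintegrable_le mJ (cmeasurable_expi _ _) (g := cst 1)) => [|t _]; last by rewrite normc_expi.
  apply/integrableP; split; first exact/measurable_EFinP.
  under eq_integral do rewrite /= normr1.
  by rewrite integral_cst//= angles_finite mul1e ltry.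
transitivity (fourier_norm%:C * cintegral leb J (fun t => (c p * fourier_norm%:C) * expi ((k - j)%:~R * t))).
  congr (_ * _); apply: eq_cintegral => t _; rewrite (mode_cyl _ _ _ Op p0) -!mulrA -expiD.
  by congr (_ * (_ * expi _)); rewrite rmorphB /=; ring.
rewrite (cintegralZ mJ _ ci) E; case: eqP => _; last by rewrite !mulr0.
rewrite mulrC -!mulrA -!real_complexM.
rewrite (_ : fourier_norm * (2 * pi * fourier_norm) = 1) ?mulr1//.
by transitivity (@fourier_norm R ^+ 2 * (2 * pi)); [ring|exact: sqr_fourier_norm].
Qed.

Lemma L2_mode k c : L2pl c -> L2esp (mode k c) /\ sqD (mode k c) = sqO c.
Proof.
move=> Lc; have mm := @cmeasurable_mode _ _ Obreve k _ mO Lc.1.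
have E : L2_integral (leb3 R) Obreve (fun=> 1) (mode k c) = L2_integral (leb2 R) Omega (@wpos R) c.
  rewrite (L2_integral_cyl rev mm); apply: eq_integral => p /[!inE] Op.
  have p0 := revolved_pos rev Op.
  under eq_integral do rewrite (mode_cyl _ _ _ Op p0) !Normc.normcM normc_expi mulr1 normc_real.
  rewrite integral_cst//= angles_finite -!EFinM; congr (_ * _)%:E.
  by rewrite exprMn (ger0_norm (ltW fourier_norm_gt0)) -mulrA sqr_fourier_norm mulr1.
by split; [split=> //; rewrite E; exact: Lc.2|rewrite /sqL2p /L2_sqnorm E].
Qed.

Lemma inner_mode k f c : L2esp f -> L2pl c ->
  inner (leb3 R) Obreve (fun=> 1) f (mode k c) = inner (leb2 R) Omega (@wpos R) (hat k f) c.
Proof.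
move=> Lf Lc; have [Lm _] := L2_mode k Lc.
have ii := L2_inner_integrable mD m1D w1D Lf Lm.
have iO := L2_inner_integrable mO mwp wp0 (L2_hat k Lf).1 Lc.
have mi := cintegrable_cmeasurable ii.
rewrite /inner (cintegral_cyl rev mi).
have ci := (cintegrable_cyl rev mi).1 ii.
rewrite (cintegral_slice1 mO mJ ci); apply: ae_eq_cintegral => //.
- exact: cintegrable_cmeasurable (cintegrable_slice1 mO mJ ci).
- exact: cintegrable_cmeasurable iO.
apply: filterS (ae_slice_integrable (- k%:~R) Lf) => p h Op; have fi := h Op.
have p0 := revolved_pos rev Op; rewrite hatE.
transitivity (cintegral leb J (fun t => (fourier_norm%:C * (c p)^*%C * (p.1)%:C) * (f (cyl (p, t)) * expi (- k%:~R * t)))).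
  apply: eq_cintegral => t _; rewrite (mode_cyl _ _ _ Op p0) /= mulr1 mulNr expiN.
  case: (f _) => x y; case: (c p) => u v; rewrite /expi; apply: complexE2 => /=; ring.
rewrite (cintegralZ mJ _ fi); ring.
Qed.

(** There are countably many frequencies, so on almost every slice all coefficients vanish together
    and [fourier_unique] applies. *)
Lemma hat_eq0 f : L2esp f -> (forall k, hat k f = (fun=> 0) %[ae leb2 R in Omega]) ->
  f = (fun=> 0) %[ae leb3 R in Obreve].
Proof.
move=> Lf f0; apply: (L2_integral_eq0 (leb3 R) mD m1D w1D Lf.1).1.
have h0 : {ae leb2 R, forall p, forall n, Omega p -> hat (int_of_nat n) f p = 0}.
  by apply: ae_foralln => n; exact: f0.
rewrite (L2_integral_cyl rev Lf.1) -[RHS](integral0 sleb2 Omega).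
apply: ge0_ae_eq_integral => //.
- exact: (L2_integral_slice Lf.1).
- by move=> p /wp0 /ltW p0; rewrite mule_ge0 ?lee_fin// integral_ge0// => t _; rewrite lee_fin sqr_ge0.
apply: filterS2 h0 (ae_slice_integrable 0 Lf) => p z fi Op.
have fn : fourier_null (fun t => f (cyl (p, t))).
  split; first by move: (fi Op); under eq_fun do rewrite mul0r expi0 mulr1.
  move=> k; have := z (nat_of_int k) Op; rewrite nat_of_intK hatE => /eqP.
  rewrite mulf_eq0 => /orP[|/eqP E].
    by rewrite eq_complex /= eqxx andbT gt_eqF// fourier_norm_gt0.
  by rewrite -[RHS]E; apply: eq_cintegral => t _; rewrite mulNr.
rewrite (_ : integral leb J _ = 0%E) ?mul0e//.
rewrite -[RHS](integral0 leb J); apply: ge0_ae_eq_integral => //.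
- exact/measurable_EFinP/measurable_sqr_normc/slice/Op/Lf.1.
- by move=> t _; rewrite lee_fin sqr_ge0.
- by apply: filterS (fourier_unique fn) => t + Jt => /(_ Jt) ->; rewrite Normc.normc0 expr0n.
Qed.

(** Follows from the norm bound of [L2_hat] applied to the difference, without slicing the
    exceptional null set. *)
Lemma ae_eq_hat k f g : L2esp f -> L2esp g -> f = g %[ae leb3 R in Obreve] ->
  hat k f = hat k g %[ae leb2 R in Omega].
Proof.
move=> Lf Lg fg; have Ld : L2esp (fun x => -1 * f x + g x).
  by apply: (L2D mD m1D w1D); [exact: L2_Z|].
have d0 : sqD (fun x => -1 * f x + g x) = 0.
  apply/(L2_sqnorm_eq0 mD m1D w1D Ld); apply: filterS fg => x + Dx => /(_ Dx) ->.
  by rewrite mulN1r addNr.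
have [Lh] := L2_hat k Ld; rewrite d0 => h0.
have : sqO (hat k (fun x => -1 * f x + g x)) = 0.
  by apply/eqP; rewrite eq_le h0 (L2_sqnorm_ge0 _ wp0).
move/(L2_sqnorm_eq0 mO mwp wp0 Lh) => z.
apply: filterS2 z (hat_linear k (-1) Lf Lg) => p h1 h2 Op.
by have := h2 Op; rewrite h1// mulN1r addrC => /esym/eqP; rewrite subr_eq0 => /eqP.
Qed.

Lemma inner_modes j k c c' : L2pl c -> L2pl c' -> j != k ->
  inner (leb3 R) Obreve (fun=> 1) (mode j c) (mode k c') = 0.
Proof.
move=> Lc Lc' jk; rewrite inner_mode//; last by have [] := L2_mode j Lc.
rewrite /inner -[RHS](cintegral0 (leb2 R) Omega); apply: eq_cintegral => p Op.
by rewrite hat_mode// eq_sym (negbTE jk) !mul0r.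
Qed.

Section riesz_fischer.
Variables (c : int -> plane R -> R[i]) (Lc : forall k, L2pl (c k)).

Definition mode_seq n := mode (int_of_nat n) (c (int_of_nat n)).
Definition mode_sum := partial_sum mode_seq.

Let Lms n : L2esp (mode_seq n).
Proof. by have [] := L2_mode (int_of_nat n) (Lc (int_of_nat n)). Qed.

Let orth i j : i != j -> inner (leb3 R) Obreve (fun=> 1) (mode_seq i) (mode_seq j) = 0.
Proof. by move=> ij; apply: inner_modes => //; rewrite (inj_eq int_of_nat_inj). Qed.

Lemma L2_mode_sum n : L2esp (mode_sum n).
Proof. exact: (L2_partial_sum mD m1D w1D Lms). Qed.

Lemma hat_mode_sum k n :
  hat k (mode_sum n) = (fun p => if (nat_of_int k < n)%N then c k p else 0) %[ae leb2 R in Omega].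
Proof.
elim: n => [|n IH].
  have z : sqO (hat k (mode_sum 0)) = 0.
    apply/eqP; rewrite eq_le (L2_sqnorm_ge0 _ wp0) andbT.
    apply: le_trans (L2_hat k (L2_mode_sum 0)).2 _.
    by rewrite (sqnorm_partial_sum mD m1D w1D Lms orth) big_geq.
  have := (L2_sqnorm_eq0 mO mwp wp0 (L2_hat k (L2_mode_sum 0)).1).1 z.
  by apply: filterS => p.
have := hat_linear k 1 (L2_mode_sum n) (Lms n).
have -> : (fun x => 1 * mode_sum n x + mode_seq n x) = mode_sum n.+1.
  by apply/funext => x; rewrite mul1r /mode_sum partial_sumS.
move=> h; apply: filterS2 IH h => p h1 h2 Op; rewrite h2// h1// mul1r hat_mode// ltnS.
have -> : (k == int_of_nat n) = (nat_of_int k == n).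
  by apply/eqP/eqP => [->|<-]; rewrite ?int_of_natK ?nat_of_intK.
case: ltngtP => [_|_|<-]; rewrite ?addr0// add0r.
by rewrite nat_of_intK.
Qed.

(** Modes of different frequencies are orthogonal, so the series converges. Its coefficients are the
    prescribed ones because [hat k] is bounded in norm and stationary along the partial sums. *)
Lemma riesz_fischer : (\esum_(k in [set: int]) (sqO (c k))%:E < +oo)%E ->
  exists f, [/\ L2esp f,
    forall e : R, 0 < e -> exists N, forall n, (N <= n)%N -> sqD (fun x => f x - mode_sum n x) <= e,
    forall k, hat k f = c k %[ae leb2 R in Omega] &
    (\esum_(k in [set: int]) (sqO (c k))%:E)%E = (sqD f)%:E].
Proof.
have c0 k : (0 <= (sqO (c k))%:E)%E by rewrite lee_fin (L2_sqnorm_ge0 _ wp0).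
rewrite esum_int// => foo; set S := (\sum_(0 <= n <oo) _)%E in foo.
have SE : S = (fine S)%:E by rewrite fineK// ge0_fin_numE// nneseries_ge0.
have sE n : sqD (mode_seq n) = sqO (c (int_of_nat n)).
  by have [] := L2_mode (int_of_nat n) (Lc (int_of_nat n)).
have HB n : \sum_(0 <= i < n) sqD (mode_seq i) <= fine S.
  rewrite -lee_fin -SE -sumEFin; under eq_bigr do rewrite sE.
  exact: nneseries_lim_ge.
have [f [Lf cf Ef]] := orthogonal_series_cvg mD m1D w1D Lms orth HB.
exists f; split=> //; last by rewrite -Ef; apply: eq_eseriesr => n _; rewrite sE.
move=> k; have Lh := (L2_hat k Lf).1.
have Ld : L2pl (fun p => -1 * c k p + hat k f p) by apply: (L2D mO mwp wp0); [exact: L2_Z|].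
have : sqO (fun p => -1 * c k p + hat k f p) = 0.
  apply/eqP; rewrite eq_le (L2_sqnorm_ge0 _ wp0) andbT.
  apply/ler_addgt0Pl => e e0; rewrite addr0; have [N HN] := cf e e0.
  (* The successor ensures that the mode of frequency [k] has entered the partial sum. *)
  pose n := (maxn N (nat_of_int k).+1).
  have Ln : L2esp (fun x => -1 * mode_sum n x + f x).
    by apply: (L2D mD m1D w1D); [apply: L2_Z => //; exact: L2_mode_sum|].
  apply: le_trans (_ : sqO (hat k (fun x => -1 * mode_sum n x + f x)) <= e).
    rewrite le_eqVlt; apply/orP; left; apply/eqP; rewrite /sqL2p /L2_sqnorm; congr fine.
    apply: (ae_eq_L2_integral mO mwp wp0); [exact: Ld.1|exact: (L2_hat k Ln).1.1|].
    apply: filterS2 (hat_mode_sum k n) (hat_linear k (-1) (L2_mode_sum n) Lf) => p h1 h2 Op.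
    by rewrite h2// h1// leq_maxr.
  apply: le_trans (L2_hat k Ln).2 _; apply: le_trans (HN n (leq_maxl _ _)).
  by rewrite (_ : (fun x => -1 * mode_sum n x + f x) = (fun x => f x - mode_sum n x))//; apply/funext => x; ring.
move/(L2_sqnorm_eq0 mO mwp wp0 Ld); apply: filterS => p + Op => /(_ Op).
by rewrite mulN1r addrC => /eqP; rewrite subr_eq0 => /eqP.
Qed.

End riesz_fischer.

(** The sum of the first [n] modes of [f] is orthogonal to the remainder, so its squared norm cannot
    exceed that of [f]. *)
Lemma sum_hat_le f n : L2esp f -> \sum_(0 <= i < n) sqO (hat (int_of_nat i) f) <= sqD f.
Proof.
move=> Lf; pose c k := hat k f; have Lc k : L2pl (c k) := (L2_hat k Lf).1.
have Lms i : L2esp (mode_seq c i) by have [] := L2_mode (int_of_nat i) (Lc (int_of_nat i)).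
have orth i j : i != j -> inner (leb3 R) Obreve (fun=> 1) (mode_seq c i) (mode_seq c j) = 0.
  by move=> ij; apply: inner_modes => //; rewrite (inj_eq int_of_nat_inj).
have Ls := L2_mode_sum Lc n.
have E : \sum_(0 <= i < n) sqO (hat (int_of_nat i) f) = sqD (mode_sum c n).
  rewrite (sqnorm_partial_sum mD m1D w1D Lms orth); apply: eq_bigr => i _.
  by have [_ ->] := L2_mode (int_of_nat i) (Lc (int_of_nat i)).
have Ld : L2esp (fun x => -1 * mode_sum c n x + f x).
  by apply: (L2D mD m1D w1D); [exact: L2_Z|].
have o : inner (leb3 R) Obreve (fun=> 1) (mode_sum c n) (fun x => -1 * mode_sum c n x + f x) = 0.
  rewrite (inner_partial_sum mD m1D w1D Lms)// big1// => i _.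
  rewrite (inner_conj mD m1D w1D Ld (Lms i)) (inner_linear mD m1D w1D (-1) Ls Lf (Lms i)).
  rewrite (inner_partial_sum mD m1D w1D Lms)// (bigD1 i)//= big1 ?addr0; last first.
    by move=> j ji; apply: orth; rewrite -val_eqE in ji.
  rewrite (inner_sqnorm (Lms i)) /mode_seq (inner_mode _ Lf (Lc _)).
  rewrite (inner_sqnorm (Lc _)).
  by have [_ ->] := L2_mode (int_of_nat i) (Lc (int_of_nat i)); rewrite mulN1r addNr; apply: complexE2; rewrite /= ?oppr0.
have := L2_sqnorm_pythagoras mD m1D w1D Ls Ld o.
rewrite (_ : (fun x => mode_sum c n x + _) = f); last by apply/funext => x; ring.
by rewrite E => ->; rewrite lerDl (L2_sqnorm_ge0 _ w1D).
Qed.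

(** Bessel's inequality allows a field [g] to be synthesized from the coefficients of [f]. The two
    have the same coefficients, hence agree almost everywhere, and the identity is known for [g]. *)
Lemma parseval f : L2esp f -> (\esum_(k in [set: int]) (sqO (hat k f))%:E)%E = (sqD f)%:E.
Proof.
move=> Lf; pose c k := hat k f; have Lc k : L2pl (c k) := (L2_hat k Lf).1.
have c0 k : (0 <= (sqO (c k))%:E)%E by rewrite lee_fin (L2_sqnorm_ge0 _ wp0).
have foo : (\esum_(k in [set: int]) (sqO (c k))%:E < +oo)%E.
  rewrite esum_int//; apply: (@le_lt_trans _ _ (sqD f)%:E); last by rewrite ltry.
  apply: lime_le; first exact: is_cvg_nneseries.
  by apply: nearW => n; rewrite sumEFin lee_fin sum_hat_le.
have [g [Lg _ hg Eg]] := riesz_fischer Lc foo.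
rewrite Eg; congr EFin; rewrite /L2_sqnorm; congr fine.
apply: (ae_eq_L2_integral mD m1D w1D); [exact: Lg.1|exact: Lf.1|].
have Ld : L2esp (fun x => -1 * f x + g x) by apply: (L2D mD m1D w1D); [exact: L2_Z|].
have : (fun x => -1 * f x + g x) = (fun=> 0) %[ae leb3 R in Obreve].
  apply: hat_eq0 => // k; apply: filterS2 (hg k) (hat_linear k (-1) Lf Lg) => p h1 h2 Op.
  by rewrite h2// h1// mulN1r addNr.
apply: filterS => x + Dx => /(_ Dx); rewrite mulN1r addrC => /eqP.
by rewrite subr_eq0 => /eqP.
Qed.

End scalar_modes.

(** * Test functions in cylindrical coordinates *)

Section chain_rule_identities.
Variable R : comPzRingType.
Implicit Types r c s x y z : R.

Lemma angular_chain r c s x y z : - (r * s) * x + r * c * y + 0 * z = r * (- s * x + c * y).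
Proof. by ring. Qed.

Lemma axial_chain x y z : 0 * x + 0 * y + 1 * z = z.
Proof. by rewrite !mul0r !add0r mul1r. Qed.

End chain_rule_identities.

Section lifted_test_functions.
Context {R : realType}.
Local Notation ex := ((1, 0, 0) : espace R).
Local Notation ey := ((0, 1, 0) : espace R).
Local Notation ez := ((0, 0, 1) : espace R).
Implicit Types (Phi : espace R -> R) (r t z : R).

Lemma is_derive_cartesian Phi r t z : smooth Phi ->
  [/\ is_derive r (1 : R) (fun r => Phi (cartesian r t z))
        (cos t * 'D_ex Phi (cartesian r t z) + sin t * 'D_ey Phi (cartesian r t z)),
      is_derive t (1 : R) (fun t => Phi (cartesian r t z))
        (r * (- sin t * 'D_ex Phi (cartesian r t z) + cos t * 'D_ey Phi (cartesian r t z))) &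
      is_derive z (1 : R) (fun z => Phi (cartesian r t z)) ('D_ez Phi (cartesian r t z))].
Proof.
move=> sP.
have dP (e q : espace R) : derivable Phi q e by exact: smooth_derivable.
have cP (e : espace R) : continuous (fun q => 'D_e Phi q) by exact: smooth_derive_continuous.
have dc (x c : R) : is_derive x (1 : R) (fun=> c) 0 by exact: is_derive_cst.
have di (x c : R) : is_derive x (1 : R) (fun r => r * c) c.
  apply: (is_derive_eq (is_deriveM (is_derive_id x (1 : R)) (is_derive_cst c x 1))).
  by rewrite /GRing.scale /= mulr0 add0r mulr1.
split.
- apply: (is_derive_eq (is_derive_espace_curve dP cP (di r (cos t)) (di r (sin t)) (dc r z))).
  by rewrite mul0r addr0.
- have d1 : is_derive t (1 : R) (fun t => r * cos t) (- (r * sin t)).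
    apply: (is_derive_eq (is_deriveM (is_derive_cst r t 1) (is_derive_cos t))).
    by rewrite /GRing.scale /= mulr0 addr0 mulrN.
  have d2 : is_derive t (1 : R) (fun t => r * sin t) (r * cos t).
    apply: (is_derive_eq (is_deriveM (is_derive_cst r t 1) (is_derive_sin t))).
    by rewrite /GRing.scale /= mulr0 addr0.
  apply: (is_derive_eq (is_derive_espace_curve dP cP d1 d2 (dc t z))).
  exact: angular_chain.
- apply: (is_derive_eq (is_derive_espace_curve dP cP (dc z (r * cos t)) (dc z (r * sin t)) (is_derive_id z (1 : R)))).
  exact: axial_chain.
Qed.

(* A function of the angle cannot be smooth on the axis: an extension is only
   required at distance [d] from it. *)
Definition circle_smooth (b : R -> R) := forall d : R, 0 < d ->
  exists2 B : espace R -> R, smooth B & forall r t z, d <= r -> B (cartesian r t z) = b t.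

Lemma circle_smooth_cst c : circle_smooth (fun=> c).
Proof. by move=> d _; exists (fun=> c) => //; exact: smooth_cst. Qed.

Lemma circle_smoothM b c : circle_smooth b -> circle_smooth c -> circle_smooth (fun t => b t * c t).
Proof.
move=> hb hc d d0; have [B sB HB] := hb d d0; have [C sC HC] := hc d d0.
by exists (fun q => B q * C q); [exact: smoothM|move=> r t z dr; rewrite HB// HC].
Qed.

Lemma circle_smoothD b c : circle_smooth b -> circle_smooth c -> circle_smooth (fun t => b t + c t).
Proof.
move=> hb hc d d0; have [B sB HB] := hb d d0; have [C sC HC] := hc d d0.
by exists (fun q => B q + C q); [exact: smoothD|move=> r t z dr; rewrite HB// HC].
Qed.

Let smooth_sqr_radius : smooth (fun q : espace R => q.1.1 * q.1.1 + q.1.2 * q.1.2).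
Proof. by apply: smoothD; [exact: (smoothM smooth_fst3 smooth_fst3)|exact: (smoothM smooth_snd3 smooth_snd3)]. Qed.

Let sqr_radius_cartesian r t z : (cartesian r t z).1.1 * (cartesian r t z).1.1 +
  (cartesian r t z).1.2 * (cartesian r t z).1.2 = r ^+ 2.
Proof. by rewrite /= -[RHS]mulr1 -(cos2Dsin2 t); ring. Qed.

Lemma circle_smooth_cos : circle_smooth cos.
Proof.
move=> d d0; have [s [k [_ sk sk1 _]]] := smooth_radius d0.
exists (fun q => q.1.1 * k (q.1.1 * q.1.1 + q.1.2 * q.1.2)).
  by apply: smoothM; [exact: smooth_fst3|exact: smooth_comp1].
move=> r t z dr; rewrite sqr_radius_cartesian (sk1 r dr).2 /= mulrAC mulfV ?mul1r//.
by rewrite gt_eqF// (lt_le_trans d0).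
Qed.

Lemma circle_smooth_sin : circle_smooth sin.
Proof.
move=> d d0; have [s [k [_ sk sk1 _]]] := smooth_radius d0.
exists (fun q => q.1.2 * k (q.1.1 * q.1.1 + q.1.2 * q.1.2)).
  by apply: smoothM; [exact: smooth_snd3|exact: smooth_comp1].
move=> r t z dr; rewrite sqr_radius_cartesian (sk1 r dr).2 /= mulrAC mulfV ?mul1r//.
by rewrite gt_eqF// (lt_le_trans d0).
Qed.

Lemma circle_smoothN b : circle_smooth b -> circle_smooth (fun t => - b t).
Proof.
move=> /(circle_smoothM (circle_smooth_cst (-1))) hb d /hb[B sB HB].
by exists B => // r t z /HB ->; rewrite mulN1r.
Qed.

Lemma circle_smooth_cos_sin_int (k : int) :
  circle_smooth (fun t => cos (k%:~R * t)) /\ circle_smooth (fun t => sin (k%:~R * t)).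
Proof.
have H (n : nat) : circle_smooth (fun t => cos (n%:R * t)) /\ circle_smooth (fun t => sin (n%:R * t)).
  elim: n => [|n [hc hs]].
    split; [have -> : (fun t : R => cos (0%:R * t)) = (fun=> 1)|
            have -> : (fun t : R => sin (0%:R * t)) = (fun=> 0)]; try exact: circle_smooth_cst.
      by apply/funext => t; rewrite mul0r cos0.
    by apply/funext => t; rewrite mul0r sin0.
  have E t : n.+1%:R * t = n%:R * t + t by rewrite -natr1 mulrDl mul1r.
  split.
    have -> : (fun t => cos (n.+1%:R * t)) = (fun t => cos (n%:R * t) * cos t + - (sin (n%:R * t) * sin t)).
      by apply/funext => t; rewrite E cosD.
    apply: circle_smoothD; first exact: circle_smoothM circle_smooth_cos.
    by apply: circle_smoothN; exact: circle_smoothM circle_smooth_sin.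
  have -> : (fun t => sin (n.+1%:R * t)) = (fun t => sin (n%:R * t) * cos t + cos (n%:R * t) * sin t).
    by apply/funext => t; rewrite E sinD.
  apply: circle_smoothD; first exact: circle_smoothM circle_smooth_cos.
  exact: circle_smoothM circle_smooth_sin.
case: k => n; first exact: H.
have [hc hs] := H n.+1; rewrite NegzE mulrNz -pmulrn; split.
  by have -> : (fun t : R => cos (- n.+1%:R * t)) = (fun t => cos (n.+1%:R * t)) by apply/funext => t; rewrite mulNr cosN.
have -> : (fun t : R => sin (- n.+1%:R * t)) = (fun t => - sin (n.+1%:R * t)) by apply/funext => t; rewrite mulNr sinN.
exact: circle_smoothN.
Qed.

Variables (Omega : set (plane R)) (Obreve : set (espace R)).
Hypothesis rev : revolved Omega Obreve.

Lemma compact_revolved (K : set (plane R)) : compact K ->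
  compact [set q : espace R | K (radius q, q.2)].
Proof.
move=> cK; have [M KM] := compact_sub_cbox2 cK.
have cr : continuous (@radius R : espace R -> R).
  move=> q; apply: (@continuous_comp _ _ _ (fun q : espace R => q.1.1 ^+ 2 + q.1.2 ^+ 2) Num.sqrt); last exact: sqrt_continuous.
  have c1 : {for q, continuous (fun q : espace R => q.1.1)} by exact: (smooth_continuous smooth_fst3).
  have c2 : {for q, continuous (fun q : espace R => q.1.2)} by exact: (smooth_continuous smooth_snd3).
  have -> : (fun q : espace R => q.1.1 ^+ 2 + q.1.2 ^+ 2) = (fun q => q.1.1 * q.1.1 + q.1.2 * q.1.2).
    by apply/funext => x; rewrite !expr2.
  exact: (continuousD (continuousM c1 c1) (continuousM c2 c2)).
have cl : closed [set q : espace R | K (radius q, q.2)].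
  apply: (@preimage_closed _ _ (fun q : espace R => (radius q, q.2) : plane R) K).
    by move=> q _; apply: cvg_pairT; [exact: cr|exact: (smooth_continuous smooth_thd3)].
  by apply: compact_closed => //; exact: (@norm_hausdorff _ (plane R)).
apply: (subclosed_compact cl (@compact_cbox3 R (- M) M (- M) M (- M) M)) => q /= Kq.
have [] := KM _ Kq; rewrite /= !in_itv /= => /andP[_ rM] zM.
have rr : radius q ^+ 2 = q.1.1 ^+ 2 + q.1.2 ^+ 2 by rewrite sqr_sqrtr// addr_ge0// sqr_ge0.
have r0 : 0 <= radius q by exact: sqrtr_ge0.
by split; [split|]; rewrite /= in_itv //=; apply/andP; split; nra.
Qed.

Lemma lifted_test (psi : plane R -> R) (b b' : R -> R) :
  test_function Omega psi -> circle_smooth b -> (forall t, is_derive t (1 : R) b (b' t)) ->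
  exists2 Phi : espace R -> R, test_function Obreve Phi &
  forall p t, Omega p ->
    (* cylindrical expressions of the gradient of [psi / r * b] *)
    let X := ('D_((1, 0) : plane R) psi p / p.1 - psi p / p.1 ^+ 2) * b t in
    let Y := psi p / p.1 ^+ 2 * b' t in
    [/\ Phi (cyl (p, t)) = psi p / p.1 * b t,
        'D_ex Phi (cyl (p, t)) = cos t * X - sin t * Y,
        'D_ey Phi (cyl (p, t)) = sin t * X + cos t * Y &
        'D_ez Phi (cyl (p, t)) = 'D_((0, 1) : plane R) psi p / p.1 * b t].
Proof.
move=> tpsi hb db; have [spsi cK KO] := tpsi; pose K := support_closure psi.
have O0 := revolved_pos rev.
have [d d0 Kd] : exists2 d : R, 0 < d & forall p, K p -> d < p.1.
  have [_ [c c0 Kc]] := locally_bounded_wpos O0 cK KO.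
  by exists (c / 2) => [|p /Kc]; rewrite ?divr_gt0// /wpos; lra.
have psi0 p : p.1 <= d -> psi p = 0.
  by move=> pd; apply: support_closure_out => /Kd; rewrite ltNge pd.
have [s [k [ss sk skd sd]]] := smooth_radius d0.
have [B sB HB] := hb d d0.
pose R2 (q : espace R) := q.1.1 * q.1.1 + q.1.2 * q.1.2.
(* [s], [k] and [B] are smooth substitutes for [r], [1 / r] and [b], exact at distance at least [d].
   Nearer to the axis [psi] vanishes, since [s] stays at most [d] there. Dividing by [r] will cancel
   the Jacobian. *)
pose Phi (q : espace R) := psi (s (R2 q), q.2) * (k (R2 q) * B q).
have sPhi : smooth Phi.
  apply: smoothM; first exact: (smooth_plane_comp spsi (smooth_comp1 ss smooth_sqr_radius) smooth_thd3).
  exact: (smoothM (smooth_comp1 sk smooth_sqr_radius) sB).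
have PhiE r t z : 0 < r -> Phi (cartesian r t z) = psi (r, z) / r * b t.
  move=> r0; rewrite /Phi /R2 sqr_radius_cartesian; have [dr|rd] := leP d r.
    by have [-> ->] := skd r dr; rewrite HB// mulrA.
  by rewrite !psi0 ?mul0r//= ?(ltW rd)//; apply: sd => //; exact: ltW.
exists Phi.
  apply: (@test_function_compact _ _ Obreve [set q : espace R | K (radius q, q.2)]) => //.
  - exact: compact_revolved.
  - apply: compact_closed; first exact: (@norm_hausdorff _ (espace R)).
    exact: compact_revolved.
  - move=> q /= Kq; case: rev => _ _ _ H; apply/H; last exact: KO.
    exact: lt_trans d0 (Kd _ Kq).
  - move=> q /= nK; have [t Jt ->] := cartesian_surj q.
    have r0 : 0 <= radius q by exact: sqrtr_ge0.
    rewrite /Phi /R2 sqr_radius_cartesian /=; have [dr|rd] := leP d (radius q).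
      by have [-> _] := skd _ dr; rewrite support_closure_out ?mul0r.
    by rewrite psi0 ?mul0r//=; exact: sd.
move=> p t Op X Y; have p0 := O0 p Op; have pn0 : p.1 != 0 by rewrite gt_eqF.
have pE : p = (p.1, p.2) by exact: surjective_pairing.
have dpsi (e q : plane R) : derivable psi q e by exact: smooth_derivable.
have cpsi (e : plane R) : continuous (fun q => 'D_e psi q) by exact: smooth_derive_continuous.
have dc (x c : R) : is_derive x (1 : R) (fun=> c) 0 by exact: is_derive_cst.
have [dr dt dz] := is_derive_cartesian p.1 t p.2 sPhi.
(* The derivatives in the rotating frame are read along the coordinate curves of [r] and [theta];
   undoing the rotation at the end gives the cartesian ones. *)
have XE : cos t * 'D_ex Phi (cyl (p, t)) + sin t * 'D_ey Phi (cyl (p, t)) = X.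
  have [_ <-] := dr.
  have d1 : is_derive p.1 (1 : R) (fun r => psi (r, p.2)) ('D_((1, 0) : plane R) psi p).
    apply: (is_derive_eq (is_derive_plane_curve dpsi cpsi (is_derive_id p.1 (1 : R)) (dc p.1 p.2))).
    by rewrite mul1r mul0r addr0 -pE.
  have d2 : is_derive p.1 (1 : R) (fun r : R => r^-1) (- p.1 ^- 2).
    have di : is_derive p.1 (1 : R) (fun r : R => r) 1 by exact: is_derive_id.
    apply: (is_derive_eq (@is_deriveV _ (fun r : R => r) p.1 1 1 pn0 di)).
    by rewrite /GRing.scale /= mulr1.
  have d3 : is_derive p.1 (1 : R) (fun r => psi (r, p.2) / r * b t) X.
    apply: (is_derive_eq (is_deriveM (is_deriveM d1 d2) (dc p.1 (b t)))).
    by rewrite /GRing.scale /= mulr0 add0r -pE /X; ring.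
  have [_ E] := d3; rewrite -E; apply: near_eq_derive.
  have : \forall r \near p.1, 0 < r by apply: lt_nbhsr.
  by apply: filterS => r r0; rewrite PhiE.
have YE : - sin t * 'D_ex Phi (cyl (p, t)) + cos t * 'D_ey Phi (cyl (p, t)) = Y.
  apply: (mulfI pn0); have [_ <-] := dt.
  have d3 : is_derive t (1 : R) (fun t => psi p / p.1 * b t) (p.1 * Y).
    apply: (is_derive_eq (is_deriveM (dc t (psi p / p.1)) (db t))).
    by rewrite /GRing.scale /= mulr0 addr0 /Y; field.
  have [_ E] := d3; rewrite -[RHS]E.
  rewrite (_ : (fun t0 => Phi (cartesian p.1 t0 p.2)) = (fun t => psi p / p.1 * b t))//.
  by apply/funext => u; rewrite PhiE// -pE.
have c1 := cos2Dsin2 t.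
split.
- by rewrite /cyl PhiE// -pE.
- rewrite -XE -YE; set u := 'D_ex Phi _; set v := 'D_ey Phi _.
  by transitivity ((cos t ^+ 2 + sin t ^+ 2) * u); [rewrite c1 mul1r|ring].
- rewrite -XE -YE; set u := 'D_ex Phi _; set v := 'D_ey Phi _.
  by transitivity ((cos t ^+ 2 + sin t ^+ 2) * v); [rewrite c1 mul1r|ring].
- have [_ <-] := dz.
  have d1 : is_derive p.2 (1 : R) (fun z => psi (p.1, z)) ('D_((0, 1) : plane R) psi p).
    apply: (is_derive_eq (is_derive_plane_curve dpsi cpsi (dc p.2 p.1) (is_derive_id p.2 (1 : R)))).
    by rewrite mul1r mul0r add0r -pE.
  have d3 : is_derive p.2 (1 : R) (fun z => psi (p.1, z) * (p.1^-1 * b t)) ('D_((0, 1) : plane R) psi p / p.1 * b t).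
    apply: (is_derive_eq (is_deriveM d1 (dc p.2 (p.1^-1 * b t)))).
    by rewrite /GRing.scale /= mulr0 add0r; ring.
  have [_ E] := d3; rewrite -[RHS]E.
  rewrite (_ : (fun z0 => Phi (cartesian p.1 t z0)) = (fun z => psi (p.1, z) * (p.1^-1 * b t)))//.
  by apply/funext => u; rewrite PhiE// mulrA.
Qed.

End lifted_test_functions.

(** * Fourier coefficients of a gradient *)

Section fourier_gradient.
Context {R : realType}.
Local Notation leb := (@lebesgue_measure R).
Local Notation Rm := (measurableTypeR R).
Local Notation J := (@angles R).
Local Notation ex := ((1, 0, 0) : espace R).
Local Notation ey := ((0, 1, 0) : espace R).
Local Notation ez := ((0, 0, 1) : espace R).
Variables (Omega : set (plane R)) (Obreve : set (espace R)).
Hypotheses (rev : revolved Omega Obreve) (Obreve_finite : (leb3 R Obreve < +oo)%E).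
Implicit Types (k : int) (f g : espace R -> R[i]) (p : plane R).

Local Notation L2esp := (L2 (leb3 R) Obreve (fun=> 1)).
Local Notation L2pl := (L2 (leb2 R) Omega (@wpos R)).
Local Notation P := (sleb2 \x leb)%E.
Local Notation X := (Omega `*` J).

Let mO : measurable Omega := revolved_measurable_plane rev.
Let mD : measurable Obreve := revolved_measurable_espace rev.
Let mJ := @measurable_angles R.
Let mX : measurable X := measurable_revolvedX rev.
Let m1D : measurable_fun Obreve (fun=> 1 : R). Proof. by []. Qed.
Let w1D (x : espace R) : Obreve x -> (0 : R) < 1. Proof. by []. Qed.
Let mwp : measurable_fun Omega (@wpos R). Proof. by apply: measurable_funTS; exact: measurable_fst. Qed.
Let wp0 p : Omega p -> 0 < wpos p. Proof. exact: (revolved_pos rev). Qed.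
Let O0 := revolved_pos rev.
Let oO : open Omega. Proof. by case: rev. Qed.
Let oD : open Obreve. Proof. by case: rev. Qed.
Let omp := @open_measurable_plane R.
Let ome := @open_measurable_espace R.

Lemma phase_cyl p t : 0 < p.1 -> phase (cyl (p, t)) = expi t.
Proof. by move=> p0; have := phasez_cyl 1 t p0; rewrite mulr1z mul1r. Qed.

Lemma hat_phase k f p : Omega p -> hat k (fun q => phase q * f q) p = hat (k - 1) f p.
Proof.
move=> Op; rewrite !hatE; congr (_ * _); apply: eq_cintegral => t _.
rewrite phase_cyl ?O0//.
rewrite mulrAC -expiD mulrC; congr (_ * expi _).
by rewrite rmorphB /=; ring.
Qed.

Lemma hat_phaseV k f p : Omega p -> hat k (fun q => (phase q)^*%C * f q) p = hat (k + 1) f p.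
Proof.
move=> Op; rewrite !hatE; congr (_ * _); apply: eq_cintegral => t _.
rewrite phase_cyl ?O0//.
rewrite -expiN mulrAC -expiD mulrC; congr (_ * expi _).
by rewrite rmorphD /=; ring.
Qed.

Lemma normc_phase_le1 (q : espace R) : Normc.normc (phase q) <= 1.
Proof.
have r0 : 0 <= radius q by exact: sqrtr_ge0.
have r2 : radius q ^+ 2 = q.1.1 ^+ 2 + q.1.2 ^+ 2 by rewrite sqr_sqrtr// addr_ge0// sqr_ge0.
rewrite -(@ler_pXn2r _ 2)// ?nnegrE ?normc_ge0// expr1n sqr_normc /= !expr_div_n -mulrDl -r2.
by have [->|rn] := eqVneq (radius q) 0; rewrite ?expr0n ?mul0r// divff// expf_neq0.
Qed.

Lemma L2_bounded_mul f (a : espace R -> R[i]) (B : R) : cmeasurable Obreve a ->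
  (forall q, Normc.normc (a q) <= B) -> L2esp f ->
  L2esp (fun q => a q * f q) /\
  L2_sqnorm (leb3 R) Obreve (fun=> 1) (fun q => a q * f q) <= B ^+ 2 * L2_sqnorm (leb3 R) Obreve (fun=> 1) f.
Proof.
move=> ma aB Lf.
have B0 : 0 <= B by apply: le_trans (aB 0); exact: normc_ge0.
have le q : Normc.normc (a q * f q) ^+ 2 * 1 <= B ^+ 2 * (Normc.normc (f q) ^+ 2 * 1).
  rewrite !mulr1 Normc.normcM exprMn; apply: ler_wpM2r; first exact: sqr_ge0.
  by rewrite ler_pXn2r// nnegrE normc_ge0.
have hi : (leb3 R).-integrable Obreve (EFin \o (fun q => B ^+ 2 * (Normc.normc (f q) ^+ 2 * 1))).
  apply: RintegrableZl => //; exact: L2_integrable.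
have La : L2esp (fun q => a q * f q).
  by apply: (L2_le mD m1D w1D _ hi) => [|q _]; [apply: cmeasurableM => //; exact: Lf.1|exact: le].
split=> //.
have E h : L2_sqnorm (leb3 R) Obreve (fun=> 1) h = \int[leb3 R]_(x in Obreve) (Normc.normc (h x) ^+ 2 * 1) by [].
rewrite !E -RintegralZl//; last exact: L2_integrable.
by apply: le_Rintegral => //; exact: L2_integrable.
Qed.

(** The measure is [dr dz dtheta], without the Jacobian. In compensation [dominated_by_radius] asks
    the meridian factor to be [O(r)], which makes the pairing with an L^2 field integrable. *)
Definition mode_pairing f (beta : R -> R[i]) (m : plane R -> R) : R[i] :=
  cintegral P X (fun w => f (cyl w) * beta w.2 * (m w.1)%:C).

Definition dominated_by_radius (m : plane R -> R) :=
  measurable_fun Omega m /\ exists C : R, forall p, Omega p -> `|m p| <= C * p.1.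

Definition bounded_circle (beta : R -> R[i]) :=
  cmeasurable (setT : set Rm) beta /\ exists B : R, forall t, Normc.normc (beta t) <= B.

Lemma mode_pairing_integrable f beta m : L2esp f -> bounded_circle beta -> dominated_by_radius m ->
  cintegrable P X (fun w => f (cyl w) * beta w.2 * (m w.1)%:C).
Proof.
move=> Lf [mb [B bB]] [mm [C mC]].
have fi := (cintegrable_cyl rev Lf.1).1 (L2_espace_integrable rev Obreve_finite Lf).
have gi := RintegrableZl mX (B * C) (cintegrable_normc mX fi).
apply: (cintegrable_le mX _ gi).
  apply: cmeasurableM; first apply: cmeasurableM.
  - exact: (cmeasurable_cyl rev Lf.1).
  - by case: mb => h1 h2; split; apply: measurable_funTS; [exact: measurableT_comp h1 measurable_snd|exact: measurableT_comp h2 measurable_snd].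
  - apply: cmeasurableC; apply: (measurable_comp mO) mm _; first by move=> _ [w [Ow _] <-].
    by apply: measurable_funTS; exact: measurable_fst.
move=> w [Ow _]; have w0 := O0 Ow; rewrite !Normc.normcM !normc_real (gtr0_norm w0).
have -> : B * C * (Normc.normc (f (cyl w)) * w.1.1) = Normc.normc (f (cyl w)) * B * (C * w.1.1) by ring.
apply: ler_pM; rewrite ?mulr_ge0 ?normc_ge0//; last exact: mC.
by apply: ler_wpM2l => //; exact: normc_ge0.
Qed.

Lemma mode_pairing_beta f beta beta' m (a : R[i]) : L2esp f -> bounded_circle beta -> bounded_circle beta' ->
  dominated_by_radius m ->
  mode_pairing f (fun t => a * beta t + beta' t) m = a * mode_pairing f beta m + mode_pairing f beta' m.
Proof.
move=> Lf hb hb' hm; have i1 := mode_pairing_integrable Lf hb hm.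
have i2 := mode_pairing_integrable Lf hb' hm.
rewrite /mode_pairing -(cintegralZ mX a i1) -(cintegralD mX (cintegrableZ mX a i1) i2).
by apply: eq_cintegral => w _; ring.
Qed.

Lemma hat_pairing k f m : L2esp f -> dominated_by_radius m ->
  cintegral (leb2 R) Omega (fun p => hat k f p * (m p)%:C) =
  fourier_norm%:C * mode_pairing f (fun t => expi (- k%:~R * t)) m.
Proof.
move=> Lf hm.
have hb : bounded_circle (fun t => expi (- k%:~R * t)).
  by split; [exact: cmeasurable_expi|exists 1 => t; rewrite normc_expi].
have ii := mode_pairing_integrable Lf hb hm.
rewrite /mode_pairing (cintegral_slice1 mO mJ ii) -(cintegralZ mO _ (cintegrable_slice1 mO mJ ii)).
apply: ae_eq_cintegral => //.
- apply: cmeasurableM; last by apply: cmeasurableC; case: hm.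
  exact: (cmeasurable_hat rev Obreve_finite k Lf).
- exact: cintegrable_cmeasurable (cintegrableZ mO _ (cintegrable_slice1 mO mJ ii)).
apply: filterS (ae_slice_integrable rev Obreve_finite (- k%:~R) Lf) => p h Op; have fi := h Op.
rewrite hatE -mulrA; congr (_ * _).
by rewrite -(cintegralZr mJ _ fi).
Qed.

Lemma test_dominated psi : test_function Omega psi ->
  dominated_by_radius psi /\ dominated_by_radius (fun p => psi p / p.1).
Proof.
move=> tpsi; have [spsi cK KO] := tpsi; pose K := support_closure psi.
have [M M0 HM] := test_function_bounded tpsi.
have [_ [d d0 Kd]] := locally_bounded_wpos O0 cK KO.
have mpsi : measurable_fun Omega psi by exact: smooth_measurable.
have mV : measurable_fun Omega (fun p : plane R => p.1^-1).
  apply: (@eq_measurable_fun _ _ _ _ _ (fun p : plane R => p.1 `^ (-1))).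
    by move=> p /[!inE] /O0 /ltW; exact: powR_inv1.
  apply: measurable_funTS.
  by apply: (measurableT_comp (f := (@powR R)^~ (-1))); [exact: measurable_powR|exact: measurable_fst].
split; split=> //; first last.
- exists (M / d ^+ 2) => p Op; have p0 := O0 Op.
  have [Kp|nK] := pselect (K p); last first.
    by rewrite support_closure_out// mul0r normr0 !mulr_ge0 ?invr_ge0 ?exprn_ge0 ?(ltW M0) ?(ltW d0)// ltW.
  rewrite normrM (ger0_norm (_ : 0 <= p.1^-1)) ?invr_ge0 ?(ltW p0)//.
  rewrite ler_pdivrMr// mulrAC -mulrA -mulrA; apply: le_trans (HM p) _.
  rewrite ler_peMr ?(ltW M0)// mulrC ler_pdivlMr ?exprn_gt0// mul1r.
  by have := Kd p Kp; rewrite /wpos; nra.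
- exact: measurable_funM.
- exists (M / d) => p Op; have p0 := O0 Op.
  have [Kp|nK] := pselect (K p); last first.
    rewrite (support_closure_out nK) normr0.
    by apply: mulr_ge0; [apply: mulr_ge0; [exact: ltW|by rewrite invr_ge0 ltW]|exact: ltW].
  apply: le_trans (HM p) _; rewrite -mulrA ler_peMr ?(ltW M0)// mulrC ler_pdivlMr// mul1r.
  exact: Kd.
Qed.

Variables (f g1 g2 g3 : espace R -> R[i]).
Hypotheses (Lf : L2esp f) (Lg1 : L2esp g1) (Lg2 : L2esp g2) (Lg3 : L2esp g3).
Hypotheses (w1 : weak_derivative (leb3 R) Obreve ex f g1) (w2 : weak_derivative (leb3 R) Obreve ey f g2)
  (w3 : weak_derivative (leb3 R) Obreve ez f g3).

(** Here [g1] and [g2] are partial derivatives of a scalar; the same formulas later give [v_r] and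
    [v_theta] from the cartesian components of a vector field. *)
Definition radial_part (q : espace R) : R[i] :=
  (complex.Re (phase q))%:C * g1 q + (complex.Im (phase q))%:C * g2 q.
Definition angular_part (q : espace R) : R[i] :=
  (- complex.Im (phase q))%:C * g1 q + (complex.Re (phase q))%:C * g2 q.

Lemma phase_part : [/\ cmeasurable Obreve (fun q => (complex.Re (phase q))%:C),
  cmeasurable Obreve (fun q => (complex.Im (phase q))%:C),
  cmeasurable Obreve (fun q => (- complex.Im (phase q))%:C) &
  forall q : espace R, [/\ Normc.normc (complex.Re (phase q))%:C <= 1, Normc.normc (complex.Im (phase q))%:C <= 1 &
    Normc.normc (- complex.Im (phase q))%:C <= 1]].
Proof.
have [h1 h2] := @cmeasurable_phase R; split.
- by apply: cmeasurableC; exact: measurable_funTS.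
- by apply: cmeasurableC; exact: measurable_funTS.
- by apply: cmeasurableC; apply: measurable_funN; exact: measurable_funTS.
- move=> q; have h := normc_phase_le1 q; rewrite !normc_real normrN.
  by split; [exact: le_trans (normr_Re_le _) h|exact: le_trans (normr_Im_le _) h|exact: le_trans (normr_Im_le _) h].
Qed.

Lemma L2_radial_part : L2esp radial_part.
Proof.
have [m1 m2 _ B] := phase_part; apply: (L2D mD m1D w1D).
  by have [] := L2_bounded_mul m1 (fun q => let: And3 h _ _ := B q in h) Lg1.
by have [] := L2_bounded_mul m2 (fun q => let: And3 _ h _ := B q in h) Lg2.
Qed.

Lemma L2_angular_part : L2esp angular_part.
Proof.
have [m1 _ m2 B] := phase_part; apply: (L2D mD m1D w1D).
  by have [] := L2_bounded_mul m2 (fun q => let: And3 _ _ h := B q in h) Lg1.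
by have [] := L2_bounded_mul m1 (fun q => let: And3 h _ _ := B q in h) Lg2.
Qed.

Let weak_cyl e g Phi : L2esp g -> weak_derivative (leb3 R) Obreve e f g -> test_function Obreve Phi ->
  [/\ cintegrable P X (fun w => f (cyl w) * ('D_e Phi (cyl w))%:C * (w.1.1)%:C),
      cintegrable P X (fun w => g (cyl w) * (Phi (cyl w))%:C * (w.1.1)%:C) &
      cintegral P X (fun w => f (cyl w) * ('D_e Phi (cyl w))%:C * (w.1.1)%:C) =
      - cintegral P X (fun w => g (cyl w) * (Phi (cyl w))%:C * (w.1.1)%:C)].
Proof.
move=> Lg [lf lg fg] tP; have tdP := test_function_derive e tP.
have i1 := cintegrable_test ome oD lf tdP; have i2 := cintegrable_test ome oD lg tP.
have m1 := cintegrable_cmeasurable i1; have m2 := cintegrable_cmeasurable i2.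
split; [exact: (cintegrable_cyl rev m1).1|exact: (cintegrable_cyl rev m2).1|].
by rewrite -(cintegral_cyl rev m1) -(cintegral_cyl rev m2) fg.
Qed.

Let phase_X w : X w -> complex.Re (phase (cyl w)) = cos w.2 /\ complex.Im (phase (cyl w)) = sin w.2.
Proof. by case: w => p t [/O0 p0 _]; rewrite phase_cyl. Qed.

Section real_modes.
Variables (psi : plane R -> R) (tpsi : test_function Omega psi).
Variables (b b' : R -> R) (sb : circle_smooth b) (db : forall t, is_derive t (1 : R) b (b' t)).

Lemma axial_pairing :
  mode_pairing f (fun t => (b t)%:C) ('D_((0, 1) : plane R) psi) =
  - mode_pairing g3 (fun t => (b t)%:C) psi.
Proof.
have [Phi tP HP] := lifted_test rev tpsi sb db.
have [_ _ E] := weak_cyl Lg3 w3 tP.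
rewrite /mode_pairing; transitivity (cintegral P X (fun w => f (cyl w) * ('D_ez Phi (cyl w))%:C * (w.1.1)%:C)).
  apply: eq_cintegral => -[p t] [/= Op _]; have [_ _ _ ->] := HP p t Op.
  have p0 : p.1 != 0 by rewrite gt_eqF// O0.
  rewrite -!mulrA -!real_complexM; congr (_ * _%:C); field; exact: p0.
rewrite E; congr (- _); apply: eq_cintegral => -[p t] [/= Op _]; have [-> _ _ _] := HP p t Op.
have p0 : p.1 != 0 by rewrite gt_eqF// O0.
rewrite -!mulrA -!real_complexM; congr (_ * _%:C); field; exact: p0.
Qed.

Let db1 t : is_derive t (1 : R) (fun t => b t * cos t) (b' t * cos t - b t * sin t).
Proof.
apply: (is_derive_eq (is_deriveM (db t) (is_derive_cos t))).
by rewrite /GRing.scale /=; ring.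
Qed.

Let db2 t : is_derive t (1 : R) (fun t => b t * sin t) (b' t * sin t + b t * cos t).
Proof.
apply: (is_derive_eq (is_deriveM (db t) (is_derive_sin t))).
by rewrite /GRing.scale /=; ring.
Qed.

(** The weak gradient is tested with the radial field of amplitude [psi b / r], whose divergence is
    [psi_r b / r]: the term produced by differentiating [1 / r] cancels against the angular
    derivatives of [cos] and [sin]. *)
Lemma radial_pairing :
  mode_pairing f (fun t => (b t)%:C) ('D_((1, 0) : plane R) psi) =
  - mode_pairing radial_part (fun t => (b t)%:C) psi.
Proof.
have [Phi tP HP] := lifted_test rev tpsi (circle_smoothM sb (@circle_smooth_cos R)) db1.
have [Psi tQ HQ] := lifted_test rev tpsi (circle_smoothM sb (@circle_smooth_sin R)) db2.
have [i1 j1 E1] := weak_cyl Lg1 w1 tP.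
have [i2 j2 E2] := weak_cyl Lg2 w2 tQ.
rewrite /mode_pairing; transitivity (cintegral P X (fun w => f (cyl w) * ('D_ex Phi (cyl w))%:C * (w.1.1)%:C +
   f (cyl w) * ('D_ey Psi (cyl w))%:C * (w.1.1)%:C)).
  apply: eq_cintegral => -[p t] [/= Op _]; have [_ -> _ _] := HP p t Op; have [_ _ -> _] := HQ p t Op.
  have p0 : p.1 != 0 by rewrite gt_eqF// O0.
  rewrite -!mulrA -!real_complexM -mulrDr -rmorphD /=; congr (_ * _%:C).
  set pr := 'D__ psi p.
  transitivity (b t * pr * (cos t ^+ 2 + sin t ^+ 2)); first by rewrite cos2Dsin2 mulr1.
  by field; exact: p0.
rewrite (cintegralD mX i1 i2) E1 E2 -opprD -(cintegralD mX j1 j2); congr (- _).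
apply: eq_cintegral => -[p t] Xw; have [Op _] := Xw; have [-> _ _ _] := HP p t Op; have [-> _ _ _] := HQ p t Op.
have p0 : p.1 != 0 by rewrite gt_eqF// O0.
rewrite /radial_part; have [-> ->] := phase_X Xw; rewrite /=.
set u := g1 _; set v := g2 _.
have e1 : (psi p / p.1 * (b t * cos t))%:C * (p.1)%:C = (cos t)%:C * ((b t)%:C * (psi p)%:C).
  by rewrite -!real_complexM; congr (_%:C); field; exact: p0.
have e2 : (psi p / p.1 * (b t * sin t))%:C * (p.1)%:C = (sin t)%:C * ((b t)%:C * (psi p)%:C).
  by rewrite -!real_complexM; congr (_%:C); field; exact: p0.
by rewrite -[u * _ * _]mulrA -[v * _ * _]mulrA e1 e2; ring.
Qed.

(** The weak gradient is tested with the angular field of amplitude [psi b / r], of divergence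
    [psi b' / r^2]. *)
Lemma angular_pairing :
  mode_pairing f (fun t => (b' t)%:C) (fun p => psi p / p.1) =
  - mode_pairing angular_part (fun t => (b t)%:C) psi.
Proof.
have sbs : circle_smooth (fun t => - (b t * sin t)).
  exact/circle_smoothN/circle_smoothM/circle_smooth_sin.
have dbs t : is_derive t (1 : R) (fun t => - (b t * sin t)) (- (b' t * sin t + b t * cos t)).
  exact: is_deriveN.
have [Phi tP HP] := lifted_test rev tpsi sbs dbs.
have [Psi tQ HQ] := lifted_test rev tpsi (circle_smoothM sb (@circle_smooth_cos R)) db1.
have [i1 j1 E1] := weak_cyl Lg1 w1 tP.
have [i2 j2 E2] := weak_cyl Lg2 w2 tQ.
rewrite /mode_pairing; transitivity (cintegral P X (fun w => f (cyl w) * ('D_ex Phi (cyl w))%:C * (w.1.1)%:C +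
   f (cyl w) * ('D_ey Psi (cyl w))%:C * (w.1.1)%:C)).
  apply: eq_cintegral => -[p t] [/= Op _]; have [_ -> _ _] := HP p t Op; have [_ _ -> _] := HQ p t Op.
  have p0 : p.1 != 0 by rewrite gt_eqF// O0.
  rewrite -!mulrA -!real_complexM -mulrDr -rmorphD /=; congr (_ * _%:C).
  set pr := 'D__ psi p.
  transitivity (b' t * (psi p / p.1) * (cos t ^+ 2 + sin t ^+ 2)); first by rewrite cos2Dsin2 mulr1.
  by field; exact: p0.
rewrite (cintegralD mX i1 i2) E1 E2 -opprD -(cintegralD mX j1 j2); congr (- _).
apply: eq_cintegral => -[p t] Xw; have [Op _] := Xw; have [-> _ _ _] := HP p t Op; have [-> _ _ _] := HQ p t Op.
have p0 : p.1 != 0 by rewrite gt_eqF// O0.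
rewrite /angular_part; have [-> ->] := phase_X Xw; rewrite /=.
set u := g1 _; set v := g2 _.
have e1 : (psi p / p.1 * - (b t * sin t))%:C * (p.1)%:C = (- sin t)%:C * ((b t)%:C * (psi p)%:C).
  by rewrite -!real_complexM; congr (_%:C); field; exact: p0.
have e2 : (psi p / p.1 * (b t * cos t))%:C * (p.1)%:C = (cos t)%:C * ((b t)%:C * (psi p)%:C).
  by rewrite -!real_complexM; congr (_%:C); field; exact: p0.
by rewrite -[u * _ * _]mulrA -[v * _ * _]mulrA e1 e2; ring.
Qed.

End real_modes.

Let bounded_real (b : R -> R) (B : R) : continuous b -> (forall t, `|b t| <= B) -> bounded_circle (fun t => (b t)%:C).
Proof.
move=> cb bB; split; last by exists B => t; rewrite normc_real.
by apply: cmeasurableC; apply: continuous_measurable_fun.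
Qed.

Let bcos k : bounded_circle (fun t => (cos (k%:~R * t))%:C).
Proof. by apply: (@bounded_real _ 1) => [|t]; [exact: continuous_Re_expi|rewrite ler_norml cos_geN1 cos_le1]. Qed.

Let bsin k : bounded_circle (fun t => (sin (k%:~R * t))%:C).
Proof. by apply: (@bounded_real _ 1) => [|t]; [exact: continuous_Im_expi|rewrite ler_norml sin_geN1 sin_le1]. Qed.

(** Test functions are real, so the exponential has to be split into cosine and sine before the
    pairing lemmas apply. *)
Let hat_pairing_cos_sin k F m : L2esp F -> dominated_by_radius m ->
  cintegral (leb2 R) Omega (fun p => hat k F p * (m p)%:C) =
  fourier_norm%:C * (- 'i%C * mode_pairing F (fun t => (sin (k%:~R * t))%:C) m +
    mode_pairing F (fun t => (cos (k%:~R * t))%:C) m).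
Proof.
move=> LF dm; rewrite (hat_pairing k LF dm).
have -> : (fun t : R => expi (- k%:~R * t)) = (fun t : R => - 'i%C * (sin (k%:~R * t))%:C + (cos (k%:~R * t))%:C).
  by apply/funext => t; rewrite mulNr expiN; apply: complexE2; rewrite /expi /=; ring.
by rewrite (mode_pairing_beta _ LF (bsin k) (bcos k) dm).
Qed.

Let dkt k (t : R) : is_derive t (1 : R) (fun t : R => k%:~R * t) k%:~R.
Proof.
apply: (is_derive_eq (is_deriveM (is_derive_cst (k%:~R : R) t 1) (is_derive_id t (1 : R)))).
by rewrite /GRing.scale /= mulr1 mulr0 addr0.
Qed.

Let dcos k t : is_derive t (1 : R) (fun t => cos (k%:~R * t)) (- k%:~R * sin (k%:~R * t)).
Proof.
apply: (is_derive_eq (is_derive_comp1 (@is_derive_cos R (k%:~R * t)) (dkt k t))).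
by rewrite !mulNr mulrC.
Qed.

Let dsin k t : is_derive t (1 : R) (fun t => sin (k%:~R * t)) (k%:~R * cos (k%:~R * t)).
Proof. by apply: (is_derive_eq (is_derive_comp1 (@is_derive_sin R (k%:~R * t)) (dkt k t))); rewrite mulrC. Qed.

Let lbw := locally_bounded_wpos O0.

Lemma hat_clocally_integrable k F : L2esp F -> clocally_integrable (leb2 R) Omega (hat k F).
Proof.
move=> LF; apply: (L2_clocally_integrable omp oO mwp wp0 lbw).
exact: (L2_hat rev Obreve_finite k LF).1.
Qed.

Lemma weak_derivative_hat_z k : weak_derivative (leb2 R) Omega (0, 1) (hat k f) (hat k g3).
Proof.
split; [exact: hat_clocally_integrable|exact: hat_clocally_integrable|move=> psi tpsi].
have [c s] := circle_smooth_cos_sin_int (R := R) k.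
have [d1 _] := test_dominated tpsi.
have [d2 _] := test_dominated (test_function_derive ((0, 1) : plane R) tpsi).
rewrite !hat_pairing_cos_sin// (axial_pairing tpsi c (dcos k)) (axial_pairing tpsi s (dsin k)).
ring.
Qed.

Lemma weak_derivative_hat_r k : weak_derivative (leb2 R) Omega (1, 0) (hat k f) (hat k radial_part).
Proof.
have Lr := L2_radial_part.
split; [exact: hat_clocally_integrable|exact: hat_clocally_integrable|move=> psi tpsi].
have [c s] := circle_smooth_cos_sin_int (R := R) k.
have [d1 _] := test_dominated tpsi.
have [d2 _] := test_dominated (test_function_derive ((1, 0) : plane R) tpsi).
rewrite !hat_pairing_cos_sin// (radial_pairing tpsi c (dcos k)) (radial_pairing tpsi s (dsin k)).
ring.
Qed.

(** For the weight [r^3], the norm of [c / r] equals the norm of [c] for the weight [r], and [r^3]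
    is bounded below on compact subsets of [Omega]. *)
Lemma clocally_integrable_div_radius (c : plane R -> R[i]) : L2pl c ->
  clocally_integrable (leb2 R) Omega (fun p => c p * (p.1^-1)%:C).
Proof.
move=> Lc; have mV : measurable_fun Omega (fun p : plane R => p.1^-1).
  apply: (@eq_measurable_fun _ _ _ _ _ (fun p : plane R => p.1 `^ (-1))).
    by move=> p /[!inE] /O0 /ltW; exact: powR_inv1.
  apply: measurable_funTS.
  by apply: (measurableT_comp (f := (@powR R)^~ (-1))); [exact: measurable_powR|exact: measurable_fst].
have mw3 : measurable_fun Omega (fun p : plane R => p.1 ^+ 3).
  by apply: measurable_funX; exact: mwp.
have w30 p : Omega p -> 0 < p.1 ^+ 3 by move=> /O0 p0; rewrite exprn_gt0.
apply: (L2_clocally_integrable omp oO mw3 w30).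
  move=> K cK KO; have [Koo [d d0 Kd]] := lbw cK KO; split=> //.
  exists (d ^+ 3); first by rewrite exprn_gt0.
  by move=> p /Kd; rewrite /wpos => h; rewrite ler_pXn2r// nnegrE ltW// (lt_le_trans d0).
have mc : cmeasurable Omega (fun p => c p * (p.1^-1)%:C).
  by apply: cmeasurableM; [exact: Lc.1|exact: cmeasurableC].
split=> //; apply: le_lt_trans Lc.2; rewrite le_eqVlt; apply/orP; left; apply/eqP.
apply: eq_integral => p /[!inE] /O0 p0; congr EFin.
rewrite Normc.normcM normc_real (ger0_norm (_ : 0 <= p.1^-1)) ?invr_ge0 ?(ltW p0)// /wpos.
by field; rewrite gt_eqF.
Qed.

(** The left-hand side is at first only known to be locally integrable. Equality as distributions
    identifies it with an L^2_1 function, which is how membership of the coefficient in L^2_{-1}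
    arises for [k] different from 0. *)
Lemma hat_angular k : (fun p => 'i%C * k%:~R * (hat k f p * (p.1^-1)%:C)) = hat k angular_part %[ae leb2 R in Omega].
Proof.
have La := L2_angular_part.
have l1 := clocally_integrable_div_radius (L2_hat rev Obreve_finite k Lf).1.
have l2 := hat_clocally_integrable k La.
have l3 := clocally_integrableD omp oO l2 (clocally_integrableZ omp oO (- ('i%C * k%:~R)) l1).
have : (fun p => hat k angular_part p + - ('i%C * k%:~R) * (hat k f p * (p.1^-1)%:C)) = (fun=> 0) %[ae leb2 R in Omega].
  apply: (fundamental_lemma_complex omp oO (fundamental_lemma_plane oO) l3) => psi tpsi.
  have [c s] := circle_smooth_cos_sin_int (R := R) k.
  have [d1 d2] := test_dominated tpsi.
  have i1 := cintegrable_test omp oO l1 tpsi; have i2 := cintegrable_test omp oO l2 tpsi.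
  transitivity (cintegral (leb2 R) Omega (fun p => hat k angular_part p * (psi p)%:C +
      - ('i%C * k%:~R) * (hat k f p * (p.1^-1)%:C * (psi p)%:C))).
    by apply: eq_cintegral => p _; ring.
  rewrite (cintegralD mO i2 (cintegrableZ mO _ i1)) (cintegralZ mO _ i1).
  have -> : cintegral (leb2 R) Omega (fun p => hat k f p * (p.1^-1)%:C * (psi p)%:C) =
      cintegral (leb2 R) Omega (fun p => hat k f p * (psi p / p.1)%:C).
    by apply: eq_cintegral => p _; rewrite -mulrA -real_complexM [p.1^-1 * _]mulrC.
  rewrite !hat_pairing_cos_sin//.
  have z : mode_pairing f (fun=> 0) (fun p => psi p / p.1) = 0.
    by rewrite /mode_pairing -[RHS](cintegral0 P X); apply: eq_cintegral => w _; rewrite mulr0 mul0r.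
  have bz : bounded_circle (fun=> 0).
    by split; [exact: cmeasurable_cst|exists 0 => t; rewrite Normc.normc0].
  have E1 := angular_pairing tpsi c (dcos k); have E2 := angular_pairing tpsi s (dsin k).
  move: E1 E2; have -> : (fun t => (- k%:~R * sin (k%:~R * t))%:C) = (fun t => (- k%:~R)%:C * (sin (k%:~R * t))%:C + 0) :> (R -> R[i]).
    by apply/funext => t; rewrite addr0 real_complexM.
  have -> : (fun t => (k%:~R * cos (k%:~R * t))%:C) = (fun t => (k%:~R)%:C * (cos (k%:~R * t))%:C + 0) :> (R -> R[i]).
    by apply/funext => t; rewrite addr0 real_complexM.
  rewrite (mode_pairing_beta _ Lf (bsin k) bz d2) (mode_pairing_beta _ Lf (bcos k) bz d2) z !addr0.
  set C := mode_pairing angular_part _ _; set S := mode_pairing angular_part _ _.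
  set Sf := mode_pairing f _ _; set Cf := mode_pairing f _ _.
  have kE : (k%:~R : R)%:C = k%:~R by rewrite -[LHS]/(real_complex _ _) rmorph_int.
  rewrite kE (_ : (- k%:~R)%:C = - k%:~R); last by rewrite -kE; apply: complexE2; rewrite /= ?oppr0.
  move=> E1 E2; have -> : C = k%:~R * Sf by rewrite -[C]opprK -E1 mulNr opprK.
  have -> : S = - (k%:~R * Cf) by rewrite E2 opprK.
  have ii : 'i%C * 'i%C = -1 :> R[i] by rewrite -expr2 sqr_i.
  transitivity (fourier_norm%:C * k%:~R * Sf * (1 + 'i%C * 'i%C)); first by ring.
  by rewrite ii subrr mulr0.
apply: filterS => p + Op => /(_ Op)/eqP; rewrite mulNr subr_eq0 => /eqP ->.
by [].
Qed.

End fourier_gradient.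

(** * Weak gradient of a mode away from the axis *)

Section elementary_bounds.
Context {R : realFieldType}.

Lemma le_sum4 (a b c d : R) : 0 <= a -> 0 <= b -> 0 <= c -> 0 <= d ->
  [/\ a <= a + b + c + d, b <= a + b + c + d, c <= a + b + c + d & d <= a + b + c + d].
Proof. by move=> *; split; lra. Qed.

Lemma le_combination (x y u v M : R) : `|x| <= 1 -> `|y| <= 1 -> `|u| <= M -> `|v| <= M ->
  `|x * u + y * v| <= 2 * M.
Proof.
move=> x1 y1 uM vM; apply: le_trans (ler_normD _ _) _; rewrite !normrM mulr2n mulrDl mul1r.
by apply: lerD; rewrite -[leRHS]mul1r; apply: ler_pM.
Qed.

End elementary_bounds.

Lemma product_rearrange (S : comPzRingType) (c cr b a x y : S) :
  c * (b * a * x) + cr * (b * a * y) = b * a * (c * x + cr * y).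
Proof. by ring. Qed.

Section single_mode.
Context {R : realType}.
Local Notation leb := (@lebesgue_measure R).
Local Notation Rm := (measurableTypeR R).
Local Notation J := (@angles R).
Local Notation ex := ((1, 0, 0) : espace R).
Local Notation ey := ((0, 1, 0) : espace R).
Local Notation ez := ((0, 0, 1) : espace R).
Variables (Omega : set (plane R)) (Obreve : set (espace R)).
Hypotheses (rev : revolved Omega Obreve) (Obreve_finite : (leb3 R Obreve < +oo)%E).

Local Notation L2pl := (L2 (leb2 R) Omega (@wpos R)).
Local Notation P := (sleb2 \x leb)%E.
Local Notation X := (Omega `*` J).

Let mO : measurable Omega := revolved_measurable_plane rev.
Let mJ := @measurable_angles R.
Let mX : measurable X := measurable_revolvedX rev.
Let O0 := revolved_pos rev.
Let oO : open Omega. Proof. by case: rev. Qed.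
Let omp := @open_measurable_plane R.
Let ome := @open_measurable_espace R.

Lemma mode_product_integrable (c : plane R -> R[i]) (h : plane R * Rm -> R[i]) (C : R) :
  L2pl c -> cmeasurable X h -> (forall w, X w -> Normc.normc (h w) <= C * w.1.1) ->
  cintegrable P X (fun w => c w.1 * h w).
Proof.
move=> Lc mh hC; have [Lm _] := L2_mode rev 0 Lc.
have fi := (cintegrable_cyl rev Lm.1).1 (L2_espace_integrable rev Obreve_finite Lm).
have gi := RintegrableZl mX (C / fourier_norm) (cintegrable_normc mX fi).
have nf := @fourier_norm_gt0 R.
apply: (cintegrable_le mX _ gi).
  apply: cmeasurableM => //; case: (Lc) => -[cR cI] _; split.
    apply: (measurable_comp mO) cR _; first by move=> _ [w [Ow _] <-].
    by apply: measurable_funTS; exact: measurable_fst.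
  apply: (measurable_comp mO) cI _; first by move=> _ [w [Ow _] <-].
  by apply: measurable_funTS; exact: measurable_fst.
move=> [p t] Xw; have [Op _] := Xw; have p0 := O0 Op.
rewrite (mode_cyl _ _ _ Op p0) !Normc.normcM !normc_real normc_expi mulr1 (gtr0_norm p0) (gtr0_norm nf).
have -> : C / fourier_norm * (Normc.normc (c p) * fourier_norm * p.1) = Normc.normc (c p) * (C * p.1).
  by field; rewrite gt_eqF.
by apply: ler_wpM2l; [exact: normc_ge0|exact: hC].
Qed.

Section away_from_axis.
Variables (phi : espace R -> R) (tphi : test_function Obreve phi) (del : R) (del0 : 0 < del).
Hypothesis phi0 : forall q, radius q < del -> phi q = 0.

Let sphi : smooth phi. Proof. by case: tphi. Qed.

(** At a fixed angle, [r phi] restricted to the half plane is a meridian test function because [phi]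
    vanishes near the axis; the factor [r] is the Jacobian. *)
Lemma planar_slice_test t : exists2 psi : plane R -> R, test_function Omega psi &
  forall p, Omega p -> [/\ psi p = p.1 * phi (cyl (p, t)),
    'D_((1, 0) : plane R) psi p = phi (cyl (p, t)) +
       p.1 * (cos t * 'D_ex phi (cyl (p, t)) + sin t * 'D_ey phi (cyl (p, t))) &
    'D_((0, 1) : plane R) psi p = p.1 * 'D_ez phi (cyl (p, t))].
Proof.
have [chi [schi _ chi0 chi1]] := @smooth_step R.
(* It vanishes for [r <= del / 2] and equals 1 for [r >= del]. Without it the slice would continue
   to negative [r], on the opposite side of the axis. *)
pose u (p : plane R) := chi (2 / del * p.1 + (-1)).
pose psi (p : plane R) := u p * (p.1 * phi (p.1 * cos t, p.1 * sin t, p.2)).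
have su : smooth u by exact: (smooth_comp1 (smooth_comp1 schi (smooth_affine _ _)) smooth_fst2).
have spsi : smooth psi.
  have sc := smoothM smooth_fst2 (smooth_cst (cos t)); have ss := smoothM smooth_fst2 (smooth_cst (sin t)).
  exact: (smoothM su (smoothM smooth_fst2 (smooth_espace_comp sphi sc ss smooth_snd2))).
have psiE (r z : R) : 0 < r -> psi (r, z) = r * phi (cartesian r t z).
  move=> r0; rewrite /psi /=; have [dr|rd] := leP del r.
    rewrite /u /= chi1 ?mul1r//.
    have : 1 <= r / del by rewrite ler_pdivlMr// mul1r.
    by rewrite mulrAC; lra.
  rewrite -/(cartesian r t z) phi0 ?mulr0//.
  by rewrite radius_cartesian// ltW.
exists psi.
  have [_ cK KD] := tphi; pose K := support_closure phi.
  pose K' := [set p : plane R | K (cartesian p.1 t p.2) /\ del / 2 <= p.1].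
  have clK' : closed K'.
    apply: closedI.
      apply: (@preimage_closed _ _ (fun p : plane R => cartesian p.1 t p.2) K); last exact: closed_closure.
      move=> p _; have c1 : {for p, continuous (fun p : plane R => p.1)} by exact: (smooth_continuous smooth_fst2).
      have c2 : {for p, continuous (fun p : plane R => p.2)} by exact: (smooth_continuous smooth_snd2).
      apply: cvg_pairT; last exact: c2.
      by apply: cvg_pairT; apply: cvgM; [exact: c1|exact: cvg_cst|exact: c1|exact: cvg_cst].
    apply: (@preimage_closed _ _ (fun p : plane R => p.1) [set x | del / 2 <= x]); last exact: closed_ge.
    by move=> p _; exact: (smooth_continuous smooth_fst2).
  have cK' : compact K'.
    have [M KM] := compact_sub_cbox3 cK.
    apply: (subclosed_compact clK' (@compact_cbox2 R (- (2 * `|M|)) (2 * `|M|) (- (2 * `|M|)) (2 * `|M|))).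
    move=> p [/KM [[]]]; rewrite /= !in_itv /= => /andP[x1 x2] /andP[y1 y2] /andP[z1 z2] dp.
    have MM := ler_norm M.
    have r2 : p.1 ^+ 2 = (p.1 * cos t) ^+ 2 + (p.1 * sin t) ^+ 2.
      by rewrite !exprMn -mulrDr cos2Dsin2 mulr1.
    have p0 : 0 <= p.1 by apply: le_trans dp; rewrite divr_ge0 ?ltW.
    by split; rewrite /= in_itv /=; apply/andP; split; nra.
  apply: (@test_function_compact _ _ Omega K') => //.
  - move=> p [/KD Dp dp]; have p0 : 0 < p.1 by apply: lt_le_trans dp; rewrite divr_gt0.
    by have := (revolved_cartesian rev t p.2 p0).1 Dp; rewrite -surjective_pairing.
  - move=> p nK; have [dp|pd] := leP (del / 2) p.1.
      rewrite /psi -/(cartesian p.1 t p.2) (_ : phi _ = 0) ?mulr0//.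
      by apply: support_closure_out => Kp; exact: nK.
    rewrite /psi /u chi0 ?mul0r//.
    have : p.1 / del <= 1 / 2 by rewrite ler_pdivrMr// mulrC mulrA mulr1 ltW.
    by rewrite mulrAC; lra.
move=> p Op; have p0 := O0 Op; have pE : p = (p.1, p.2) by exact: surjective_pairing.
have dpsi (e q : plane R) : derivable psi q e by exact: smooth_derivable.
have cpsi (e : plane R) : continuous (fun q => 'D_e psi q) by exact: smooth_derive_continuous.
have dc (x c : R) : is_derive x (1 : R) (fun=> c) 0 by exact: is_derive_cst.
have [dr _ dz] := is_derive_cartesian p.1 t p.2 sphi.
split; first by rewrite {1}pE psiE.
- have d1 : is_derive p.1 (1 : R) (fun r => psi (r, p.2)) ('D_((1, 0) : plane R) psi p).
    apply: (is_derive_eq (is_derive_plane_curve dpsi cpsi (is_derive_id p.1 (1 : R)) (dc p.1 p.2))).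
    by rewrite mul1r mul0r addr0 -pE.
  have [_ <-] := d1.
  have d3 : is_derive p.1 (1 : R) (fun r => r * phi (cartesian r t p.2))
      (phi (cyl (p, t)) + p.1 * (cos t * 'D_ex phi (cyl (p, t)) + sin t * 'D_ey phi (cyl (p, t)))).
    apply: (is_derive_eq (is_deriveM (is_derive_id p.1 (1 : R)) dr)).
    by rewrite /GRing.scale /= mulr1 addrC.
  have [_ E] := d3; rewrite -[RHS]E; apply: near_eq_derive.
  have : \forall r \near p.1, 0 < r by apply: lt_nbhsr.
  by apply: filterS => r r0; rewrite psiE.
- have d1 : is_derive p.2 (1 : R) (fun z => psi (p.1, z)) ('D_((0, 1) : plane R) psi p).
    apply: (is_derive_eq (is_derive_plane_curve dpsi cpsi (dc p.2 p.1) (is_derive_id p.2 (1 : R)))).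
    by rewrite mul1r mul0r add0r -pE.
  have [_ <-] := d1.
  have d3 : is_derive p.2 (1 : R) (fun z => p.1 * phi (cartesian p.1 t z)) (p.1 * 'D_ez phi (cyl (p, t))).
    apply: (is_derive_eq (is_deriveM (dc p.2 p.1) dz)).
    by rewrite /GRing.scale /= mulr0 addr0.
  have [_ E] := d3; rewrite -[RHS]E.
  rewrite (_ : (fun z => psi (p.1, z)) = (fun z => p.1 * phi (cartesian p.1 t z)))//.
  by apply/funext => z; rewrite psiE.
Qed.

Let bounded_phi : exists2 M : R, 0 < M & forall q, [/\ `|phi q| <= M, `|'D_ex phi q| <= M,
  `|'D_ey phi q| <= M & `|'D_ez phi q| <= M].
Proof.
have [M0 m0 H0] := test_function_bounded tphi.
have [M1 m1 H1] := test_function_bounded (test_function_derive ex tphi).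
have [M2 m2 H2] := test_function_bounded (test_function_derive ey tphi).
have [M3 m3 H3] := test_function_bounded (test_function_derive ez tphi).
have [h0 h1 h2 h3] := le_sum4 (ltW m0) (ltW m1) (ltW m2) (ltW m3).
exists (M0 + M1 + M2 + M3); first by rewrite !addr_gt0.
move=> q; split; [exact: le_trans (H0 q) h0|exact: le_trans (H1 q) h1|exact: le_trans (H2 q) h2|].
exact: le_trans (H3 q) h3.
Qed.

Let phi_le (M : R) w : 0 < M -> `|phi (cyl w)| <= M -> X w -> `|phi (cyl w)| <= M / del * w.1.1.
Proof.
move=> M0 h [Ow _]; have w0 := O0 Ow; have [dw|wd] := leP del w.1.1.
  apply: le_trans h _; rewrite -mulrA ler_peMr ?(ltW M0)// mulrC ler_pdivlMr// mul1r.
  exact: dw.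
rewrite phi0 ?normr0; last by rewrite radius_cartesian// ltW.
by apply: mulr_ge0; [apply: mulr_ge0; [exact: ltW|by rewrite invr_ge0 ltW]|exact: ltW].
Qed.

Let measurable_cyl_smooth (g : espace R -> R) : smooth g -> cmeasurable X (fun w => (g (cyl w))%:C).
Proof.
move=> sg; apply: cmeasurableC; apply: measurable_funTS.
apply: (measurableT_comp (f := g)) measurable_cyl.
exact: smooth_measurable.
Qed.

Let measurable_angle (b : R -> R) : continuous b -> cmeasurable X (fun w => (b w.2)%:C).
Proof.
move=> cb; apply: cmeasurableC; apply: measurable_funTS.
apply: (measurableT_comp (f := b : Rm -> R)) measurable_snd.
exact: continuous_measurable_fun.
Qed.

Let measurable_beta (k : int) : cmeasurable X (fun w => circle_basis k w.2).
Proof.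
have [h1 h2] : cmeasurable (setT : set Rm) (circle_basis k : R -> R[i]).
  by apply: cmeasurableZ; exact: cmeasurable_expi.
split; apply: measurable_funTS.
  exact: measurableT_comp h1 measurable_snd.
exact: measurableT_comp h2 measurable_snd.
Qed.

Let measurable_r : cmeasurable X (fun w => (w.1.1)%:C).
Proof. by apply: cmeasurableC; exact: measurable_fst1. Qed.

Variables (k : int) (c cr cz : plane R -> R[i]).
Hypotheses (Lc : L2pl c) (Lcr : L2pl cr) (Lcz : L2pl cz).
Hypotheses (wr : weak_derivative (leb2 R) Omega (1, 0) c cr) (wz : weak_derivative (leb2 R) Omega (0, 1) c cz).
Local Notation beta := (@circle_basis R k).

Let normc_beta_le t : Normc.normc (beta t) <= fourier_norm.
Proof. by rewrite Normc.normcM normc_expi mulr1 normc_real ger0_norm// ltW// fourier_norm_gt0. Qed.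

Section directions.
(* [(A, dA) = (cos, - sin)] or [(sin, cos)]: the first two directional
   derivatives read [A d_r + (dA / r) d_theta]. *)
Variables (A dA : R -> R).
Hypotheses (A_le1 : forall t, `|A t| <= 1) (dA_le1 : forall t, `|dA t| <= 1).
Hypotheses (ddA : forall t, is_derive t (1 : R) dA (- A t)) (dA_pi : dA pi = dA (- pi)).
Hypotheses (cA : continuous A) (cdA : continuous dA).

Let Dr w := cos w.2 * 'D_ex phi (cyl w) + sin w.2 * 'D_ey phi (cyl w).
Let Dt w := - sin w.2 * 'D_ex phi (cyl w) + cos w.2 * 'D_ey phi (cyl w).

Let mcos : cmeasurable X (fun w => (cos w.2)%:C).
Proof. by apply: measurable_angle; exact: continuous_cos. Qed.
Let msin : cmeasurable X (fun w => (sin w.2)%:C).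
Proof. by apply: measurable_angle; exact: continuous_sin. Qed.

Let mDr : cmeasurable X (fun w => (Dr w)%:C).
Proof.
have h1 := measurable_cyl_smooth (smooth_derive ex sphi); have h2 := measurable_cyl_smooth (smooth_derive ey sphi).
have := cmeasurableD (cmeasurableM mcos h1) (cmeasurableM msin h2).
by apply: eq_cmeasurable => w _; rewrite -!real_complexM -rmorphD.
Qed.

Let mDt : cmeasurable X (fun w => (Dt w)%:C).
Proof.
have h1 := measurable_cyl_smooth (smooth_derive ex sphi); have h2 := measurable_cyl_smooth (smooth_derive ey sphi).
have := cmeasurableD (cmeasurableM (cmeasurableN msin) h1) (cmeasurableM mcos h2).
by apply: eq_cmeasurable => w _; rewrite /Dt -rmorphN -!real_complexM -rmorphD.
Qed.

Let Dr_le (M : R) w : `|'D_ex phi (cyl w)| <= M -> `|'D_ey phi (cyl w)| <= M -> `|Dr w| <= 2 * M /\ `|Dt w| <= 2 * M.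
Proof.
have c1 : `|cos w.2| <= 1 by rewrite ler_norml cos_geN1 cos_le1.
have s1 : `|sin w.2| <= 1 by rewrite ler_norml sin_geN1 sin_le1.
have ns1 : `|- sin w.2| <= 1 by rewrite normrN.
by move=> h1 h2; split; [exact: (le_combination c1 s1 h1 h2)|exact: (le_combination ns1 c1 h1 h2)].
Qed.

(** Fubini's theorem with the angle outermost: on each slice the integrand is a constant times the
    weak [r]-derivative identity for [c], tested with [r phi]. *)
Lemma radial_by_parts :
  let H := fun w => c w.1 * (beta w.2 * (A w.2)%:C * (phi (cyl w) + w.1.1 * Dr w)%:C) +
                    cr w.1 * (beta w.2 * (A w.2)%:C * (w.1.1 * phi (cyl w))%:C) in
  cintegrable P X H /\ cintegral P X H = 0.
Proof.
move=> H; have [M M0 HM] := bounded_phi.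
have nf := @fourier_norm_gt0 R.
have mbA : cmeasurable X (fun w => beta w.2 * (A w.2)%:C).
  by apply: cmeasurableM; [exact: measurable_beta|exact: measurable_angle].
have bA t : Normc.normc (beta t * (A t)%:C) <= fourier_norm.
  rewrite Normc.normcM normc_real -[leRHS]mulr1.
  by apply: ler_pM => //; exact: normc_ge0.
have i1 : cintegrable P X (fun w => c w.1 * (beta w.2 * (A w.2)%:C * (phi (cyl w) + w.1.1 * Dr w)%:C)).
  apply: (mode_product_integrable (C := fourier_norm * (M / del + 2 * M)) Lc).
    apply: cmeasurableM => //.
    have := cmeasurableD (measurable_cyl_smooth sphi) (cmeasurableM measurable_r mDr).
    by apply: eq_cmeasurable => w _; apply: complexE2 => /=; ring.
  move=> w Xw; have [h1 h2 h3 _] := HM (cyl w); rewrite Normc.normcM -mulrA.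
  apply: ler_pM; rewrite ?normc_ge0// normc_real mulrDl; apply: le_trans (ler_normD _ _) _.
  apply: lerD; first exact: phi_le.
  have w0 := O0 Xw.1; rewrite normrM (gtr0_norm w0) mulrC; apply: ler_wpM2r; first exact: ltW.
  by have [] := Dr_le h2 h3.
have i2 : cintegrable P X (fun w => cr w.1 * (beta w.2 * (A w.2)%:C * (w.1.1 * phi (cyl w))%:C)).
  apply: (mode_product_integrable (C := fourier_norm * M) Lcr).
    apply: cmeasurableM => //.
    have := cmeasurableM measurable_r (measurable_cyl_smooth sphi).
    by apply: eq_cmeasurable => w _; rewrite -real_complexM.
  move=> w Xw; have [h1 h2 h3 _] := HM (cyl w); rewrite Normc.normcM -mulrA.
  apply: ler_pM; rewrite ?normc_ge0// normc_real.
  by have w0 := O0 Xw.1; rewrite normrM (gtr0_norm w0) mulrC; apply: ler_wpM2r; [exact: ltW|].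
have iH := cintegrableD mX i1 i2; split=> //.
rewrite (cintegral_slice2 mO mJ iH) -[RHS](cintegral0 leb J); apply: eq_cintegral => t _.
have [psi tpsi HP] := planar_slice_test t.
have [lc lcr E] := wr.
have j1 := cintegrable_test omp oO lc (test_function_derive ((1, 0) : plane R) tpsi).
have j2 := cintegrable_test omp oO lcr tpsi.
transitivity (cintegral (leb2 R) Omega (fun p => beta t * (A t)%:C * (c p * ('D_((1, 0) : plane R) psi p)%:C +
   cr p * (psi p)%:C))).
  by apply: eq_cintegral => p Op; have [-> -> _] := HP p Op; exact: product_rearrange.
rewrite (cintegralZ mO _ (cintegrableD mO j1 j2)) (cintegralD mO j1 j2) E//.
by rewrite addNr mulr0.
Qed.

(** Fubini's theorem with the meridian point outermost: [B] is the derivative in the angle of the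
    periodic function [beta dA phi], so its integral over the circle vanishes. *)
Lemma angular_by_parts :
  let B := fun w => 'i%C * k%:~R * beta w.2 * (dA w.2 * phi (cyl w))%:C - beta w.2 * (A w.2 * phi (cyl w))%:C +
     beta w.2 * (dA w.2 * (w.1.1 * Dt w))%:C in
  let H := fun w => c w.1 * B w in
  cintegrable P X H /\ cintegral P X H = 0.
Proof.
move=> B H; have [M M0 HM] := bounded_phi.
have nf := @fourier_norm_gt0 R.
have mphi := measurable_cyl_smooth sphi.
have mB : cmeasurable X B.
  have m1 := cmeasurableM (cmeasurableZ ('i%C * k%:~R) (measurable_beta k)) (cmeasurableM (measurable_angle cdA) mphi).
  have m2 := cmeasurableN (cmeasurableM (measurable_beta k) (cmeasurableM (measurable_angle cA) mphi)).
  have m3 := cmeasurableM (measurable_beta k) (cmeasurableM (measurable_angle cdA) (cmeasurableM measurable_r mDt)).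
  have := cmeasurableD (cmeasurableD m1 m2) m3.
  by apply: eq_cmeasurable => w _; rewrite /B !real_complexM.
have [N HN] : exists N, forall w, X w -> `|Dt w| <= N.
  by exists (2 * M) => w _; have [_ h2 h3 _] := HM (cyl w); have [] := Dr_le h2 h3.
pose C := Normc.normc ('i%C * k%:~R) * fourier_norm * (M / del) + fourier_norm * (M / del) + fourier_norm * N.
have B_le w : X w -> Normc.normc (B w) <= C * w.1.1.
  move=> Xw; have [h1 h2 h3 _] := HM (cyl w); have w0 := O0 Xw.1.
  have ph := phi_le M0 h1 Xw; have dt := HN w Xw.
  have b1 : `|dA w.2 * phi (cyl w)| <= M / del * w.1.1.
    by rewrite normrM -[leRHS]mul1r; apply: ler_pM.
  have b2 : `|A w.2 * phi (cyl w)| <= M / del * w.1.1.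
    by rewrite normrM -[leRHS]mul1r; apply: ler_pM.
  have b3 : `|dA w.2 * (w.1.1 * Dt w)| <= N * w.1.1.
    rewrite normrM -[leRHS]mul1r; apply: ler_pM => //.
    by rewrite normrM (gtr0_norm w0) mulrC; apply: ler_wpM2r; [exact: ltW|].
  apply: le_trans (le_normcD _ _) _; rewrite /C !mulrDl; apply: lerD; last first.
    by rewrite Normc.normcM normc_real -mulrA; apply: ler_pM => //; exact: normc_ge0.
  apply: le_trans (le_normcD _ _) _; rewrite normcN; apply: lerD.
    rewrite (Normc.normcM ('i%C * k%:~R * beta w.2)) (Normc.normcM ('i%C * k%:~R)) normc_real -!mulrA.
    apply: ler_wpM2l; first exact: normc_ge0.
    by apply: ler_pM; [exact: normc_ge0|exact: normr_ge0|exact: normc_beta_le|rewrite mulrA].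
  by rewrite Normc.normcM normc_real -mulrA; apply: ler_pM => //; exact: normc_ge0.
have iH : cintegrable P X H by exact: mode_product_integrable Lc mB B_le.
split=> //; rewrite (cintegral_slice1 mO mJ iH) -[RHS](cintegral0 (leb2 R) Omega).
apply: eq_cintegral => p Op; have p0 := O0 Op.
have iB : cintegrable leb J (fun t => B (p, t)).
  have mBp : cmeasurable J (fun t => B (p, t)).
    by case: mB => m1 m2; split; [exact: (measurable_slice1 mO mJ m1 Op)|exact: (measurable_slice1 mO mJ m2 Op)].
  apply: (cintegrable_le mJ mBp (g := cst (C * p.1))) => [|t Jt]; last exact: (B_le (p, t)).
  apply/integrableP; split; first exact/measurable_EFinP.
  by under eq_integral do rewrite /=; rewrite integral_cst//= angles_finite -EFinM ltry.
rewrite (_ : cintegral leb J _ = c p * cintegral leb J (fun t => B (p, t))); last exact: (cintegralZ mJ (c p) iB).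
rewrite (_ : cintegral leb J _ = 0) ?mulr0//.
pose Psi (t : R) := phi (cyl (p, t)).
have dPsi t : is_derive t (1 : R) Psi (p.1 * Dt (p, t)).
  by have [_ + _] := is_derive_cartesian p.1 t p.2 sphi.
have cg (g : espace R -> R) : continuous g -> continuous (fun t => g (cyl (p, t))).
  move=> cg t; apply: (@continuous_comp _ _ _ (fun t => cyl (p, t)) g); last exact: cg.
  apply: cvg_pairT; last exact: cvg_cst.
  by apply: cvg_pairT; apply: cvgM; [exact: cvg_cst|exact: continuous_cos|exact: cvg_cst|exact: continuous_sin].
have cPsi : continuous Psi by apply: cg; exact: smooth_continuous.
have cDt : continuous (fun t => p.1 * Dt (p, t)).
  have c1 := cg _ (smooth_derive_continuous (e := ex) sphi); have c2 := cg _ (smooth_derive_continuous (e := ey) sphi).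
  move=> t; apply: cvgM; first exact: cvg_cst.
  by apply: cvgD; apply: cvgM; [apply: cvgN; exact: continuous_sin|exact: c1|exact: continuous_cos|exact: c2].
have Psi_pi : Psi pi = Psi (- pi) by rewrite /Psi /cyl /cartesian /= cosN sinN sinpi oppr0.
have ends := @expi_int_endpoints R k.
have dk (t : R) : is_derive t (1 : R) (fun t : R => k%:~R * t) k%:~R.
  apply: (is_derive_eq (is_deriveM (is_derive_cst (k%:~R : R) t 1) (is_derive_id t (1 : R)))).
  by rewrite /GRing.scale /= mulr1 mulr0 addr0.
(* Used with [b] the cosine and the sine of [k t], for the real and imaginary parts. *)
have periodic (b db : R -> R) : (forall t, is_derive t (1 : R) b (db t)) -> continuous b -> continuous db ->
    b pi = b (- pi) ->
    \int[leb]_(t in J) (fourier_norm * (db t * (dA t * Psi t) + b t * (- A t * Psi t) + b t * (dA t * (p.1 * Dt (p, t))))) = 0.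
  move=> hb cb cdb bpi.
  apply: (@integral_periodic_derivative _ (fun t => fourier_norm * (b t * (dA t * Psi t)))).
  - move=> t; apply: (is_derive_eq (is_deriveM (is_derive_cst fourier_norm t 1) (is_deriveM (hb t) (is_deriveM (ddA t) (dPsi t))))).
    rewrite -[(dA * Psi) t]/(dA t * Psi t) -[(b * _) t]/(b t * (dA t * Psi t)) -[cst _ t]/fourier_norm /GRing.scale /=.
    by ring.
  - move=> t; apply: cvgM; first exact: cvg_cst.
    apply: cvgD; first apply: cvgD.
    + by apply: cvgM; [exact: cdb|apply: cvgM; [exact: cdA|exact: cPsi]].
    + by apply: cvgM; [exact: cb|apply: cvgM; [apply: cvgN; exact: cA|exact: cPsi]].
    + by apply: cvgM; [exact: cb|apply: cvgM; [exact: cdA|exact: cDt]].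
  - by rewrite bpi dA_pi Psi_pi.
have kE : (k%:~R : R)%:C = k%:~R by rewrite -[LHS]/(real_complex _ _) rmorph_int.
have dcos t : is_derive t (1 : R) (fun t : R => cos (k%:~R * t)) (- k%:~R * sin (k%:~R * t)).
  by apply: (is_derive_eq (is_derive_comp1 (@is_derive_cos R (k%:~R * t)) (dk t))); rewrite !mulNr mulrC.
have dsin t : is_derive t (1 : R) (fun t : R => sin (k%:~R * t)) (k%:~R * cos (k%:~R * t)).
  by apply: (is_derive_eq (is_derive_comp1 (@is_derive_sin R (k%:~R * t)) (dk t))); rewrite mulrC.
have ccos := @continuous_Re_expi R k%:~R; have csin := @continuous_Im_expi R k%:~R.
have cdcos : continuous (fun t : R => - k%:~R * sin (k%:~R * t)).
  by move=> t; apply: cvgM; [exact: cvg_cst|exact: csin].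
have cdsin : continuous (fun t : R => k%:~R * cos (k%:~R * t)).
  by move=> t; apply: cvgM; [exact: cvg_cst|exact: ccos].
have ecos : cos (k%:~R * pi) = cos (k%:~R * - pi) :> R by move/(congr1 (@complex.Re R)) : ends.
have esin : sin (k%:~R * pi) = sin (k%:~R * - pi) :> R by move/(congr1 (@complex.Im R)) : ends.
apply: complexE2 => /=.
  rewrite -[RHS](periodic _ _ dcos ccos cdcos ecos).
  by apply: eq_Rintegral => t _; rewrite /B -kE /circle_basis /expi /= /Psi; ring.
rewrite -[RHS](periodic _ _ dsin csin cdsin esin).
by apply: eq_Rintegral => t _; rewrite /B -kE /circle_basis /expi /= /Psi; ring.
Qed.

(** In the sum of the two integrations by parts, the undifferentiated terms [beta A phi] cancel: one
    comes from differentiating [r phi] in [r], the other from [dA' = - A]. *)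
Lemma planar_by_parts (e : espace R) :
  (forall w, X w -> 'D_e phi (cyl w) = A w.2 * Dr w + dA w.2 * Dt w) ->
  cintegral P X (fun w => (c w.1 * beta w.2 * ('D_e phi (cyl w))%:C +
     ((A w.2)%:C * (cr w.1 * beta w.2) + (dA w.2)%:C * ('i%C * k%:~R * (c w.1 * (w.1.1^-1)%:C) * beta w.2)) * (phi (cyl w))%:C) * (w.1.1)%:C) = 0.
Proof.
move=> De; have [i1 E1] := radial_by_parts; have [i2 E2] := angular_by_parts.
rewrite -[RHS](addr0 0) -{1}E1 -{1}E2 -(cintegralD mX i1 i2); apply: eq_cintegral => w Xw.
have w0 := O0 Xw.1; have wV : (w.1.1^-1)%:C * (w.1.1)%:C = 1 :> R[i].
  by rewrite -real_complexM mulVf ?gt_eqF.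
rewrite De// !rmorphD !real_complexM; set a := (A _)%:C; set da := (dA _)%:C; set r := (w.1.1)%:C in wV *.
set x := (Dr w)%:C; set y := (Dt w)%:C; set f := (phi _)%:C; set rV := (_^-1)%:C in wV *.
set b := circle_basis _ _.
transitivity (c w.1 * b * (a * x + da * y) * r + a * (cr w.1 * b) * f * r + da * ('i%C * k%:~R * c w.1 * b) * f * (rV * r)).
  by ring.
by rewrite wV; ring.
Qed.

End directions.

Lemma axial_by_parts :
  cintegral P X (fun w => (c w.1 * beta w.2 * ('D_ez phi (cyl w))%:C +
     cz w.1 * beta w.2 * (phi (cyl w))%:C) * (w.1.1)%:C) = 0.
Proof.
have [M M0 HM] := bounded_phi.
have nf := @fourier_norm_gt0 R.
have H0 (h : plane R -> R[i]) (g : espace R -> R) : L2pl h -> smooth g -> (forall q, `|g q| <= M) ->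
    cintegrable P X (fun w => h w.1 * (beta w.2 * (w.1.1 * g (cyl w))%:C)).
  move=> Lh sg gM; apply: (mode_product_integrable (C := fourier_norm * M) Lh).
    apply: cmeasurableM; first exact: measurable_beta.
    have := cmeasurableM measurable_r (measurable_cyl_smooth sg).
    by apply: eq_cmeasurable => w _; rewrite -real_complexM.
  move=> w Xw; have w0 := O0 Xw.1; rewrite Normc.normcM -mulrA.
  apply: ler_pM; rewrite ?normc_ge0// normc_real normrM (gtr0_norm w0) mulrC.
  by apply: ler_wpM2r; [exact: ltW|exact: gM].
have i1 : cintegrable P X (fun w => c w.1 * (beta w.2 * (w.1.1 * 'D_ez phi (cyl w))%:C)).
  exact: (H0 c _ Lc (smooth_derive ez sphi) (fun q => let: And4 _ _ _ h := HM q in h)).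
have i2 : cintegrable P X (fun w => cz w.1 * (beta w.2 * (w.1.1 * phi (cyl w))%:C)).
  exact: (H0 cz _ Lcz sphi (fun q => let: And4 h _ _ _ := HM q in h)).
have iH := cintegrableD mX i1 i2.
transitivity (cintegral P X (fun w => c w.1 * (beta w.2 * (w.1.1 * 'D_ez phi (cyl w))%:C) +
  cz w.1 * (beta w.2 * (w.1.1 * phi (cyl w))%:C))).
  by apply: eq_cintegral => w _; rewrite !real_complexM; ring.
rewrite (cintegral_slice2 mO mJ iH) -[RHS](cintegral0 leb J); apply: eq_cintegral => t _.
have [psi tpsi HP] := planar_slice_test t.
have [lc lcz E] := wz.
have j1 := cintegrable_test omp oO lc (test_function_derive ((0, 1) : plane R) tpsi).
have j2 := cintegrable_test omp oO lcz tpsi.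
transitivity (cintegral (leb2 R) Omega (fun p => beta t * (c p * ('D_((0, 1) : plane R) psi p)%:C +
   cz p * (psi p)%:C))).
  by apply: eq_cintegral => p Op; have [-> _ ->] := HP p Op; rewrite /=; ring.
rewrite (cintegralZ mO _ (cintegrableD mO j1 j2)) (cintegralD mO j1 j2) E//.
by rewrite addNr mulr0.
Qed.

End away_from_axis.
End single_mode.

(** * Removal of the axis *)

Lemma smooth_step_derive_bound (R : realType) (chi : R -> R) : smooth chi ->
  exists2 L : R, 0 < L & forall v, -1 <= v <= 1 -> `|'D_1 chi v| <= L.
Proof.
move=> schi; have cd := smooth_derive_continuous (e := (1 : R)) schi.
have : compact ((fun v : R => 'D_1 chi v) @` `[-1, 1]%classic).
  by apply: continuous_compact; [exact: continuous_subspaceT|exact: segment_compact].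
move=> /compact_bounded [M [_ HM]].
exists (Num.max (M + 1) 1); first by rewrite lt_max ltr01 orbT.
move=> v v1; apply: (HM (Num.max (M + 1) 1)); first by rewrite lt_max ltrDl ltr01.
by exists v => //; rewrite /= in_itv.
Qed.

Lemma leb3_cbox3 (R : realType) (a b c d e f : R) : a <= b -> c <= d -> e <= f ->
  leb3 R (cbox3 a b c d e f) = ((b - a) * (d - c) * (f - e))%:E.
Proof.
have E (x y : R) : x <= y -> (@lebesgue_measure R `[x, y]%classic = (y - x)%:E)%E.
  move=> xy; rewrite lebesgue_measure_itv /= lte_fin; have [_|yx] := ltP x y; first by rewrite EFinB.
  by congr (_%:E); apply/eqP; rewrite eq_sym subr_eq0 eq_le yx.
move=> ab cd ef; rewrite (_ : leb3 R _ = (leb2 R (cbox2 a b c d) * lebesgue_measure `[e, f]%classic)%E); last first.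
  by apply: product_measure1E; [exact: measurable_cbox2|exact: measurable_itv].
rewrite (_ : leb2 R _ = (lebesgue_measure `[a, b]%classic * lebesgue_measure `[c, d]%classic)%E); last first.
  by apply: product_measure1E; exact: measurable_itv.
by rewrite !E// -!EFinM.
Qed.

Lemma rotating_frame (R : comPzRingType) (a b x y : R) : a ^+ 2 + b ^+ 2 = 1 ->
  x = a * (a * x + b * y) + - b * (- b * x + a * y) /\ y = b * (a * x + b * y) + a * (- b * x + a * y).
Proof. by move=> ab; split; rewrite -[LHS]mul1r -ab; ring. Qed.

Section off_axis.
Context {R : realType}.
Local Notation leb := (@lebesgue_measure R).
Local Notation Rm := (measurableTypeR R).
Local Notation J := (@angles R).
Variables (Omega : set (plane R)) (Obreve : set (espace R)).
Hypotheses (rev : revolved Omega Obreve) (Obreve_finite : (leb3 R Obreve < +oo)%E).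

Local Notation L2esp := (L2 (leb3 R) Obreve (fun=> 1)).
Local Notation sqD := (L2_sqnorm (leb3 R) Obreve (fun=> 1)).
Local Notation P := (sleb2 \x leb)%E.
Local Notation X := (Omega `*` J).

Let mD : measurable Obreve := revolved_measurable_espace rev.
Let mX : measurable X := measurable_revolvedX rev.
Let m1D : measurable_fun Obreve (fun=> 1 : R). Proof. by []. Qed.
Let w1D (x : espace R) : Obreve x -> (0 : R) < 1. Proof. by []. Qed.
Let O0 := revolved_pos rev.
Let oD : open Obreve. Proof. by case: rev. Qed.
Let ome := @open_measurable_espace R.

(** In cylindrical coordinates only points with [r > 0] are seen, so pointwise convergence off the
    axis suffices for dominated convergence. *)
Lemma cintegral_cvg_off_axis (h_ : nat -> espace R -> R[i]) (h g : espace R -> R[i]) :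
  (forall n, cmeasurable Obreve (h_ n)) -> cmeasurable Obreve h -> cintegrable (leb3 R) Obreve g ->
  (forall n q, Normc.normc (h_ n q) <= Normc.normc (g q)) ->
  (forall q, 0 < radius q -> \forall n \near \oo, h_ n q = h q) ->
  ((fun n => complex.Re (cintegral (leb3 R) Obreve (h_ n))) @ \oo --> complex.Re (cintegral (leb3 R) Obreve h)) /\
  ((fun n => complex.Im (cintegral (leb3 R) Obreve (h_ n))) @ \oo --> complex.Im (cintegral (leb3 R) Obreve h)).
Proof.
move=> mh_ mh ig hg hh; have mg := cintegrable_cmeasurable ig.
have igX := (cintegrable_cyl rev mg).1 ig.
rewrite (cintegral_cyl rev mh).
have -> : (fun n => complex.Re (cintegral (leb3 R) Obreve (h_ n))) =
    (fun n => complex.Re (cintegral P X (fun w => h_ n (cyl w) * (w.1.1)%:C))).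
  by apply/funext => n; rewrite (cintegral_cyl rev (mh_ n)).
have -> : (fun n => complex.Im (cintegral (leb3 R) Obreve (h_ n))) =
    (fun n => complex.Im (cintegral P X (fun w => h_ n (cyl w) * (w.1.1)%:C))).
  by apply/funext => n; rewrite (cintegral_cyl rev (mh_ n)).
have mr : cmeasurable X (fun w => (w.1.1)%:C) by apply: cmeasurableC; exact: measurable_fst1.
have ev w : X w -> \forall n \near \oo, h_ n (cyl w) * (w.1.1)%:C = h (cyl w) * (w.1.1)%:C.
  move=> Xw; have w0 := O0 Xw.1; apply: filterS (hh (cyl w) _); first by move=> n ->.
  by rewrite radius_cartesian// ltW.
apply: (cintegral_dominated mX _ _ (cintegrable_normc mX igX)).
- by move=> n; apply: cmeasurableM => //; exact: (cmeasurable_cyl rev (mh_ n)).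
- by apply: cmeasurableM => //; exact: (cmeasurable_cyl rev mh).
- move=> n w Xw; rewrite !Normc.normcM; apply: ler_wpM2r; first exact: normc_ge0.
  exact: hg.
- by move=> w Xw; apply: cvg_near_cst; apply: filterS (ev w Xw) => n ->.
- by move=> w Xw; apply: cvg_near_cst; apply: filterS (ev w Xw) => n ->.
Qed.

Lemma L2_espace_clocally_integrable f : L2esp f -> clocally_integrable (leb3 R) Obreve f.
Proof. by move=> Lf; have := L2_clocally_integrable ome oD m1D w1D (@locally_bounded_cst1 R Obreve) Lf. Qed.

(* The axis has zero H^1-capacity: the gradient of the cutoff at distance 1/n
   is of size n on a set of measure O(1/n^2). *)
Section removal.
Variables (f G : espace R -> R[i]) (e : espace R).
Hypotheses (Lf : L2esp f) (LG : L2esp G) (e1 : `|e.1.1| <= 1) (e2 : `|e.1.2| <= 1).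
Hypothesis off : forall (phi : espace R -> R) (del : R), test_function Obreve phi -> 0 < del ->
  (forall q, radius q < del -> phi q = 0) ->
  cintegral (leb3 R) Obreve (fun q => f q * ('D_e phi q)%:C + G q * (phi q)%:C) = 0.

Variables (chi : R -> R) (schi : smooth chi) (chi01 : forall x, 0 <= chi x <= 1)
  (chi0 : forall x, x <= 0 -> chi x = 0) (chi1 : forall x, 1 <= x -> chi x = 1).
Variables (phi : espace R -> R) (tphi : test_function Obreve phi).

Let rho2 (q : espace R) := q.1.1 * q.1.1 + q.1.2 * q.1.2.
Let srho2 : smooth rho2.
Proof. exact: (smoothD (smoothM smooth_fst3 smooth_fst3) (smoothM smooth_snd3 smooth_snd3)). Qed.
Let rho2E q : radius q ^+ 2 = rho2 q.
Proof. by rewrite sqr_sqrtr ?addr_ge0 ?sqr_ge0. Qed.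
Let cut (s : R) n q := chi (n.+1%:R ^+ 2 * rho2 q + - s).
Let scut s n : smooth (cut s n).
Proof. exact: (smooth_comp1 (smooth_comp1 schi (smooth_affine _ _)) srho2). Qed.
Let eta := cut 1.
(** Equal to 1 wherever the gradient of [eta n] is nonzero, and 0 for [radius q] at least
    [sqrt 3 / (n + 1)]. It localizes [f] in the error term, so that the factor tending to 0 is the
    L^2 norm of [f] near the axis. *)
Let near_axis n q := 1 - cut 2 n q.

Let derive_rho2 q : 'D_e rho2 q = 2 * (q.1.1 * e.1.1 + q.1.2 * e.1.2).
Proof.
have d1 : is_derive q e (fun q : espace R => q.1.1) e.1.1.
  apply/is_derive_lineP => /=.
  apply: (is_derive_eq (is_deriveD (is_deriveM (is_derive_id (0 : R) (1 : R)) (is_derive_cst e.1.1 (0 : R) 1)) (is_derive_cst q.1.1 (0 : R) 1))).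
  by rewrite /GRing.scale /=; ring.
have d2 : is_derive q e (fun q : espace R => q.1.2) e.1.2.
  apply/is_derive_lineP => /=.
  apply: (is_derive_eq (is_deriveD (is_deriveM (is_derive_id (0 : R) (1 : R)) (is_derive_cst e.1.2 (0 : R) 1)) (is_derive_cst q.1.2 (0 : R) 1))).
  by rewrite /GRing.scale /=; ring.
have [_ ->] := is_deriveD (is_deriveM d1 d1) (is_deriveM d2 d2).
by rewrite /GRing.scale /=; ring.
Qed.

Let derive_eta n q : 'D_e (eta n) q = 'D_1 chi (n.+1%:R ^+ 2 * rho2 q - 1) * (n.+1%:R ^+ 2 * 'D_e rho2 q).
Proof.
have du : is_derive q e (fun q => n.+1%:R ^+ 2 * rho2 q + - 1) (n.+1%:R ^+ 2 * 'D_e rho2 q).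
  apply: (is_derive_eq (is_deriveD (is_deriveM (is_derive_cst (n.+1%:R ^+ 2 : R) q e) (smooth_is_derive e q srho2)) (is_derive_cst (- 1 : R) q e))).
  by rewrite /GRing.scale /=; ring.
by have [_ ->] := is_derive_comp1 (u := fun q => n.+1%:R ^+ 2 * rho2 q + - 1) (smooth_is_derive (1 : R) (n.+1%:R ^+ 2 * rho2 q + - 1) schi) du.
Qed.

Let derive_eta_out n q : 2 < n.+1%:R ^+ 2 * rho2 q -> 'D_e (eta n) q = 0.
Proof.
move=> h; rewrite derive_eta (_ : 'D_1 chi _ = 0) ?mul0r//.
rewrite -[RHS](derive_cst (1 : R) (n.+1%:R ^+ 2 * rho2 q - 1 : R) (1 : R)); apply: near_eq_derive.
have : 1 < n.+1%:R ^+ 2 * rho2 q - 1 by lra.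
move=> /lt_nbhsr; apply: filterS => x x1; rewrite chi1//; exact: ltW.
Qed.

Let derive_eta_le : exists2 C : R, 0 < C & forall n q, `|'D_e (eta n) q| <= C * n.+1%:R.
Proof.
have [L L0 HL] := smooth_step_derive_bound schi.
(* With [N = n + 1], the gradient of [N^2 rho2] along [e] is [2 N (N x e_x + N y e_y)], and [|N x|],
   [|N y|] are at most 2 where [chi'] is nonzero. *)
exists (L * 8); first by rewrite mulr_gt0.
move=> n q; have N0 : (0 : R) < n.+1%:R by rewrite ltr0n.
have [h|/derive_eta_out ->] := leP (n.+1%:R ^+ 2 * rho2 q) 2; last first.
  by rewrite normr0 !mulr_ge0// ltW.
rewrite derive_eta normrM -mulrA; apply: ler_pM => //.
  apply: HL; have : 0 <= n.+1%:R ^+ 2 * rho2 q by rewrite -rho2E mulr_ge0// sqr_ge0.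
  by move: h; set v := _ * _ => *; apply/andP; split; lra.
rewrite derive_rho2.
have bound (x y : R) : (n.+1%:R * x) ^+ 2 + (n.+1%:R * y) ^+ 2 <= 2 -> `|n.+1%:R * x| <= 2.
  set a := _ * x; set b := _ * y => ab; rewrite ler_norml; have := sqr_ge0 b.
  by move=> *; apply/andP; split; nra.
have hx : `|n.+1%:R * q.1.1| <= 2.
  by apply: (bound _ q.1.2); apply: le_trans h; rewrite /rho2 le_eqVlt; apply/orP; left; apply/eqP; ring.
have hy : `|n.+1%:R * q.1.2| <= 2.
  by apply: (bound _ q.1.1); apply: le_trans h; rewrite /rho2 le_eqVlt; apply/orP; left; apply/eqP; ring.
rewrite (_ : _ * (2 * _) = 2 * n.+1%:R * ((n.+1%:R * q.1.1) * e.1.1 + (n.+1%:R * q.1.2) * e.1.2)); last by ring.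
rewrite normrM ger0_norm ?mulr_ge0 ?(ltW N0)// (_ : 8 * _ = 2 * n.+1%:R * 4); last by ring.
apply: ler_wpM2l; first by rewrite mulr_ge0 ?(ltW N0).
apply: le_trans (ler_normD _ _) _; rewrite !normrM.
rewrite (_ : 4 = 2 * 1 + 2 * 1 :> R); last by ring.
by rewrite -!normrM; apply: lerD; rewrite normrM; apply: ler_pM.
Qed.

Let near_axis1 n q : n.+1%:R ^+ 2 * rho2 q <= 2 -> near_axis n q = 1.
Proof. by move=> h; rewrite /near_axis /cut chi0 ?subr0//; lra. Qed.

Let large q s : 0 < radius q -> \forall n \near \oo, s <= n.+1%:R ^+ 2 * rho2 q.
Proof.
move=> q0; have r0 : 0 < rho2 q by rewrite -rho2E exprn_gt0.
near=> n; have : s / rho2 q <= n%:R by near: n; exact: nbhs_infty_ger.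
rewrite ler_pdivrMr// => h; apply: (le_trans h); apply: ler_wpM2r; first exact: ltW.
rewrite -natrX ler_nat expnS expn1; apply: leq_trans (leqnSn n) _.
by rewrite leq_pmulr.
Unshelve. all: by end_near. Qed.

Let eta_eventually q : 0 < radius q -> \forall n \near \oo, eta n q = 1.
Proof. by move=> /(large 2); apply: filterS => n h; rewrite /eta /cut chi1//; lra. Qed.

Let near_axis_eventually q : 0 < radius q -> \forall n \near \oo, near_axis n q = 0.
Proof. by move=> /(large 3); apply: filterS => n h; rewrite /near_axis /cut chi1 ?subrr//; lra. Qed.

Let snear n : smooth (near_axis n).
Proof.
rewrite (_ : near_axis n = (fun q => 1 + (- 1) * cut 2 n q)); last by apply/funext => q; rewrite mulN1r.
apply: smoothD; first exact: smooth_cst.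
by apply: smoothM; [exact: smooth_cst|exact: scut].
Qed.

Let near_axis01 n q : 0 <= near_axis n q <= 1.
Proof. by have /andP[h1 h2] := chi01 (n.+1%:R ^+ 2 * rho2 q + - 2); rewrite /near_axis /cut; apply/andP; split; lra. Qed.

Let msmooth g : smooth g -> cmeasurable Obreve (fun q => (g q)%:C).
Proof. by move=> sg; apply: cmeasurableC; exact: smooth_measurable. Qed.

Let fa n q := (near_axis n q)%:C * f q.

Let Lfa n : L2esp (fa n).
Proof.
have [] // := @L2_bounded_mul _ Omega Obreve rev f (fun q => (near_axis n q)%:C) 1 (msmooth (snear n)) _ Lf.
by move=> q; rewrite normc_real; have /andP[h1 h2] := near_axis01 n q; rewrite ger0_norm.
Qed.

Let sq_fa_cvg : (fun n => sqD (fa n)) @ \oo --> (0 : R).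
Proof.
have Ef n : sqD (fa n) = complex.Re (cintegral (leb3 R) Obreve (fun q => fa n q * (fa n q)^*%C * 1%:C)).
  by rewrite -/(inner _ _ _ (fa n) (fa n)) (inner_sqnorm (Lfa n)).
have mfa n : cmeasurable Obreve (fun q => fa n q * (fa n q)^*%C * 1%:C).
  exact: cintegrable_cmeasurable (L2_inner_integrable mD m1D w1D (Lfa n) (Lfa n)).
have le n q : Normc.normc (fa n q * (fa n q)^*%C * 1%:C) <= Normc.normc (f q * (f q)^*%C * 1%:C).
  have /andP[h1 h2] := near_axis01 n q.
  have h : Normc.normc (fa n q) <= Normc.normc (f q).
    by rewrite Normc.normcM normc_real ger0_norm// ler_piMl// normc_ge0.
  have conj (z : R[i]) : Normc.normc z^*%C = Normc.normc z by case: z => a b /=; rewrite sqrrN.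
  have sq (z : R[i]) : Normc.normc (z * z^*%C * 1%:C) = Normc.normc z ^+ 2.
    by rewrite !Normc.normcM conj normc_real normr1 mulr1.
  by rewrite !sq ler_sqr ?nnegrE ?normc_ge0.
have ev q : 0 < radius q -> \forall n \near \oo, fa n q * (fa n q)^*%C * 1%:C = (0 : R[i]).
  by move=> /near_axis_eventually; apply: filterS => n h; rewrite /fa h !mul0r.
have [+ _] := cintegral_cvg_off_axis mfa (cmeasurable_cst _ _) (L2_inner_integrable mD m1D w1D Lf Lf) le ev.
rewrite cintegral0.
by rewrite (_ : (fun n => sqD (fa n)) = (fun n => complex.Re (cintegral (leb3 R) Obreve (fun q => fa n q * (fa n q)^*%C * 1%:C)))); last exact/funext.
Qed.

Let pd n q := phi q * 'D_e (eta n) q.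

Let sq_pd_le : exists2 B : R, 0 < B & forall n, L2esp (fun q => (pd n q)%:C) /\ sqD (fun q => (pd n q)%:C) <= B.
Proof.
have [C C0 HC] := derive_eta_le.
have [M M0 HM] := test_function_bounded tphi.
have [sphi cK KD] := tphi; have [M' KM] := compact_sub_cbox3 cK.
(* The function [pd n] is at most [M C N] and lives in a box of volume [(4 / N)^2 (2 Z)], so the
   powers of [N] cancel. *)
pose Z := `|M'|; pose B := (M * C) ^+ 2 * (32 * Z).
have Z0 : 0 <= Z by exact: normr_ge0.
exists (B + 1); first by rewrite ltr_wpDl// !mulr_ge0 ?sqr_ge0// ltW.
move=> n; have N0 : (0 : R) < n.+1%:R by rewrite ltr0n.
pose N : R := n.+1%:R; pose Q := cbox3 (- (2 / N)) (2 / N) (- (2 / N)) (2 / N) (- Z) Z.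
have mQ : measurable Q by exact: measurable_cbox3.
have pd0 q : ~ Q q -> pd n q = 0.
  move=> nQ; rewrite /pd; have [h|/derive_eta_out ->] := leP (N ^+ 2 * rho2 q) 2; last by rewrite mulr0.
  rewrite (_ : phi q = 0) ?mul0r//; apply: support_closure_out => Kq; apply: nQ.
  have [[_ _]] := KM _ Kq; rewrite /= in_itv /= => /andP[z1 z2].
  have bound (x y : R) : N ^+ 2 * (x * x + y * y) <= 2 -> - (2 / N) <= x <= 2 / N.
    move=> hxy; rewrite -ler_norml ler_pdivlMr// -[X in _ * X](gtr0_norm N0) -normrM ler_norml.
    have : (x * N) ^+ 2 + (y * N) ^+ 2 <= 2 by apply: le_trans hxy; rewrite le_eqVlt; apply/orP; left; apply/eqP; ring.
    set a := x * N; set b := y * N; have := sqr_ge0 b => b0 ab.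
    by apply/andP; split; nra.
  have := ler_norm M'; have := lerNnormlW (lexx `|M'|) => ZM1 ZM2.
  split; [split|]; rewrite /= in_itv /=.
  - exact: (bound _ q.1.2).
  - by apply: (bound _ q.1.1); rewrite addrC.
  - by rewrite /Z; apply/andP; split; lra.
have pdle q : `|pd n q| <= M * C * N.
  by rewrite normrM -mulrA; apply: ler_pM.
have spd : smooth (pd n) by exact: (smoothM sphi (smooth_derive e (scut 1 n))).
have mpd := msmooth spd.
have le : (L2_integral (leb3 R) Obreve (fun=> 1%R) (fun q => (pd n q)%:C) <= B%:E)%E.
  apply: (@le_trans _ _ (\int[leb3 R]_(q in Obreve) (((M * C * N) ^+ 2)%:E * (\1_Q q)%:E))%E).
    apply: ge0_le_integral => //.
    - by move=> q _; rewrite lee_fin mulr1 sqr_ge0.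
    - by apply/measurable_EFinP; exact: measurable_L2_integrand.
    - apply: measurable_funeM; apply/measurable_EFinP; apply: measurable_funTS.
      exact: measurable_indic.
    - move=> q _; rewrite -EFinM lee_fin mulr1 normc_real indicE.
      have [Qq|/pd0 ->] := pselect (Q q); last by rewrite normr0 expr0n /= mulr_ge0// sqr_ge0.
      rewrite mem_set// mulr1 ler_sqr ?nnegrE ?normr_ge0//.
      by rewrite !mulr_ge0// ltW.
  have mQ1 : measurable_fun Obreve (fun q => (\1_Q q)%:E : \bar R).
    by apply/measurable_EFinP; apply: measurable_funTS; exact: measurable_indic.
  rewrite (ge0_integralZl _ mD mQ1); [|by move=> q _; rewrite lee_fin|by rewrite lee_fin sqr_ge0].
  rewrite integral_indic//.
  apply: (@le_trans _ _ (((M * C * N) ^+ 2)%:E * leb3 R Q)%E).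
    apply: lee_wpmul2l; first by rewrite lee_fin sqr_ge0.
    by apply: le_measure; rewrite ?inE//; exact: measurableI.
  have N2 : 0 <= 2 / N by rewrite divr_ge0// ltW.
  have sym (x : R) : 0 <= x -> - x <= x by move=> x0; apply: (le_trans _ x0); rewrite oppr_le0.
  rewrite leb3_cbox3 ?sym//.
  rewrite -EFinM lee_fin /B le_eqVlt; apply/orP; left; apply/eqP.
  by field; exact: lt0r_neq0.
have foo : (L2_integral (leb3 R) Obreve (fun=> 1%R) (fun q => (pd n q)%:C) < +oo)%E.
  by apply: le_lt_trans le _; rewrite ltry.
split; first by split.
have := le; rewrite -(L2_sqnormE w1D) ?lee_fin; last by split.
by move=> h; apply: le_trans h _; rewrite lerDl.
Qed.

(** The identity is applied to [eta n * phi]. The extra term pairs [f], localized near the axis and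
    thus tending to 0 in L^2, with [phi] times the gradient of [eta n], bounded in L^2. *)
Lemma weak_derivative_remove_axis :
  cintegral (leb3 R) Obreve (fun q => f q * ('D_e phi q)%:C) = - cintegral (leb3 R) Obreve (fun q => G q * (phi q)%:C).
Proof.
have clf := L2_espace_clocally_integrable Lf; have clG := L2_espace_clocally_integrable LG.
have tdphi := test_function_derive e tphi.
have i1 := cintegrable_test ome oD clf tdphi; have i2 := cintegrable_test ome oD clG tphi.
have iF := cintegrableD mD i1 i2.
suff F0 : cintegral (leb3 R) Obreve (fun q => f q * ('D_e phi q)%:C + G q * (phi q)%:C) = 0.
  by move: F0; rewrite (cintegralD mD i1 i2) => /eqP; rewrite addr_eq0 => /eqP.
pose F n q := (eta n q)%:C * (f q * ('D_e phi q)%:C + G q * (phi q)%:C).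
have mF n : cmeasurable Obreve (F n).
  by apply: cmeasurableM; [exact: msmooth (scut 1 n)|exact: cintegrable_cmeasurable iF].
have eta01 n q : 0 <= eta n q <= 1 by exact: chi01.
have F_le n q : Normc.normc (F n q) <= Normc.normc (f q * ('D_e phi q)%:C + G q * (phi q)%:C).
  have /andP[h1 h2] := eta01 n q.
  by rewrite /F Normc.normcM normc_real ger0_norm// ler_piMl// normc_ge0.
have [cR cI] := cintegral_cvg_off_axis mF (cintegrable_cmeasurable iF) iF F_le
  (fun q q0 => filterS (fun n (h : eta n q = 1) => eq_trans (congr1 (fun x : R => x%:C * _) h) (mul1r _)) (eta_eventually q0)).
have [B B0 HB] := sq_pd_le.
have tF n : test_function Obreve (fun q => eta n q * phi q) by exact: (test_functionM (scut 1 n) tphi).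
have sphi : smooth phi by case: tphi.
have DF n q : 'D_e (fun q => eta n q * phi q) q = eta n q * 'D_e phi q + pd n q.
  by have [_ ->] := is_deriveM (smooth_is_derive e q (scut 1 n)) (smooth_is_derive e q sphi).
have E n : cintegral (leb3 R) Obreve (F n) = - inner (leb3 R) Obreve (fun=> 1) (fa n) (fun q => (pd n q)%:C).
  have V0 : (0 : R) < n.+1%:R^-1 by rewrite invr_gt0 ltr0n.
  have off0 q : radius q < n.+1%:R^-1 -> eta n q * phi q = 0.
    move=> h; rewrite /eta /cut chi0 ?mul0r// -rho2E -exprMn subr_le0 -[leRHS](expr1n R 2).
    have q0 : 0 <= radius q by exact: sqrtr_ge0.
    rewrite ler_sqr ?nnegrE ?mulr_ge0//; move: (ltW h).
    by rewrite -ler_pdivlMl ?ltr0n// mulr1.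
  have i3 := cintegrable_test ome oD clf (test_function_derive e (tF n)).
  have i4 := cintegrable_test ome oD clG (tF n).
  have [Lp _] := HB n.
  have i5 := L2_inner_integrable mD m1D w1D (Lfa n) Lp.
  apply/eqP; rewrite -addr_eq0 -(off (tF n) V0 off0) /inner.
  rewrite -(cintegralD mD _ i5); last first.
    apply: (cintegrable_le mD (mF n) (cintegrable_normc mD iF)) => q _.
    exact: F_le.
  apply/eqP; apply: eq_cintegral => q _; rewrite DF /F.
  rewrite (_ : ((pd n q)%:C)^*%C = (pd n q)%:C); last by apply: complexE2 => //=; rewrite oppr0.
  rewrite (_ : (eta n q * 'D_e phi q + pd n q)%:C = (eta n q)%:C * ('D_e phi q)%:C + (pd n q)%:C); last first.
    by rewrite -real_complexM -rmorphD.
  rewrite /fa real_complexM (_ : (near_axis n q)%:C * f q * (pd n q)%:C = f q * (pd n q)%:C).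
    by rewrite mulr1; ring.
  have [h|h] := leP (n.+1%:R ^+ 2 * rho2 q) 2; first by rewrite near_axis1// mul1r.
  by rewrite /pd derive_eta_out// mulr0 !mulr0.
(* In [normc_inner_le], this [s] makes the term of the bounded factor at most [eps / 2]; the other
   term is then small for large [n]. *)
have small (eps : R) : 0 < eps -> \forall n \near \oo, Normc.normc (cintegral (leb3 R) Obreve (F n)) <= eps.
  move=> eps0; pose s := 2 * B / eps; have s0 : 0 < s by rewrite !divr_gt0// mulr_gt0.
  have : \forall n \near \oo, sqD (fa n) < eps / 2 / s.
    have h : 0 < eps / 2 / s := divr_gt0 (divr_gt0 eps0 (ltr0Sn R 1)) s0.
    have /cvgrPdist_lt/(_ _ h) := sq_fa_cvg; apply: filterS => n; rewrite sub0r normrN.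
    exact: le_lt_trans (ler_norm _).
  apply: filterS => n h; rewrite E normcN; have [Lp sp] := HB n.
  apply: le_trans (normc_inner_le mD m1D w1D s0 (Lfa n) Lp) _.
  have -> : eps = s * (eps / 2 / s) + s^-1 * B by rewrite /s; field; rewrite !gt_eqF.
  by apply: lerD; apply: ler_wpM2l => //; [exact: ltW|exact: ltW|rewrite invr_ge0 ltW].
have lim0 (u : nat -> R) l : u @ \oo --> l ->
    (forall n, `|u n| <= Normc.normc (cintegral (leb3 R) Obreve (F n))) -> l = 0.
  move=> ul le; apply: (@cvg_unique _ (@norm_hausdorff _ R) (u @ \oo)) => //.
  apply/cvgrPdist_le => eps eps0; apply: filterS (small eps eps0) => n h.
  by rewrite sub0r normrN; apply: le_trans (le n) h.
apply: complexE2.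
  by apply: lim0 cR _ => n; exact: normr_Re_le.
by apply: lim0 cI _ => n; exact: normr_Im_le.
Qed.

End removal.

Lemma weak_derivative_off_axis (f G : espace R -> R[i]) (e : espace R) :
  L2esp f -> L2esp G -> `|e.1.1| <= 1 -> `|e.1.2| <= 1 ->
  (forall (phi : espace R -> R) (del : R), test_function Obreve phi -> 0 < del ->
    (forall q, radius q < del -> phi q = 0) ->
    cintegral (leb3 R) Obreve (fun q => f q * ('D_e phi q)%:C + G q * (phi q)%:C) = 0) ->
  weak_derivative (leb3 R) Obreve e f G.
Proof.
move=> Lf LG e1 e2 off; have [chi [schi chi01 chi0 chi1]] := @smooth_step R.
split.
- exact: L2_espace_clocally_integrable.
- exact: L2_espace_clocally_integrable.
- by move=> phi tphi; exact: (weak_derivative_remove_axis Lf LG e1 e2 off schi chi01 chi0 chi1 tphi).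
Qed.

Local Notation L2pl := (L2 (leb2 R) Omega (@wpos R)).
Local Notation ex := ((1, 0, 0) : espace R).
Local Notation ey := ((0, 1, 0) : espace R).
Local Notation ez := ((0, 0, 1) : espace R).

(* The coefficient of [(1 / r) d_theta] applied to the mode [c e^(i k theta)]. *)
Definition mode_angular (k : int) (c : plane R -> R[i]) : plane R -> R[i] :=
  fun p => 'i%C * k%:~R * (c p * (p.1^-1)%:C).

Section mode_gradient.
Variables (k : int) (c cr cz : plane R -> R[i]).
Hypotheses (Lc : L2pl c) (Lcr : L2pl cr) (Lcz : L2pl cz) (Ld : L2pl (mode_angular k c)).
Hypotheses (wr : weak_derivative (leb2 R) Omega (1, 0) c cr) (wz : weak_derivative (leb2 R) Omega (0, 1) c cz).
Local Notation m := (mode Omega k).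
Local Notation d := (mode_angular k c).
Let Lm h (Lh : L2pl h) : L2esp (m h) := (L2_mode rev k Lh).1.

Let mode_X h w : X w -> m h (cyl w) = h w.1 * circle_basis k w.2.
Proof. by case: w => p t [Op _]; rewrite (mode_cyl _ _ _ Op (O0 Op)). Qed.

Let to_cylinder (f G : espace R -> R[i]) e (F : plane R * Rm -> R[i]) phi : L2esp f -> L2esp G -> test_function Obreve phi ->
  (forall w, X w -> f (cyl w) * ('D_e phi (cyl w))%:C + G (cyl w) * (phi (cyl w))%:C = F w) ->
  cintegral P X (fun w => F w * (w.1.1)%:C) = 0 ->
  cintegral (leb3 R) Obreve (fun q => f q * ('D_e phi q)%:C + G q * (phi q)%:C) = 0.
Proof.
move=> Lf LG tphi EF F0.
have i1 := cintegrable_test ome oD (L2_espace_clocally_integrable Lf) (test_function_derive e tphi).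
have i2 := cintegrable_test ome oD (L2_espace_clocally_integrable LG) tphi.
rewrite (cintegral_cyl rev (cintegrable_cmeasurable (cintegrableD mD i1 i2))) -F0.
by apply: eq_cintegral => w Xw; rewrite EF.
Qed.

Lemma weak_derivative_mode_z : weak_derivative (leb3 R) Obreve ez (m c) (m cz).
Proof.
apply: weak_derivative_off_axis; rewrite ?normr0 ?ler01//; [exact: Lm|exact: Lm|].
move=> phi del tphi del0 phi0.
apply: (to_cylinder (Lm Lc) (Lm Lcz) tphi _ (axial_by_parts rev Obreve_finite tphi del0 phi0 k Lc Lcz wz)).
by move=> w Xw; rewrite !mode_X.
Qed.

Let phase_X w : X w -> phase (cyl w) = expi w.2.
Proof. by case: w => p t [Op _]; rewrite phase_cyl// O0. Qed.

Lemma weak_derivative_mode_x : weak_derivative (leb3 R) Obreve ex (m c)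
  (fun q => (complex.Re (phase q))%:C * m cr q + (- complex.Im (phase q))%:C * m d q).
Proof.
have [m1 m2 m3 B] := phase_part Obreve.
have LG : L2esp (fun q => (complex.Re (phase q))%:C * m cr q + (- complex.Im (phase q))%:C * m d q).
  apply: (L2D mD m1D w1D).
    by have [] := L2_bounded_mul rev m1 (fun q => let: And3 h _ _ := B q in h) (Lm Lcr).
  by have [] := L2_bounded_mul rev m3 (fun q => let: And3 _ _ h := B q in h) (Lm Ld).
apply: weak_derivative_off_axis; rewrite ?normr0 ?normr1 ?ler01//; first exact: Lm.
move=> phi del tphi del0 phi0.
have dms (t : R) : is_derive t (1 : R) (fun t => - sin t) (- cos t).
  by apply: is_deriveN.
have cms : continuous (fun t : R => - sin t) by move=> t; apply: cvgN; exact: continuous_sin.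
apply: (to_cylinder (Lm Lc) LG tphi _ (planar_by_parts rev Obreve_finite tphi del0 phi0 k Lc Lcr wr
   (A := cos) (dA := fun t => - sin t) (e := ex) _ _ dms _ (@continuous_cos R) cms _)).
- by move=> w Xw; rewrite !mode_X// phase_X//= /mode_angular; congr (_ + _ * _); ring.
- by move=> t; rewrite ler_norml cos_geN1 cos_le1.
- by move=> t; rewrite normrN ler_norml sin_geN1 sin_le1.
- by rewrite sinN sinpi !oppr0.
- by move=> w Xw; exact: (rotating_frame _ _ (cos2Dsin2 w.2)).1.
Qed.

Lemma weak_derivative_mode_y : weak_derivative (leb3 R) Obreve ey (m c)
  (fun q => (complex.Im (phase q))%:C * m cr q + (complex.Re (phase q))%:C * m d q).
Proof.
have [m1 m2 m3 B] := phase_part Obreve.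
have LG : L2esp (fun q => (complex.Im (phase q))%:C * m cr q + (complex.Re (phase q))%:C * m d q).
  apply: (L2D mD m1D w1D).
    by have [] := L2_bounded_mul rev m2 (fun q => let: And3 _ h _ := B q in h) (Lm Lcr).
  by have [] := L2_bounded_mul rev m1 (fun q => let: And3 h _ _ := B q in h) (Lm Ld).
apply: weak_derivative_off_axis; rewrite ?normr0 ?normr1 ?ler01//; first exact: Lm.
move=> phi del tphi del0 phi0.
apply: (to_cylinder (Lm Lc) LG tphi _ (planar_by_parts rev Obreve_finite tphi del0 phi0 k Lc Lcr wr
   (A := sin) (dA := cos) (e := ey) _ _ (@is_derive_cos R) _ (@continuous_sin R) (@continuous_cos R) _)).
- by move=> w Xw; rewrite !mode_X// phase_X//= /mode_angular; congr (_ + _ * _); ring.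
- by move=> t; rewrite ler_norml sin_geN1 sin_le1.
- by move=> t; rewrite ler_norml cos_geN1 cos_le1.
- by rewrite cosN.
- by move=> w Xw; exact: (rotating_frame _ _ (cos2Dsin2 w.2)).2.
Qed.

End mode_gradient.
End off_axis.

(** * Quadratic forms and H1 spaces *)

Section quadratic_forms.
Context {R : realType} {V : Type}.
Variables (zero : V) (comb : R[i] -> V -> V -> V).
Implicit Types (X : set V) (q : V -> R).

(* [comb a u v] stands for [a u + v]; the number [b] is the value at [(u, v)]
   of the sesquilinear form polarizing [q]. *)
Definition quadratic X q :=
  [/\ X zero /\ q zero = 0,
      forall a u v, X u -> X v -> X (comb a u v),
      forall u, X u -> 0 <= q u
    & forall u v, X u -> X v -> exists b, forall a,
        q (comb a u v) = Normc.normc a ^+ 2 * q u + q v + 2 * complex.Re (a * b)].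

Lemma quadraticD X q q' : quadratic X q -> quadratic X q' -> quadratic X (fun u => q u + q' u).
Proof.
move=> [[X0 q0] XL qpos qb] [[_ q'0] _ q'pos q'b]; split=> //.
- by rewrite q0 q'0 addr0.
- by move=> u Xu; rewrite addr_ge0 ?qpos ?q'pos.
- move=> u v Xu Xv; have [b hb] := qb u v Xu Xv; have [b' hb'] := q'b u v Xu Xv.
  by exists (b + b') => a; rewrite hb hb' [a * (b + b')]mulrDr ReD; ring.
Qed.

Lemma quadraticZ X q (s : R) : 0 <= s -> quadratic X q -> quadratic X (fun u => s * q u).
Proof.
move=> s0 [[X0 q0] XL qpos qb]; split=> //.
- by rewrite q0 mulr0.
- by move=> u Xu; rewrite mulr_ge0 ?qpos.
- move=> u v Xu Xv; have [b hb] := qb u v Xu Xv.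
  exists (s%:C * b) => a; rewrite hb [a * (_ * _)]mulrCA; case: (a * b) => x y /=; ring.
Qed.

Lemma quadratic_sum (I : eqType) (r : seq I) X (q : I -> V -> R) : quadratic X (fun=> 0) ->
  (forall i, i \in r -> quadratic X (q i)) -> quadratic X (fun u => \sum_(i <- r) q i u).
Proof.
move=> Q0; elim: r => [|i r IH] Q.
  by rewrite (_ : (fun u => _) = fun=> 0)//; apply/funext => u; rewrite big_nil.
rewrite (_ : (fun u => _) = (fun u => q i u + \sum_(j <- r) q j u)); last first.
  by apply/funext => u; rewrite big_cons.
apply: quadraticD; first by apply: Q; rewrite mem_head.
by apply: IH => j jr; apply: Q; rewrite in_cons jr orbT.
Qed.

Lemma quadratic_sub X Y q : Y `<=` X -> Y zero -> (forall a u v, Y u -> Y v -> Y (comb a u v)) ->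
  quadratic X q -> quadratic Y q.
Proof.
move=> YX Y0 YL [[_ q0] _ qpos qb]; split=> //.
- by move=> u /YX; exact: qpos.
- by move=> u v /YX Xu /YX Xv; exact: qb.
Qed.

Lemma eq_quadratic X q q' : (forall u, X u -> q u = q' u) -> quadratic X q -> quadratic X q'.
Proof.
move=> E [[X0 q0] XL qpos qb]; split=> //.
- by rewrite -E.
- by move=> u Xu; rewrite -E// qpos.
- move=> u v Xu Xv; have [b hb] := qb u v Xu Xv.
  by exists b => a; rewrite -!E//; exact: XL.
Qed.

(** [comb] is abstract, so the polarization [b] against [zero] has to be shown to vanish.
    Nonnegativity at the scalar [- conj b / (q u + 1)] gives [- (x + x^2) |b|^2 >= 0] with
    [x = 1 / (q u + 1)]. *)
Lemma quadratic_homogeneous X q (a : R[i]) u : quadratic X q -> X u ->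
  q (comb a u zero) = Normc.normc a ^+ 2 * q u.
Proof.
move=> [[X0 q0] XL qpos qb] Xu; have [b hb] := qb u zero Xu X0.
suff b0 : b = 0 by rewrite hb q0 b0 mulr0 /= mulr0 !addr0.
have sq : Normc.normc b ^+ 2 = 0.
  apply/eqP; rewrite eq_le sqr_ge0 andbT.
  have s0 : 0 < 2 * (q u + 1) by rewrite mulr_gt0// ltr_wpDl// qpos.
  have := qpos _ (XL (- (q u + 1)^-1%:C * b^*%C) u zero Xu X0).
  have qu1 : 0 < q u + 1 by rewrite ltr_wpDl// qpos.
  have bb : complex.Re (- (q u + 1)^-1%:C * b^*%C * b) = - (q u + 1)^-1 * Normc.normc b ^+ 2.
    by rewrite sqr_normc; case: (b) => x y /=; ring.
  have nb : Normc.normc (- (q u + 1)^-1%:C * b^*%C) ^+ 2 = (q u + 1)^-1 ^+ 2 * Normc.normc b ^+ 2.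
    by rewrite !sqr_normc; case: (b) => x y /=; ring.
  rewrite hb bb nb q0 addr0; set n := Normc.normc b ^+ 2; set x := (q u + 1)^-1.
  have x0 : 0 < x by rewrite invr_gt0.
  have xq : x * (q u + 1) = 1 by rewrite /x mulVf ?gt_eqF.
  have -> : x ^+ 2 * n * q u + 2 * (- x * n) = x * n * (x * (q u + 1)) - x ^+ 2 * n - 2 * x * n by ring.
  rewrite xq mulr1 => h.
  have : (x * n + x ^+ 2 * n) <= 0 by lra.
  have -> : x * n + x ^+ 2 * n = (x + x ^+ 2) * n by ring.
  by rewrite pmulr_rle0// addr_gt0// exprn_gt0.
apply: complexE2 => /=; move: sq; rewrite sqr_normc; case: (b) => x y /= h.
  by have := sqr_ge0 x; have := sqr_ge0 y => h1 h2; apply/eqP; rewrite -sqrf_eq0; apply/eqP; lra.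
by have := sqr_ge0 x; have := sqr_ge0 y => h1 h2; apply/eqP; rewrite -sqrf_eq0; apply/eqP; lra.
Qed.

Lemma quadratic_parallelogram X q u v : quadratic X q -> X u -> X v ->
  q (comb 1 u v) + q (comb (-1) u v) = 2 * q u + 2 * q v.
Proof.
move=> [_ XL qpos qb] Xu Xv; have [b hb] := qb u v Xu Xv; rewrite !hb.
have n1 : Normc.normc (1 : R[i]) = 1 by rewrite -[1%R]/(1%:C) normc_real normr1.
by rewrite normcN n1 expr1n mulN1r mul1r; case: b {hb} => x y /=; ring.
Qed.

(** The parallelogram law with the opposite unit scalars [i] and [- i]: the polarization terms
    cancel. *)
Lemma quadratic_spin X q u v : quadratic X q -> X u -> X v ->
  q (comb 'i%C u v) + q (comb (- 'i%C) u v) = 2 * q u + 2 * q v.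
Proof.
move=> [_ XL qpos qb] Xu Xv; have [b hb] := qb u v Xu Xv; rewrite !hb normcN.
have n1 : Normc.normc ('i%C : R[i]) ^+ 2 = 1 by rewrite sqr_normc /=; ring.
by rewrite n1 mulNr; case: ('i%C * b) => x y /=; ring.
Qed.

Lemma quadratic_add_le X q u v : quadratic X q -> X u -> X v -> q (comb 1 u v) <= 2 * q u + 2 * q v.
Proof.
move=> Q Xu Xv; rewrite -(quadratic_parallelogram Q Xu Xv) lerDl.
by have [_ XL qpos _] := Q; apply: qpos; exact: XL.
Qed.

Lemma quadratic_triangle X q u v : quadratic X q -> X u -> X v ->
  Num.sqrt (q (comb 1 u v)) <= Num.sqrt (q u) + Num.sqrt (q v).
Proof.
move=> [[X0 q0] XL qpos qb] Xu Xv; have [b hb] := qb u v Xu Xv.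
have qu := qpos u Xu; have qv := qpos v Xv.
have n1 : Normc.normc (1 : R[i]) = 1 by rewrite -[1%R]/(1%:C) normc_real normr1.
set x := Num.sqrt (q u); set y := Num.sqrt (q v).
have x0 : 0 <= x by exact: sqrtr_ge0.
have y0 : 0 <= y by exact: sqrtr_ge0.
have xE : x ^+ 2 = q u by exact: sqr_sqrtr.
have yE : y ^+ 2 = q v by exact: sqr_sqrtr.
have key (s : R) : 0 <= s ^+ 2 * q u + q v + 2 * (s * complex.Re b).
  have := qpos _ (XL s%:C u v Xu Xv); rewrite hb normc_real real_normK ?num_real//.
  by rewrite ReM /= mul0r subr0.
(* Cauchy-Schwarz from nonnegativity along real multiples of [u]: [s = - y / x] in general, other
   values when [x] or [y] vanishes. *)
have cs : complex.Re b <= x * y.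
  have [xp|] := ltP 0 x.
    have := key (- y / x); rewrite -xE -yE (_ : (- y / x) ^+ 2 * x ^+ 2 = y ^+ 2); last by field; rewrite gt_eqF.
    rewrite (_ : - y / x * complex.Re b = - (y * complex.Re b / x)); last by ring.
    have [yp|] := ltP 0 y.
      move=> h; have : y * complex.Re b / x <= y ^+ 2 by lra.
      by rewrite ler_pdivrMr// expr2 -mulrA ler_pM2l// mulrC.
    move=> yn; have y00 : y = 0 by apply/eqP; rewrite eq_le yn.
    move=> _; have := key (- (complex.Re b) / x ^+ 2); rewrite -xE -yE y00 expr0n addr0.
    rewrite (_ : _ + _ = - (complex.Re b / x) ^+ 2); last by field; rewrite gt_eqF.
    rewrite oppr_ge0 => h; have : (complex.Re b / x) ^+ 2 == 0 by rewrite eq_le h sqr_ge0.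
    by rewrite sqrf_eq0 mulf_eq0 invr_eq0 (gt_eqF xp) orbF => /eqP ->; rewrite mulr0.
  move=> xn; have x00 : x = 0 by apply/eqP; rewrite eq_le xn.
  rewrite x00 mul0r; have q00 : q u = 0 by rewrite -xE x00 expr0n.
  rewrite leNgt; apply/negP => bp.
  have := key (- (q v + 1) / complex.Re b); rewrite q00 mulr0 add0r divfK ?gt_eqF//; lra.
rewrite -(ger0_norm (addr_ge0 x0 y0)) -sqrtr_sqr; apply: ler_wsqrtr.
rewrite hb n1 expr1n mul1r mul1r -xE -yE; lra.
Qed.

End quadratic_forms.

Lemma quadratic_comp (R : realType) (V W : Type) (zV : V) (zW : W) (cV : R[i] -> V -> V -> V) (cW : R[i] -> W -> W -> W)
    (L : V -> W) (X : set W) (q : W -> R) :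
  L zV = zW -> (forall a u v, L (cV a u v) = cW a (L u) (L v)) ->
  quadratic zW cW X q -> quadratic zV cV [set u | X (L u)] (fun u => q (L u)).
Proof.
move=> L0 LL [[X0 q0] XL qpos qb]; split=> /=.
- by rewrite L0.
- by move=> a u v Xu Xv; rewrite LL; exact: XL.
- by move=> u; exact: qpos.
- move=> u v Xu Xv; have [b hb] := qb _ _ Xu Xv.
  by exists b => a; rewrite LL.
Qed.

Lemma quadratic_normed_space (R : realType) (V : lmodType R[i]) (X : set V) (eqX : V -> V -> Prop) (q : V -> R) :
  quadratic 0 (fun a u v => a *: u + v) X q -> (forall u, X u -> q u = 0 <-> eqX u 0) ->
  normed_space X eqX (fun u => Num.sqrt (q u)).
Proof.
move=> Q def; have [[X0 q0] XL qpos qb] := Q; split=> //.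
- by move=> u v Xu Xv; have := quadratic_triangle Q Xu Xv; rewrite scale1r.
- move=> a u Xu; have := quadratic_homogeneous a Q Xu; rewrite addr0 => ->.
  by rewrite sqrtrM ?sqr_ge0// sqrtr_sqr ger0_norm// normc_ge0.
- move=> u Xu; split; first exact: sqrtr_ge0.
  split; last by move=> /(def u Xu) ->; rewrite sqrtr0.
  move=> /eqP; rewrite sqrtr_eq0 => h; apply/(def u Xu); apply/eqP.
  by rewrite eq_le h qpos.
Qed.

Section function_spaces.
Context {R : realType} {d : measure_display} {T : measurableNormedModType R d}.
Variables (mu : {measure set T -> \bar R}) (D : set T).
Hypothesis open_measurableT : forall U : set T, open U -> measurable U.
Hypothesis oD : open D.
Hypothesis FL : fundamental_lemma mu D.
Variables (w : T -> R) (mw : measurable_fun D w) (w_gt0 : forall x, D x -> 0 < w x).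
Implicit Types (f g u v : T -> R[i]) (e : T) (es : seq T).

Let mD : measurable D. Proof. exact: open_measurableT. Qed.

Definition fcomb (a : R[i]) u v : T -> R[i] := fun x => a * u x + v x.
Local Notation L2 := (L2 mu D w).
Local Notation sqn := (L2_sqnorm mu D w).
Local Notation fquadratic := (quadratic (fun=> 0) fcomb).

Lemma L2_zero : L2 (fun=> 0).
Proof.
split; first exact: cmeasurable_cst.
by rewrite /L2_integral; under eq_integral do rewrite Normc.normc0 expr0n mul0r; rewrite integral0.
Qed.

Lemma ae_eq_L2_sqnorm f g : cmeasurable D f -> cmeasurable D g -> f = g %[ae mu in D] -> sqn f = sqn g.
Proof. by move=> mf mg fg; rewrite /L2_sqnorm (ae_eq_L2_integral mD mw w_gt0 mf mg fg). Qed.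

Lemma L2_fcomb a u v : L2 u -> L2 v -> L2 (fcomb a u v).
Proof. by move=> Lu Lv; apply: (L2D mD mw w_gt0) => //; exact: L2_Z. Qed.

Lemma L2_sqnorm_fcomb a u v : L2 u -> L2 v ->
  sqn (fcomb a u v) = Normc.normc a ^+ 2 * sqn u + sqn v + 2 * complex.Re (a * inner mu D w u v).
Proof.
move=> Lu Lv; have Lau : L2 (fun x => a * u x) by exact: L2_Z.
rewrite /fcomb (L2_sqnormD mD mw w_gt0 Lau Lv) (L2_sqnormZ mD mw w_gt0 a Lu).
have := inner_linear mD mw w_gt0 a Lu L2_zero Lv.
rewrite (_ : (fun x => a * u x + 0) = (fun x => a * u x)); last by apply/funext => x; rewrite addr0.
move=> ->; congr (_ + 2 * complex.Re _); rewrite (_ : inner _ _ _ (fun=> 0) v = 0) ?addr0//.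
by rewrite /inner; under eq_cintegral do rewrite !mul0r; rewrite cintegral0.
Qed.

Lemma L2_quadratic : fquadratic L2 sqn.
Proof.
split.
- split; first exact: L2_zero.
  by apply/(L2_sqnorm_eq0 mD mw w_gt0 L2_zero); apply: aeW.
- exact: L2_fcomb.
- by move=> u _; exact: L2_sqnorm_ge0.
- by move=> u v Lu Lv; exists (inner mu D w u v) => a; exact: L2_sqnorm_fcomb.
Qed.

(** [wderive] is an arbitrary choice; almost everywhere uniqueness lets any explicit weak derivative
    compute the seminorm. *)
Lemma sqn_wderive e v g : weak_derivative mu D e v g -> L2 g ->
  L2 (wderive mu D e v) /\ sqn (wderive mu D e v) = sqn g.
Proof.
move=> vg Lg; have [vd dg] := wderiveP open_measurableT oD FL vg.
have [_ [md _] _] := vd.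
have gd : g = wderive mu D e v %[ae mu in D] by apply: filterS dg => x + Dx => /(_ Dx) ->.
by split; [exact: (ae_eq_L2 mD mw w_gt0 md gd Lg)|apply: ae_eq_L2_sqnorm => //; exact: Lg.1].
Qed.

Lemma H1_wderive es e v : H1 mu D w es v -> e \in es ->
  weak_derivative mu D e v (wderive mu D e v) /\ L2 (wderive mu D e v).
Proof.
move=> [Lv dv] ee; have [g vg Lg] := dv e ee.
by split; [exact: (wderiveP open_measurableT oD FL vg).1|exact: (sqn_wderive vg Lg).1].
Qed.

Lemma H1_fcomb es a u v : H1 mu D w es u -> H1 mu D w es v -> H1 mu D w es (fcomb a u v).
Proof.
move=> Hu Hv; split; first exact: L2_fcomb Hu.1 Hv.1.
move=> e ee; have [du Lu] := H1_wderive Hu ee; have [dv Lv] := H1_wderive Hv ee.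
exists (fcomb a (wderive mu D e u) (wderive mu D e v)); last exact: L2_fcomb.
exact: weak_derivative_linear.
Qed.

Lemma H1_zero es : H1 mu D w es (fun=> 0).
Proof.
split; first exact: L2_zero.
by move=> e _; exists (fun=> 0); [exact: weak_derivative0|exact: L2_zero].
Qed.

Lemma H1_quadratic es : fquadratic (H1 mu D w es) (H1_sqseminorm mu D w es).
Proof.
apply: quadratic_sum.
  split=> //; [by split=> //; exact: H1_zero|exact: H1_fcomb|].
  by move=> u v _ _; exists 0 => a; rewrite !mulr0 /= !addr0.
have [[_ q0] _ qpos qb] := L2_quadratic.
move=> e ee; split.
- split; first exact: H1_zero.
  by have [_ ->] := sqn_wderive (weak_derivative0 mu D e) L2_zero.
- exact: H1_fcomb.
- by move=> u Hu; apply: L2_sqnorm_ge0.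
- move=> u v Hu Hv; have [du Lu] := H1_wderive Hu ee; have [dv Lv] := H1_wderive Hv ee.
  have [b hb] := qb _ _ Lu Lv; exists b => a; rewrite -hb.
  have wd := weak_derivative_linear open_measurableT oD a du dv.
  by have [_ ->] := sqn_wderive wd (L2_fcomb a Lu Lv).
Qed.

Lemma ae_eq_H1 es u v : H1 mu D w es u -> cmeasurable D v -> u = v %[ae mu in D] ->
  H1 mu D w es v /\ H1_sqseminorm mu D w es v = H1_sqseminorm mu D w es u.
Proof.
move=> Hu mv uv.
have dv e : e \in es -> weak_derivative mu D e v (wderive mu D e u).
  move=> ee; have [du Lu] := H1_wderive Hu ee.
  apply: (ae_eq_weak_derivative open_measurableT oD mv Lu.1 uv _ du); exact: ae_eq_refl.
split; first split.
- exact: (ae_eq_L2 mD mw w_gt0 mv uv Hu.1).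
- by move=> e ee; exists (wderive mu D e u); [exact: dv|exact: (H1_wderive Hu ee).2].
- apply: eq_big_seq => e ee.
  by have [_ ->] := sqn_wderive (dv e ee) (H1_wderive Hu ee).2.
Qed.

End function_spaces.

(** * Scalar fields *)

Lemma sum_rearrange (R : zmodType) (r a x y z t : R) : r + a = x + y -> t + r + z + a = t + (x + y + z).
Proof. by move=> <-; rewrite -!addrA; congr (_ + (_ + _)); rewrite addrC. Qed.

Section scalar_fourier.
Context {R : realType}.
Local Notation J := (@angles R).
Local Notation ex := ((1, 0, 0) : espace R).
Local Notation ey := ((0, 1, 0) : espace R).
Local Notation ez := ((0, 0, 1) : espace R).
Variables (Omega : set (plane R)) (Obreve : set (espace R)).
Hypotheses (rev : revolved Omega Obreve) (Obreve_finite : (leb3 R Obreve < +oo)%E).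

Local Notation L2esp := (L2 (leb3 R) Obreve (fun=> 1)).
Local Notation L2pl := (L2 (leb2 R) Omega (@wpos R)).
Local Notation sqD := (L2_sqnorm (leb3 R) Obreve (fun=> 1)).
Local Notation H1esp := (H1 (leb3 R) Obreve (fun=> 1) (@axes3 R)).
Local Notation sqO := (sqL2p Omega).
Implicit Types (f g : espace R -> R[i]) (c : plane R -> R[i]) (k : int).

Let mO : measurable Omega := revolved_measurable_plane rev.
Let mD : measurable Obreve := revolved_measurable_espace rev.
Let m1D : measurable_fun Obreve (fun=> 1 : R). Proof. by []. Qed.
Let w1D (x : espace R) : Obreve x -> (0 : R) < 1. Proof. by []. Qed.
Let mwp : measurable_fun Omega (@wpos R). Proof. by apply: measurable_funTS; exact: measurable_fst. Qed.
Let wp0 p : Omega p -> 0 < wpos p. Proof. exact: (revolved_pos rev). Qed.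
Let O0 := revolved_pos rev.
Let oO : open Omega. Proof. by case: rev. Qed.
Let oD : open Obreve. Proof. by case: rev. Qed.
Let omp := @open_measurable_plane R.
Let ome := @open_measurable_espace R.
Let FLO := fundamental_lemma_plane oO.
Let FLD := fundamental_lemma_espace oD.

Lemma measurable_wneg : measurable_fun Omega (@wneg R).
Proof.
apply: (@eq_measurable_fun _ _ _ _ _ (fun p : plane R => p.1 `^ (-1))).
  by move=> p /[!inE] /O0 /ltW; exact: powR_inv1.
apply: measurable_funTS.
by apply: (measurableT_comp (f := (@powR R)^~ (-1))); [exact: measurable_powR|exact: measurable_fst].
Qed.

Lemma wneg_gt0 p : Omega p -> 0 < wneg p.
Proof. by move=> /O0; rewrite /wneg invr_gt0. Qed.

Lemma L2_integral_mode_angular k c : cmeasurable Omega c ->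
  L2_integral (leb2 R) Omega (@wpos R) (mode_angular k c) =
  ((k%:~R ^+ 2)%:E * L2_integral (leb2 R) Omega (@wneg R) c)%E.
Proof.
move=> mc; rewrite /L2_integral -ge0_integralZl//; last 3 first.
- by apply/measurable_EFinP; apply: measurable_L2_integrand => //; exact: measurable_wneg.
- by move=> p /wneg_gt0 w0; rewrite lee_fin mulr_ge0 ?sqr_ge0// ltW.
- by rewrite lee_fin sqr_ge0.
apply: eq_integral => p /[!inE] /O0 p0; rewrite -EFinM; congr EFin.
have kE : (k%:~R : R[i]) = (k%:~R)%:C by rewrite -[RHS]/(real_complex _ _) rmorph_int.
rewrite /mode_angular !sqr_normc /wpos /wneg kE; case: (c p) => x y /=.
by field; rewrite gt_eqF.
Qed.

Lemma cmeasurable_mode_angular k c : cmeasurable Omega c -> cmeasurable Omega (mode_angular k c).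
Proof.
move=> mc; apply: cmeasurableZ; apply: cmeasurableM => //; apply: cmeasurableC.
exact: measurable_wneg.
Qed.

Lemma L2_mode_angular k c : cmeasurable Omega c -> (k != 0 -> L2m Omega c) ->
  L2pl (mode_angular k c) /\ sqO (mode_angular k c) = k%:~R ^+ 2 * sqL2m Omega c.
Proof.
move=> mc Lc; have mk := cmeasurable_mode_angular k mc.
rewrite /sqL2p /L2 /= /L2_sqnorm L2_integral_mode_angular//.
have [->|k0] := eqVneq k 0.
  have z : (0%:~R : R) ^+ 2 = 0 by rewrite expr0n.
  by rewrite z mul0r mul0e; split; [split; [exact: cmeasurable_mode_angular|exact: lt0y]|].
have Lm := Lc k0; rewrite /sqL2m -(L2_sqnormE wneg_gt0 Lm) -EFinM; split=> //.
by split=> //; rewrite ltry.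
Qed.

Lemma L2_mode_angular_inv k c : cmeasurable Omega c -> k != 0 -> L2pl (mode_angular k c) -> L2m Omega c.
Proof.
move=> mc k0 [_]; rewrite L2_integral_mode_angular// => h; split=> //; move: h.
have k2 : 0 < (k%:~R : R) ^+ 2 by rewrite exprn_even_gt0 ?intr_eq0//=.
rewrite /L2_integral; set I := integral _ _ _ => h.
have I0 : (0 <= I)%E by apply: integral_ge0 => p /wneg_gt0 w0; rewrite lee_fin mulr_ge0 ?sqr_ge0// ltW.
by move: h; case: (I) I0 => [r|_|]//; rewrite ?ltry// muleC gt0_mulye// lte_fin.
Qed.

(* The scalar counterpart of [H1k]: the functions [c] such that [c e^(i k theta)] is in
   H^1 of the revolved domain. *)
Definition scalar_space k c := H11 Omega c /\ (k != 0 -> L2m Omega c).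
Definition scalar_sqnorm k c : R := sqO c + sqH11 Omega c + k%:~R ^+ 2 * sqL2m Omega c.

Lemma sqL2p_ge0 c : 0 <= sqO c. Proof. exact: L2_sqnorm_ge0. Qed.
Lemma sqL2m_ge0 c : 0 <= sqL2m Omega c. Proof. exact/L2_sqnorm_ge0/wneg_gt0. Qed.
Lemma sqH11_ge0 c : 0 <= sqH11 Omega c.
Proof. by apply: sumr_ge0 => e _; exact: L2_sqnorm_ge0. Qed.

Lemma scalar_sqnorm_ge0 k c : 0 <= scalar_sqnorm k c.
Proof.
by rewrite addr_ge0//; [rewrite addr_ge0 ?sqL2p_ge0 ?sqH11_ge0|rewrite mulr_ge0 ?sqr_ge0 ?sqL2m_ge0].
Qed.

Lemma sqH11E c : sqH11 Omega c =
  L2_sqnorm (leb2 R) Omega (@wpos R) (wderive (leb2 R) Omega (1, 0) c) +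
  L2_sqnorm (leb2 R) Omega (@wpos R) (wderive (leb2 R) Omega (0, 1) c).
Proof. by rewrite /sqH11 /H1_sqseminorm /axes2 big_cons big_seq1. Qed.

Lemma scalar_spaceP k c cr cz : L2pl c -> L2pl cr -> L2pl cz -> L2pl (mode_angular k c) ->
  weak_derivative (leb2 R) Omega (1, 0) c cr -> weak_derivative (leb2 R) Omega (0, 1) c cz ->
  scalar_space k c /\ scalar_sqnorm k c = sqO c + sqO cr + sqO cz + sqO (mode_angular k c).
Proof.
move=> Lc Lcr Lcz Ld wr wz.
have Lm (k0 : k != 0) : L2m Omega c by exact: L2_mode_angular_inv Lc.1 k0 Ld.
split.
  split=> //; split=> // e; rewrite /axes2 !inE => /orP[] /eqP ->; first by exists cr.
  by exists cz.
have [_ ->] := L2_mode_angular Lc.1 Lm.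
have [_ Er] := sqn_wderive omp oO FLO mwp wp0 wr Lcr; have [_ Ez] := sqn_wderive omp oO FLO mwp wp0 wz Lcz.
rewrite /scalar_sqnorm (eq_trans (sqH11E c) (f_equal2 +%R Er Ez)).
exact: (congr1 (+%R^~ _) (addrA _ _ _)).
Qed.

Lemma scalar_spaceE k c : scalar_space k c -> exists cr cz,
  [/\ L2pl cr, L2pl cz, weak_derivative (leb2 R) Omega (1, 0) c cr & weak_derivative (leb2 R) Omega (0, 1) c cz].
Proof.
move=> [Hc _]; have e1 : (1, 0) \in @axes2 R by rewrite inE eqxx.
have e2 : (0, 1) \in @axes2 R by rewrite !inE eqxx orbT.
have [wr Lr] := H1_wderive omp oO FLO mwp wp0 Hc e1; have [wz Lz] := H1_wderive omp oO FLO mwp wp0 Hc e2.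
exact: (ex_intro _ _ (ex_intro _ _ (And4 Lr Lz wr wz))).
Qed.

(** The rotation is pointwise isometric off the axis. The comparison is made in cylindrical
    coordinates because [phase] is 0, not of modulus 1, on the axis. *)
Lemma L2_sqnorm_radial_angular g1 g2 : L2esp g1 -> L2esp g2 ->
  sqD (radial_part g1 g2) + sqD (angular_part g1 g2) = sqD g1 + sqD g2.
Proof.
move=> L1 L2; have Lr := L2_radial_part rev L1 L2; have La := L2_angular_part rev L1 L2.
have E g : L2esp g -> sqD g = complex.Re (inner (leb3 R) Obreve (fun=> 1) g g) by move=> /inner_sqnorm ->.
rewrite !E// -!ReD; congr complex.Re; rewrite /inner.
have ii g (Lg : L2esp g) := L2_inner_integrable mD m1D w1D Lg Lg.
rewrite -(cintegralD mD (ii _ Lr) (ii _ La)) -(cintegralD mD (ii _ L1) (ii _ L2)).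
have m g h : L2esp g -> L2esp h -> cmeasurable Obreve (fun x => g x * (g x)^*%C * 1%:C + h x * (h x)^*%C * 1%:C).
  move=> Lg Lh; exact: cintegrable_cmeasurable (cintegrableD mD (L2_inner_integrable mD m1D w1D Lg Lg) (L2_inner_integrable mD m1D w1D Lh Lh)).
rewrite (cintegral_cyl rev (m _ _ Lr La)) (cintegral_cyl rev (m _ _ L1 L2)); apply: eq_cintegral => -[p t] [Op _].
have ph := phase_cyl t (O0 Op); rewrite /radial_part /angular_part ph /=; congr (_ * _).
have := cos2Dsin2 t; set a := cos t; set b := sin t => ab.
case: (g1 _) => x y; case: (g2 _) => u v; apply: complexE2 => /=.
  transitivity ((a ^+ 2 + b ^+ 2) * (x ^+ 2 + y ^+ 2 + u ^+ 2 + v ^+ 2)); first by ring.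
  by rewrite ab; ring.
by ring.
Qed.

Lemma hat_scalar_space k f : H1esp f ->
  let g e := wderive (leb3 R) Obreve e f in
  scalar_space k (hat k f) /\ scalar_sqnorm k (hat k f) =
  sqO (hat k f) + sqO (hat k (radial_part (g ex) (g ey))) + sqO (hat k (g ez)) +
  sqO (hat k (angular_part (g ex) (g ey))).
Proof.
move=> Hf g; have H e (ee : e \in @axes3 R) := H1_wderive ome oD FLD m1D w1D Hf ee.
have e1 : ex \in @axes3 R by rewrite !inE eqxx.
have e2 : ey \in @axes3 R by rewrite !inE eqxx ?orbT.
have e3 : ez \in @axes3 R by rewrite !inE eqxx ?orbT.
have [w1 L1] := H _ e1; have [w2 L2] := H _ e2; have [w3 L3] := H _ e3.
have hL h : L2esp h -> L2pl (hat k h) by move=> Lh; have [] := L2_hat rev Obreve_finite k Lh.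
have Lc := hL _ Hf.1; have La := hL _ (L2_angular_part rev L1 L2).
have da := hat_angular rev Obreve_finite Hf.1 L1 L2 w1 w2 k.
have md := cmeasurable_mode_angular k Lc.1.
have ad : hat k (angular_part (g ex) (g ey)) = mode_angular k (hat k f) %[ae leb2 R in Omega].
  by apply: filterS da => p + Op => /(_ Op) <-.
have Ld : L2pl (mode_angular k (hat k f)) := ae_eq_L2 mO mwp wp0 md ad La.
have wr := weak_derivative_hat_r rev Obreve_finite Hf.1 L1 L2 w1 w2 k.
have wz := weak_derivative_hat_z rev Obreve_finite Hf.1 L3 w3 k.
have [S E] := scalar_spaceP Lc (hL _ (L2_radial_part rev L1 L2)) (hL _ L3) Ld wr wz.
split=> //; rewrite E; congr (_ + _).
by apply/esym; apply: (ae_eq_L2_sqnorm omp oO mwp wp0 La.1 md ad).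
Qed.

Lemma H1_sqseminorm3E f : H1_sqseminorm (leb3 R) Obreve (fun=> 1) (@axes3 R) f =
  sqD (wderive (leb3 R) Obreve ex f) + sqD (wderive (leb3 R) Obreve ey f) + sqD (wderive (leb3 R) Obreve ez f).
Proof. by rewrite /H1_sqseminorm /axes3 big_cons big_cons big_seq1; exact: addrA. Qed.

Lemma scalar_parseval f : H1esp f ->
  (\esum_(k in [set: int]) (scalar_sqnorm k (hat k f))%:E)%E =
  (sqD f + H1_sqseminorm (leb3 R) Obreve (fun=> 1) (@axes3 R) f)%:E.
Proof.
move=> Hf; pose g e := wderive (leb3 R) Obreve e f.
have H e (ee : e \in @axes3 R) := (H1_wderive ome oD FLD m1D w1D Hf ee).2.
have e1 : ex \in @axes3 R by rewrite !inE eqxx.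
have e2 : ey \in @axes3 R by rewrite !inE eqxx ?orbT.
have e3 : ez \in @axes3 R by rewrite !inE eqxx ?orbT.
have L1 := H _ e1; have L2 := H _ e2; have L3 := H _ e3.
have c0 c : (0 <= (sqO c)%:E)%E by rewrite lee_fin sqL2p_ge0.
under eq_esum => k _ do rewrite (hat_scalar_space k Hf).2 !EFinD.
rewrite !esumD//; try by move=> k _; rewrite ?adde_ge0.
have P1 := parseval rev Obreve_finite Hf.1; have P2 := parseval rev Obreve_finite (L2_radial_part rev L1 L2).
have P3 := parseval rev Obreve_finite L3; have P4 := parseval rev Obreve_finite (L2_angular_part rev L1 L2).
transitivity ((sqD f)%:E + (sqD (radial_part (g ex) (g ey)))%:E + (sqD (g ez))%:E +
    (sqD (angular_part (g ex) (g ey)))%:E)%E.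
  by congr (_ + _ + _ + _)%E; [exact: P1|exact: P2|exact: P3|exact: P4].
rewrite -!EFinD; congr EFin; rewrite H1_sqseminorm3E.
exact: sum_rearrange (L2_sqnorm_radial_angular L1 L2).
Qed.

Lemma weak_derivative_partial_sum e (m g : nat -> espace R -> R[i]) n :
  (forall i, weak_derivative (leb3 R) Obreve e (m i) (g i)) ->
  weak_derivative (leb3 R) Obreve e (partial_sum m n) (partial_sum g n).
Proof.
move=> H; elim: n => [|n IH].
  rewrite (_ : partial_sum m 0 = fun=> 0); last by apply/funext => x; rewrite /partial_sum big_ord0.
  rewrite (_ : partial_sum g 0 = fun=> 0); last by apply/funext => x; rewrite /partial_sum big_ord0.
  exact: weak_derivative0.
rewrite (_ : partial_sum m n.+1 = fun x => 1 * m n x + partial_sum m n x); last first.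
  by apply/funext => x; rewrite partial_sumS mul1r addrC.
rewrite (_ : partial_sum g n.+1 = fun x => 1 * g n x + partial_sum g n x); last first.
  by apply/funext => x; rewrite partial_sumS mul1r addrC.
exact: (weak_derivative_linear ome oD 1 (H n) IH).
Qed.

Lemma partial_sum_comb (A B : espace R -> R[i]) (u v : nat -> espace R -> R[i]) n :
  (fun q => A q * partial_sum u n q + B q * partial_sum v n q) = partial_sum (fun i q => A q * u i q + B q * v i q) n.
Proof. by apply/funext => q; rewrite /partial_sum big_split /= -!mulr_sumr. Qed.

Lemma common_limit (u v : nat -> espace R -> R[i]) f g :
  (forall e : R, 0 < e -> exists N, forall n, (N <= n)%N -> sqD (fun x => f x - u n x) <= e) ->
  (forall e : R, 0 < e -> exists N, forall n, (N <= n)%N -> sqD (fun x => g x - v n x) <= e) ->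
  forall e : R, 0 < e -> exists n, sqD (fun x => f x - u n x) <= e /\ sqD (fun x => g x - v n x) <= e.
Proof.
move=> uf vg e e0; have [N HN] := uf e e0; have [M HM] := vg e e0.
by exists (maxn N M); rewrite HN ?leq_maxl// HM ?leq_maxr.
Qed.

Lemma combination_cvg (A B f g : espace R -> R[i]) (u v : nat -> espace R -> R[i]) :
  cmeasurable Obreve A -> cmeasurable Obreve B ->
  (forall q, Normc.normc (A q) <= 1) -> (forall q, Normc.normc (B q) <= 1) ->
  L2esp f -> L2esp g -> (forall n, L2esp (u n)) -> (forall n, L2esp (v n)) ->
  (forall e : R, 0 < e -> exists N, forall n, (N <= n)%N -> sqD (fun x => f x - u n x) <= e) ->
  (forall e : R, 0 < e -> exists N, forall n, (N <= n)%N -> sqD (fun x => g x - v n x) <= e) ->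
  [/\ L2esp (fun q => A q * f q + B q * g q), forall n, L2esp (fun q => A q * u n q + B q * v n q) &
  forall e : R, 0 < e -> exists N, forall n, (N <= n)%N ->
    sqD (fun x => (A x * f x + B x * g x) - (A x * u n x + B x * v n x)) <= e].
Proof.
move=> mA mB A1 B1 Lf Lg Lu Lv uf vg.
have L h h' : L2esp h -> L2esp h' -> L2esp (fun q => A q * h q + B q * h' q).
  move=> Lh Lh'; apply: (L2D mD m1D w1D).
    by have [] := L2_bounded_mul rev mA A1 Lh.
  by have [] := L2_bounded_mul rev mB B1 Lh'.
split; [exact: L|by move=> n; exact: L|move=> e e0].
have e4 : 0 < e / 4 by rewrite divr_gt0.
have [N HN] := uf _ e4; have [M HM] := vg _ e4; exists (maxn N M) => n; rewrite geq_max => /andP[Nn Mn].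
have Ldu : L2esp (fun x => f x - u n x) := L2B mD m1D w1D Lf (Lu n).
have Ldv : L2esp (fun x => g x - v n x) := L2B mD m1D w1D Lg (Lv n).
have [LA hA] := L2_bounded_mul rev mA A1 Ldu; have [LB hB] := L2_bounded_mul rev mB B1 Ldv.
have := quadratic_add_le (L2_quadratic (leb3 R) ome oD m1D w1D) LA LB.
rewrite (_ : fcomb _ _ _ = (fun x => (A x * f x + B x * g x) - (A x * u n x + B x * v n x))); last first.
  by apply/funext => x; rewrite /fcomb; ring.
move=> h; apply: le_trans h _; have h1 := HN n Nn; have h2 := HM n Mn.
rewrite expr1n mul1r in hA; rewrite expr1n mul1r in hB.
have h3 := le_trans hA h1; have h4 := le_trans hB h2.
rewrite [leRHS](_ : e = 2 * (e / 4) + 2 * (e / 4)); last by field.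
by apply: lerD; apply: ler_wpM2l.
Qed.

Section surjectivity.
Variables (c : int -> plane R -> R[i]).
Hypotheses (Sc : forall k, scalar_space k (c k))
  (sum_c : (\esum_(k in [set: int]) (scalar_sqnorm k (c k))%:E < +oo)%E).

Let derivatives : exists d : int -> (plane R -> R[i]) * (plane R -> R[i]), forall k,
  [/\ L2pl (d k).1, L2pl (d k).2, weak_derivative (leb2 R) Omega (1, 0) (c k) (d k).1 &
      weak_derivative (leb2 R) Omega (0, 1) (c k) (d k).2].
Proof.
have H k : exists d : (plane R -> R[i]) * (plane R -> R[i]),
  [/\ L2pl d.1, L2pl d.2, weak_derivative (leb2 R) Omega (1, 0) (c k) d.1 &
      weak_derivative (leb2 R) Omega (0, 1) (c k) d.2].
  by have [cr [cz h]] := scalar_spaceE (Sc k); exists (cr, cz); exact: h.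
have [d Hd] := boolp.choice H.
exact: (ex_intro _ d Hd).
Qed.

(** [riesz_fischer] is applied to the coefficients and to their radial, axial and angular
    derivatives. All four series follow the same enumeration of frequencies, so partial sums are
    differentiated term by term and closedness of weak derivatives gives the gradient of the
    limit. *)
Lemma scalar_surjective : exists f, H1esp f /\ forall k, hat k f = c k %[ae leb2 R in Omega].
Proof.
have [d Hd] := derivatives.
have Lc k : L2pl (c k) by have [[]] := Sc k.
have Lr k : L2pl (d k).1 by have [] := Hd k.
have Lz k : L2pl (d k).2 by have [] := Hd k.
have La k : L2pl (mode_angular k (c k)) by have [] := L2_mode_angular (Lc k).1 (Sc k).2.
have E k : scalar_sqnorm k (c k) = sqO (c k) + sqO (d k).1 + sqO (d k).2 + sqO (mode_angular k (c k)).
  by have [_ _ wr wz] := Hd k; have [_ ->] := scalar_spaceP (Lc k) (Lr k) (Lz k) (La k) wr wz.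
(* Each of the four squared norms is one summand of [scalar_sqnorm], hence summable over the
   frequencies. *)
have sum_le (b : int -> plane R -> R[i]) : (forall k, sqO (b k) <= scalar_sqnorm k (c k)) ->
    (\esum_(k in [set: int]) (sqO (b k))%:E < +oo)%E.
  move=> h; apply: le_lt_trans sum_c; apply: le_esum => k _ //.
  by rewrite lee_fin.
have bounds k : [/\ sqO (c k) <= scalar_sqnorm k (c k), sqO (d k).1 <= scalar_sqnorm k (c k),
    sqO (d k).2 <= scalar_sqnorm k (c k) & sqO (mode_angular k (c k)) <= scalar_sqnorm k (c k)].
  by rewrite E; apply: le_sum4; exact: sqL2p_ge0.
have [f [Lf cf hf _]] := riesz_fischer rev Obreve_finite Lc (sum_le c (fun k => let: And4 h _ _ _ := bounds k in h)).
have [U [LU cU _ _]] := riesz_fischer rev Obreve_finite Lr (sum_le _ (fun k => let: And4 _ h _ _ := bounds k in h)).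
have [V [LV cV _ _]] := riesz_fischer rev Obreve_finite Lz (sum_le _ (fun k => let: And4 _ _ h _ := bounds k in h)).
have [W [LW cW _ _]] := riesz_fischer rev Obreve_finite La (sum_le _ (fun k => let: And4 _ _ _ h := bounds k in h)).
have lbw := @locally_bounded_cst1 R Obreve.
have gx : weak_derivative (leb3 R) Obreve ex f (fun q => (complex.Re (phase q))%:C * U q + (- complex.Im (phase q))%:C * W q).
  have [m1 m2 m3 B] := phase_part Obreve.
  have [LG Lg lim] := combination_cvg m1 m3 (fun q => let: And3 h _ _ := B q in h) (fun q => let: And3 _ _ h := B q in h)
    LU LW (L2_mode_sum rev Lr) (L2_mode_sum rev La) cU cW.
  apply: (weak_derivative_cvg_L2 ome oD m1D w1D lbw Lf LG (L2_mode_sum rev Lc) Lg).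
    move=> n; rewrite /mode_sum partial_sum_comb; apply: weak_derivative_partial_sum => i.
    have [_ _ wr _] := Hd (int_of_nat i).
    exact: (weak_derivative_mode_x rev Obreve_finite (Lc _) (Lr _) (La _) wr).
  exact: common_limit cf lim.
have gy : weak_derivative (leb3 R) Obreve ey f (fun q => (complex.Im (phase q))%:C * U q + (complex.Re (phase q))%:C * W q).
  have [m1 m2 m3 B] := phase_part Obreve.
  have [LG Lg lim] := combination_cvg m2 m1 (fun q => let: And3 _ h _ := B q in h) (fun q => let: And3 h _ _ := B q in h)
    LU LW (L2_mode_sum rev Lr) (L2_mode_sum rev La) cU cW.
  apply: (weak_derivative_cvg_L2 ome oD m1D w1D lbw Lf LG (L2_mode_sum rev Lc) Lg).
    move=> n; rewrite /mode_sum partial_sum_comb; apply: weak_derivative_partial_sum => i.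
    have [_ _ wr _] := Hd (int_of_nat i).
    exact: (weak_derivative_mode_y rev Obreve_finite (Lc _) (Lr _) (La _) wr).
  exact: common_limit cf lim.
have gz : weak_derivative (leb3 R) Obreve ez f V.
  apply: (weak_derivative_cvg_L2 ome oD m1D w1D lbw Lf LV (L2_mode_sum rev Lc) (L2_mode_sum rev Lz)).
    move=> n; apply: weak_derivative_partial_sum => i.
    have [_ _ _ wz] := Hd (int_of_nat i).
    exact: (weak_derivative_mode_z rev Obreve_finite (int_of_nat i) (Lc _) (Lz _) wz).
  exact: common_limit cf cV.
have [LX LY] : L2esp (fun q => (complex.Re (phase q))%:C * U q + (- complex.Im (phase q))%:C * W q) /\
    L2esp (fun q => (complex.Im (phase q))%:C * U q + (complex.Re (phase q))%:C * W q).
  have [m1 m2 m3 B] := phase_part Obreve.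
  have [LG _ _] := combination_cvg m1 m3 (fun q => let: And3 h _ _ := B q in h) (fun q => let: And3 _ _ h := B q in h)
    LU LW (L2_mode_sum rev Lr) (L2_mode_sum rev La) cU cW.
  have [LG' _ _] := combination_cvg m2 m1 (fun q => let: And3 _ h _ := B q in h) (fun q => let: And3 h _ _ := B q in h)
    LU LW (L2_mode_sum rev Lr) (L2_mode_sum rev La) cU cW.
  exact: (conj LG LG').
exists f; split; last exact: hf.
split; first exact: Lf.
move=> e; rewrite /axes3 !inE => /orP[/eqP ->|/orP[] /eqP ->].
- exact: (ex_intro2 _ _ _ gx LX).
- exact: (ex_intro2 _ _ _ gy LY).
- exact: (ex_intro2 _ _ _ gz LV).
Qed.

End surjectivity.
End scalar_fourier.

(** * Spin components *)

Lemma int_norm1 (k : int) : `|k| = 1 -> k = 1 \/ k = -1.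
Proof. by move/eqP; rewrite eqr_norml ler01 andbT => /orP[] /eqP ->; [left|right]. Qed.

Section spin_arithmetic.
Context {R : realFieldType}.

(** Here and below [p], [h], [m] stand for the squared norms [sqL2p], [sqH11], [sqL2m]; plain and
    primed letters belong to the spins [i] and [- i], suffixes to the cylindrical components. *)
Lemma spin_arith0 (p p' h h' m m' pt pr pz ht hr hz mt mr mz : R) :
  p + p' = 2 * pt + 2 * pr -> h + h' = 2 * ht + 2 * hr -> m + m' = 2 * mt + 2 * mr ->
  pr + pt + pz + ((mr + hr) + (mt + ht) + hz) =
  2^-1 * (p + h + (0 + 1) ^+ 2 * m + (p' + h' + (0 - 1) ^+ 2 * m')) + (pz + hz + 0 ^+ 2 * mz).
Proof. by move=> *; lra. Qed.

Lemma spin_arith1 (p p' h h' m m' pt pr pz ht hr hz mz : R) :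
  p + p' = 2 * pt + 2 * pr -> h + h' = 2 * ht + 2 * hr ->
  pr + pt + pz + (2 * m + hr + ht + (mz + hz)) =
  2^-1 * (p + h + (1 + 1) ^+ 2 * m + (p' + h' + (1 - 1) ^+ 2 * m')) + (pz + hz + 1 ^+ 2 * mz).
Proof. by move=> *; lra. Qed.

Lemma spin_arithN1 (p p' h h' m m' pt pr pz ht hr hz mz : R) :
  p + p' = 2 * pt + 2 * pr -> h + h' = 2 * ht + 2 * hr ->
  pr + pt + pz + (2 * m' + hr + ht + (mz + hz)) =
  2^-1 * (p + h + (-1 + 1) ^+ 2 * m + (p' + h' + (-1 - 1) ^+ 2 * m')) + (pz + hz + (-1) ^+ 2 * mz).
Proof. by move=> *; lra. Qed.

(** [a] is the polarization term between [v_theta] and [v_r]; it enters the two spins with opposite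
    signs, and [(s + 1)^2 - (s - 1)^2 = 4 s] produces the cross term. *)
Lemma spin_arith2 (p p' h h' pt pr pz ht hr hz mt mr mz s a : R) :
  p + p' = 2 * pt + 2 * pr -> h + h' = 2 * ht + 2 * hr ->
  pr + pt + pz + (hr + ht + hz + (1 + s ^+ 2) * (mr + mt) + s ^+ 2 * mz + 4 * s * a) =
  2^-1 * (p + h + (s + 1) ^+ 2 * (1 * mt + mr + 2 * a) + (p' + h' + (s - 1) ^+ 2 * (1 * mt + mr + 2 * - a))) +
  (pz + hz + s ^+ 2 * mz).
Proof.
move=> pE hE; have -> : p' = 2 * pt + 2 * pr - p by rewrite -pE; ring.
have -> : h' = 2 * ht + 2 * hr - h by rewrite -hE; ring.
by field.
Qed.

Lemma spin_arith_star (p p' h h' m m' pt pr pz ht hr hz mt mr mz s : R) :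
  p + p' = 2 * pt + 2 * pr -> h + h' = 2 * ht + 2 * hr -> m + m' = 2 * mt + 2 * mr ->
  pr + pt + pz + (hr + ht + hz) + s * (mr + mt + mz) =
  2^-1 * (p + h + s * m + (p' + h' + s * m')) + (pz + hz + s * mz).
Proof.
move=> pE hE mE; have -> : p' = 2 * pt + 2 * pr - p by rewrite -pE; ring.
have -> : h' = 2 * ht + 2 * hr - h by rewrite -hE; ring.
have -> : m' = 2 * mt + 2 * mr - m by rewrite -mE; ring.
by field.
Qed.

(** The differences factor explicitly. The constant 4 is attained at [s = 2] and [s = -2], where one
    of the shifted squares is 1. *)
Lemma le_sqr_shift (s : R) : 2 <= `|s| ->
  [/\ (s + 1) ^+ 2 <= 4 * s ^+ 2, (s - 1) ^+ 2 <= 4 * s ^+ 2, s ^+ 2 <= 4 * (s + 1) ^+ 2 & s ^+ 2 <= 4 * (s - 1) ^+ 2].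
Proof.
rewrite ler_normr => /orP[] h.
  split; rewrite -subr_ge0.
  - by rewrite (_ : _ - _ = (s - 1) * (3 * s + 1)); [apply: mulr_ge0; lra|ring].
  - by rewrite (_ : _ - _ = (s + 1) * (3 * s - 1)); [apply: mulr_ge0; lra|ring].
  - by rewrite (_ : _ - _ = (s + 2) * (3 * s + 2)); [apply: mulr_ge0; lra|ring].
  - by rewrite (_ : _ - _ = (s - 2) * (3 * s - 2)); [apply: mulr_ge0; lra|ring].
split; rewrite -subr_ge0.
- by rewrite (_ : _ - _ = (s - 1) * (3 * s + 1)); [apply: mulr_le0; lra|ring].
- by rewrite (_ : _ - _ = (s + 1) * (3 * s - 1)); [apply: mulr_le0; lra|ring].
- by rewrite (_ : _ - _ = (s + 2) * (3 * s + 2)); [apply: mulr_le0; lra|ring].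
- by rewrite (_ : _ - _ = (s - 2) * (3 * s - 2)); [apply: mulr_le0; lra|ring].
Qed.

Lemma le_weighted (p h m x y : R) : 0 <= p -> 0 <= h -> 0 <= m -> x <= 4 * y ->
  p + h + x * m <= 4 * (p + h + y * m).
Proof.
move=> p0 h0 m0 xy; have := ler_wpM2r m0 xy.
by rewrite -mulrA => ?; lra.
Qed.

Lemma le_half_sum (a b c a' b' c' : R) : a <= 4 * a' -> b <= 4 * b' -> c <= 4 * c' ->
  2^-1 * (a + b) + c <= 4 * (2^-1 * (a' + b') + c').
Proof. by move=> *; lra. Qed.

Lemma half_sum_eq0 (a b c : R) : 0 <= a -> 0 <= b -> 0 <= c -> 2^-1 * (a + b) + c = 0 -> [/\ a = 0, b = 0 & c = 0].
Proof. by move=> *; split; lra. Qed.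

End spin_arithmetic.

Section spin_components.
Context {R : realType} {d : measure_display} {T : measurableNormedModType R d}.
Implicit Types (u v : T -> 'cV[R[i]]_3) (c : T -> R[i]) (a e : R[i]).

(* For [e = i] and [e = - i] the combinations [u_r + e u_theta] diagonalize the
   angular derivative of a vector field in cylindrical components. *)
Definition spin (e : R[i]) u : T -> R[i] := fcomb e (component jt u) (component jr u).

Lemma component_comb (j : 'I_3) a u v : component j (a *: u + v) = fcomb a (component j u) (component j v).
Proof. by apply/funext => p; rewrite /component /fcomb !mxE. Qed.

Lemma spin_comb e a u v : spin e (a *: u + v) = fcomb a (spin e u) (spin e v).
Proof. by rewrite /spin !component_comb; apply/funext => p; rewrite /fcomb; ring. Qed.

Lemma component0 (j : 'I_3) : component j (0 : T -> 'cV[R[i]]_3) = fun=> 0.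
Proof. by apply/funext => p; rewrite /component mxE. Qed.

Lemma spin0 e : spin e 0 = fun=> 0.
Proof. by rewrite /spin !component0; apply/funext => p; rewrite /fcomb mulr0 addr0. Qed.

Lemma component_spin u :
  component jr u = fcomb 2^-1%:C (fcomb 1 (spin 'i%C u) (spin (- 'i%C) u)) (fun=> 0) /\
  component jt u = fcomb (- 'i%C / 2) (fcomb (-1) (spin (- 'i%C) u) (spin 'i%C u)) (fun=> 0).
Proof.
have h2 : (2^-1 : R)%:C = 2^-1 :> R[i] by rewrite -[LHS]/(real_complex _ _) fmorphV rmorph_nat.
have ii : 'i%C * 'i%C = -1 :> R[i] by rewrite -expr2 sqr_i.
have t2 : (2^-1 : R[i]) * 2 = 1 by rewrite mulVf ?pnatr_eq0.
split; apply/funext => p; rewrite /spin /fcomb; set r := component jr u p; set t := component jt u p.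
  transitivity (2^-1 * 2 * r); first by rewrite t2 mul1r.
  by rewrite h2; ring.
transitivity (- ('i%C * 'i%C) * (2^-1 * 2) * t); first by rewrite ii t2 opprK !mul1r.
by ring.
Qed.

Lemma spin_closed (X : set (T -> R[i])) u : X (fun=> 0) ->
  (forall a c c', X c -> X c' -> X (fcomb a c c')) ->
  (X (component jr u) /\ X (component jt u)) <-> (X (spin 'i%C u) /\ X (spin (- 'i%C) u)).
Proof.
move=> X0 XL; split=> [[Xr Xt]|[Xp Xm]]; first by split; exact: XL.
have [-> ->] := component_spin u.
by split; [exact: (XL _ _ _ (XL _ _ _ Xp Xm) X0)|exact: (XL _ _ _ (XL _ _ _ Xm Xp) X0)].
Qed.

Variables (mu : {measure set T -> \bar R}) (D : set T).

Lemma ae_eq_components u v : (forall j : 'I_3, component j u = component j v %[ae mu in D]) -> u = v %[ae mu in D].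
Proof.
move=> h; have H : {ae mu, forall p, D p -> [/\ u p jr 0 = v p jr 0, u p jt 0 = v p jt 0 & u p jz 0 = v p jz 0]}.
  apply: filterS3 (h jr) (h jt) (h jz) => p h1 h2 h3 Dp.
  by split; [exact: h1|exact: h2|exact: h3].
apply: filterS H => p + Dp => /(_ Dp) [h1 h2 h3]; apply/colP => i.
by case: i => [[|[|[|i]]] // hi]; [move: h1|move: h2|move: h3]; congr (_ = _); congr (_ _ _); exact: val_inj.
Qed.

Lemma ae_eq_component (j : 'I_3) u v : u = v %[ae mu in D] -> component j u = component j v %[ae mu in D].
Proof. by apply: filterS => p + Dp => /(_ Dp); rewrite /component => ->. Qed.

Lemma ord3_cases (j : 'I_3) : [\/ j = jr, j = jt | j = jz].
Proof.
by case: j => [[|[|[|j]]] // h]; [apply: Or31|apply: Or32|apply: Or33]; exact: val_inj.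
Qed.

Lemma ae_eq_spin u v :
  spin 'i%C u = spin 'i%C v %[ae mu in D] -> spin (- 'i%C) u = spin (- 'i%C) v %[ae mu in D] ->
  component jz u = component jz v %[ae mu in D] -> u = v %[ae mu in D].
Proof.
move=> hp hm hz; have [[Er Et] [Er' Et']] := (component_spin u, component_spin v).
apply: ae_eq_components => j; have [->|->|->] := ord3_cases j; last exact: hz.
- by rewrite Er Er'; apply: filterS2 hp hm => p h1 h2 Dp; rewrite /fcomb h1// h2.
- by rewrite Et Et'; apply: filterS2 hp hm => p h1 h2 Dp; rewrite /fcomb h1// h2.
Qed.

Lemma spin_ae_eq e u v : u = v %[ae mu in D] -> spin e u = spin e v %[ae mu in D].
Proof. by apply: filterS => p + Dp => /(_ Dp); rewrite /spin /fcomb /component => ->. Qed.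

End spin_components.

Section spin.
Context {R : realType}.
Variables (Omega : set (plane R)) (Obreve : set (espace R)).
Hypothesis rev : revolved Omega Obreve.
Implicit Types (c : plane R -> R[i]) (u v : plane R -> 'cV[R[i]]_3) (k : int).

Local Notation L2pl := (L2 (leb2 R) Omega (@wpos R)).
Local Notation fquadratic := (quadratic (fun=> 0) fcomb).
Local Notation sqn := (scalar_sqnorm Omega).
Local Notation S := (scalar_space Omega).

Let mO : measurable Omega := revolved_measurable_plane rev.
Let mwp : measurable_fun Omega (@wpos R). Proof. by apply: measurable_funTS; exact: measurable_fst. Qed.
Let wp0 p : Omega p -> 0 < wpos p. Proof. exact: (revolved_pos rev). Qed.
Let mwn : measurable_fun Omega (@wneg R) := measurable_wneg rev.
Let wn0 p : Omega p -> 0 < wneg p. Proof. exact: (wneg_gt0 rev). Qed.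
Let oO : open Omega. Proof. by case: rev. Qed.
Let omp := @open_measurable_plane R.
Let FL := fundamental_lemma_plane oO.

Lemma sqL2p_quadratic : fquadratic L2pl (sqL2p Omega).
Proof. exact: (L2_quadratic (leb2 R) omp oO mwp wp0). Qed.

Lemma sqL2m_quadratic : fquadratic (L2m Omega) (sqL2m Omega).
Proof. exact: (L2_quadratic (leb2 R) omp oO mwn wn0). Qed.

Lemma sqH11_quadratic : fquadratic (H11 Omega) (sqH11 Omega).
Proof. exact: (H1_quadratic omp oO FL mwp wp0 axes2). Qed.

Lemma scalar_space_comb k a c c' : S k c -> S k c' -> S k (fcomb a c c').
Proof.
have [_ LH _ _] := sqH11_quadratic; have [_ Lm _ _] := sqL2m_quadratic.
by move=> [Hc mc] [Hc' mc']; split; [exact: LH|move=> k0; apply: Lm; [exact: mc|exact: mc']].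
Qed.

Lemma scalar_space0 k : S k (fun=> 0).
Proof.
have [[H0 _] _ _ _] := sqH11_quadratic; have [[m0 _] _ _ _] := sqL2m_quadratic.
by split=> // _; exact: m0.
Qed.

Lemma scalar_quadratic k : fquadratic (S k) (sqn k).
Proof.
have S0 := scalar_space0 k; have SL := @scalar_space_comb k.
apply: quadraticD; first apply: quadraticD.
- by apply: quadratic_sub S0 SL sqL2p_quadratic => c [[]].
- by apply: quadratic_sub S0 SL sqH11_quadratic => c [].
- have [k0|k0] := eqVneq k 0; last first.
    apply: quadraticZ; first exact: sqr_ge0.
    by apply: quadratic_sub S0 SL sqL2m_quadratic => c [_]; exact.
  have z : (k%:~R : R) ^+ 2 = 0 by rewrite k0 expr0n.
  split=> //.
  + by split=> //; rewrite z mul0r.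
  + by move=> c _; rewrite z mul0r.
  + by move=> c c' _ _; exists 0 => a; rewrite z !mul0r !mulr0 /= !addr0.
Qed.

Lemma ae_eq_scalar_space k c c' : S k c -> cmeasurable Omega c' -> c = c' %[ae leb2 R in Omega] ->
  S k c' /\ sqn k c' = sqn k c.
Proof.
move=> [Hc mc] mc' cc'; have [H E] := ae_eq_H1 omp oO FL mwp wp0 Hc mc' cc'.
have cm := Hc.1.1; split.
  by split; [exact: H|move=> k0; exact: (ae_eq_L2 mO mwn wn0 mc' cc' (mc k0))].
have e1 := esym (ae_eq_L2_sqnorm omp oO mwp wp0 cm mc' cc').
have e3 := esym (ae_eq_L2_sqnorm omp oO mwn wn0 cm mc' cc').
exact: (f_equal2 +%R (f_equal2 +%R e1 E) (congr1 ( *%R _) e3)).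
Qed.

Lemma scalar_sqnorm_eq0 k c : S k c -> sqn k c = 0 -> c = (fun=> 0) %[ae leb2 R in Omega].
Proof.
move=> Sc; have Lc : L2pl c by case: Sc => -[].
have h1 := sqL2p_ge0 rev c; have h2 := sqH11_ge0 rev c.
have h3 : 0 <= (k%:~R : R) ^+ 2 * sqL2m Omega c by rewrite mulr_ge0 ?sqr_ge0 ?(sqL2m_ge0 rev).
rewrite /scalar_sqnorm => h; have /(L2_sqnorm_eq0 mO mwp wp0 Lc) // : sqL2p Omega c = 0 by lra.
Qed.

(** The indices are the angular frequencies of the three scalars: [(k + 1, k - 1, k)] describes
    [H1k], and [(k, k, k)] the starred norm. *)
Definition spin_space (m1 m2 m3 : int) : set (plane R -> 'cV[R[i]]_3) :=
  [set u | [/\ S m1 (spin 'i%C u), S m2 (spin (- 'i%C) u) & S m3 (component jz u)]].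
Definition spin_sqnorm (m1 m2 m3 : int) u : R :=
  2^-1 * (sqn m1 (spin 'i%C u) + sqn m2 (spin (- 'i%C) u)) + sqn m3 (component jz u).

Lemma spin_quadratic m1 m2 m3 :
  quadratic 0 (fun a u v => a *: u + v) (spin_space m1 m2 m3) (spin_sqnorm m1 m2 m3).
Proof.
have Q1 := quadratic_comp (spin0 'i%C) (spin_comb 'i%C) (scalar_quadratic m1).
have Q2 := quadratic_comp (spin0 (- 'i%C)) (spin_comb (- 'i%C)) (scalar_quadratic m2).
have Q3 := quadratic_comp (component0 jz) (component_comb jz) (scalar_quadratic m3).
have X0 : spin_space m1 m2 m3 0.
  by have [[h1 _] _ _ _] := Q1; have [[h2 _] _ _ _] := Q2; have [[h3 _] _ _ _] := Q3.
have XL a u v : spin_space m1 m2 m3 u -> spin_space m1 m2 m3 v -> spin_space m1 m2 m3 (a *: u + v).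
  have [_ L1 _ _] := Q1; have [_ L2 _ _] := Q2; have [_ L3 _ _] := Q3.
  by move=> [u1 u2 u3] [v1 v2 v3]; split; [exact: L1|exact: L2|exact: L3].
apply: quadraticD; first apply: quadraticZ; first by rewrite invr_ge0.
  apply: quadraticD; first by apply: quadratic_sub X0 XL Q1 => u [].
  by apply: quadratic_sub X0 XL Q2 => u [].
by apply: quadratic_sub X0 XL Q3 => u [].
Qed.

Lemma spin_sqnorm_eq0 m1 m2 m3 u : spin_space m1 m2 m3 u -> spin_sqnorm m1 m2 m3 u = 0 <-> ae_eq2 Omega u 0.
Proof.
move=> [S1 S2 S3]; have n0 m c : 0 <= sqn m c := scalar_sqnorm_ge0 rev m c.
split=> [h|h].
  have [z1 z2 z3] := half_sum_eq0 (n0 _ _) (n0 _ _) (n0 _ _) h.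
  have a1 := scalar_sqnorm_eq0 S1 z1; have a2 := scalar_sqnorm_eq0 S2 z2; have a3 := scalar_sqnorm_eq0 S3 z3.
  by apply: ae_eq_spin; rewrite ?spin0 ?component0.
have comp0 (j : 'I_3) : component j u = (fun=> 0) %[ae leb2 R in Omega].
  by apply: filterS h => p + Op => /(_ Op); rewrite /component => ->; rewrite mxE.
have sp0 e : spin e u = (fun=> 0) %[ae leb2 R in Omega].
  by apply: filterS2 (comp0 jt) (comp0 jr) => p h1 h2 Op; rewrite /spin /fcomb h1// h2// mulr0 addr0.
have z m c : S m c -> c = (fun=> 0) %[ae leb2 R in Omega] -> sqn m c = 0.
  move=> Sc c0; have [[_ q0] _ _ _] := scalar_quadratic m.
  by have [_ <-] := ae_eq_scalar_space Sc (cmeasurable_cst _ _) c0.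
by rewrite /spin_sqnorm (z _ _ S1 (sp0 _)) (z _ _ S2 (sp0 _)) (z _ _ S3 (comp0 _)) !(mulr0, addr0).
Qed.

Lemma spin_normed_space m1 m2 m3 (X : set (plane R -> 'cV[R[i]]_3)) (q : (plane R -> 'cV[R[i]]_3) -> R) :
  X = spin_space m1 m2 m3 -> (forall u, X u -> q u = spin_sqnorm m1 m2 m3 u) ->
  normed_space X (ae_eq2 Omega) (fun u => Num.sqrt (q u)).
Proof.
move=> -> qE; apply: quadratic_normed_space.
  by apply: eq_quadratic (spin_quadratic m1 m2 m3) => u Xu; rewrite qE.
by move=> u Xu; rewrite qE//; exact: spin_sqnorm_eq0.
Qed.

Lemma mixed1 u : mixed 1 u = spin 'i%C u.
Proof. by apply/funext => p; rewrite /mixed /spin /fcomb mulr1z mulr1 addrC. Qed.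

Lemma mixedN1 u : mixed (-1) u = spin (- 'i%C) u.
Proof. by apply/funext => p; rewrite /mixed /spin /fcomb mulrN1z mulrN1 addrC. Qed.

(** [scalar_space m] constrains the L^2_{-1} norm only for [m] different from 0. For [k = 0] the
    axial component escapes the constraint; for [k = 1] and [k = -1] one spin does, and the
    remaining spin is [mixed k]. *)
Lemma H1k_spin k : H1k Omega k = spin_space (k + 1) (k - 1) k.
Proof.
have [[H0 _] HL _ _] := sqH11_quadratic; have [[m0 _] mL _ _] := sqL2m_quadratic.
apply/seteqP; split=> u; rewrite /H1k /spin_space /= /V11 /scalar_space.
all: have eH := spin_closed u H0 HL; have eM := spin_closed u m0 mL.
all: have [->|k0] := eqVneq k 0 => /=.
- move=> [[Hr mr] [Ht mt] Hz]; have [Hp Hm] := eH.1 (conj Hr Ht); have [mp mm] := eM.1 (conj mr mt).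
  exact: (And3 (conj Hp (fun=> mp)) (conj Hm (fun=> mm)) (conj Hz (fun h => False_ind _ (notF h)))).
- case: ifP => k1.
    have [kE|kE] := int_norm1 (eqP k1); rewrite kE.
      move=> [Hr Ht [Hz mz] mp]; rewrite mixed1 in mp; have [Hp Hm] := eH.1 (conj Hr Ht).
      exact: (And3 (conj Hp (fun=> mp)) (conj Hm (fun h => False_ind _ (notF h))) (conj Hz (fun=> mz))).
    move=> [Hr Ht [Hz mz] mm]; rewrite mixedN1 in mm; have [Hp Hm] := eH.1 (conj Hr Ht).
    exact: (And3 (conj Hp (fun h => False_ind _ (notF h))) (conj Hm (fun=> mm)) (conj Hz (fun=> mz))).
  move=> [[Hr mr] [Ht mt] [Hz mz]]; have [Hp Hm] := eH.1 (conj Hr Ht); have [mp mm] := eM.1 (conj mr mt).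
  exact: (And3 (conj Hp (fun=> mp)) (conj Hm (fun=> mm)) (conj Hz (fun=> mz))).
- move=> [[Hp mp] [Hm mm] [Hz _]]; have [Hr Ht] := eH.2 (conj Hp Hm).
  have [mr mt] := eM.2 (conj (mp isT) (mm isT)).
  exact: (And3 (conj Hr mr) (conj Ht mt) Hz).
- move=> [[Hp mp] [Hm mm] [Hz mz]]; have [Hr Ht] := eH.2 (conj Hp Hm).
  case: ifP => k1.
    have [kE|kE] := int_norm1 (eqP k1); move: mp mm; rewrite kE => mp mm.
      have mx : L2m Omega (mixed 1 u) by rewrite mixed1; exact: mp.
      exact: (And4 Hr Ht (conj Hz (mz isT)) mx).
    have mx : L2m Omega (mixed (-1) u) by rewrite mixedN1; exact: mm.
    exact: (And4 Hr Ht (conj Hz (mz isT)) mx).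
  have kp : k + 1 != 0 by apply: contraFN k1; rewrite addr_eq0 => /eqP ->.
  have km : k - 1 != 0 by apply: contraFN k1; rewrite subr_eq0 => /eqP ->.
  have [mr mt] := eM.2 (conj (mp kp) (mm km)).
  exact: (And3 (conj Hr mr) (conj Ht mt) (conj Hz (mz isT))).
Qed.

(** The integrand is a product minus its conjugate, so the cross term is a multiple of the imaginary
    part of one inner product, which is the polarization term of the spins. *)
Lemma cross_term_inner k u : L2m Omega (component jr u) -> L2m Omega (component jt u) ->
  complex.Re (cross_term Omega k u) =
  4 * k%:~R * complex.Re ('i%C * inner (leb2 R) Omega (@wneg R) (component jt u) (component jr u)).
Proof.
move=> Lr Lt; have irt := L2_inner_integrable mO mwn wn0 Lr Lt; have itr := L2_inner_integrable mO mwn wn0 Lt Lr.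
rewrite /cross_term (_ : cintegral _ _ _ = inner (leb2 R) Omega (@wneg R) (component jt u) (component jr u) -
    inner (leb2 R) Omega (@wneg R) (component jr u) (component jt u)); last first.
  rewrite /inner -(cintegralB mO itr irt); apply: eq_cintegral => p _.
  by rewrite mulrBl.
rewrite (inner_conj mO mwn wn0 Lt Lr).
have kE : (k%:~R : R[i]) = (k%:~R)%:C by rewrite -[RHS]/(real_complex _ _) rmorph_int.
by rewrite kE; case: (inner _ _ _ _ _) => x y /=; ring.
Qed.

Lemma H1k_sqnorm_spin k u : H1k Omega k u -> H1k_sqnorm Omega k u = spin_sqnorm (k + 1) (k - 1) k u.
Proof.
move=> Hu; have : spin_space (k + 1) (k - 1) k u by rewrite -H1k_spin.
move=> [[Hp mp] [Hm mm] [Hz mz]].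
have [[H0 _] HL _ _] := sqH11_quadratic; have [[m0 _] mL _ _] := sqL2m_quadratic.
have [Hr Ht] := (spin_closed u H0 HL).2 (conj Hp Hm).
have pP : sqL2p Omega (spin 'i%C u) + sqL2p Omega (spin (- 'i%C) u) =
    2 * sqL2p Omega (component jt u) + 2 * sqL2p Omega (component jr u).
  exact: (quadratic_spin sqL2p_quadratic Ht.1 Hr.1).
have pH : sqH11 Omega (spin 'i%C u) + sqH11 Omega (spin (- 'i%C) u) =
    2 * sqH11 Omega (component jt u) + 2 * sqH11 Omega (component jr u).
  exact: (quadratic_spin sqH11_quadratic Ht Hr).
rewrite /H1k_sqnorm /spin_sqnorm /scalar_sqnorm !big_ord_recr !big_ord0 /= !add0r.
have -> : component (widen_ord (leqnSn 2) (widen_ord (leqnSn 1) ord_max)) u = component jr u by congr component; exact: val_inj.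
have -> : component (widen_ord (leqnSn 2) ord_max) u = component jt u by congr component; exact: val_inj.
have -> : component ord_max u = component jz u by congr component; exact: val_inj.
have kp : ((k + 1)%:~R : R) = k%:~R + 1 by rewrite rmorphD.
have km : ((k - 1)%:~R : R) = k%:~R - 1 by rewrite rmorphB.
rewrite kp km.
have [k0|k0] := eqVneq k 0.
  have mrt : sqL2m Omega (spin 'i%C u) + sqL2m Omega (spin (- 'i%C) u) =
      2 * sqL2m Omega (component jt u) + 2 * sqL2m Omega (component jr u).
    have [mr mt] : L2m Omega (component jr u) /\ L2m Omega (component jt u).
      by apply/(spin_closed u m0 mL); split; [apply: mp|apply: mm]; rewrite k0.
    exact: (quadratic_spin sqL2m_quadratic mt mr).
  have -> : (k%:~R : R) = 0 by rewrite k0.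
  exact: spin_arith0.
case: ifP => k1.
  have [kE|kE] := int_norm1 (eqP k1).
    have -> : mixed k u = spin 'i%C u by rewrite kE mixed1.
    have -> : (k%:~R : R) = 1 by rewrite kE.
    exact: spin_arith1.
  have -> : mixed k u = spin (- 'i%C) u by rewrite kE mixedN1.
  have -> : (k%:~R : R) = -1 by rewrite kE.
  exact: spin_arithN1.
have kp0 : k + 1 != 0 by apply: contraFN k1; rewrite addr_eq0 => /eqP ->.
have km0 : k - 1 != 0 by apply: contraFN k1; rewrite subr_eq0 => /eqP ->.
have [mr mt] : L2m Omega (component jr u) /\ L2m Omega (component jt u).
  by apply/(spin_closed u m0 mL); split; [exact: mp|exact: mm].
have n1 : Normc.normc ('i%C : R[i]) ^+ 2 = 1 by rewrite sqr_normc /=; ring.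
have Ep : sqL2m Omega (spin 'i%C u) = _ := L2_sqnorm_fcomb omp oO mwn wn0 'i%C mt mr.
have Em : sqL2m Omega (spin (- 'i%C) u) = _ := L2_sqnorm_fcomb omp oO mwn wn0 (- 'i%C) mt mr.
rewrite Ep Em (cross_term_inner k mr mt) normcN n1 mulNr.
have -> : complex.Re (- ('i%C * inner (leb2 R) Omega (@wneg R) (component jt u) (component jr u))) =
    - complex.Re ('i%C * inner (leb2 R) Omega (@wneg R) (component jt u) (component jr u)).
  by case: (_ * inner _ _ _ _ _).
exact: spin_arith2.
Qed.

Lemma spin_sqnorm_le m1 m2 m3 m1' m2' m3' u :
  (m1%:~R : R) ^+ 2 <= 4 * m1'%:~R ^+ 2 -> (m2%:~R : R) ^+ 2 <= 4 * m2'%:~R ^+ 2 ->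
  (m3%:~R : R) ^+ 2 <= 4 * m3'%:~R ^+ 2 -> spin_sqnorm m1 m2 m3 u <= 4 * spin_sqnorm m1' m2' m3' u.
Proof.
move=> h1 h2 h3; have le m m' c : (m%:~R : R) ^+ 2 <= 4 * m'%:~R ^+ 2 -> sqn m c <= 4 * sqn m' c.
  by move=> h; exact: le_weighted (sqL2p_ge0 rev c) (sqH11_ge0 rev c) (sqL2m_ge0 rev c) h.
exact: le_half_sum (le _ _ _ h1) (le _ _ _ h2) (le _ _ _ h3).
Qed.

Section large_frequency.
Variables (k : int) (k2 : 2 <= `|k|).

Let k0 : k != 0.
Proof. by apply: contraTneq k2 => ->; rewrite normr0. Qed.
Let k1 : (`|k| == 1) = false.
Proof. by apply: contraTF k2 => /eqP ->. Qed.

Lemma H1k_large : H1k Omega k =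
  [set u | [/\ V11 Omega (component jr u), V11 Omega (component jt u) & V11 Omega (component jz u)]].
Proof. by rewrite /H1k (negbTE k0) k1. Qed.

Lemma H1k_spin_star : H1k Omega k = spin_space k k k.
Proof.
have [[H0 _] HL _ _] := sqH11_quadratic; have [[m0 _] mL _ _] := sqL2m_quadratic.
rewrite H1k_large; apply/seteqP; split=> u; rewrite /spin_space /= /V11 /scalar_space.
  move=> [[Hr mr] [Ht mt] [Hz mz]].
  have [Hp Hm] := (spin_closed u H0 HL).1 (conj Hr Ht); have [mp mm] := (spin_closed u m0 mL).1 (conj mr mt).
  by split.
move=> [[Hp /(_ k0) mp] [Hm /(_ k0) mm] [Hz /(_ k0) mz]].
have [Hr Ht] := (spin_closed u H0 HL).2 (conj Hp Hm); have [mr mt] := (spin_closed u m0 mL).2 (conj mp mm).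
by split.
Qed.

Lemma H1k_star_sqnorm_spin u : H1k Omega k u ->
  \sum_(j < 3) sqL2p Omega (component j u) + \sum_(j < 3) sqH11 Omega (component j u)
    + k%:~R ^+ 2 * \sum_(j < 3) sqL2m Omega (component j u) = spin_sqnorm k k k u.
Proof.
rewrite H1k_large => -[[Hr mr] [Ht mt] [Hz mz]].
rewrite /spin_sqnorm /scalar_sqnorm !big_ord_recr !big_ord0 /= !add0r.
have -> : component (widen_ord (leqnSn 2) (widen_ord (leqnSn 1) ord_max)) u = component jr u by congr component; exact: val_inj.
have -> : component (widen_ord (leqnSn 2) ord_max) u = component jt u by congr component; exact: val_inj.
have -> : component ord_max u = component jz u by congr component; exact: val_inj.
apply: spin_arith_star.
- exact: (quadratic_spin sqL2p_quadratic Ht.1 Hr.1).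
- exact: (quadratic_spin sqH11_quadratic Ht Hr).
- exact: (quadratic_spin sqL2m_quadratic mt mr).
Qed.

Lemma H1k_star_normed_space : normed_space (H1k Omega k) (ae_eq2 Omega) (H1k_star_norm Omega k).
Proof. exact: (spin_normed_space H1k_spin_star H1k_star_sqnorm_spin). Qed.

Lemma H1k_equivalent_norms : equivalent_norms (H1k Omega k) (H1k_norm Omega k) (H1k_star_norm Omega k).
Proof.
have s2 : (2 : R) <= `|k%:~R| by rewrite -intr_norm -[2]/(2%:~R) ler_int.
have [h1 h2 h3 h4] := le_sqr_shift s2.
have kp : ((k + 1)%:~R : R) = k%:~R + 1 by rewrite rmorphD.
have km : ((k - 1)%:~R : R) = k%:~R - 1 by rewrite rmorphB.
have hk : (k%:~R : R) ^+ 2 <= 4 * k%:~R ^+ 2 by rewrite ler_peMl ?sqr_ge0// ler1n.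
(* Square roots of the constant 4 that relates the squared norms in both directions. *)
exists 2^-1, 2; split; [by rewrite invr_gt0|by []|move=> u Hu].
rewrite /H1k_star_norm (H1k_star_sqnorm_spin Hu) /H1k_norm (H1k_sqnorm_spin Hu).
have a1 : spin_sqnorm (k + 1) (k - 1) k u <= 4 * spin_sqnorm k k k u by apply: spin_sqnorm_le; rewrite ?kp ?km.
have a2 : spin_sqnorm k k k u <= 4 * spin_sqnorm (k + 1) (k - 1) k u by apply: spin_sqnorm_le; rewrite ?kp ?km.
have four (x y : R) : x <= 4 * y -> Num.sqrt x <= 2 * Num.sqrt y.
  move=> h; have -> : 2 * Num.sqrt y = Num.sqrt (4 * y).
    by rewrite sqrtrM// (_ : 4 = 2 ^+ 2) ?sqrtr_sqr ?ger0_norm//; ring.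
  exact: ler_wsqrtr.
by split; [rewrite ler_pdivrMl//; exact: four|exact: four].
Qed.

End large_frequency.

Lemma H1k_normed_space k : normed_space (H1k Omega k) (ae_eq2 Omega) (H1k_norm Omega k).
Proof. by apply: (spin_normed_space (H1k_spin k)) => u; exact: H1k_sqnorm_spin. Qed.

End spin.

(** * Vector fields *)

Section geometry_of_revolution.
Context {R : realType}.
Variables (Omega : set (plane R)) (Obreve : set (espace R)).

Lemma revolve_revolved : (forall p, Omega p -> 0 < p.1) -> open Omega -> open Obreve ->
  Obreve = revolve (Omega `|` axis_part Omega) -> revolved Omega Obreve.
Proof.
move=> O0 oO oD OE; split=> // q q0; rewrite OE; split.
  move=> [p [t [[Op|[p0 _]] _ qE]]]; move: q0; rewrite qE radius_cartesian ?p0// ?ltxx//.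
    by rewrite -surjective_pairing.
  exact: ltW (O0 _ Op).
move=> Oq; have [t Jt qE] := cartesian_surj q.
exists (radius q, q.2), t; split; [by left|by move: Jt; rewrite /angles /= in_itv|exact: qE].
Qed.

Lemma bounded_leb3_lty : open Obreve -> bounded_set Obreve -> (leb3 R Obreve < +oo)%E.
Proof.
move=> oD [M [_ KM]]; pose N := `|M| + 1.
have sub : Obreve `<=` cbox3 (- N) N (- N) N (- N) N.
  move=> p Kp; have : `|p| <= N by apply: (KM N) => //; rewrite (le_lt_trans (ler_norm M))// ltrDl.
  rewrite [X in X <= _]prod_normE ge_max prod_normE ge_max /= !ler_norml => /andP[/andP[h1 h2] h3].
  by split; [split|]; rewrite /= in_itv.
apply: le_lt_trans (compact_leb3_lty (@compact_cbox3 R (- N) N (- N) N (- N) N)).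
apply: le_measure => //; rewrite inE; first exact: open_measurable_espace.
exact: measurable_cbox3.
Qed.

End geometry_of_revolution.

Lemma cylindricalE (R : realType) (v : espace R -> 'cV[R[i]]_3) r t z (q := cartesian r t z) :
  [/\ cylindrical v r t z jr 0 = (cos t)%:C * v q jr 0 + (sin t)%:C * v q jt 0,
      cylindrical v r t z jt 0 = (- sin t)%:C * v q jr 0 + (cos t)%:C * v q jt 0
    & cylindrical v r t z jz 0 = v q jz 0].
Proof.
have := cos2Dsin2 t; move: (cylindrical v r t z) (rotation_cylindrical v r t z) => w E; rewrite /q E.
rewrite !mxE !big_ord_recr !big_ord0 /= !mxE /= !add0r.
have -> : widen_ord (leqnSn 2) (widen_ord (leqnSn 1) ord_max) = jr by exact: val_inj.
have -> : widen_ord (leqnSn 2) ord_max = jt by exact: val_inj.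
have -> : ord_max = jz by exact: val_inj.
set a := cos t; set b := sin t => ab.
case: (w jr 0) => x x'; case: (w jt 0) => y y'; case: (w jz 0) => u u'.
split; apply: complexE2 => /=.
- by transitivity ((a ^+ 2 + b ^+ 2) * x); [rewrite ab mul1r|ring].
- by transitivity ((a ^+ 2 + b ^+ 2) * x'); [rewrite ab mul1r|ring].
- by transitivity ((a ^+ 2 + b ^+ 2) * y); [rewrite ab mul1r|ring].
- by transitivity ((a ^+ 2 + b ^+ 2) * y'); [rewrite ab mul1r|ring].
- by ring.
- by ring.
Qed.

Lemma spin_decomposition (R : realType) (fp fm fz : espace R -> R[i]) : exists u : espace R -> 'cV[R[i]]_3,
  [/\ spin 'i%C u = fp, spin (- 'i%C) u = fm & component jz u = fz].
Proof.
pose f1 := fcomb 2^-1%:C (fcomb 1 fp fm) (fun=> 0); pose f2 := fcomb (- 'i%C / 2) (fcomb (-1) fm fp) (fun=> 0).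
exists (fun q => \col_(j < 3) nth 0 [:: f1 q; f2 q; fz q] j).
have h2 : (2^-1 : R)%:C = 2^-1 :> R[i] by rewrite -[LHS]/(real_complex _ _) fmorphV rmorph_nat.
have ii : 'i%C * 'i%C = -1 :> R[i] by rewrite -expr2 sqr_i.
have t2 : (2^-1 : R[i]) * 2 = 1 by rewrite mulVf ?pnatr_eq0.
split; apply/funext => q; rewrite /spin /fcomb /component !mxE //= /f1 /f2 /fcomb h2.
  transitivity (2^-1 * ((1 - 'i%C * 'i%C) * fp q + (1 + 'i%C * 'i%C) * fm q)); first by ring.
  by rewrite ii subrr mul0r addr0 opprK mulrA t2 mul1r.
transitivity (2^-1 * ((1 + 'i%C * 'i%C) * fp q + (1 - 'i%C * 'i%C) * fm q)); first by ring.
by rewrite ii subrr mul0r add0r opprK mulrA t2 mul1r.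
Qed.

Lemma esum_shift (R : realType) (a : int -> \bar R) (m : int) :
  (\esum_(k in [set: int]) a (k + m)%R = \esum_(k in [set: int]) a k)%E.
Proof.
apply/esym/(@reindex_esum R int int setT setT (fun k => k + m) a); split=> //.
  by move=> j k _ _; exact: addIr.
by move=> k _; exists (k - m) => //; rewrite subrK.
Qed.

Lemma half_double (R : realFieldType) (x y z : R) : y + x + z = 2^-1 * (2 * x + 2 * y) + z.
Proof. by field. Qed.

Lemma double_half (R : realFieldType) (x y z : R) :
  2^-1 * (x + y) + z + (2^-1 * (x + y) + z) = x + y + (z + z).
Proof. by field. Qed.

Lemma esum_half_shift (R : realType) (x y z s : int -> R) (X Y Z : R) :
  (forall k, 0 <= x k) -> (forall k, 0 <= y k) -> (forall k, 0 <= z k) ->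
  (forall k, s k = 2^-1 * (x (k + 1) + y (k - 1)) + z k) ->
  (\esum_(k in [set: int]) (x k)%:E = X%:E)%E -> (\esum_(k in [set: int]) (y k)%:E = Y%:E)%E ->
  (\esum_(k in [set: int]) (z k)%:E = Z%:E)%E ->
  (\esum_(k in [set: int]) (s k)%:E = (2^-1 * (X + Y) + Z)%:E)%E.
Proof.
move=> x0 y0 z0 sE EX EY EZ.
have s0 k : (0 <= (s k)%:E)%E.
  by rewrite lee_fin sE addr_ge0 ?z0// mulr_ge0 ?invr_ge0// addr_ge0.
(* Doubling avoids scaling an extended sum by 1/2; once the double is finite, the division takes
   place among real numbers. *)
have double : (\esum_(k in [set: int]) (s k)%:E + \esum_(k in [set: int]) (s k)%:E = (X + Y + (Z + Z))%:E)%E.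
  rewrite -esumD//.
  transitivity (\esum_(k in [set: int]) ((x (k + 1))%:E + (y (k - 1))%:E + ((z k)%:E + (z k)%:E)))%E.
    by apply: eq_esum => k _; rewrite -!EFinD sE; congr EFin; exact: double_half.
  rewrite esumD; [|by move=> k _; rewrite adde_ge0// lee_fin|by move=> k _; rewrite adde_ge0// lee_fin].
  rewrite esumD; [|by move=> k _; rewrite lee_fin|by move=> k _; rewrite lee_fin].
  rewrite esumD; [|by move=> k _; rewrite lee_fin|by move=> k _; rewrite lee_fin].
  by rewrite (esum_shift (fun k => (x k)%:E) 1) (esum_shift (fun k => (y k)%:E) (-1)) EX EY EZ -!EFinD.
move: double; have : (0 <= \esum_(k in [set: int]) (s k)%:E)%E by exact: esum_ge0.
case: (\esum_(k in [set: int]) (s k)%:E)%E => [t|//|//] _; rewrite -EFinD => -[h]; congr EFin.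
by lra.
Qed.

Lemma ae_eq_fcomb (R : realType) (d : measure_display) (T : measurableNormedModType R d)
    (mu : {measure set T -> \bar R}) (D : set T) (a : R[i]) (f g h f' g' h' : T -> R[i]) :
  h' = h %[ae mu in D] -> h = fcomb a f g %[ae mu in D] ->
  f' = f %[ae mu in D] -> g' = g %[ae mu in D] -> h' = fcomb a f' g' %[ae mu in D].
Proof.
move=> hh hfg ff gg; have E : h = fcomb a f' g' %[ae mu in D].
  by apply: filterS3 hfg ff gg => x h1 h2 h3 Dx; rewrite h1// /fcomb h2// h3.
by apply: filterS2 hh E => x h1 h2 Dx; rewrite h1// h2.
Qed.

Section vector_fields.
Context {R : realType}.
Variables (Omega : set (plane R)) (Obreve : set (espace R)).
Hypotheses (rev : revolved Omega Obreve) (Obreve_finite : (leb3 R Obreve < +oo)%E).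

Local Notation L2esp := (L2 (leb3 R) Obreve (fun=> 1)).
Local Notation H1esp := (H1 (leb3 R) Obreve (fun=> 1) (@axes3 R)).
Local Notation F := fourier_coefficients.
Implicit Types (u v : espace R -> 'cV[R[i]]_3) (w : int -> plane R -> 'cV[R[i]]_3) (k : int).

Let m1D : measurable_fun Obreve (fun=> 1 : R). Proof. by []. Qed.
Let w1D (x : espace R) : Obreve x -> (0 : R) < 1. Proof. by []. Qed.
Let O0 := revolved_pos rev.
Let oD : open Obreve. Proof. by case: rev. Qed.
Let ome := @open_measurable_espace R.
Let FLD := fundamental_lemma_espace oD.

Definition H1_sqnorm (f : espace R -> R[i]) : R :=
  L2_sqnorm (leb3 R) Obreve (fun=> 1) f + H1_sqseminorm (leb3 R) Obreve (fun=> 1) (@axes3 R) f.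

Lemma H1_sqnorm_quadratic : quadratic (fun=> 0) fcomb H1esp H1_sqnorm.
Proof.
have Q := H1_quadratic ome oD FLD m1D w1D (@axes3 R).
have [[X0 _] XL _ _] := Q; apply: quadraticD Q.
by apply: quadratic_sub X0 XL (L2_quadratic (leb3 R) ome oD m1D w1D) => f [].
Qed.

(** For a field on space the positions [jr], [jt], [jz] hold the cartesian components, so
    [spin 'i%C u] is [v_x + i v_y]. *)
Lemma H1vec_norm_spin u : H1vec Obreve u -> H1vec_norm Obreve u =
  Num.sqrt (2^-1 * (H1_sqnorm (spin 'i%C u) + H1_sqnorm (spin (- 'i%C) u)) + H1_sqnorm (component jz u)).
Proof.
move=> Hu; congr Num.sqrt; rewrite (quadratic_spin H1_sqnorm_quadratic (Hu jt) (Hu jr)).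
rewrite !big_ord_recr !big_ord0 /= !add0r -/(H1_sqnorm _).
have -> : component (widen_ord (leqnSn 2) (widen_ord (leqnSn 1) ord_max)) u = component jr u by congr component; exact: val_inj.
have -> : component (widen_ord (leqnSn 2) ord_max) u = component jt u by congr component; exact: val_inj.
have -> : component ord_max u = component jz u by congr component; exact: val_inj.
rewrite -/(H1_sqnorm (component jr u)) -/(H1_sqnorm (component jt u)) -/(H1_sqnorm (component jz u)).
exact: half_double.
Qed.

Lemma H1vec_spin e u : H1vec Obreve u -> H1esp (spin e u).
Proof. by move=> Hu; have [_ XL _ _] := H1_sqnorm_quadratic; exact: XL. Qed.

Lemma L2vec_spin e u : (forall j, L2esp (component j u)) -> L2esp (spin e u).
Proof. by move=> Lu; exact: L2_fcomb. Qed.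

Lemma component_fourier k u p : Omega p ->
  [/\ component jr (F u k) p = hat k (radial_part (component jr u) (component jt u)) p,
      component jt (F u k) p = hat k (angular_part (component jr u) (component jt u)) p
    & component jz (F u k) p = hat k (component jz u) p].
Proof.
move=> Op; rewrite /component /fourier_coefficients /hat !mxE.
split; congr fourier_coefficient; apply/funext => t; have [hr ht hz] := cylindricalE u p.1 t p.2.
- by rewrite hr /radial_part -/(cyl (p, t)) phase_cyl ?O0.
- by rewrite ht /angular_part -/(cyl (p, t)) phase_cyl ?O0.
- exact: hz.
Qed.

(** A polynomial identity in the real and imaginary parts of [phase], valid whatever its value,
    hence also on the axis. *)
Lemma spin_radial_angular (f g : espace R -> R[i]) :
  fcomb 'i%C (angular_part f g) (radial_part f g) = (fun q => (phase q)^*%C * fcomb 'i%C g f q) /\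
  fcomb (- 'i%C) (angular_part f g) (radial_part f g) = (fun q => phase q * fcomb (- 'i%C) g f q).
Proof.
split; apply/funext => q; rewrite /fcomb /angular_part /radial_part.
  by case: (phase q) => a b; case: (f q) => x x'; case: (g q) => y y'; apply: complexE2 => /=; ring.
by case: (phase q) => a b; case: (f q) => x x'; case: (g q) => y y'; apply: complexE2 => /=; ring.
Qed.

Lemma spin_fourier k u : (forall j, L2esp (component j u)) ->
  [/\ spin 'i%C (F u k) = hat (k + 1) (spin 'i%C u) %[ae leb2 R in Omega],
      spin (- 'i%C) (F u k) = hat (k - 1) (spin (- 'i%C) u) %[ae leb2 R in Omega]
    & component jz (F u k) = hat k (component jz u) %[ae leb2 R in Omega]].
Proof.
move=> Lu; have La := L2_angular_part rev (Lu jr) (Lu jt); have Lr := L2_radial_part rev (Lu jr) (Lu jt).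
have [Ep Em] := spin_radial_angular (component jr u) (component jt u).
split.
- apply: filterS (hat_linear rev Obreve_finite k 'i%C La Lr) => p h Op.
  have [hr ht _] := component_fourier k u Op.
  by rewrite -(hat_phaseV rev)// -Ep; move: (h Op); rewrite /fcomb => ->; rewrite /spin /fcomb hr ht.
- apply: filterS (hat_linear rev Obreve_finite k (- 'i%C) La Lr) => p h Op.
  have [hr ht _] := component_fourier k u Op.
  by rewrite -(hat_phase rev)// -Em; move: (h Op); rewrite /fcomb => ->; rewrite /spin /fcomb hr ht.
- by apply: aeW => p Op; have [_ _ ->] := component_fourier k u Op.
Qed.

Lemma cmeasurable_fourier k u : (forall j, L2esp (component j u)) ->
  (forall e, cmeasurable Omega (spin e (F u k))) /\ cmeasurable Omega (component jz (F u k)).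
Proof.
move=> Lu; have La := L2_angular_part rev (Lu jr) (Lu jt); have Lr := L2_radial_part rev (Lu jr) (Lu jt).
have mh f : L2esp f -> cmeasurable Omega (hat k f) by exact: cmeasurable_hat.
split=> [e|]; last first.
  by apply: eq_cmeasurable (mh _ (Lu jz)) => p Op; have [_ _ ->] := component_fourier k u Op.
apply: eq_cmeasurable (cmeasurableD (cmeasurableZ e (mh _ La)) (mh _ Lr)) => p Op.
by have [hr ht _] := component_fourier k u Op; rewrite /spin /fcomb hr ht.
Qed.

Lemma fourier_H1k k u : H1vec Obreve u -> H1k Omega k (F u k) /\
  H1k_sqnorm Omega k (F u k) =
  2^-1 * (scalar_sqnorm Omega (k + 1) (hat (k + 1) (spin 'i%C u)) +
          scalar_sqnorm Omega (k - 1) (hat (k - 1) (spin (- 'i%C) u))) +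
  scalar_sqnorm Omega k (hat k (component jz u)).
Proof.
move=> Hu; have Lu j : L2esp (component j u) := (Hu j).1.
have [hp hm hz] := spin_fourier k Lu; have [ms mz] := cmeasurable_fourier k Lu.
have S m f (Hf : H1esp f) := (hat_scalar_space rev Obreve_finite m Hf).1.
have sym (f g : plane R -> R[i]) : f = g %[ae leb2 R in Omega] -> g = f %[ae leb2 R in Omega].
  by apply: filterS => p + Op => /(_ Op) ->.
have [Sp Ep] := ae_eq_scalar_space rev (S (k + 1) _ (H1vec_spin 'i%C Hu)) (ms _) (sym _ _ hp).
have [Sm Em] := ae_eq_scalar_space rev (S (k - 1) _ (H1vec_spin (- 'i%C) Hu)) (ms _) (sym _ _ hm).
have [Sz Ez] := ae_eq_scalar_space rev (S k _ (Hu jz)) mz (sym _ _ hz).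
have Hk : H1k Omega k (F u k) by rewrite (H1k_spin rev).
by split=> //; rewrite (H1k_sqnorm_spin rev Hk) /spin_sqnorm Ep Em Ez.
Qed.

Lemma fourier_isometry u : H1vec Obreve u ->
  l2_sqsum (H1k_norm Omega) (F u) =
  (2^-1 * (H1_sqnorm (spin 'i%C u) + H1_sqnorm (spin (- 'i%C) u)) + H1_sqnorm (component jz u))%:E.
Proof.
move=> Hu; pose sn m f : R := scalar_sqnorm Omega m (hat m f).
have n0 m f : 0 <= sn m f := scalar_sqnorm_ge0 rev m _.
have SP f (Hf : H1esp f) : (\esum_(k in [set: int]) (sn k f)%:E = (H1_sqnorm f)%:E)%E := scalar_parseval rev Obreve_finite Hf.
have Ek k : H1k_norm Omega k (F u k) ^+ 2 =
    2^-1 * (sn (k + 1) (spin 'i%C u) + sn (k - 1) (spin (- 'i%C) u)) + sn k (component jz u).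
  have [_ E] := fourier_H1k k Hu; rewrite /H1k_norm sqr_sqrtr E// addr_ge0 ?n0//.
  by rewrite mulr_ge0 ?invr_ge0// addr_ge0 ?n0.
exact: (esum_half_shift (fun k => n0 k _) (fun k => n0 k _) (fun k => n0 k _) Ek
  (SP _ (H1vec_spin 'i%C Hu)) (SP _ (H1vec_spin (- 'i%C) Hu)) (SP _ (Hu jz))).
Qed.

(** For injectivity, the coefficient of index [m] of each cartesian spin is read in the vector
    coefficient of index [m - 1] or [m + 1]. *)
Lemma fourier_ae_eq u v : (forall j, L2esp (component j u)) -> (forall j, L2esp (component j v)) ->
  ae_eq3 Obreve u v <-> ae_eq_seq Omega (F u) (F v).
Proof.
move=> Lu Lv; split=> [uv k|uv].
  have [up um uz] := spin_fourier k Lu; have [vp vm vz] := spin_fourier k Lv.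
  have h m f g : L2esp f -> L2esp g -> f = g %[ae leb3 R in Obreve] -> hat m f = hat m g %[ae leb2 R in Omega].
    by move=> Lf Lg; exact: ae_eq_hat.
  have hp := h (k + 1) _ _ (L2vec_spin 'i%C Lu) (L2vec_spin 'i%C Lv) (spin_ae_eq _ uv).
  have hm := h (k - 1) _ _ (L2vec_spin (- 'i%C) Lu) (L2vec_spin (- 'i%C) Lv) (spin_ae_eq _ uv).
  have hz := h k _ _ (Lu jz) (Lv jz) (ae_eq_component jz uv).
  apply: ae_eq_spin.
  - by apply: filterS3 up vp hp => p h1 h2 h3 Op; rewrite (h1 Op) (h2 Op) (h3 Op).
  - by apply: filterS3 um vm hm => p h1 h2 h3 Op; rewrite (h1 Op) (h2 Op) (h3 Op).
  - by apply: filterS3 uz vz hz => p h1 h2 h3 Op; rewrite (h1 Op) (h2 Op) (h3 Op).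
have inj f g : L2esp f -> L2esp g -> (forall m, hat m f = hat m g %[ae leb2 R in Omega]) -> f = g %[ae leb3 R in Obreve].
  move=> Lf Lg hfg; have Ld : L2esp (fcomb (-1) g f) by exact: L2_fcomb.
  have : fcomb (-1) g f = (fun=> 0) %[ae leb3 R in Obreve].
    apply: (hat_eq0 rev Obreve_finite Ld) => m.
    apply: filterS2 (hfg m) (hat_linear rev Obreve_finite m (-1) Lg Lf) => p h1 h2 Op.
    by rewrite [LHS](h2 Op) h1// mulN1r addNr.
  by apply: filterS => q + Dq => /(_ Dq); rewrite /fcomb mulN1r addrC => /eqP; rewrite subr_eq0 => /eqP.
apply: ae_eq_spin.
- apply: inj => [||m]; [exact: L2vec_spin|exact: L2vec_spin|].
  have := spin_fourier (m - 1) Lu; have := spin_fourier (m - 1) Lv; rewrite subrK => -[vp _ _] [up _ _].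
  by apply: filterS3 up vp (spin_ae_eq 'i%C (uv (m - 1))) => p h1 h2 h3 Op; rewrite -(h1 Op) -(h2 Op) (h3 Op).
- apply: inj => [||m]; [exact: L2vec_spin|exact: L2vec_spin|].
  have := spin_fourier (m + 1) Lu; have := spin_fourier (m + 1) Lv; rewrite addrK => -[_ vp _] [_ up _].
  by apply: filterS3 up vp (spin_ae_eq (- 'i%C) (uv (m + 1))) => p h1 h2 h3 Op; rewrite -(h1 Op) -(h2 Op) (h3 Op).
- apply: inj => [||m]; [exact: Lu|exact: Lv|].
  have [_ _ up] := spin_fourier m Lu; have [_ _ vp] := spin_fourier m Lv.
  by apply: filterS3 up vp (ae_eq_component jz (uv m)) => p h1 h2 h3 Op; rewrite -(h1 Op) -(h2 Op) (h3 Op).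
Qed.

Lemma fourier_linear (a : R[i]) u v : (forall j, L2esp (component j u)) -> (forall j, L2esp (component j v)) ->
  ae_eq_seq Omega (F (a *: u + v)) (a *: F u + F v).
Proof.
move=> Lu Lv k; have Lw j : L2esp (component j (a *: u + v)).
  by rewrite component_comb; exact: L2_fcomb.
have [up um uz] := spin_fourier k Lu; have [vp vm vz] := spin_fourier k Lv; have [wp wm wz] := spin_fourier k Lw.
have hl m f g (Lf : L2esp f) (Lg : L2esp g) := hat_linear rev Obreve_finite m a Lf Lg.
have cp := hl (k + 1) _ _ (L2vec_spin 'i%C Lu) (L2vec_spin 'i%C Lv).
have cm := hl (k - 1) _ _ (L2vec_spin (- 'i%C) Lu) (L2vec_spin (- 'i%C) Lv).
have cz := hl k _ _ (Lu jz) (Lv jz).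
rewrite spin_comb in wp; rewrite spin_comb in wm; rewrite component_comb in wz.
rewrite -[(a *: F u + F v) k]/(a *: F u k + F v k).
apply: ae_eq_spin; rewrite ?spin_comb ?component_comb.
- exact: ae_eq_fcomb wp cp up vp.
- exact: ae_eq_fcomb wm cm um vm.
- exact: ae_eq_fcomb wz cz uz vz.
Qed.

Lemma fourier_surjective w : l2_sum (H1k Omega) (H1k_norm Omega) w ->
  exists2 u, H1vec Obreve u & ae_eq_seq Omega (F u) w.
Proof.
move=> [Hw sum_w].
have Sw k : spin_space Omega (k + 1) (k - 1) k (w k) by rewrite -(H1k_spin rev).
have n0 m c : 0 <= scalar_sqnorm Omega m c := scalar_sqnorm_ge0 rev m c.
have Ew k : H1k_norm Omega k (w k) ^+ 2 = 2^-1 * (scalar_sqnorm Omega (k + 1) (spin 'i%C (w k)) +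
    scalar_sqnorm Omega (k - 1) (spin (- 'i%C) (w k))) + scalar_sqnorm Omega k (component jz (w k)).
  rewrite /H1k_norm (H1k_sqnorm_spin rev (Hw k)) sqr_sqrtr// addr_ge0 ?n0//.
  by rewrite mulr_ge0 ?invr_ge0// addr_ge0 ?n0.
have e0 k : (0 <= (H1k_norm Omega k (w k) ^+ 2)%:E)%E by rewrite lee_fin sqr_ge0.
(* The factor 2 undoes the weight 1/2 of the spins in [spin_sqnorm]. *)
have fin (s : int -> R) : (forall k, s k <= 2 * H1k_norm Omega k (w k) ^+ 2) ->
    (\esum_(k in [set: int]) (s k)%:E < +oo)%E.
  move=> h; apply: (@le_lt_trans _ _ (\esum_(k in [set: int]) ((H1k_norm Omega k (w k) ^+ 2)%:E + (H1k_norm Omega k (w k) ^+ 2)%:E))%E).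
    apply: le_esum => k _; rewrite -EFinD lee_fin; apply: le_trans (h k) _.
    by rewrite mulr2n mulrDl !mul1r.
  by rewrite esumD//; apply: lte_add_pinfty.
have bounds k : [/\ scalar_sqnorm Omega (k + 1) (spin 'i%C (w k)) <= 2 * H1k_norm Omega k (w k) ^+ 2,
    scalar_sqnorm Omega (k - 1) (spin (- 'i%C) (w k)) <= 2 * H1k_norm Omega k (w k) ^+ 2 &
    scalar_sqnorm Omega k (component jz (w k)) <= 2 * H1k_norm Omega k (w k) ^+ 2].
  rewrite Ew; have := n0 (k + 1) (spin 'i%C (w k)); have := n0 (k - 1) (spin (- 'i%C) (w k)).
  have := n0 k (component jz (w k)).
  set x := scalar_sqnorm _ _ _; set y := scalar_sqnorm _ _ _; set z := scalar_sqnorm _ _ _ => *.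
  by split; lra.
(* Reindexed by frequency: the spin [i] of [w k] is the coefficient of frequency [k + 1] of a scalar
   field, the spin [- i] that of frequency [k - 1]. *)
pose cp m := spin 'i%C (w (m - 1)); pose cm m := spin (- 'i%C) (w (m + 1)).
have Sp m : scalar_space Omega m (cp m) by have [] := Sw (m - 1); rewrite subrK.
have Sm m : scalar_space Omega m (cm m) by have [_] := Sw (m + 1); rewrite addrK.
have Sz m : scalar_space Omega m (component jz (w m)) by have [] := Sw m.
have Fp : (\esum_(k in [set: int]) (scalar_sqnorm Omega k (cp k))%:E < +oo)%E.
  rewrite -(esum_shift (fun k => (scalar_sqnorm Omega k (cp k))%:E) 1); apply: fin => k.
  by rewrite /cp addrK; have [] := bounds k.
have Fm : (\esum_(k in [set: int]) (scalar_sqnorm Omega k (cm k))%:E < +oo)%E.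
  rewrite -(esum_shift (fun k => (scalar_sqnorm Omega k (cm k))%:E) (-1)); apply: fin => k.
  by rewrite /cm subrK; have [] := bounds k.
have Fz : (\esum_(k in [set: int]) (scalar_sqnorm Omega k (component jz (w k)))%:E < +oo)%E.
  by apply: fin => k; have [] := bounds k.
have [fp [Hp hp]] := scalar_surjective rev Obreve_finite Sp Fp.
have [fm [Hm hm]] := scalar_surjective rev Obreve_finite Sm Fm.
have [fz [Hz hz]] := scalar_surjective rev Obreve_finite Sz Fz.
have [u [up um uz]] := spin_decomposition fp fm fz.
have Hu : H1vec Obreve u.
  have [[X0 _] XL _ _] := H1_sqnorm_quadratic.
  have [Hr Ht] : H1esp (component jr u) /\ H1esp (component jt u).
    by apply/(spin_closed u X0 XL); rewrite up um.
  by move=> j; have [->|->|->] := ord3_cases j; [exact: Hr|exact: Ht|rewrite uz].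
exists u => // k; have [sp sm sz] := spin_fourier k (fun j => (Hu j).1).
apply: ae_eq_spin.
- have := hp (k + 1); rewrite /cp addrK => h; apply: filterS2 sp h => p h1 h2 Op.
  by rewrite h1// up h2.
- have := hm (k - 1); rewrite /cm subrK => h; apply: filterS2 sm h => p h1 h2 Op.
  by rewrite h1// um h2.
- by apply: filterS2 sz (hz k) => p h1 h2 Op; rewrite h1// uz h2.
Qed.

End vector_fields.

Theorem theorem5p4 (R : realType)
    (Obreve : set (espace R)) (Omega : set (plane R))
    (Omega_half : forall p, Omega p -> 0 < p.1)
    (Omega_polygonal : polygonal_domain Omega)
    (Obreve_domain : bounded_domain Obreve)
    (Obreve_revolve : Obreve = revolve (Omega `|` axis_part Omega)) :
  [/\ forall k : int, normed_space (H1k Omega k) (ae_eq2 Omega) (H1k_norm Omega k),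
      isometric_isomorphism
        (H1vec Obreve) (ae_eq3 Obreve) (H1vec_norm Obreve)
        (l2_sum (H1k Omega) (H1k_norm Omega)) (ae_eq_seq Omega)
        (l2_norm (H1k_norm Omega))
        fourier_coefficients
    & forall k : int, 2 <= `|k| ->
        normed_space (H1k Omega k) (ae_eq2 Omega) (H1k_star_norm Omega k) /\
        equivalent_norms (H1k Omega k) (H1k_norm Omega k)
          (H1k_star_norm Omega k)].
Proof.
have [[oO _ _ _] _] := Omega_polygonal; have [oD _ _ bD] := Obreve_domain.
have rev := revolve_revolved Omega_half oO oD Obreve_revolve.
have fin := bounded_leb3_lty oD bD.
split.
- exact: H1k_normed_space rev.
- split.
  + move=> u Hu; split=> [k|]; first exact: (fourier_H1k rev fin k Hu).1.
    by rewrite (fourier_isometry rev fin Hu) ltry.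
  + by move=> u v Hu Hv; exact: (fourier_ae_eq rev fin (fun j => (Hu j).1) (fun j => (Hv j).1)).
  + by move=> a u v Hu Hv; exact: (fourier_linear rev fin a (fun j => (Hu j).1) (fun j => (Hv j).1)).
  + by move=> w Hw; exact: (fourier_surjective rev fin Hw).
  + move=> u Hu; rewrite (H1vec_norm_spin rev Hu) /l2_norm.
    by rewrite (fourier_isometry rev fin Hu).
- by move=> k k2; split; [exact: H1k_star_normed_space rev k k2|exact: H1k_equivalent_norms rev k k2].
Qed.
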